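(* Let $A=\mathbb C_q[GL_2]$ with its strongly bicovariant exterior algebra $\Omega(\mathbb C_q[GL_2])$ given by $(d\mathbf t_1)\mathbf t_2=R_{21}\mathbf t_2\,d\mathbf t_1R$, $d\mathbf t_1\,d\mathbf t_2=-R_{21}\,d\mathbf t_2\,d\mathbf t_1R$, and let $\lambda=q-q^{-1}$. Then $B=\mathbb C_q^2$ is a braided-Hopf algebra in $\mathcal M^A_A$ and $\Omega(\mathbb C_q^2)$ a super braided-Hopf algebra in the category of super right $\Omega(\mathbb C_q[GL_2])$-crossed modules with (co)action and coproduct (a matrix identity is read entrywise) $$x_1\triangleleft\begin{pmatrix}a&b \\ c&d\end{pmatrix}=\begin{pmatrix}q^{-2}x_1&-q^{-1}\lambda x_2 \\ 0&q^{-1}x_1\end{pmatrix},\quad x_2\triangleleft\begin{pmatrix}a&b \\ c&d\end{pmatrix}=\begin{pmatrix}q^{-1}x_2&0 \\ 0&q^{-2}x_2\end{pmatrix},$$ $$x_1\triangleleft\begin{pmatrix}da&db \\ dc&dd\end{pmatrix}=\begin{pmatrix}-q^{-1}\lambda dx_1&-q^{-1}\lambda dx_2 \\ 0&0\end{pmatrix},\quad dx_1\triangleleft\begin{pmatrix}a&b \\ c&d\end{pmatrix}=\begin{pmatrix}dx_1&0 \\ 0&q^{-1}dx_1\end{pmatrix},$$ $$x_2\triangleleft\begin{pmatrix}da&db \\ dc&dd\end{pmatrix}=\begin{pmatrix}0&0 \\ -q^{-1}\lambda dx_1&-q^{-1}\lambda dx_2\end{pmatrix},\quad dx_2\triangleleft\begin{pmatrix}a&b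 \\ c&d\end{pmatrix}=\begin{pmatrix}q^{-1}dx_2&0 \\ q^{-1}\lambda dx_1&dx_2\end{pmatrix},$$ $$dx_i\triangleleft dt^k{}_l=0,\quad\Delta_Rx_1=x_1\otimes a+x_2\otimes c,\quad\Delta_Rx_2=x_1\otimes b+x_2\otimes d,$$ $$\Delta_{R*}dx_1=dx_1\otimes a+dx_2\otimes c+x_1\otimes da+x_2\otimes dc,\quad\Delta_{R*}dx_2=dx_1\otimes b+dx_2\otimes d+x_1\otimes db+x_2\otimes dd,$$ $$\underline\Delta x_i=x_i\otimes1+1\otimes x_i,\quad\underline\Delta_*dx_i=dx_i\otimes1+1\otimes dx_i.$$ Its super bosonisation is a strongly bicovariant exterior algebra $\Omega(\mathbb C_q[GL_2]\rtimes\mathbb C_q^2):=\Omega(\mathbb C_q[GL_2])\rtimes\Omega(\mathbb C_q^2)$ with sub-exterior algebras $\Omega(\mathbb C_q[GL_2])$, $\Omega(\mathbb C_q^2)$ and cross relations and super coproduct $$x_1\begin{pmatrix}a&b \\ c&d\end{pmatrix}=\begin{pmatrix}q^{-2}ax_1&q^{-1}bx_1-q^{-1}\lambda ax_2 \\ q^{-2}cx_1&q^{-1}dx_1-q^{-1}\lambda cx_2\end{pmatrix},\quad x_2\begin{pmatrix}a&b \\ c&d\end{pmatrix}=\begin{pmatrix}q^{-1}ax_2&q^{-2}bx_2 \\ q^{-1}cx_2&q^{-2}dx_2\end{pmatrix},$$ $$dx_1\begin{pmatrix}a&b \\ c&d\end{pmatrix}=\begin{pmatrix}a\,dx_1&q^{-1}b\,dx_1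 \\ c\,dx_1&q^{-1}d\,dx_1\end{pmatrix},\quad dx_2\begin{pmatrix}a&b \\ c&d\end{pmatrix}=\begin{pmatrix}q^{-1}a\,dx_2+q^{-1}\lambda b\,dx_1&b\,dx_2 \\ q^{-1}c\,dx_2+q^{-1}\lambda d\,dx_1&d\,dx_2\end{pmatrix},$$ $$x_1\begin{pmatrix}da&db \\ dc&dd\end{pmatrix}=\begin{pmatrix}q^{-2}(da)x_1-q^{-1}\lambda a\,dx_1&q^{-1}(db)x_1-q^{-1}\lambda((da)x_2+a\,dx_2) \\ q^{-2}(dc)x_1-q^{-1}\lambda c\,dx_1&q^{-1}(dd)x_1-q^{-1}\lambda((dc)x_2+c\,dx_2)\end{pmatrix},$$ $$x_2\begin{pmatrix}da&db \\ dc&dd\end{pmatrix}=\begin{pmatrix}q^{-1}(da)x_2-q^{-1}\lambda b\,dx_1&q^{-2}(db)x_2-q^{-1}\lambda b\,dx_2 \\ q^{-1}(dc)x_2-q^{-1}\lambda d\,dx_1&q^{-2}(dd)x_2-q^{-1}\lambda d\,dx_2\end{pmatrix},$$ $$dx_1\begin{pmatrix}da&db \\ dc&dd\end{pmatrix}=-\begin{pmatrix}da\,dx_1&q^{-1}db\,dx_1 \\ dc\,dx_1&q^{-1}dd\,dx_1\end{pmatrix},$$ $$dx_2\begin{pmatrix}da&db \\ dc&dd\end{pmatrix}=-\begin{pmatrix}q^{-1}da\,dx_2+q^{-1}\lambda db\,dx_1&db\,dx_2 \\ q^{-1}dc\,dx_2+q^{-1}\lambda dd\,dx_1&dd\,dx_2\end{pmatrix},$$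 $$\Delta x_i=1\otimes x_i+\Delta_R(x_i),\quad\Delta_*(dx_i)=1\otimes dx_i+\Delta_{R*}(dx_i)$$ and the coproduct of $\Omega(\mathbb C_q[GL_2])$. Moreover, the canonical coaction $\Delta_R:\mathbb C_q^2\to\mathbb C_q^2\otimes(\mathbb C_q[GL_2]\rtimes\mathbb C_q^2)$, $\Delta_Rx_i=1\otimes x_i+\sum_jx_j\otimes t^j{}_i$, is differentiable.
   Context: $q\in\mathbb C$, $q\ne0$. The letter $d$ denotes both the generator $t^2{}_2$ and the exterior derivative: $da,db,dc,dd$ in the matrices of differentials, and $dx_i$, are exterior derivatives of $a,b,c,t^2{}_2,x_i$; in expressions such as $d\,dx_1$ the first $d$ is the generator $t^2{}_2$, whereas $dd\,dx_1$ is the exterior derivative of the generator $t^2{}_2$ times $dx_1$. $\mathbb C_q[GL_2]$ is the Hopf algebra generated by $t^1{}_1=a,t^1{}_2=b,t^2{}_1=c,t^2{}_2=d$ and $D^{-1}$ with $ba=qab$, $ca=qac$, $db=qbd$, $dc=qcd$, $cb=bc$, $da-ad=(q-q^{-1})bc$ (products of generators here), $D=ad-q^{-1}bc=da-qcb$ central and inverted, $\Delta t^i{}_j=\sum_kt^i{}_k\otimes t^k{}_j$. $R=(R^i{}_j{}^k{}_l)$ has nonzero entries $R^1{}_1{}^1{}_1=R^2{}_2{}^2{}_2=q$, $R^1{}_1{}^2{}_2=R^2{}_2{}^1{}_1=1$, $R^1{}_2{}^2{}_1=q-q^{-1}$; in components (summed) the calculus reads $(dt^i{}_j)t^k{}_l=R^k{}_{b}{}^i{}_{a}\,t^b{}_n(dt^a{}_m)R^m{}_j{}^n{}_l$,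 $dt^i{}_jdt^k{}_l=-R^k{}_{b}{}^i{}_{a}\,dt^b{}_ndt^a{}_mR^m{}_j{}^n{}_l$, $dD^{-1}=-D^{-1}(dD)D^{-1}$, with $\Delta_*dt^i{}_j=dt^i{}_k\otimes t^k{}_j+t^i{}_k\otimes dt^k{}_j$. $\mathbb C_q^2$ has generators $x_1,x_2$ with $x_2x_1=qx_1x_2$, and $\Omega(\mathbb C_q^2)$ has $(dx_i)x_i=q^2x_idx_i$, $(dx_1)x_2=qx_2dx_1$, $(dx_2)x_1=qx_1dx_2+(q^2-1)x_2dx_1$, $(dx_i)^2=0$, $dx_2dx_1=-q^{-1}dx_1dx_2$. An exterior algebra on an algebra $A$ is a DGA $\Omega(A)$ with $\Omega^0=A$ generated by $A$ and $\Omega^1=\mathrm{span}\{a\,db\}$. The super tensor product $\underline\otimes$ has product $(a\otimes b)(c\otimes e)=(-1)^{|b||c|}ac\otimes be$ and differential $d\otimes\mathrm{id}+(-1)^{|\ |}\mathrm{id}\otimes d$. For a Hopf algebra, $\Omega(A)$ is strongly bicovariant if it is a super-Hopf algebra (grade = form degree mod 2) with $\Delta_*$ preserving total degree, restricting to $\Delta$, and $\Delta_*d=(d\otimes\mathrm{id}+(-1)^{|\ |}\mathrm{id}\otimes d)\Delta_*$. A coaction $B\to B\otimes K$ (comodule algebra) is differentiable if it extends to a degree-preserving DGA map $\Omega(B)\to\Omega(B)\underline\otimes\Omega(K)$. For a super-Hopf algebra $K$, $\mathcal M^K_K$ is the category of super right $K$-modules and comodules ($v\mapsto v^{(0)}\otimes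 v^{(1)}$) with $\Delta_R(v\triangleleft k)=(-1)^{|v^{(1)}|(|k_{(1)}|+|k_{(2)}|)+|k_{(1)}||k_{(2)}|}v^{(0)}\triangleleft k_{(2)}\otimes(Sk_{(1)})v^{(1)}k_{(3)}$ and braiding $\Psi(v\otimes w)=(-1)^{|v||w^{(0)}|}w^{(0)}\otimes(v\triangleleft w^{(1)})$; (super) braided-Hopf algebras in it satisfy $\underline\Delta(uv)=u_{\underline{(1)}}\Psi(u_{\underline{(2)}}\otimes v_{\underline{(1)}})v_{\underline{(2)}}$. The super bosonisation $\Omega(A)\rtimes\Omega(B)$ is $\Omega(A)\otimes\Omega(B)$ with $(\omega\otimes\eta)(\tau\otimes\xi)=(-1)^{|\eta||\tau_{(1)}|}\omega\tau_{(1)}\otimes(\eta\triangleleft\tau_{(2)})\xi$, $\Delta_*(\omega\otimes\eta)=(-1)^{|\omega_{(2)}||\eta_{\underline{(1)}}^{(0)}|}\omega_{(1)}\otimes\eta_{\underline{(1)}}^{(0)}\otimes\omega_{(2)}\eta_{\underline{(1)}}^{(1)}\otimes\eta_{\underline{(2)}}$ and $d(\omega\otimes\eta)=d\omega\otimes\eta+(-1)^{|\omega|}\omega\otimes d\eta$; $A\rtimes B$ is its degree 0 part.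
   Formalization: The hypothesis q² ≠ −1 is added: for q² = −1 the relations of Ω(C_q[GL_2]) do not force (da)² = 0, so Δ_{R*} does not respect (dx_1)² = 0 and the stated coaction does not exist. *)

(* Defs.v *)
From HB Require Import structures.
From mathcomp Require Import all_boot all_order all_algebra.
From mathcomp Require Import boolp classical_sets cardinality fsbigop.
From mathcomp Require Import reals complex.

Set Implicit Arguments.
Unset Strict Implicit.
Unset Printing Implicit Defensive.

Import GRing.Theory.

Local Open Scope ring_scope.
Local Open Scope quotient_scope.

(** * Algebras given by generators and relations *)

Inductive pterm (F I : Type) :=
| TGen of I
| TConst of F
| TAdd of pterm F I & pterm F I
| TMul of pterm F I & pterm F I.

Arguments TGen {F I}.
Arguments TConst {F I}.

HB.instance Definition _ (F I : Type) := gen_eqMixin (pterm F I).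
HB.instance Definition _ (F I : Type) := gen_choiceMixin (pterm F I).

Declare Scope pterm_scope.
Delimit Scope pterm_scope with P.
Bind Scope pterm_scope with pterm.
Notation "s + t" := (TAdd s t) : pterm_scope.
Notation "s * t" := (TMul s t) : pterm_scope.
Notation "c *: t" := (TMul (TConst c) t) : pterm_scope.
Notation "0" := (TConst 0%R) : pterm_scope.
Notation "1" := (TConst 1%R) : pterm_scope.

(* Least congruence on terms containing the laws of unital associative
   F-algebras and the relations rel: the quotient is the algebra presented by
   the generators I and the relations rel. *)
Inductive pres_eq (F : fieldType) (I : Type)
    (rel : pterm F I -> pterm F I -> Prop) : pterm F I -> pterm F I -> Prop :=
| pres_refl s : pres_eq rel s s
| pres_sym s t : pres_eq rel s t -> pres_eq rel t s
| pres_trans s t u : pres_eq rel s t -> pres_eq rel t u -> pres_eq rel s u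
| pres_add s s' t t' :
    pres_eq rel s s' -> pres_eq rel t t' -> pres_eq rel (s + t) (s' + t')
| pres_mul s s' t t' :
    pres_eq rel s s' -> pres_eq rel t t' -> pres_eq rel (s * t) (s' * t')
| pres_addA s t u : pres_eq rel (s + (t + u)) (s + t + u)
| pres_addC s t : pres_eq rel (s + t) (t + s)
| pres_add0 s : pres_eq rel (0 + s) s
| pres_mulA s t u : pres_eq rel (s * (t * u)) (s * t * u)
| pres_mul1l s : pres_eq rel (1 * s) s
| pres_mul1r s : pres_eq rel (s * 1) s
| pres_mul0 s : pres_eq rel (0 * s) 0
| pres_mulDl s t u : pres_eq rel ((s + t) * u) (s * u + t * u)
| pres_mulDr s t u : pres_eq rel (u * (s + t)) (u * s + u * t)
| pres_constD c c' : pres_eq rel (TConst (c + c')%R) (TConst c + TConst c')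
| pres_constM c c' : pres_eq rel (TConst (c * c')%R) (TConst c * TConst c')
| pres_constC c s : pres_eq rel (TConst c * s) (s * TConst c)
| pres_rel s t : rel s t -> pres_eq rel s t.

Section PresentedAlgebra.
Variables (F : fieldType) (I : Type) (rel : pterm F I -> pterm F I -> Prop).

Definition pres_eqb (s t : pterm F I) : bool := `[< pres_eq rel s t >].

Fact pres_eqb_refl : reflexive pres_eqb.
Proof. by move=> s; apply/asboolP; apply: pres_refl. Qed.

Fact pres_eqb_sym : symmetric pres_eqb.
Proof. by move=> s t; apply/asboolP/asboolP; apply: pres_sym. Qed.

Fact pres_eqb_trans : transitive pres_eqb.
Proof.
by move=> t s u /asboolP st /asboolP tu; apply/asboolP; apply: pres_trans tu.
Qed.

Canonical pres_equiv := EquivRel pres_eqb pres_eqb_refl pres_eqb_sym pres_eqb_trans.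

Definition presAlg := {eq_quot pres_equiv}.
HB.instance Definition _ := Choice.on presAlg.
HB.instance Definition _ := EqQuotient.on presAlg.

Definition pres_pi (t : pterm F I) : presAlg := \pi_presAlg t.
Definition pgen (i : I) : presAlg := pres_pi (TGen i).

Lemma pres_piP s t : pres_eq rel s t <-> pres_pi s = pres_pi t.
Proof.
by split=> [st|/eqmodP /asboolP //]; apply/eqmodP/asboolP.
Qed.

Lemma pres_reprK t : pres_eq rel (repr (pres_pi t)) t.
Proof. by apply/pres_piP; rewrite /pres_pi reprK. Qed.

Lemma pres_piS (x : presAlg) : x = pres_pi (repr x).
Proof. by rewrite /pres_pi reprK. Qed.

Definition padd (x y : presAlg) : presAlg := pres_pi (repr x + repr y).
Definition pmul (x y : presAlg) : presAlg := pres_pi (repr x * repr y).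
Definition pscale (c : F) (x : presAlg) : presAlg := pres_pi (c *: repr x).

Lemma paddE s t : padd (pres_pi s) (pres_pi t) = pres_pi (s + t).
Proof. by apply/pres_piP; apply: pres_add; apply: pres_reprK. Qed.

Lemma pmulE s t : pmul (pres_pi s) (pres_pi t) = pres_pi (s * t).
Proof. by apply/pres_piP; apply: pres_mul; apply: pres_reprK. Qed.

Lemma pscaleE c t : pscale c (pres_pi t) = pres_pi (c *: t).
Proof.
by apply/pres_piP; apply: pres_mul; [apply: pres_refl | apply: pres_reprK].
Qed.

Fact paddA : associative padd.
Proof.
move=> x y z; rewrite (pres_piS x) (pres_piS y) (pres_piS z) !paddE.
by apply/pres_piP; apply: pres_addA.
Qed.

Fact paddC : commutative padd.
Proof.
move=> x y; rewrite (pres_piS x) (pres_piS y) !paddE.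
by apply/pres_piP; apply: pres_addC.
Qed.

Fact padd0 : left_id (pres_pi 0) padd.
Proof.
by move=> x; rewrite (pres_piS x) paddE; apply/pres_piP; apply: pres_add0.
Qed.

Fact paddN : left_inverse (pres_pi 0) (pscale (-1)) padd.
Proof.
move=> x; rewrite (pres_piS x) pscaleE paddE; apply/pres_piP.
set s := repr x.
apply: (pres_trans (t := ((-1) *: s + 1 * s)%P)).
  by apply: pres_add; [apply: pres_refl | apply/pres_sym/pres_mul1l].
apply: pres_trans (pres_sym (pres_mulDl _ _ _ _)) _.
apply: pres_trans (pres_mul0 _ s).
apply: pres_mul (pres_refl _ _); apply: pres_sym.
by have := pres_constD rel (-1) 1; rewrite addNr.
Qed.

HB.instance Definition _ :=
  GRing.isZmodule.Build presAlg paddA paddC padd0 paddN.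

Fact pmulA : associative pmul.
Proof.
move=> x y z; rewrite (pres_piS x) (pres_piS y) (pres_piS z) !pmulE.
by apply/pres_piP; apply: pres_mulA.
Qed.

Fact pmul1l : left_id (pres_pi 1) pmul.
Proof.
by move=> x; rewrite (pres_piS x) pmulE; apply/pres_piP; apply: pres_mul1l.
Qed.

Fact pmul1r : right_id (pres_pi 1) pmul.
Proof.
by move=> x; rewrite (pres_piS x) pmulE; apply/pres_piP; apply: pres_mul1r.
Qed.

Fact pmulDl : left_distributive pmul padd.
Proof.
move=> x y z; rewrite (pres_piS x) (pres_piS y) (pres_piS z).
by rewrite !(paddE, pmulE); apply/pres_piP; apply: pres_mulDl.
Qed.

Fact pmulDr : right_distributive pmul padd.
Proof.
move=> x y z; rewrite (pres_piS x) (pres_piS y) (pres_piS z).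
by rewrite !(paddE, pmulE); apply/pres_piP; apply: pres_mulDr.
Qed.

HB.instance Definition _ :=
  GRing.Zmodule_isPzRing.Build presAlg pmulA pmul1l pmul1r pmulDl pmulDr.

Fact pscaleA a b v : pscale a (pscale b v) = pscale (a * b) v.
Proof.
rewrite (pres_piS v) !pscaleE; apply/pres_piP.
apply: pres_trans (pres_mulA _ _ _ _) _.
by apply: pres_mul (pres_refl _ _); apply/pres_sym/pres_constM.
Qed.

Fact pscale1 : left_id 1 pscale.
Proof.
by move=> x; rewrite (pres_piS x) pscaleE; apply/pres_piP; apply: pres_mul1l.
Qed.

Fact pscaleDr : right_distributive pscale +%R.
Proof.
move=> c x y; rewrite (pres_piS x) (pres_piS y).
by rewrite [_ + _]paddE !pscaleE [_ + _]paddE; apply/pres_piP/pres_mulDr.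
Qed.

Fact pscaleDl v : {morph pscale^~ v : a b / a + b}.
Proof.
move=> a b; rewrite (pres_piS v) !pscaleE [RHS]paddE; apply/pres_piP.
apply: pres_trans (pres_mulDl _ _ _ _).
by apply: pres_mul (pres_refl _ _); apply: pres_constD.
Qed.

HB.instance Definition _ :=
  GRing.Zmodule_isLmodule.Build F presAlg pscaleA pscale1 pscaleDr pscaleDl.

End PresentedAlgebra.

(* The component of degree n of a pterm whose generators have degrees deg. *)
Fixpoint tcomp (F : fieldType) (I : Type) (deg : I -> nat) (t : pterm F I) :
    nat -> pterm F I :=
  match t with
  | TGen i => fun n => if deg i == n then TGen i else 0%P
  | TConst c => fun n => if n == 0%N then TConst c else 0%P
  | TAdd s u => fun n => TAdd (tcomp deg s n) (tcomp deg u n)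
  | TMul s u => fun n =>
      \big[@TAdd F I/0%P]_(k < n.+1) TMul (tcomp deg s k) (tcomp deg u (n - k)%N)
  end.

(** * Tensor products over a field *)

(* seq (V * W) stands for formal sums of pure tensors. *)
Inductive tens_eq (F : fieldType) (V W : lmodType F) :
    seq (V * W) -> seq (V * W) -> Prop :=
| tens_refl s : tens_eq s s
| tens_sym s t : tens_eq s t -> tens_eq t s
| tens_trans s t u : tens_eq s t -> tens_eq t u -> tens_eq s u
| tens_cat s s' t t' :
    tens_eq s s' -> tens_eq t t' -> tens_eq (s ++ t) (s' ++ t')
| tens_catC s t : tens_eq (s ++ t) (t ++ s)
| tens_0 w : tens_eq [:: (0, w)] [::]
| tens_Dl v v' w : tens_eq [:: (v + v', w)] [:: (v, w); (v', w)]
| tens_Dr v w w' : tens_eq [:: (v, w + w')] [:: (v, w); (v, w')]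
| tens_Z c v w : tens_eq [:: (c *: v, w)] [:: (v, c *: w)].

Section Tensor.
Variables (F : fieldType) (V W : lmodType F).

Definition tens_eqb (s t : seq (V * W)) : bool := `[< tens_eq s t >].

Fact tens_eqb_refl : reflexive tens_eqb.
Proof. by move=> s; apply/asboolP; apply: tens_refl. Qed.

Fact tens_eqb_sym : symmetric tens_eqb.
Proof. by move=> s t; apply/asboolP/asboolP; apply: tens_sym. Qed.

Fact tens_eqb_trans : transitive tens_eqb.
Proof.
by move=> t s u /asboolP st /asboolP tu; apply/asboolP; apply: tens_trans tu.
Qed.

Canonical tens_equiv := EquivRel tens_eqb tens_eqb_refl tens_eqb_sym tens_eqb_trans.

Definition tens := {eq_quot tens_equiv}.
HB.instance Definition _ := Choice.on tens.
HB.instance Definition _ := EqQuotient.on tens.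

Definition tens_pi (s : seq (V * W)) : tens := \pi_tens s.
Definition tpure (v : V) (w : W) : tens := tens_pi [:: (v, w)].

Lemma tens_piP s t : tens_eq s t <-> tens_pi s = tens_pi t.
Proof.
by split=> [st|/eqmodP /asboolP //]; apply/eqmodP/asboolP.
Qed.

Lemma tens_reprK s : tens_eq (repr (tens_pi s)) s.
Proof. by apply/tens_piP; rewrite /tens_pi reprK. Qed.

Lemma tens_piS (x : tens) : x = tens_pi (repr x).
Proof. by rewrite /tens_pi reprK. Qed.

Definition tscale_seq (c : F) (s : seq (V * W)) : seq (V * W) :=
  [seq (c *: p.1, p.2) | p <- s].

Definition tadd (x y : tens) : tens := tens_pi (repr x ++ repr y).
Definition tscale (c : F) (x : tens) : tens := tens_pi (tscale_seq c (repr x)).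

Lemma tscale_seq_eq c s t : tens_eq s t -> tens_eq (tscale_seq c s) (tscale_seq c t).
Proof.
elim=> {s t} /=.
- by move=> s; apply: tens_refl.
- by move=> s t _; apply: tens_sym.
- by move=> s t u _ st _ tu; apply: tens_trans tu.
- by move=> s s' t t' _ ss' _ tt'; rewrite /tscale_seq !map_cat; apply: tens_cat.
- by move=> s t; rewrite /tscale_seq !map_cat; apply: tens_catC.
- by move=> w; rewrite scaler0; apply: tens_0.
- by move=> v v' w; rewrite scalerDr; apply: tens_Dl.
- by move=> v w w'; apply: tens_Dr.
- by move=> d v w; rewrite scalerA mulrC -scalerA; apply: tens_Z.
Qed.

Lemma taddE s t : tadd (tens_pi s) (tens_pi t) = tens_pi (s ++ t).
Proof. by apply/tens_piP; apply: tens_cat; apply: tens_reprK. Qed.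

Lemma tscaleE c s : tscale c (tens_pi s) = tens_pi (tscale_seq c s).
Proof. by apply/tens_piP; apply: tscale_seq_eq; apply: tens_reprK. Qed.

Fact taddA : associative tadd.
Proof.
by move=> x y z; rewrite (tens_piS x) (tens_piS y) (tens_piS z) !taddE catA.
Qed.

Fact taddC : commutative tadd.
Proof.
move=> x y; rewrite (tens_piS x) (tens_piS y) !taddE.
by apply/tens_piP; apply: tens_catC.
Qed.

Fact tadd0 : left_id (tens_pi [::]) tadd.
Proof. by move=> x; rewrite (tens_piS x) taddE. Qed.

Lemma tscale_seqDl a b s :
  tens_eq (tscale_seq (a + b) s) (tscale_seq a s ++ tscale_seq b s).
Proof.
elim: s => [|[v w] s IHs] /=; first exact: tens_refl.
apply: (tens_trans (t := [:: (a *: v, w); (b *: v, w)] ++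
                         (tscale_seq a s ++ tscale_seq b s))).
  by rewrite -cat1s; apply: tens_cat IHs; rewrite scalerDl; apply: tens_Dl.
rewrite /= -[X in tens_eq X]cat1s -[X in tens_eq _ X]cat1s.
apply: tens_cat (tens_refl _) _.
rewrite -cat1s -[X in tens_eq _ (_ ++ X)]cat1s !catA.
by apply: tens_cat (tens_refl _); apply: tens_catC.
Qed.

Lemma tscale_seq0 s : tens_eq (tscale_seq 0 s) [::].
Proof.
elim: s => [|[v w] s IHs] /=; first exact: tens_refl.
rewrite scale0r -cat1s -[X in tens_eq _ X]cats0.
by apply: tens_cat IHs; apply: tens_0.
Qed.

Lemma tscale_seq1 s : tscale_seq 1 s = s.
Proof. by elim: s => [|[v w] s IHs] //=; rewrite scale1r IHs. Qed.

Fact taddN : left_inverse (tens_pi [::]) (tscale (-1)) tadd.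
Proof.
move=> x; rewrite (tens_piS x) tscaleE taddE; apply/tens_piP.
rewrite -[X in tens_eq (_ ++ X)]tscale_seq1.
apply: tens_trans (tens_sym (tscale_seqDl _ _ _)) _.
by rewrite addNr; apply: tscale_seq0.
Qed.

HB.instance Definition _ := GRing.isZmodule.Build tens taddA taddC tadd0 taddN.

Fact tscaleA a b v : tscale a (tscale b v) = tscale (a * b) v.
Proof.
rewrite (tens_piS v) !tscaleE /tscale_seq -map_comp.
by congr tens_pi; apply: eq_map => p /=; rewrite scalerA.
Qed.

Fact tscale1 : left_id 1 tscale.
Proof. by move=> x; rewrite (tens_piS x) tscaleE tscale_seq1. Qed.

Fact tscaleDr : right_distributive tscale +%R.
Proof.
move=> c x y; rewrite (tens_piS x) (tens_piS y) [_ + _]taddE !tscaleE.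
by rewrite [_ + _]taddE /tscale_seq map_cat.
Qed.

Fact tscaleDl v : {morph tscale^~ v : a b / a + b}.
Proof.
move=> a b; rewrite (tens_piS v) !tscaleE [RHS]taddE.
by apply/tens_piP; apply: tscale_seqDl.
Qed.

HB.instance Definition _ :=
  GRing.Zmodule_isLmodule.Build F tens tscaleA tscale1 tscaleDr tscaleDl.

(* For bilinear f, the linear map on the tensor product induced by f; it is
   only meaningful (independent of the chosen representative) for such f. *)
Definition tlift (U : lmodType F) (f : V -> W -> U) (t : tens) : U :=
  \sum_(p <- repr t) f p.1 p.2.

Lemma tliftE (U : lmodType F) (f : V -> W -> U) :
    (forall w, linear (fun v => f v w)) -> (forall v, linear (f v)) ->
  linear (tlift f) /\ (forall v w, tlift f (tpure v w) = f v w).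
Proof.
move=> fl fr.
have fl0 w : f 0 w = 0.
  have := fl w (-1) 0 0; rewrite scaler0 addr0 => {1}->.
  by rewrite scaleN1r addNr.
have flZ w c v : f (c *: v) w = c *: f v w.
  by have := fl w c v 0; rewrite addr0 fl0 addr0.
have flD w u v : f (u + v) w = f u w + f v w.
  by have := fl w 1 u v; rewrite !scale1r.
have fr0 v : f v 0 = 0.
  have := fr v (-1) 0 0; rewrite scaler0 addr0 => {1}->.
  by rewrite scaleN1r addNr.
have frZ v c w : f v (c *: w) = c *: f v w.
  by have := fr v c w 0; rewrite addr0 fr0 addr0.
have frD v u w : f v (u + w) = f v u + f v w.
  by have := fr v 1 u w; rewrite !scale1r.
have feq s t : tens_eq s t ->
    \sum_(p <- s) f p.1 p.2 = \sum_(p <- t) f p.1 p.2.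
  elim=> {s t} // [s t u _ -> _ -> //|s s' t t' _ e1 _ e2|s t|w|v v' w|v w w'|c v w].
  - by rewrite !big_cat /= e1 e2.
  - by rewrite !big_cat /= addrC.
  - by rewrite big_seq1 big_nil fl0.
  - by rewrite !big_cons !big_nil !addr0 flD.
  - by rewrite !big_cons !big_nil !addr0 frD.
  - by rewrite !big_seq1 flZ frZ.
have fpi s : tlift f (tens_pi s) = \sum_(p <- s) f p.1 p.2.
  by apply: feq; apply: tens_reprK.
split=> [c x y|v w]; last by rewrite fpi big_seq1.
rewrite (tens_piS x) (tens_piS y) [c *: _]tscaleE [_ + _]taddE !fpi big_cat /=.
by rewrite big_map scaler_sumr; congr (_ + _); apply: eq_bigr => p _; rewrite flZ.
Qed.

End Tensor.

Notation "v ⊗ w" := (tpure v w) (at level 39, left associativity) : ring_scope.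

(* Sweedler notation: E summed over the legs x and y of the tensor t. *)
Notation "'\sw_' ( x , y <- t ) E" := (tlift (fun x y => E) t)
  (at level 41, x name, y name, t at level 200, E at level 41,
   format "'\sw_' ( x ,  y  <-  t )  E") : ring_scope.

(** * Graded modules, graded algebras, differential graded algebras *)

Section Graded.
Variable F : fieldType.

(* gpr n is the projection onto the component of degree n.  The records gmod,
   galg, hopf_ops and cmod only hold operations; the axioms are the predicates
   is_gmod, is_galg, is_shopf, is_bhopf and is_cmod. *)
Record gmod := Gmod { gcar :> lmodType F; gpr : nat -> gcar -> gcar }.

Definition homog (V : gmod) (n : nat) (v : V) : Prop := gpr n v = v.

Record is_gmod (V : gmod) : Prop := IsGmod {
  gpr_linear : forall n, linear (@gpr V n);
  gpr_gpr : forall m n (v : V), gpr m (gpr n v) = if m == n then gpr n v else 0;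
  gpr_fin : forall v : V, exists N, v = \sum_(n < N) gpr n v
}.

(* The component of v of parity i (true is odd): the superspace underlying a
   graded module. *)
Definition par (V : gmod) (i : bool) (v : V) : V :=
  \sum_(n \in [set n : nat | odd n = i]%classic) gpr n v.

Definition sign (i : bool) : F := (-1) ^+ i.

Definition hlift (V : gmod) (U : lmodType F) (f : V -> bool -> U) (v : V) : U :=
  \sum_(i : bool) f (par i v) i.

Definition slift (V W : gmod) (U : lmodType F) (f : V -> bool -> W -> bool -> U)
    (t : tens V W) : U :=
  \sw_(v, w <- t) \sum_(i : bool) \sum_(j : bool) f (par i v) i (par j w) j.

End Graded.

Arguments gpr {F g}.
Arguments sign {F}.

(* Sums over the homogeneous components x, of parity i, of an element v. *)
Notation "'\hg_' ( x 'of' i <- v ) E" := (hlift (fun x i => E) v)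
  (at level 41, x name, i name, v at level 200, E at level 41,
   format "'\hg_' ( x  'of'  i  <-  v )  E") : ring_scope.

(* Sweedler sums with homogeneous legs x, y of parities i, j. *)
Notation "'\sw_' ( x 'of' i , y 'of' j <- t ) E" :=
  (slift (fun x i y j => E) t)
  (at level 41, x name, i name, y name, j name, t at level 200, E at level 41,
   format "'\sw_' ( x  'of'  i ,  y  'of'  j  <-  t )  E") : ring_scope.

Section GradedAlgebra.
Variable F : fieldType.
Implicit Types V W : gmod F.

Definition tpr V W (n : nat) (t : tens V W) : tens V W :=
  \sw_(v, w <- t) \sum_(k < n.+1) gpr k v ⊗ gpr (n - k) w.

Definition gtens V W : gmod F := @Gmod F (tens V W) (@tpr V W).

Definition tmap (V V' W W' : lmodType F) (f : V -> V') (g : W -> W')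
    (t : tens V W) : tens V' W' := \sw_(v, w <- t) f v ⊗ g w.

Definition is_glin V W (f : V -> W) : Prop :=
  linear f /\ (forall n v, f (gpr n v) = gpr n (f v)).

Record galg := Galg {
  galg_gmod :> gmod F;
  gmul : galg_gmod -> galg_gmod -> galg_gmod;
  gone : galg_gmod
}.

Local Notation "x ∙ y" := (gmul x y) (at level 40, left associativity).

Record is_galg (A : galg) : Prop := IsGalg {
  galg_is_gmod : is_gmod A;
  gmul_linearl : forall y : A, linear (fun x : A => x ∙ y);
  gmul_linearr : forall x : A, linear (fun y : A => x ∙ y);
  gmulA : forall x y z : A, x ∙ (y ∙ z) = x ∙ y ∙ z;
  gmul1l : forall x : A, gone A ∙ x = x;
  gmul1r : forall x : A, x ∙ gone A = x;
  gone_homog : homog 0 (gone A);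
  gmul_homog : forall m n (x y : A),
    homog m x -> homog n y -> homog (m + n) (x ∙ y)
}.

Definition is_galg_map (A A' : galg) (f : A -> A') : Prop :=
  [/\ is_glin f, f (gone A) = gone A' & forall x y, f (x ∙ y) = f x ∙ f y].

Definition smul (A A' : galg) (s t : tens A A') : tens A A' :=
  \sw_(a of _, b of i <- s) \sw_(c of j, e of _ <- t)
    sign (i && j) *: ((a ∙ c) ⊗ (b ∙ e)).

Definition stens (A A' : galg) : galg :=
  @Galg (gtens A A') (@smul A A') (gone A ⊗ gone A').

Definition tdif V W (dV : V -> V) (dW : W -> W) (t : tens V W) : tens V W :=
  \sw_(v of i, w of _ <- t) (dV v ⊗ w + sign i *: (v ⊗ dW w)).

Record is_dga (O : galg) (d : O -> O) : Prop := IsDga {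
  dga_is_galg : is_galg O;
  dga_linear : linear d;
  dga_homog : forall n (x : O), homog n x -> homog n.+1 (d x);
  dga_dd : forall x, d (d x) = 0;
  dga_leibniz : forall n (x y : O),
    homog n x -> d (x ∙ y) = d x ∙ y + (-1) ^+ n *: (x ∙ d y)
}.

Definition is_dga_map (O O' : galg) (d : O -> O) (d' : O' -> O')
    (f : O -> O') : Prop :=
  is_galg_map f /\ (forall x, f (d x) = d' (f x)).

(* (O, d) is an exterior algebra on A, where iA identifies A with O^0. *)
Record is_exterior (A O : galg) (iA : A -> O) (d : O -> O) : Prop :=
IsExterior {
  ext_deg0 : forall a : A, homog 0 a;
  ext_is_galg : is_galg A;
  ext_is_dga : is_dga d;
  ext_map : is_galg_map iA;
  ext_inj : injective iA;
  ext_zero : forall x : O, homog 0 x -> exists a, x = iA a;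
  ext_one : forall x : O, homog 1 x <->
    exists s : seq (A * A), x = \sum_(p <- s) iA p.1 ∙ d (iA p.2);
  ext_gen : forall P : O -> Prop,
    (forall a, P (iA a)) -> (forall x, homog 1 x -> P x) ->
    (forall x y, P x -> P y -> P (x + y)) ->
    (forall x y, P x -> P y -> P (x ∙ y)) -> forall x, P x
}.

(** * Super-Hopf algebras and crossed modules *)

(* Coproduct, counit and antipode. *)
Record hopf_ops (V : gmod F) := HopfOps {
  cop : V -> tens V V;
  cou : V -> F;
  anti : V -> V
}.

Record is_coalg V (H : hopf_ops V) : Prop := IsCoalg {
  cop_glin : @is_glin V (gtens V V) (cop H);
  copA : forall v, \sw_(v1, v2 <- cop H v) (cop H v1 ⊗ v2) =
    \sw_(v1, v23 <- cop H v) \sw_(v2, v3 <- cop H v23) (v1 ⊗ v2 ⊗ v3);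
  cou_linear : linear (cou H : V -> F^o);
  cou_homog : forall n v, cou H (gpr n.+1 v) = 0;
  coul : forall v, \sw_(v1, v2 <- cop H v) (cou H v1 *: v2) = v;
  cour : forall v, \sw_(v1, v2 <- cop H v) (cou H v2 *: v1) = v
}.

Record is_antipode (A : galg) (H : hopf_ops A) : Prop := IsAntipode {
  anti_glin : is_glin (anti H);
  antil : forall x, \sw_(x1, x2 <- cop H x) (anti H x1 ∙ x2) = cou H x *: gone A;
  antir : forall x, \sw_(x1, x2 <- cop H x) (x1 ∙ anti H x2) = cou H x *: gone A
}.

Record is_shopf (A : galg) (H : hopf_ops A) : Prop := IsShopf {
  shopf_galg : is_galg A;
  shopf_coalg : is_coalg H;
  shopf_cop : @is_galg_map A (stens A A) (cop H);
  shopf_couM : forall x y, cou H (x ∙ y) = cou H x * cou H y;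
  shopf_cou1 : cou H (gone A) = 1;
  shopf_anti : is_antipode H
}.

Record is_strongly_bicovariant (A O : galg) (HA : hopf_ops A) (HO : hopf_ops O)
    (iA : A -> O) (d : O -> O) : Prop := IsStronglyBicovariant {
  sb_ext : is_exterior iA d;
  sb_hopf : is_shopf HA;
  sb_shopf : is_shopf HO;
  sb_restr : forall a, cop HO (iA a) = tmap iA iA (cop HA a);
  sb_dif : forall x, cop HO (d x) = tdif d d (cop HO x)
}.

(* Right action and right coaction of K on V. *)
Record cmod (K : galg) (V : gmod F) := Cmod {
  act : V -> K -> V;
  coact : V -> tens V K
}.

Section Crossed.
Variables (K : galg) (H : hopf_ops K).

Record is_cmod V (C : cmod K V) : Prop := IsCmod {
  cmod_gmod : is_gmod V;
  act_linearl : forall k, linear (fun v => act C v k);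
  act_linearr : forall v, linear (fun k => act C v k);
  act_homog : forall m n (v : V) (k : K),
    homog m v -> homog n k -> homog (m + n) (act C v k);
  act1 : forall v, act C v (gone K) = v;
  actM : forall v k l, act C v (k ∙ l) = act C (act C v k) l;
  coact_glin : @is_glin V (gtens V K) (coact C);
  coactA : forall v, \sw_(v0, v1 <- coact C v) (coact C v0 ⊗ v1) =
    \sw_(v0, v12 <- coact C v) \sw_(v1, v2 <- cop H v12) (v0 ⊗ v1 ⊗ v2);
  coact_cou : forall v, \sw_(v0, v1 <- coact C v) (cou H v1 *: v0) = v;
  coact_act : forall v k, coact C (act C v k) =
    \sw_(v0 of _, v1 of r <- coact C v)
    \sw_(k12, k3 <- cop H k) \sw_(k1 of i, k2 of j <- cop H k12)
      sign ((r && (i (+) j)) (+) (i && j)) *: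
        (act C v0 k2 ⊗ (anti H k1 ∙ v1 ∙ k3))
}.

Definition is_cmod_map V W (C : cmod K V) (D : cmod K W) (f : V -> W) : Prop :=
  [/\ is_glin f,
      forall v k, f (act C v k) = act D (f v) k &
      forall v, coact D (f v) = \sw_(v0, v1 <- coact C v) (f v0 ⊗ v1)].

Definition cmod_tens V W (C : cmod K V) (D : cmod K W) : cmod K (gtens V W) :=
  @Cmod K (gtens V W)
    (fun t k => \sw_(v of _, w of r <- t) \sw_(k1 of i, k2 of _ <- cop H k)
       sign (r && i) *: (act C v k1 ⊗ act D w k2))
    (fun t => \sw_(v, w <- t)
       \sw_(v0 of _, v1 of i <- coact C v) \sw_(w0 of j, w1 of _ <- coact D w)
       sign (i && j) *: (v0 ⊗ w0 ⊗ (v1 ∙ w1))).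

Definition braiding V W (C : cmod K V) (D : cmod K W) (v : V) (w : W) :
    tens W V :=
  \hg_(v' of i <- v) \sw_(w0 of j, w1 of _ <- coact D w)
    sign (i && j) *: (w0 ⊗ act C v' w1).

(* Product of the braided tensor product algebra B ⊗ B. *)
Definition braided_mul (B : galg) (C : cmod K B) (s t : tens B B) : tens B B :=
  \sw_(u1, u2 <- s) \sw_(v1, v2 <- t) \sw_(w, w' <- braiding C C u2 v1)
    ((u1 ∙ w) ⊗ (w' ∙ v2)).

(* (Super) braided-Hopf algebra in the category of (super) right K-crossed
   modules: all structure maps are morphisms of the category, the ground field
   having the action v ◁ k = ε(k) v and the coaction 1 |-> 1 ⊗ 1. *)
Record is_bhopf (B : galg) (C : cmod K B) (HB : hopf_ops B) : Prop := IsBhopf {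
  bhopf_cmod : is_cmod C;
  bhopf_galg : is_galg B;
  bhopf_coalg : is_coalg HB;
  bhopf_mul : is_cmod_map (cmod_tens C C) C (fun t => \sw_(u, v <- t) u ∙ v);
  bhopf_act1 : forall k, act C (gone B) k = cou H k *: gone B;
  bhopf_coact1 : coact C (gone B) = gone B ⊗ gone K;
  bhopf_cop : is_cmod_map C (cmod_tens C C) (cop HB);
  bhopf_cou_act : forall u k, cou HB (act C u k) = cou HB u * cou H k;
  bhopf_cou_coact : forall u,
    \sw_(u0, u1 <- coact C u) (cou HB u0 *: u1) = cou HB u *: gone K;
  bhopf_copM : forall u v,
    cop HB (u ∙ v) = braided_mul C (cop HB u) (cop HB v);
  bhopf_cop1 : cop HB (gone B) = gone B ⊗ gone B;
  bhopf_couM : forall u v, cou HB (u ∙ v) = cou HB u * cou HB v;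
  bhopf_cou1 : cou HB (gone B) = 1;
  bhopf_anti : is_antipode HB;
  bhopf_anti_map : is_cmod_map C C (anti HB)
}.

Variables (B : galg) (C : cmod K B) (HB : hopf_ops B).

Definition bos_mul (s t : tens K B) : tens K B :=
  \sw_(w of _, e of i <- s) \sw_(tau, xi <- t)
    \sw_(tau1 of j, tau2 of _ <- cop H tau)
      sign (i && j) *: ((w ∙ tau1) ⊗ (act C e tau2 ∙ xi)).

Definition bos : galg := @Galg (gtens K B) bos_mul (gone K ⊗ gone B).

Definition bos_cop (t : tens K B) : tens (tens K B) (tens K B) :=
  \sw_(w, e <- t) \sw_(w1 of _, w2 of i <- cop H w) \sw_(e1, e2 <- cop HB e)
    \sw_(e10 of j, e11 of _ <- coact C e1)
      sign (i && j) *: ((w1 ⊗ e10) ⊗ ((w2 ∙ e11) ⊗ e2)).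

Definition bos_cou (t : tens K B) : F :=
  \sw_(w, e <- t) (cou H w * cou HB e : F^o).

Definition bos_hopf (S : bos -> bos) : hopf_ops bos :=
  @HopfOps bos bos_cop bos_cou S.

Definition bos_inl (w : K) : bos := w ⊗ gone B.
Definition bos_inr (e : B) : bos := gone K ⊗ e.

End Crossed.

(** * Differentiable coactions *)

Record is_comodule_algebra (K B : galg) (H : hopf_ops K) (D : B -> tens B K) :
    Prop := IsComoduleAlgebra {
  coma_map : @is_galg_map B (stens B K) D;
  comaA : forall v, \sw_(v0, v1 <- D v) (D v0 ⊗ v1) =
    \sw_(v0, v12 <- D v) \sw_(v1, v2 <- cop H v12) (v0 ⊗ v1 ⊗ v2);
  coma_cou : forall v, \sw_(v0, v1 <- D v) (cou H v1 *: v0) = v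
}.

Definition is_differentiable (B K OB OK : galg) (iB : B -> OB) (dB : OB -> OB)
    (iK : K -> OK) (dK : OK -> OK) (D : B -> tens B K) : Prop :=
  exists D' : OB -> tens OB OK,
    @is_dga_map OB (stens OB OK) dB (tdif dB dK) D' /\
    (forall b, D' (iB b) = tmap iB iK (D b)).

Definition presGalg (I : Type) (deg : I -> nat)
    (rel : pterm F I -> pterm F I -> Prop) : galg :=
  @Galg (@Gmod F (presAlg rel) (fun n x => pres_pi rel (tcomp deg (repr x) n)))
    *%R 1.

End GradedAlgebra.

Notation "x ∙ y" := (gmul x y) (at level 40, left associativity) : ring_scope.

(** * The quantum group, the quantum plane and their calculi *)

Notation i1 := (ord0 : 'I_2).
Notation i2 := (ord_max : 'I_2).

Definition mx2 (T : Type) (m11 m12 m21 m22 : T) (i j : 'I_2) : T :=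
  if i == i1 then (if j == i1 then m11 else m12)
  else (if j == i1 then m21 else m22).

Section Quantum.
Variables (F : fieldType) (q : F).

Local Notation lam := (q - q^-1).

(* Rmx i j k l = R^i_j^k_l. *)
Definition Rmx (i j k l : 'I_2) : F :=
  if (i == j) && (k == l) then (if i == k then q else 1)
  else if [&& i == i1, j == i2, k == i2 & l == i1] then lam else 0.

(* Di inverts D = ad - q^-1 bc; that D = da - q cb and that D is central follow
   from the other relations. *)
Inductive gl2_rel (I : Type) (t : 'I_2 -> 'I_2 -> pterm F I) (Di : pterm F I) :
    pterm F I -> pterm F I -> Prop :=
| gl2_ba : gl2_rel t Di (t i1 i2 * t i1 i1)%P (q *: (t i1 i1 * t i1 i2))%P
| gl2_ca : gl2_rel t Di (t i2 i1 * t i1 i1)%P (q *: (t i1 i1 * t i2 i1))%P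
| gl2_db : gl2_rel t Di (t i2 i2 * t i1 i2)%P (q *: (t i1 i2 * t i2 i2))%P
| gl2_dc : gl2_rel t Di (t i2 i2 * t i2 i1)%P (q *: (t i2 i1 * t i2 i2))%P
| gl2_cb : gl2_rel t Di (t i2 i1 * t i1 i2)%P (t i1 i2 * t i2 i1)%P
| gl2_da : gl2_rel t Di (t i2 i2 * t i1 i1)%P
    (t i1 i1 * t i2 i2 + lam *: (t i1 i2 * t i2 i1))%P
| gl2_Dr : gl2_rel t Di
    ((t i1 i1 * t i2 i2 + (- q^-1) *: (t i1 i2 * t i2 i1)) * Di)%P 1%P
| gl2_Dl : gl2_rel t Di
    (Di * (t i1 i1 * t i2 i2 + (- q^-1) *: (t i1 i2 * t i2 i1)))%P 1%P.

Inductive gl2_gen := GLt of 'I_2 & 'I_2 | GLDi.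

Definition CqGL2 : galg F :=
  presGalg (fun _ => 0%N) (gl2_rel (fun i j => TGen (GLt i j)) (TGen GLDi)).

Definition glt (i j : 'I_2) : CqGL2 := pgen _ (GLt i j).
Definition glDi : CqGL2 := pgen _ GLDi.

Inductive ogl2_gen := OGLt of 'I_2 & 'I_2 | OGLDi | OGLdt of 'I_2 & 'I_2.

Definition ogl2_deg (g : ogl2_gen) : nat := if g is OGLdt _ _ then 1 else 0.

Local Notation tT i j := (TGen (OGLt i j)).
Local Notation dtT i j := (TGen (OGLdt i j)).

Inductive ogl2_rel : pterm F ogl2_gen -> pterm F ogl2_gen -> Prop :=
| ogl2_tt s u :
    gl2_rel (fun i j => tT i j) (TGen OGLDi) s u -> ogl2_rel s u
| ogl2_dtt i j k l : ogl2_rel (dtT i j * tT k l)%P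
    (\big[@TAdd F ogl2_gen/0%P]_(a : 'I_2) \big[@TAdd F ogl2_gen/0%P]_(b : 'I_2)
     \big[@TAdd F ogl2_gen/0%P]_(m : 'I_2) \big[@TAdd F ogl2_gen/0%P]_(n : 'I_2)
       ((Rmx k b i a * Rmx m j n l)%R *: (tT b n * dtT a m))%P)
| ogl2_dtdt i j k l : ogl2_rel (dtT i j * dtT k l)%P
    (\big[@TAdd F ogl2_gen/0%P]_(a : 'I_2) \big[@TAdd F ogl2_gen/0%P]_(b : 'I_2)
     \big[@TAdd F ogl2_gen/0%P]_(m : 'I_2) \big[@TAdd F ogl2_gen/0%P]_(n : 'I_2)
       ((- (Rmx k b i a * Rmx m j n l))%R *: (dtT b n * dtT a m))%P).

Definition OmGL2 : galg F := presGalg ogl2_deg ogl2_rel.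

Definition oglt (i j : 'I_2) : OmGL2 := pgen _ (OGLt i j).
Definition oglDi : OmGL2 := pgen _ OGLDi.
Definition ogldt (i j : 'I_2) : OmGL2 := pgen _ (OGLdt i j).

Inductive plane_rel (I : Type) (x : 'I_2 -> pterm F I) :
    pterm F I -> pterm F I -> Prop :=
| plane_xx : plane_rel x (x i2 * x i1)%P (q *: (x i1 * x i2))%P.

Definition Cq2 : galg F :=
  presGalg (fun _ => 0%N) (plane_rel (fun i : 'I_2 => TGen i)).

Definition plx (i : 'I_2) : Cq2 := pgen _ i.

Inductive oplane_gen := OPx of 'I_2 | OPdx of 'I_2.

Definition oplane_deg (g : oplane_gen) : nat := if g is OPdx _ then 1 else 0.

Local Notation xT i := (TGen (OPx i)).
Local Notation dxT i := (TGen (OPdx i)).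

Inductive oplane_rel : pterm F oplane_gen -> pterm F oplane_gen -> Prop :=
| oplane_xx s u : plane_rel (fun i => xT i) s u -> oplane_rel s u
| oplane_dxx i : oplane_rel (dxT i * xT i)%P ((q ^+ 2)%R *: (xT i * dxT i))%P
| oplane_dx1x2 : oplane_rel (dxT i1 * xT i2)%P (q *: (xT i2 * dxT i1))%P
| oplane_dx2x1 : oplane_rel (dxT i2 * xT i1)%P
    (q *: (xT i1 * dxT i2) + (q ^+ 2 - 1)%R *: (xT i2 * dxT i1))%P
| oplane_dxdx i : oplane_rel (dxT i * dxT i)%P 0%P
| oplane_dx2dx1 : oplane_rel (dxT i2 * dxT i1)%P
    ((- q^-1)%R *: (dxT i1 * dxT i2))%P.

Definition OmCq2 : galg F := presGalg oplane_deg oplane_rel.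

Definition oplx (i : 'I_2) : OmCq2 := pgen _ (OPx i).
Definition opldx (i : 'I_2) : OmCq2 := pgen _ (OPdx i).

End Quantum.

(* Main.v *)
(* All algebras are presented by generators and relations, so that structure
   maps are defined on generators and identities between (super) algebra maps are
   checked on generators.  That a map respects the relations, or that two maps
   agree on a generator, is an identity between words in letters that satisfy
   quadratic relations over Z[q, q^-1]; it is verified by rewriting to a normal
   form, without any basis theorem.  The algebras in degree 0 have the same
   relations with differentials set to zero, and are treated simultaneously.

   The coaction of Omega(C_q[GL_2]) on Omega(C_q^2), the coaction D of the
   bosonisation W, and the coproduct of W all exist by the universal property.
   The braided coproduct is recovered from D by projecting W to Omega(C_q^2),
   and its axioms, crossed module condition included, follow from those of W.
   The antipode of Omega(C_q[GL_2]) is given on generators; those of Omega(C_q^2)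
   and W are convolution inverses of the identity, given by geometric series that
   are finite along the filtration by the degree in x_i, dx_i.  A differential d
   is encoded by the algebra map x |-> (x, dx) into an algebra of triangular
   matrices. *)

(* The hypothesis q^2 <> -1 is what makes the calculus on GL_2 usable for rewriting: the relations
   only give (1 + q^2)(dt)^2 = 0 for each generator t, whereas the normal forms need (dt)^2 = 0. The
   construction that resists the universal property is the action. Since (uv) acted upon by k
   involves the coproduct of k, it is an algebra map out of neither algebra. It is built from a
   representation of Omega(C_q[GL_2]) by 4 x 4 matrices, whose coefficients presuppose no linear
   independence of x_i and dx_i, and from operators on the tensor product of both calculi that
   imitate left multiplication in the smash product still to be constructed. Write K, B, W for the
   two calculi and the bosonisation. The crossed module condition, freed of the antipode, says that
   two elements of B ⊗ K agree; both are the image of the coproduct of e k in W ⊗ W, for e in B and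
   k in K, under the projection of the first leg to B and of the second to K. One comes from
   multiplicativity of the coproduct, the other from the cross relation for e k. The remaining
   braided axioms are obtained by similar projections. *)
Require Import Defs.
From HB Require Import structures.
From mathcomp Require Import all_boot all_order all_algebra.
From mathcomp Require Import ring.
From mathcomp Require Import boolp classical_sets cardinality fsbigop.
From mathcomp Require Import reals complex.

Set Implicit Arguments.
Unset Strict Implicit.
Unset Printing Implicit Defensive.

Import GRing.Theory.

Local Open Scope ring_scope.

(** * Tensor products *)

Section Linear.
Variable F : fieldType.
Implicit Types T U V W : lmodType F.

Lemma linD V W (f : V -> W) : linear f -> forall u v, f (u + v) = f u + f v.
Proof. by move=> fl u v; have := fl 1 u v; rewrite !scale1r. Qed.

Lemma lin0 V W (f : V -> W) : linear f -> f 0 = 0.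
Proof.
by move=> fl; have := fl (-1) 0 0; rewrite scaler0 addr0 => {1}->; rewrite scaleN1r addNr.
Qed.

Lemma linZ V W (f : V -> W) : linear f -> forall c v, f (c *: v) = c *: f v.
Proof. by move=> fl c v; have := fl c v 0; rewrite addr0 lin0 ?addr0. Qed.

Lemma linN V W (f : V -> W) : linear f -> forall v, f (- v) = - f v.
Proof. by move=> fl v; rewrite -scaleN1r linZ // scaleN1r. Qed.

Lemma linB V W (f : V -> W) : linear f -> forall u v, f (u - v) = f u - f v.
Proof. by move=> fl u v; rewrite linD // linN. Qed.

Lemma lin_sum V W (f : V -> W) : linear f ->
  forall (I : Type) (r : seq I) (P : pred I) (g : I -> V),
    f (\sum_(i <- r | P i) g i) = \sum_(i <- r | P i) f (g i).
Proof.
by move=> fl I r P g; apply: (big_morph f (linD fl) (lin0 fl)).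
Qed.

Lemma lf_id V : linear (fun v : V => v).
Proof. by []. Qed.

Lemma lf_comp U V W (f : V -> W) (g : U -> V) :
  linear f -> linear g -> linear (fun x => f (g x)).
Proof. by move=> fl gl a u v; rewrite gl fl. Qed.

Lemma lf_zero V W : linear (fun _ : V => 0 : W).
Proof. by move=> a u v; rewrite scaler0 addr0. Qed.

Lemma lf_add V W (f g : V -> W) :
  linear f -> linear g -> linear (fun x => f x + g x).
Proof. by move=> fl gl a u v; rewrite fl gl scalerDr addrACA. Qed.

Lemma lf_opp V W (f : V -> W) : linear f -> linear (fun x => - f x).
Proof. by move=> fl a u v; rewrite fl opprD scalerN. Qed.

Lemma lf_scale V W (c : F) (f : V -> W) :
  linear f -> linear (fun x => c *: f x).
Proof. by move=> fl a u v; rewrite fl scalerDr !scalerA mulrC. Qed.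

Lemma lf_scalel V W (f : V -> F) (w : W) :
  linear (f : V -> F^o) -> linear (fun x => f x *: w).
Proof. by move=> fl a u v; rewrite fl scalerDl scalerA. Qed.

Lemma lf_sum V W (I : Type) (r : seq I) (P : pred I) (f : I -> V -> W) :
  (forall i, linear (f i)) -> linear (fun x => \sum_(i <- r | P i) f i x).
Proof.
move=> fl a u v; rewrite scaler_sumr -big_split /=.
by apply: eq_bigr => i _; rewrite fl.
Qed.

Definition bilin U V W (f : U -> V -> W) : Prop :=
  (forall v, linear (fun u => f u v)) /\ (forall u, linear (f u)).

Lemma bilin_tpure V W : bilin (@tpure F V W).
Proof.
split=> [w|v] a u u'.
  rewrite [X in _ = X + _]tscaleE [RHS]taddE; apply/tens_piP; exact: tens_Dl.
rewrite [X in _ = X + _]tscaleE [RHS]taddE; apply/tens_piP.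
apply: (tens_trans (tens_Dr _ _ _)).
rewrite -cat1s -[X in tens_eq _ X]cat1s; apply: tens_cat (tens_refl _).
exact/tens_sym/tens_Z.
Qed.

Lemma lf_tpl U V W (f : U -> V) (w : W) : linear f -> linear (fun x => f x ⊗ w).
Proof. exact: lf_comp ((bilin_tpure V W).1 w). Qed.

Lemma lf_tpr U V W (f : U -> W) (v : V) : linear f -> linear (fun x => v ⊗ f x).
Proof. exact: lf_comp ((bilin_tpure V W).2 v). Qed.

Lemma tensDl V W (v v' : V) (w : W) : (v + v') ⊗ w = v ⊗ w + v' ⊗ w.
Proof. exact: linD ((bilin_tpure V W).1 w) _ _. Qed.
Lemma tensDr V W (v : V) (w w' : W) : v ⊗ (w + w') = v ⊗ w + v ⊗ w'.
Proof. exact: linD ((bilin_tpure V W).2 v) _ _. Qed.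
Lemma tensZl V W c (v : V) (w : W) : (c *: v) ⊗ w = c *: (v ⊗ w).
Proof. exact: linZ ((bilin_tpure V W).1 w) _ _. Qed.
Lemma tensZr V W c (v : V) (w : W) : v ⊗ (c *: w) = c *: (v ⊗ w).
Proof. exact: linZ ((bilin_tpure V W).2 v) _ _. Qed.
Lemma tens0l V W (w : W) : (0 : V) ⊗ w = 0.
Proof. exact: lin0 ((bilin_tpure V W).1 w). Qed.
Lemma tens0r V W (v : V) : v ⊗ (0 : W) = 0.
Proof. exact: lin0 ((bilin_tpure V W).2 v). Qed.
Lemma tensNl V W (v : V) (w : W) : (- v) ⊗ w = - (v ⊗ w).
Proof. exact: linN ((bilin_tpure V W).1 w) _. Qed.
Lemma tens_suml V W (I : Type) (r : seq I) (P : pred I) (g : I -> V) (w : W) :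
  (\sum_(i <- r | P i) g i) ⊗ w = \sum_(i <- r | P i) g i ⊗ w.
Proof. exact: lin_sum ((bilin_tpure V W).1 w) _ _ _ _. Qed.
Lemma tens_sumr V W (I : Type) (r : seq I) (P : pred I) (g : I -> W) (v : V) :
  v ⊗ (\sum_(i <- r | P i) g i) = \sum_(i <- r | P i) v ⊗ g i.
Proof. exact: lin_sum ((bilin_tpure V W).2 v) _ _ _ _. Qed.

(** The empty formal sum is 0 ⊗ 0, which is why no case for the zero tensor is needed. *)
Lemma tens_ind V W (P : tens V W -> Prop) :
  (forall v w, P (v ⊗ w)) -> (forall s t, P s -> P t -> P (s + t)) ->
  forall t, P t.
Proof.
move=> Pp PD t; rewrite (tens_piS t); elim: (repr t) => [|[v w] s IHs].
  have -> : tens_pi [::] = (0 : V) ⊗ (0 : W) by rewrite tens0l.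
  exact: Pp.
have -> : tens_pi ((v, w) :: s) = v ⊗ w + tens_pi s.
  by rewrite [RHS]taddE.
by apply: PD.
Qed.

Lemma tens_ext U V W (f g : tens V W -> U) : linear f -> linear g ->
  (forall v w, f (v ⊗ w) = g (v ⊗ w)) -> forall t, f t = g t.
Proof.
move=> fl gl fg; apply: tens_ind => // s t fs ft.
by rewrite (linD fl) (linD gl) fs ft.
Qed.

Lemma lf_tlift U V W (f : V -> W -> U) : bilin f -> linear (tlift f).
Proof. by case=> fl fr; case: (tliftE fl fr). Qed.

Lemma tlift_pure U V W (f : V -> W -> U) : bilin f ->
  forall v w, tlift f (v ⊗ w) = f v w.
Proof. by case=> fl fr; case: (tliftE fl fr). Qed.

Lemma lf_tlift_arg T U V W (f : V -> W -> U) (g : T -> tens V W) :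
  bilin f -> linear g -> linear (fun x => tlift f (g x)).
Proof. by move=> /lf_tlift; apply: lf_comp. Qed.

(** No bilinearity in the legs is required: [tlift] sums over one fixed representative of [t]. The
    same applies to [eq_tlift] and [lin_tlift]; bilinearity matters only when the tensor itself
    varies or is pure. *)
Lemma lf_tlift_par T U V W (f : T -> V -> W -> U) t :
  (forall v w, linear (fun x => f x v w)) -> linear (fun x => tlift (f x) t).
Proof. by move=> fl; apply: lf_sum => p. Qed.

Lemma eq_tlift U V W (f g : V -> W -> U) t : (forall v w, f v w = g v w) ->
  tlift f t = tlift g t.
Proof. by move=> fg; apply: eq_bigr => p _. Qed.

Lemma lin_tlift T U V W (h : U -> T) (f : V -> W -> U) t : linear h ->
  h (tlift f t) = tlift (fun v w => h (f v w)) t.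
Proof. by move=> hl; rewrite /tlift lin_sum. Qed.

Lemma tlift_id V W (t : tens V W) : tlift (fun v w => v ⊗ w) t = t.
Proof.
have bl := bilin_tpure V W.
by apply: (tens_ext (lf_tlift bl) (@lf_id _)) => v w; rewrite tlift_pure.
Qed.

End Linear.

(* Discharges linearity goals for composite expressions; lin_hook is extended
   below by the linear operations of graded algebras. *)
Ltac lin_hook := fail.
Ltac lin_step := cbv beta; match goal with
  | |- bilin _ => split
  | |- forall _, _ => intro
  | _ => first
    [ assumption | apply: lf_id | apply: lf_zero
    | apply: lf_tpl | apply: lf_tpr | lin_hook
    | apply: lf_tlift_arg | apply: lf_tlift_par
    | apply: lf_add | apply: lf_opp | apply: lf_scale
    | apply: lf_sum | apply: lf_scalel ]
  end.
Ltac lin := repeat lin_step.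

(** * Parities *)

Section Parity.
Variable F : fieldType.
Implicit Types V W : gmod F.

(** Stated through the components of the other parity, which avoids the sum over an infinite index
    set in [par]. *)
Definition ph V (i : bool) (v : V) : Prop := forall n, odd n != i -> gpr n v = 0.

Section One.
Variables (V : gmod F) (hV : is_gmod V).

Lemma homog_gpr n m (v : V) : homog n v -> gpr m v = if m == n then v else 0.
Proof. by move=> hv; rewrite -[v in LHS]hv (gpr_gpr hV) hv. Qed.

Lemma gpr_homog n (v : V) : homog n (gpr n v).
Proof. by rewrite /homog (gpr_gpr hV) eqxx. Qed.

Lemma gpr_bound (v : V) : exists N, forall n, (N <= n)%N -> gpr n v = 0.
Proof.
have [N vE] := gpr_fin hV v; exists N => n Nn.
rewrite vE (lin_sum (gpr_linear hV n)) big1 // => i _.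
by rewrite (gpr_gpr hV) gtn_eqF // (leq_trans (ltn_ord i)).
Qed.

Lemma gpr_sum (v : V) N : (forall n, (N <= n)%N -> gpr n v = 0) ->
  v = \sum_(n < N) gpr n v.
Proof.
move=> hN; have [M vE] := gpr_fin hV v; rewrite {1}vE.
rewrite (big_ord_widen _ (fun n => gpr n v) (leq_maxl M N)).
rewrite [RHS](big_ord_widen _ (fun n => gpr n v) (leq_maxr M N)).
rewrite big_mkcond [RHS]big_mkcond /=; apply: eq_bigr => i _.
case: ltnP => iM; case: ltnP => iN //; first by rewrite hN.
have : gpr i v = 0; last by [].
rewrite vE (lin_sum (gpr_linear hV i)) big1 // => j _.
by rewrite (gpr_gpr hV) gtn_eqF // (leq_trans (ltn_ord j)).
Qed.

(** A bound on the degrees of [v] turns the sum over all degrees of one parity into an ordinary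
    finite sum, on which linearity and projections can be computed. The bound is arbitrary, so that
    two vectors can share one. *)
Lemma parE (v : V) i N : (forall n, (N <= n)%N -> gpr n v = 0) ->
  par i v = \sum_(n < N | odd n == i) gpr n v.
Proof.
move=> hN; rewrite /par (@fsbigE _ _ _ _ _ [seq n <- iota 0 N | odd n == i]).
- rewrite big_filter_cond -(big_mkord (fun n => odd n == i) (fun n => gpr n v)) /index_iota subn0.
  apply: eq_bigl => n; apply/andP/idP => [[]//|/eqP ni].
  by split; [apply/eqP | rewrite inE].
- exact/filter_uniq/iota_uniq.
- by move=> n /=; rewrite mem_filter => /andP[/eqP].
- move=> n /= ni; rewrite mem_filter ni eqxx mem_iota add0n /= -leqNgt.
  exact: hN.
Qed.

Lemma lf_gpr n : linear (@gpr F V n).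
Proof. exact: (gpr_linear hV). Qed.

Lemma lf_par i : linear (@par F V i).
Proof.
move=> a u v; have [N1 h1] := gpr_bound u; have [N2 h2] := gpr_bound v.
set N := maxn N1 N2.
have hu n : (N <= n)%N -> gpr n u = 0.
  by move=> Nn; apply: h1; apply: leq_trans Nn; apply: leq_maxl.
have hv n : (N <= n)%N -> gpr n v = 0.
  by move=> Nn; apply: h2; apply: leq_trans Nn; apply: leq_maxr.
rewrite (parE i hu) (parE i hv) (@parE _ _ N); last first.
  by move=> n Nn; rewrite lf_gpr hu // hv // scaler0 addr0.
rewrite scaler_sumr -big_split /=; apply: eq_bigr => n _.
by rewrite lf_gpr.
Qed.

Lemma gpr_par n i (v : V) : gpr n (par i v) = if odd n == i then gpr n v else 0.
Proof.
have [N hN] := gpr_bound v; rewrite (parE i hN) (lin_sum (lf_gpr n)).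
rewrite (eq_bigr (fun m : 'I_N => if (m : nat) == n then gpr n v else 0)); last first.
  by move=> m _; rewrite (gpr_gpr hV) eq_sym; case: eqP => // ->.
rewrite -big_mkcondr /=; case: (ltnP n N) => nN.
  rewrite (eq_bigl (fun m : 'I_N => (m == Ordinal nN) && (odd n == i))).
    by case: eqP => _; [rewrite (eq_bigl _ _ (fun=> andbT _)) big_pred1_eq
      | rewrite big_pred0 // => m; rewrite andbF].
  move=> m; rewrite andbC; case: (altP (m =P Ordinal nN)) => [->|mn] /=.
    by rewrite eqxx.
  by apply/negbTE; apply: contra mn => /andP[/eqP mn _]; apply/eqP/val_inj.
by rewrite hN // big1 //; case: ifP.
Qed.

Lemma gpr_inj (v w : V) : (forall n, gpr n v = gpr n w) -> v = w.
Proof.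
move=> vw; have [N hN] := gpr_bound v.
rewrite (gpr_sum hN) (@gpr_sum w N); first exact: eq_bigr.
by move=> n nN; rewrite -vw hN.
Qed.

Lemma ph_par i (v : V) : ph i (par i v).
Proof. by move=> n /negbTE ni; rewrite gpr_par ni. Qed.

Lemma par_id i (v : V) : ph i v -> par i v = v.
Proof.
by move=> vi; apply: gpr_inj => n; rewrite gpr_par; case: eqP => // /eqP /vi.
Qed.

Lemma par_neq i j (v : V) : ph i v -> j != i -> par j v = 0.
Proof.
move=> vi ji; apply: gpr_inj => n; rewrite gpr_par (lin0 (lf_gpr n)).
by case: eqP => // nj; apply: vi; rewrite nj.
Qed.

Lemma par_sum (v : V) : v = \sum_(i : bool) par i v.
Proof.
apply: gpr_inj => n; rewrite big_bool /= (linD (lf_gpr n)) !gpr_par.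
by case: (odd n); rewrite /= ?addr0 ?add0r.
Qed.

Lemma homog_ph n (v : V) : homog n v -> ph (odd n) v.
Proof. by move=> hv m mn; rewrite (homog_gpr _ hv); case: (m =P n) mn => // ->; rewrite eqxx. Qed.

Lemma ph0 i : ph i (0 : V).
Proof. by move=> n _; rewrite (lin0 (lf_gpr n)). Qed.
Lemma phD i (v w : V) : ph i v -> ph i w -> ph i (v + w).
Proof. by move=> hv hw n ni; rewrite (linD (lf_gpr n)) hv // hw // addr0. Qed.
Lemma phZ i c (v : V) : ph i v -> ph i (c *: v).
Proof. by move=> hv n ni; rewrite (linZ (lf_gpr n)) hv // scaler0. Qed.

Lemma ph_ext (U : lmodType F) (f g : V -> U) : linear f -> linear g ->
  (forall i v, ph i v -> f v = g v) -> forall v, f v = g v.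
Proof.
move=> fl gl fg v; rewrite (par_sum v) !lin_sum //.
by apply: eq_bigr => i _; apply/fg/ph_par.
Qed.

Lemma homog_ext (U : lmodType F) (f g : V -> U) : linear f -> linear g ->
  (forall n v, homog n v -> f v = g v) -> forall v, f v = g v.
Proof.
move=> fl gl fg v; have [N ->] := gpr_fin hV v; rewrite !lin_sum //.
by apply: eq_bigr => i _; apply/fg/gpr_homog.
Qed.

Lemma homogD n (v w : V) : homog n v -> homog n w -> homog n (v + w).
Proof. by move=> hv hw; rewrite /homog (linD (lf_gpr n)) hv hw. Qed.
Lemma homogZ n c (v : V) : homog n v -> homog n (c *: v).
Proof. by move=> hv; rewrite /homog (linZ (lf_gpr n)) hv. Qed.
Lemma homog0 n : homog n (0 : V).
Proof. exact: (lin0 (lf_gpr n)). Qed.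
Lemma homogN n (v : V) : homog n v -> homog n (- v).
Proof. by rewrite -scaleN1r; apply: homogZ. Qed.
Lemma homog_sum n (I : Type) (r : seq I) (P : pred I) (g : I -> V) :
  (forall i, homog n (g i)) -> homog n (\sum_(i <- r | P i) g i).
Proof. by move=> hg; apply: (big_ind (homog n)); [apply: homog0 | apply: homogD|]. Qed.

(** The operator multiplying an element of parity j by (-1)^(ij). It absorbs Koszul signs into a
    linear map, so that formulas need no splitting into homogeneous components. *)
Definition sg (i : bool) (v : V) : V := par false v + sign i *: par true v.

Lemma lf_sg i : linear (sg i).
Proof. by apply: lf_add; [|apply: lf_scale]; apply: lf_par. Qed.

Lemma sg_ph i j (v : V) : ph j v -> sg i v = sign (i && j) *: v.
Proof.
move=> vj; rewrite /sg; case: j vj => vj.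
  by rewrite (par_neq vj) // (par_id vj) add0r andbT.
by rewrite (par_id vj) (par_neq vj) // andbF scaler0 addr0 scale1r.
Qed.

Lemma ph_sg i j (v : V) : ph j v -> ph j (sg i v).
Proof. by move=> vj; rewrite (sg_ph i vj); apply: phZ. Qed.

Lemma sgE i (v : V) : sg i v = \sum_(j : bool) sign (i && j) *: par j v.
Proof. by rewrite /sg big_bool /= andbT andbF scale1r addrC. Qed.

Lemma sg0 (v : V) : sg false v = v.
Proof. by rewrite [RHS]par_sum sgE; apply: eq_bigr => j _; rewrite scale1r. Qed.

Lemma sg_homog i n (v : V) : homog n v -> sg i v = sign (i && odd n) *: v.
Proof. by move/homog_ph/sg_ph. Qed.

Lemma lf_hlift (U : lmodType F) (f : V -> bool -> U) :
  (forall i, linear (fun v => f v i)) -> linear (hlift f).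
Proof.
by move=> fl; apply: lf_sum => i; apply: lf_comp (fl i) (lf_par i).
Qed.

Lemma hlift_ph (U : lmodType F) (f : V -> bool -> U) i v :
  (forall i, linear (fun v => f v i)) -> ph i v -> hlift f v = f v i.
Proof.
move=> fl vi; rewrite /hlift big_bool /=; case: i vi => vi.
  by rewrite (par_id vi) (par_neq vi) // (lin0 (fl _)) addr0.
by rewrite (par_id vi) (par_neq vi) // (lin0 (fl _)) add0r.
Qed.

End One.

Lemma sign_sq i : sign i * sign i = 1 :> F.
Proof. by case: i; rewrite /sign /= ?expr1 ?expr0 ?mulrNN mulr1. Qed.

Lemma signM i j : sign i * sign j = sign (i (+) j) :> F.
Proof. by case: i j => -[]; rewrite /sign /= ?expr1 ?expr0 ?mulrNN ?mulr1 ?mul1r. Qed.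

Section Two.
Variables (V W : gmod F) (hV : is_gmod V) (hW : is_gmod W).

Section Slift.
Variables (U : lmodType F) (f : V -> bool -> W -> bool -> U).
Hypothesis fb : forall i j, bilin (fun v w => f v i w j).

Lemma bilin_slift : bilin (fun v w => \sum_(i : bool) \sum_(j : bool) f (par i v) i (par j w) j).
Proof.
split=> [w|v]; apply: lf_sum => i; apply: lf_sum => j.
  exact: lf_comp ((fb i j).1 (par j w)) (lf_par hV i).
exact: lf_comp ((fb i j).2 (par i v)) (lf_par hW j).
Qed.

Lemma lf_slift : linear (slift f).
Proof. exact: lf_tlift bilin_slift. Qed.

Lemma slift_ph i j v w : ph i v -> ph j w -> slift f (v ⊗ w) = f v i w j.
Proof.
move=> vi wj; rewrite /slift (tlift_pure bilin_slift).
have f0l i' j' w' : f 0 i' w' j' = 0 by apply: (lin0 ((fb i' j').1 w')).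
have f0r i' j' v' : f v' i' 0 j' = 0 by apply: (lin0 ((fb i' j').2 v')).
rewrite !big_bool /=.
by case: i vi => vi; case: j wj => wj;
  rewrite ?(par_id hV vi) ?(par_id hW wj) ?(par_neq hV vi) ?(par_neq hW wj) //
    ?f0l ?f0r ?addr0 ?add0r.
Qed.

End Slift.

Lemma tens_phext (U : lmodType F) (f g : tens V W -> U) : linear f -> linear g ->
  (forall i j v w, ph i v -> ph j w -> f (v ⊗ w) = g (v ⊗ w)) ->
  forall t, f t = g t.
Proof.
move=> fl gl fg; apply: tens_ext => // v.
have l1 (h : tens V W -> U) : linear h -> linear (fun w => h (v ⊗ w)).
  by move=> hl; apply: lf_comp hl _; lin.
apply: (ph_ext hW (l1 _ fl) (l1 _ gl)) => j w wj.
have l2 (h : tens V W -> U) : linear h -> linear (fun v => h (v ⊗ w)).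
  by move=> hl; apply: lf_comp hl _; lin.
by apply: (ph_ext hV (l2 _ fl) (l2 _ gl)) => i u ui; apply: fg ui wj.
Qed.

Lemma tens_homext (U : lmodType F) (f g : tens V W -> U) : linear f -> linear g ->
  (forall i j v w, homog i v -> homog j w -> f (v ⊗ w) = g (v ⊗ w)) ->
  forall t, f t = g t.
Proof.
move=> fl gl fg; apply: tens_ext => // v.
have l1 (h : tens V W -> U) : linear h -> linear (fun w => h (v ⊗ w)).
  by move=> hl; apply: lf_comp hl _; lin.
apply: (homog_ext hW (l1 _ fl) (l1 _ gl)) => j w wj.
have l2 (h : tens V W -> U) : linear h -> linear (fun v => h (v ⊗ w)).
  by move=> hl; apply: lf_comp hl _; lin.
by apply: (homog_ext hV (l2 _ fl) (l2 _ gl)) => i u ui; apply: fg ui wj.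
Qed.

(** Converts the signed Sweedler sums of the definitions into unsigned ones with [sg] on a leg, the
    form in which all later computations are done. *)
Lemma slift_sgl (U : lmodType F) (f : V -> W -> U) k t : bilin f ->
  slift (fun v i w _ => sign (k && i) *: f v w) t = tlift (fun v w => f (sg k v) w) t.
Proof.
move=> fb.
have b1 (i j : bool) : bilin (fun v w => sign (k && i) *: f v w).
  by case: fb => f1 f2; lin.
have b2 : bilin (fun v w => f (sg k v) w).
  case: fb => f1 f2; split=> [w|v]; last exact: f2.
  exact: lf_comp (f1 w) (lf_sg hV k).
apply: (tens_phext (lf_slift b1) (lf_tlift b2)) => i j v w vi wj.
rewrite (slift_ph b1 vi wj) tlift_pure // (sg_ph hV k vi).
by rewrite (linZ (fb.1 w)).
Qed.

Lemma bilin_tpr n : bilin (fun (v : V) (w : W) => \sum_(k < n.+1) gpr k v ⊗ gpr (n - k) w).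
Proof.
by split=> [w|v]; apply: lf_sum => k; [apply: lf_tpl|apply: lf_tpr];
  apply: lf_gpr.
Qed.

Lemma lf_tpr_deg n : linear (@tpr F V W n).
Proof. exact: lf_tlift (bilin_tpr n). Qed.

Lemma tpr_pure n v w : @tpr F V W n (v ⊗ w) = \sum_(k < n.+1) gpr k v ⊗ gpr (n - k) w.
Proof. exact: tlift_pure (bilin_tpr n) _ _. Qed.

Lemma tpr_homog n a b v w : homog a v -> homog b w ->
  @tpr F V W n (v ⊗ w) = if n == (a + b)%N then v ⊗ w else 0.
Proof.
move=> va wb; rewrite tpr_pure.
case: eqP => [->|nab].
  have an : (a < (a + b).+1)%N by rewrite ltnS leq_addr.
  rewrite (bigD1 (Ordinal an)) //= addKn va wb big1 ?addr0 // => i ia.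
  rewrite (homog_gpr hV _ va); case: eqP => [e|]; last by rewrite tens0l.
  by case/eqP: ia; apply: val_inj.
rewrite big1 // => i _; rewrite (homog_gpr hV _ va) (homog_gpr hW _ wb).
case: eqP => [e|]; last by rewrite tens0l.
case: eqP => [e'|]; last by rewrite tens0r.
by case: nab; rewrite -e -e' subnKC // -ltnS ltn_ord.
Qed.

Lemma gtens_gmod : is_gmod (gtens V W).
Proof.
split.
- exact: lf_tpr_deg.
- move=> m n.
  have l (k : nat) := @lf_tpr_deg k.
  apply: tens_homext => [||a b v w va wb].
  + exact: lf_comp (l m) (l n).
  + by case: (m == n); [exact: l | exact: lf_zero].
  + rewrite /= (tpr_homog n va wb); case: (n =P (a + b)%N) => [->|nab].
      by rewrite (tpr_homog m va wb); case: eqP.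
    by rewrite (lin0 (l m)) if_same.
- apply: tens_ind => [v w|s t [N sN] [M tM]].
    have [N vN] := gpr_bound hV v; have [M wM] := gpr_bound hW w.
    exists (N + M)%N.
    pose P := fun t : tens V W => t = \sum_(n < N + M) tpr n t.
    have PD : forall s t, P s -> P t -> P (s + t).
      move=> s t; rewrite /P => {1}-> {1}->; rewrite -big_split /=.
      by apply: eq_bigr => i _; rewrite (linD (lf_tpr_deg i)).
    have P0 : P 0.
      by rewrite /P big1 // => i _; rewrite (lin0 (lf_tpr_deg i)).
    change (P (v ⊗ w)).
    rewrite (gpr_sum hV vN) (gpr_sum hW wM) tens_suml.
    apply: big_ind => // i _; rewrite tens_sumr; apply: big_ind => // j _.
    have ijN : (i + j < N + M)%N by rewrite -addSn leq_add ?ltn_ord // ltnW ?ltn_ord.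
    rewrite /P (bigD1 (Ordinal ijN)) //=.
    rewrite (tpr_homog _ (gpr_homog hV _ _) (gpr_homog hW _ _)) eqxx big1 ?addr0 // => k.
    rewrite (tpr_homog _ (gpr_homog hV _ _) (gpr_homog hW _ _)) => kij.
    case: eqP => // e; case/eqP: kij; exact: val_inj.
  exists (maxn N M).
  pose h (x : tens V W) K := forall n, (K <= n)%N -> tpr n x = 0.
  have bnd (x : tens V W) K : x = \sum_(n < K) tpr n x -> h x K.
    move=> xE n Kn; rewrite xE (lin_sum (lf_tpr_deg n)) big1 // => i _.
    have := @tens_homext _ (fun x => tpr n (tpr i x)) (fun=> 0).
    apply=> [||a b v w va wb].
    + exact: lf_comp (lf_tpr_deg n) (lf_tpr_deg i).
    + exact: lf_zero.
    + rewrite (tpr_homog i va wb); case: eqP => [ie|]; last by rewrite (lin0 (lf_tpr_deg n)).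
      rewrite (tpr_homog n va wb) -ie gtn_eqF //.
      by apply: leq_trans Kn.
  have wid (x : tens V W) K : x = \sum_(n < K) tpr n x -> (K <= maxn N M)%N ->
      x = \sum_(n < maxn N M) tpr n x.
    move=> xE Km; rewrite {1}xE (big_ord_widen _ (fun n => tpr n x) Km) big_mkcond /=.
    by apply: eq_bigr => i _; case: ltnP => // /(bnd _ _ xE) ->.
  rewrite {1}(wid _ _ sN) ?leq_maxl // {1}(wid _ _ tM) ?leq_maxr // -big_split /=.
  by apply: eq_bigr => i _; rewrite (linD (lf_tpr_deg i)).
Qed.

Lemma tens_homog a b (v : V) (w : W) : homog a v -> homog b w ->
  @homog F (gtens V W) (a + b)%N (v ⊗ w).
Proof. by move=> va wb; rewrite /homog /= (tpr_homog _ va wb) eqxx. Qed.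

Lemma ph_tens i j (v : V) (w : W) : ph i v -> ph j w -> @ph (gtens V W) (i (+) j) (v ⊗ w).
Proof.
move=> vi wj n nij /=; rewrite tpr_pure big1 // => k _.
case: (altP (odd k =P i)) => [ki|]; last by move=> /vi ->; rewrite tens0l.
have kn : (k <= n)%N by rewrite -ltnS.
rewrite wj ?tens0r // oddB // ki.
by apply: contra nij => /eqP <-; rewrite addbC addbK.
Qed.

End Two.

Lemma glin_ph V W (f : V -> W) i v : is_glin f -> ph i v -> ph i (f v).
Proof. by case=> fl fg vi n ni; rewrite -fg vi // (lin0 fl). Qed.

Lemma glin_homog V W (f : V -> W) n v : is_glin f -> homog n v -> homog n (f v).
Proof. by case=> fl fg vi; rewrite /homog -fg vi. Qed.

Lemma glin_sg V W (hV : is_gmod V) (hW : is_gmod W) (f : V -> W) i v :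
  is_glin f -> f (sg i v) = sg i (f v).
Proof.
move=> fg; move: v; apply: (ph_ext hV) => [||j v vj].
- by apply: lf_comp fg.1 _; apply: lf_sg.
- by apply: lf_comp fg.1; apply: lf_sg.
- by rewrite (sg_ph hV i vj) (linZ fg.1) (sg_ph hW i (glin_ph fg vj)).
Qed.

Lemma glinI V W (hV : is_gmod V) (hW : is_gmod W) (f : V -> W) : linear f ->
  (forall n v, homog n v -> homog n (f v)) -> is_glin f.
Proof.
move=> fl fh; split=> // n; apply: (homog_ext hV) => [||m v vm].
- exact: lf_comp fl (lf_gpr hV n).
- exact: lf_comp (lf_gpr hW n) fl.
- rewrite (homog_gpr hV _ vm) (homog_gpr hW _ (fh _ _ vm)).
  by case: ifP => // _; rewrite (lin0 fl).
Qed.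

Lemma sg_tens V W (hV : is_gmod V) (hW : is_gmod W) i (v : V) (w : W) :
  @sg (gtens V W) i (v ⊗ w) = sg i v ⊗ sg i w.
Proof.
have hT := gtens_gmod hV hW.
move: v; apply: (ph_ext hV) => [||j v vj].
- by apply: lf_comp (lf_sg hT i) _; lin.
- by apply: lf_tpl; apply: lf_sg.
move: w; apply: (ph_ext hW) => [||k w wk].
- by apply: lf_comp (lf_sg hT i) _; lin.
- by apply: lf_tpr; apply: lf_sg.
rewrite (sg_ph hT i (ph_tens hV hW vj wk)) (sg_ph hV i vj) (sg_ph hW i wk) tensZl tensZr.
by rewrite scalerA signM; case: i; case: j {vj}; case: k {wk}.
Qed.

End Parity.

(** * Graded and differential graded algebras *)

Section Algebras.
Variable F : fieldType.

(** Ungraded on purpose: among the targets of the universal properties are matrix algebras, the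
    ground field and algebras of triangular matrices, which carry no grading here. *)
Record is_alg (U : lmodType F) (mul : U -> U -> U) (one : U) : Prop := IsAlg {
  alg_mull : forall y, linear (fun x => mul x y);
  alg_mulr : forall x, linear (mul x);
  alg_mulA : forall x y z, mul x (mul y z) = mul (mul x y) z;
  alg_mul1l : forall x, mul one x = x;
  alg_mul1r : forall x, mul x one = x
}.

Definition alg_map (A : galg F) (U : lmodType F) (mul : U -> U -> U) (one : U)
    (f : A -> U) : Prop :=
  [/\ linear f, f (gone A) = one & forall x y, f (x ∙ y) = mul (f x) (f y)].

Definition generated (A : galg F) (G : A -> Prop) : Prop :=
  forall P : A -> Prop, P (gone A) -> (forall c x, P x -> P (c *: x)) ->
    (forall x y, P x -> P y -> P (x + y)) ->
    (forall x y, P x -> P y -> P (x ∙ y)) ->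
    (forall x, G x -> P x) -> forall x, P x.

Section One.
Variables (A : galg F) (hA : is_galg A).
Let mA := galg_is_gmod hA.

Lemma galg_alg : is_alg (@gmul F A) (gone A).
Proof. by case: hA => *; split. Qed.

Lemma lf_gmull (U : lmodType F) (f : U -> A) y : linear f -> linear (fun x => f x ∙ y).
Proof. exact: lf_comp (gmul_linearl hA y). Qed.

Lemma lf_gmulr (U : lmodType F) (f : U -> A) x : linear f -> linear (fun y => x ∙ f y).
Proof. exact: lf_comp (gmul_linearr hA x). Qed.

Lemma gmulDl (x y z : A) : (x + y) ∙ z = x ∙ z + y ∙ z.
Proof. exact: linD (gmul_linearl hA z) _ _. Qed.
Lemma gmulDr (x y z : A) : z ∙ (x + y) = z ∙ x + z ∙ y.
Proof. exact: linD (gmul_linearr hA z) _ _. Qed.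
Lemma gmulZl c (x z : A) : (c *: x) ∙ z = c *: (x ∙ z).
Proof. exact: linZ (gmul_linearl hA z) _ _. Qed.
Lemma gmulZr c (x z : A) : z ∙ (c *: x) = c *: (z ∙ x).
Proof. exact: linZ (gmul_linearr hA z) _ _. Qed.
Lemma gmul0l (z : A) : 0 ∙ z = 0.
Proof. exact: lin0 (gmul_linearl hA z). Qed.
Lemma gmul0r (z : A) : z ∙ 0 = 0.
Proof. exact: lin0 (gmul_linearr hA z). Qed.

Lemma homog_ext2 (U : lmodType F) (f g : A -> A -> U) : bilin f -> bilin g ->
  (forall m n x y, homog m x -> homog n y -> f x y = g x y) ->
  forall x y, f x y = g x y.
Proof.
case=> f1 f2 [g1 g2] fg x y; move: x.
apply: (homog_ext mA (f1 y) (g1 y)) => m x xm; move: y.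
by apply: (homog_ext mA (f2 x) (g2 x)) => n y yn; apply: fg xm yn.
Qed.

Lemma ph_ext2 (U : lmodType F) (f g : A -> A -> U) : bilin f -> bilin g ->
  (forall i j x y, ph i x -> ph j y -> f x y = g x y) ->
  forall x y, f x y = g x y.
Proof.
case=> f1 f2 [g1 g2] fg x y; move: x.
apply: (ph_ext mA (f1 y) (g1 y)) => m x xm; move: y.
by apply: (ph_ext mA (f2 x) (g2 x)) => n y yn; apply: fg xm yn.
Qed.

Lemma gprM n (x y : A) : gpr n (x ∙ y) = \sum_(k < n.+1) gpr k x ∙ gpr (n - k) y.
Proof.
move: x y; apply: homog_ext2.
- by split=> [y|x]; apply: lf_comp (lf_gpr mA n) _; [apply: lf_gmull|apply: lf_gmulr].
- by split=> [y|x]; apply: lf_sum => k; [apply: lf_gmull|apply: lf_gmulr]; apply: lf_gpr.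
move=> a b v w va wb; rewrite (homog_gpr mA _ (gmul_homog hA va wb)).
case: eqP => [->|nab].
  have an : (a < (a + b).+1)%N by rewrite ltnS leq_addr.
  rewrite (bigD1 (Ordinal an)) //= addKn va wb big1 ?addr0 // => i ia.
  rewrite (homog_gpr mA _ va); case: eqP => [e|]; last by rewrite gmul0l.
  by case/eqP: ia; apply: val_inj.
rewrite big1 // => i _; rewrite (homog_gpr mA _ va) (homog_gpr mA _ wb).
case: eqP => [e|]; last by rewrite gmul0l.
case: eqP => [e'|]; last by rewrite gmul0r.
by case: nab; rewrite -e -e' subnKC // -ltnS ltn_ord.
Qed.

Lemma phM i j (x y : A) : ph i x -> ph j y -> ph (i (+) j) (x ∙ y).
Proof.
move=> vi wj n nij; rewrite gprM big1 // => k _.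
case: (altP (odd k =P i)) => [ki|]; last by move=> /vi ->; rewrite gmul0l.
have kn : (k <= n)%N by rewrite -ltnS.
rewrite wj ?gmul0r // oddB // ki.
by apply: contra nij => /eqP <-; rewrite addbC addbK.
Qed.

Lemma ph1 : ph false (gone A).
Proof. exact: homog_ph (gone_homog hA). Qed.

Lemma sgM i (x y : A) : sg i (x ∙ y) = sg i x ∙ sg i y.
Proof.
move: x y; apply: ph_ext2.
- by split=> [y|x]; apply: lf_comp (lf_sg mA i) _; [apply: lf_gmull|apply: lf_gmulr].
- by split=> [y|x]; [apply: lf_gmull|apply: lf_gmulr]; apply: lf_sg.
move=> j k x y xj yk; rewrite (sg_ph mA i (phM xj yk)) (sg_ph mA i xj) (sg_ph mA i yk).
by rewrite gmulZl gmulZr scalerA signM; case: i; case: j {xj}; case: k {yk}.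
Qed.

Lemma sg1 i : sg i (gone A) = gone A.
Proof. by rewrite (sg_ph mA i ph1) andbF scale1r. Qed.

Lemma sg_sg i (x : A) : sg i (sg i x) = x.
Proof.
move: x; apply: (ph_ext mA) => [||j x xj].
- by apply: lf_comp; apply: lf_sg.
- exact: lf_id.
- by rewrite (sg_ph mA i xj) (linZ (lf_sg mA i)) (sg_ph mA i xj) scalerA sign_sq scale1r.
Qed.

Lemma generated_eq (G : A -> Prop) (U : lmodType F) mul one (f g : A -> U) :
  generated G -> alg_map mul one f -> alg_map mul one g ->
  (forall x, G x -> f x = g x) -> forall x, f x = g x.
Proof.
move=> hG [fl f1 fM] [gl g1 gM] fg; apply: hG => //.
- by rewrite f1 g1.
- by move=> c x e; rewrite (linZ fl) (linZ gl) e.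
- by move=> x y ex ey; rewrite (linD fl) (linD gl) ex ey.
- by move=> x y ex ey; rewrite fM gM ex ey.
Qed.

End One.

Lemma galg_map_alg (A A' : galg F) (f : A -> A') : is_galg_map f ->
  alg_map (@gmul F A') (gone A') f.
Proof. by case=> -[fl _] f1 fM; split. Qed.

(** By [gprM], compatibility with the projections passes to products, so a common degree for each
    generator and its image suffices. *)
Lemma generated_galg_map (A A' : galg F) (hA : is_galg A) (hA' : is_galg A')
    (G : A -> Prop) (f : A -> A') : generated G ->
  alg_map (@gmul F A') (gone A') f ->
  (forall x, G x -> exists2 n, homog n x & homog n (f x)) -> is_galg_map f.
Proof.
move=> hG [fl f1 fM] fG; split=> //; split=> // n v.
have mA := galg_is_gmod hA; have mA' := galg_is_gmod hA'.
move: v n; apply: hG.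
- move=> n; rewrite f1 (homog_gpr mA _ (gone_homog hA)) (homog_gpr mA' _ (gone_homog hA')).
  by case: eqP => // _; rewrite (lin0 fl).
- by move=> c x e n; rewrite (linZ (lf_gpr mA n)) !(linZ fl) (linZ (lf_gpr mA' n)) e.
- by move=> x y ex ey n; rewrite (linD (lf_gpr mA n)) !(linD fl) (linD (lf_gpr mA' n)) ex ey.
- move=> x y ex ey n; rewrite fM (gprM hA) (gprM hA') (lin_sum fl).
  by apply: eq_bigr => k _; rewrite fM ex ey.
- move=> x /fG[m xm fxm] n; rewrite (homog_gpr mA _ xm) (homog_gpr mA' _ fxm).
  by case: eqP => // _; rewrite (lin0 fl).
Qed.

Lemma galg_map_id (A : galg F) : is_galg_map (fun x : A => x).
Proof. by []. Qed.

Lemma galg_map_comp (A B C : galg F) (f : B -> C) (g : A -> B) :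
  is_galg_map f -> is_galg_map g -> is_galg_map (fun x => f (g x)).
Proof.
case=> -[fl fg] f1 fM [[gl gg] g1 gM]; split=> [||x y].
- by split=> [|n v]; [apply: lf_comp | rewrite gg fg].
- by rewrite g1.
- by rewrite gM fM.
Qed.

Section Stens.
Variables (A B : galg F) (hA : is_galg A) (hB : is_galg B).
Let mA := galg_is_gmod hA.
Let mB := galg_is_gmod hB.

Lemma lf_sgc (U : lmodType F) (V : gmod F) (hV : is_gmod V) i (f : U -> V) :
  linear f -> linear (fun x => sg i (f x)).
Proof. exact: lf_comp (lf_sg hV i). Qed.

Let bilin_smul_in (a : A) (b : B) i j :
  bilin (fun (c : A) (e : B) => sign (i && j) *: ((a ∙ c) ⊗ (b ∙ e))).
Proof. by split=> [e|c]; apply: lf_scale; [apply: lf_tpl; apply: lf_gmulr|apply: lf_tpr; apply: lf_gmulr]. Qed.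

Let bilin_smul_out (t : tens A B) (i k : bool) :
  bilin (fun (a : A) (b : B) =>
    slift (fun (c : A) j (e : B) (_ : bool) => sign (k && j) *: ((a ∙ c) ⊗ (b ∙ e))) t).
Proof.
split=> [b|a]; apply: lf_tlift_par => c e; apply: lf_sum => j; apply: lf_sum => l;
  apply: lf_scale; [apply: lf_tpl|apply: lf_tpr]; exact: lf_gmull.
Qed.

Lemma bilin_smul : bilin (@smul F A B).
Proof.
split=> [t|s]; first exact: (lf_slift mA mB (bilin_smul_out t)).
apply: lf_tlift_par => a b; apply: lf_sum => i; apply: lf_sum => k.
by apply: lf_slift => // *; apply: bilin_smul_in.
Qed.

Lemma smul_ph i j (a c : A) (b e : B) : ph i b -> ph j c ->
  smul (a ⊗ b) (c ⊗ e) = sign (i && j) *: ((a ∙ c) ⊗ (b ∙ e)).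
Proof.
move=> bi cj; move: a; apply: (ph_ext mA) => [||k a ak].
- apply: lf_comp (bilin_smul.1 _) _; lin.
- by apply: lf_scale; apply: lf_tpl; apply: lf_gmull.
move: e; apply: (ph_ext mB) => [||l e el].
- apply: lf_comp (bilin_smul.2 _) _; lin.
- by apply: lf_scale; apply: lf_tpr; apply: lf_gmulr.
rewrite /smul (slift_ph mA mB (bilin_smul_out _) ak bi).
by rewrite (slift_ph mA mB (fun _ _ => bilin_smul_in _ _ _ _) cj el).
Qed.

Lemma smul_sg j (a c : A) (b e : B) : ph j c ->
  smul (a ⊗ b) (c ⊗ e) = (a ∙ c) ⊗ (sg j b ∙ e).
Proof.
move=> cj; move: b; apply: (ph_ext mB) => [||k b bk].
- apply: lf_comp (bilin_smul.1 _) _; lin.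
- by apply: lf_tpr; apply: lf_gmull => //; apply: lf_sg.
- by rewrite (smul_ph _ _ bk cj) (sg_ph mB j bk) (gmulZl hB) tensZr andbC.
Qed.

Lemma stens_galg : is_galg (stens A B).
Proof.
have hT := gtens_gmod mA mB.
have [bl br] := bilin_smul.
split=> //=.
- move=> x y z; move: x; apply: (tens_phext mA mB) => [||ia ib a b aP bP].
  + exact: bl.
  + exact: lf_comp (bl z) (bl y).
  move: y; apply: (tens_phext mA mB) => [||ic ie c e cP eP].
  + exact: lf_comp (br _) (bl z).
  + exact: lf_comp (bl z) (br _).
  move: z; apply: (tens_phext mA mB) => [||iu iv u v uP vP].
  + exact: lf_comp (br _) (br _).
  + exact: br.
  rewrite (smul_ph _ _ eP uP) (linZ (br _)) (smul_ph _ _ bP (phM hA cP uP)).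
  rewrite (smul_ph _ _ bP cP) (linZ (bl _)) (smul_ph _ _ (phM hB bP eP) uP).
  rewrite !scalerA !signM (gmulA hA) (gmulA hB); congr (sign _ *: _).
  by case: ib bP; case: ic cP; case: ie eP; case: iu uP.
- move=> x; move: x; apply: (tens_phext mA mB) => [||ia ib a b aP bP].
  + exact: br.
  + exact: lf_id.
  by rewrite (smul_ph _ _ (ph1 hB) aP) scale1r (gmul1l hA) (gmul1l hB).
- move=> x; move: x; apply: (tens_phext mA mB) => [||ia ib a b aP bP].
  + exact: bl.
  + exact: lf_id.
  by rewrite (smul_ph _ _ bP (ph1 hA)) andbF scale1r (gmul1r hA) (gmul1r hB).
- exact: (tens_homog mA mB (gone_homog hA) (gone_homog hB)).
- move=> m n x y xm yn.
  (* A homogeneous tensor equals its own component of degree k, hence is a sum of pure tensors of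
     homogeneous elements whose degrees add up to k. *)
  have sumh k (x' : tens A B) (x'k : @homog F (gtens A B) k x') (P : tens A B -> Prop) :
      (forall s t, P s -> P t -> P (s + t)) -> P 0 ->
      (forall i j a b, homog i a -> homog j b -> k = (i + j)%N -> P (a ⊗ b)) -> P x'.
    move=> PD P0 Pp; rewrite -x'k /=; move: (x').
    apply: tens_ind => [a b|s t Ps Pt]; last by rewrite (linD (lf_tpr_deg mA mB k)); apply: PD.
    rewrite (tpr_pure mA mB); apply: big_ind => // i _.
    apply: Pp (gpr_homog mA _ _) (gpr_homog mB _ _) _.
    by rewrite subnKC // -ltnS ltn_ord.
  apply: (sumh _ _ xm (fun x => @homog F (gtens A B) (m + n)%N (smul x y))).
  + by move=> s t hs ht; rewrite (linD (bl y)); apply: homogD.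
  + by rewrite (lin0 (bl y)); apply: homog0.
  move=> i j a b ai bj ->.
  apply: (sumh _ _ yn (fun y => @homog F (gtens A B) (i + j + n)%N (smul (a ⊗ b) y))).
  + by move=> s t hs ht; rewrite (linD (br _)); apply: homogD.
  + by rewrite (lin0 (br _)); apply: homog0.
  move=> k l c e ck el ->.
  rewrite (smul_ph _ _ (homog_ph mB bj) (homog_ph mA ck)); apply: homogZ => //.
  rewrite addnACA; exact: (tens_homog mA mB (gmul_homog hA ai ck) (gmul_homog hB bj el)).
Qed.

Lemma galg_map_inl : @is_galg_map F A (stens A B) (fun a => a ⊗ gone B).
Proof.
have hT := galg_is_gmod stens_galg.
split=> //=; last first.
  move=> x y; move: y; apply: (ph_ext mA) => [||j y yj].
  - by apply: lf_tpl; apply: lf_gmulr.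
  - apply: lf_comp (bilin_smul.2 _) _; lin.
  by rewrite (smul_sg _ _ _ yj) (sg1 hB) (gmul1l hB).
apply: (glinI mA hT) => [|n v vn]; first by lin.
by rewrite -[n]addn0; apply: (tens_homog mA mB vn (gone_homog hB)).
Qed.

Lemma galg_map_inr : @is_galg_map F B (stens A B) (fun b => gone A ⊗ b).
Proof.
have hT := galg_is_gmod stens_galg.
split=> //=; last first.
  by move=> x y; rewrite (smul_sg _ _ _ (ph1 hA)) (sg0 mB) (gmul1l hA).
apply: (glinI mB hT) => [|n v vn]; first by lin.
by rewrite -[n]add0n; apply: (tens_homog mA mB (gone_homog hA) vn).
Qed.

End Stens.

Lemma tmap_pure (V V' W W' : lmodType F) (f : V -> V') (g : W -> W') :
  linear f -> linear g -> forall v w, tmap f g (v ⊗ w) = f v ⊗ g w.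
Proof. by move=> fl gl v w; rewrite /tmap tlift_pure //; lin. Qed.

Lemma lf_tmap (V V' W W' : lmodType F) (f : V -> V') (g : W -> W') :
  linear f -> linear g -> linear (tmap f g).
Proof. by move=> fl gl; apply: lf_tlift; lin. Qed.

Lemma tmap_comp (V V' V'' W W' W'' : lmodType F) (f : V -> V') (g : W -> W')
    (f' : V' -> V'') (g' : W' -> W'') : linear f -> linear g -> linear f' -> linear g' ->
  forall t, tmap f' g' (tmap f g t) = tmap (fun v => f' (f v)) (fun w => g' (g w)) t.
Proof.
move=> fl gl fl' gl'.
have c1 := lf_comp fl' fl; have c2 := lf_comp gl' gl.
apply: tens_ext => [||v w].
- by apply: lf_comp; apply: lf_tmap.
- exact: lf_tmap.
by rewrite !tmap_pure.
Qed.

Lemma tmap_id (V W : lmodType F) (t : tens V W) : tmap (fun v => v) (fun w => w) t = t.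
Proof. exact: tlift_id. Qed.

Lemma eq_tmap (V V' W W' : lmodType F) (f f' : V -> V') (g g' : W -> W') t :
  (forall v, f v = f' v) -> (forall w, g w = g' w) -> tmap f g t = tmap f' g' t.
Proof. by move=> ff gg; apply: eq_tlift => v w; rewrite ff gg. Qed.

Lemma glin_tmap (V V' W W' : gmod F) (hV : is_gmod V) (hW : is_gmod W)
    (hV' : is_gmod V') (hW' : is_gmod W') (f : V -> V') (g : W -> W') :
  is_glin f -> is_glin g -> @is_glin F (gtens V W) (gtens V' W') (tmap f g).
Proof.
move=> fg gg; have [fl fh] := fg; have [gl gh] := gg.
have tl := lf_tmap fl gl; split=> // n.
apply: (tens_homext hV hW) => [||i j v w vi wj].
- by apply: lf_comp tl _; apply: lf_tpr_deg.
- by apply: lf_comp tl; apply: lf_tpr_deg.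
rewrite /= (tpr_homog hV hW _ vi wj) tmap_pure //.
rewrite (tpr_homog hV' hW' _ (glin_homog fg vi) (glin_homog gg wj)).
by case: eqP => _; [rewrite tmap_pure | rewrite (lin0 tl)].
Qed.

Lemma galg_map_tmap (A B A' B' : galg F) (hA : is_galg A) (hB : is_galg B)
    (hA' : is_galg A') (hB' : is_galg B') (f : A -> A') (g : B -> B') :
  is_galg_map f -> is_galg_map g ->
  @is_galg_map F (stens A B) (stens A' B') (tmap f g).
Proof.
move=> [fg f1 fM] [gg g1 gM].
have [mA mB] := (galg_is_gmod hA, galg_is_gmod hB).
have [mA' mB'] := (galg_is_gmod hA', galg_is_gmod hB').
have tl := lf_tmap fg.1 gg.1.
split=> /=.
- exact: glin_tmap.
- by rewrite tmap_pure ?f1 ?g1 //; [case: fg | case: gg].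
have [bl br] := bilin_smul hA hB; have [bl' br'] := bilin_smul hA' hB'.
move=> x y; move: x; apply: (tens_phext mA mB) => [||ia ib a b aP bP].
- exact: lf_comp tl (bl y).
- exact: lf_comp (bl' _) tl.
move: y; apply: (tens_phext mA mB) => [||ic ie c e cP eP].
- exact: lf_comp tl (br _).
- exact: lf_comp (br' _) tl.
rewrite (smul_ph hA hB _ _ bP cP) (linZ tl).
rewrite !(tmap_pure fg.1 gg.1) (smul_ph hA' hB' _ _ (glin_ph gg bP) (glin_ph fg cP)).
by rewrite fM gM.
Qed.

(** Coassociativity axioms are stated with all triple tensors bracketed to the left; their
    right-hand side is [tassoc] after the coproduct on the second leg ([tassocE]). As [tassoc] is a
    graded algebra map, both sides can then be compared on generators. *)
Definition tassoc (V W U : lmodType F) (t : tens V (tens W U)) : tens (tens V W) U :=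
  \sw_(v, s <- t) \sw_(w, u <- s) (v ⊗ w ⊗ u).

Lemma lf_tassoc (V W U : lmodType F) : linear (@tassoc V W U).
Proof.
apply: lf_tlift; split=> [s|v]; first by apply: lf_tlift_par => w u; lin.
by apply: lf_tlift; lin.
Qed.

Lemma tassoc_pure (V W U : lmodType F) (v : V) (w : W) (u : U) :
  tassoc (v ⊗ (w ⊗ u)) = v ⊗ w ⊗ u.
Proof.
rewrite /tassoc tlift_pure ?tlift_pure //; first by lin.
split=> [s|v']; first by apply: lf_tlift_par => w' u'; lin.
by apply: lf_tlift; lin.
Qed.

Lemma galg_map_tassoc (A B C : galg F) (hA : is_galg A) (hB : is_galg B) (hC : is_galg C) :
  @is_galg_map F (stens A (stens B C)) (stens (stens A B) C) (@tassoc A B C).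
Proof.
have [mA mB mC] := And3 (galg_is_gmod hA) (galg_is_gmod hB) (galg_is_gmod hC).
have [hAB hBC] := (stens_galg hA hB, stens_galg hB hC).
have [mAB mBC] := (galg_is_gmod hAB, galg_is_gmod hBC).
have tl := @lf_tassoc A B C.
have ext3 (U : lmodType F) (f g : tens A (tens B C) -> U) : linear f -> linear g ->
    (forall i j k a b c, homog i a -> homog j b -> homog k c ->
      f (a ⊗ (b ⊗ c)) = g (a ⊗ (b ⊗ c))) -> forall t, f t = g t.
  move=> fl gl fg; apply: tens_ext => // a s.
  have l1 (h : tens A (tens B C) -> U) : linear h -> linear (fun s => h (a ⊗ s)).
    by move=> hl; apply: lf_comp hl _; lin.
  move: s; apply: (tens_homext mB mC (l1 _ fl) (l1 _ gl)) => j k b c bj ck.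
  have l2 (h : tens A (tens B C) -> U) : linear h -> linear (fun a => h (a ⊗ (b ⊗ c))).
    by move=> hl; apply: lf_comp hl _; lin.
  move: a {l1}; apply: (homog_ext mA (l2 _ fl) (l2 _ gl)) => i a ai; exact: fg ai bj ck.
split=> /=.
- split=> // n; apply: (ext3) => [||i j k a b c ai bj ck].
  + by apply: lf_comp tl _; apply: (lf_tpr_deg mA mBC).
  + by apply: lf_comp tl; apply: (lf_tpr_deg mAB mC).
  rewrite /= tassoc_pure (tpr_homog mA mBC _ ai (tens_homog mB mC bj ck)).
  rewrite (@tpr_homog _ (gtens A B) C mAB mC _ _ _ _ _ (tens_homog mA mB ai bj) ck) addnA.
  by case: eqP => _; rewrite ?tassoc_pure // (lin0 tl).
- exact: tassoc_pure.
have [bl br] := bilin_smul hA hBC; have [bl' br'] := bilin_smul hAB hC.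
move=> x y; move: x; apply: (ext3) => [||ia ib ic a b c aP bP cP].
- exact: lf_comp tl (bl y).
- exact: lf_comp (bl' _) tl.
move: y; apply: (ext3) => [||iu iv iw u v w uP vP wP].
- exact: lf_comp tl (br _).
- exact: lf_comp (br' _) tl.
move/(homog_ph mA): aP => aP; move/(homog_ph mB): bP => bP; move/(homog_ph mC): cP => cP.
move/(homog_ph mA): uP => uP; move/(homog_ph mB): vP => vP; move/(homog_ph mC): wP => wP.
rewrite !tassoc_pure (smul_ph hA hBC _ _ (ph_tens mB mC bP cP) uP) (linZ tl) /=.
rewrite (smul_ph hB hC _ _ cP vP) tensZr (linZ tl) tassoc_pure.
rewrite (@smul_ph (stens A B) C hAB hC _ _ _ _ _ _ cP (ph_tens mA mB uP vP)) /=.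
rewrite (smul_ph hA hB _ _ bP uP) tensZl !scalerA !signM; congr (sign _ *: _).
by case: (odd ib); case: (odd ic); case: (odd iu); case: (odd iv).
Qed.

Section Tdif.
Variables (V W : gmod F) (hV : is_gmod V) (hW : is_gmod W).
Variables (dV : V -> V) (dW : W -> W) (lV : linear dV) (lW : linear dW).

Lemma tdifE t : tdif dV dW t = tlift (fun v w => dV v ⊗ w + sg true v ⊗ dW w) t.
Proof.
have b (i : bool) : bilin (fun v w => dV v ⊗ w + sign i *: (v ⊗ dW w)) by lin.
have b' : bilin (fun v w => dV v ⊗ w + sg true v ⊗ dW w).
  split=> [w|v]; last by lin.
  by apply: lf_add; apply: lf_tpl => //; apply: lf_sg.
move: t; apply: (tens_phext hV hW).
- by apply: lf_slift => // i _; apply: b.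
- exact: lf_tlift.
move=> i j v w vi wj; rewrite /tdif (slift_ph hV hW (fun i _ => b i) vi wj) tlift_pure //.
by rewrite (sg_ph hV true vi) tensZl.
Qed.

Lemma lf_tdif : linear (tdif dV dW).
Proof.
have b' : bilin (fun v w => dV v ⊗ w + sg true v ⊗ dW w).
  split=> [w|v]; last by lin.
  by apply: lf_add; apply: lf_tpl => //; apply: lf_sg.
by move=> a u v; rewrite !tdifE; apply: lf_tlift.
Qed.

Lemma tdif_pure v w : tdif dV dW (v ⊗ w) = dV v ⊗ w + sg true v ⊗ dW w.
Proof.
rewrite tdifE tlift_pure //; split=> [w'|v']; last by lin.
by apply: lf_add; apply: lf_tpl => //; apply: lf_sg.
Qed.
End Tdif.

Section Dga.
Variables (O : galg F) (hO : is_galg O) (d : O -> O).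
Let mO := galg_is_gmod hO.

Lemma dga_sg : is_dga d -> forall x, d (sg true x) = - sg true (d x).
Proof.
case=> _ dl dh _ _; apply: (homog_ext mO) => [||n x xn].
- by apply: lf_comp dl _; apply: lf_sg.
- by apply: lf_opp; apply: lf_comp dl; apply: lf_sg.
rewrite (sg_homog mO _ xn) (linZ dl) (sg_homog mO _ (dh _ _ xn)) /=.
by case: (odd n); rewrite /sign /= ?expr1 ?expr0 ?scaleN1r ?opprK ?scale1r.
Qed.

Lemma dga_gprS : is_dga d -> forall n x, gpr n.+1 (d x) = d (gpr n x).
Proof.
case=> _ dl dh _ _ n; apply: (homog_ext mO) => [||m x xm].
- exact: lf_comp (lf_gpr mO _) dl.
- exact: lf_comp dl (lf_gpr mO _).
rewrite (homog_gpr mO _ (dh _ _ xm)) (homog_gpr mO _ xm) eqSS.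
by case: eqP => // _; rewrite (lin0 dl).
Qed.

Lemma dga_gpr0 : is_dga d -> forall x, gpr 0 (d x) = 0.
Proof.
case=> _ dl dh _ _; apply: (homog_ext mO) => [||m x xm].
- exact: lf_comp (lf_gpr mO _) dl.
- exact: lf_zero.
by rewrite (homog_gpr mO _ (dh _ _ xm)).
Qed.

Lemma dga_ph : is_dga d -> forall i x, ph i x -> ph (~~ i) (d x).
Proof.
move=> hd i x xi [|n] ni; first exact: dga_gpr0.
rewrite (dga_gprS hd) xi ?(lin0 (dga_linear hd)) //.
by apply: contra ni => /= /eqP ->.
Qed.

Lemma sign_odd n : sign (odd n) = (-1) ^+ n :> F.
Proof. by rewrite /sign signr_odd. Qed.

Lemma dga_leib : is_dga d -> forall x y, d (x ∙ y) = d x ∙ y + sg true x ∙ d y.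
Proof.
case=> _ dl _ _ dM x y; move: x; apply: (homog_ext mO) => [||n x xn].
- by apply: lf_comp dl _; apply: lf_gmull.
- by apply: lf_add; apply: lf_gmull => //; apply: lf_sg.
by rewrite (dM _ _ _ xn) (sg_homog mO _ xn) (gmulZl hO) sign_odd.
Qed.

Lemma dgaI : linear d -> (forall n (x : O), homog n x -> homog n.+1 (d x)) ->
  (forall x, d (d x) = 0) -> (forall x y, d (x ∙ y) = d x ∙ y + sg true x ∙ d y) ->
  is_dga d.
Proof.
move=> dl dh dd dM; split=> // n x y xn.
by rewrite dM (sg_homog mO _ xn) (gmulZl hO) sign_odd.
Qed.

(** The Leibniz rule for 1 = 1 1 gives d1 = d1 + d1. *)
Lemma dga_one : is_dga d -> d (gone O) = 0.
Proof.
move=> hd; have := dga_leib hd (gone O) (gone O).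
rewrite (sg1 hO) (gmul1l hO) (gmul1r hO) (gmul1l hO) => /eqP.
by rewrite -subr_eq subrr eq_sym => /eqP.
Qed.
End Dga.

(** The square vanishes because d anticommutes with the parity operator [sg true] ([dga_sg]), which
    kills the mixed terms. The Leibniz rule is checked on pure tensors of homogeneous parity, term
    by term. *)
Lemma stens_dga (A B : galg F) dA dB : @is_dga F A dA -> @is_dga F B dB ->
  @is_dga F (stens A B) (tdif dA dB).
Proof.
move=> hdA hdB; have [hA hB] := (dga_is_galg hdA, dga_is_galg hdB).
have [mA mB] := (galg_is_gmod hA, galg_is_gmod hB).
have hS := stens_galg hA hB; have mS := galg_is_gmod hS.
have [lA lB] := (dga_linear hdA, dga_linear hdB).
have tl := lf_tdif mA mB lA lB.
have tp := tdif_pure mA mB lA lB.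
have [bl br] := bilin_smul hA hB.
apply: dgaI => //.
- move=> n x xn; rewrite -xn /=; move: x {xn}; apply: tens_ind.
    move=> v w; rewrite (tpr_pure mA mB) (lin_sum tl).
    apply: homog_sum => // k; rewrite tp.
    have kn : (k <= n)%N by rewrite -ltnS.
    move: (nat_of_ord k) kn => {}k kn.
    apply: homogD => //.
      have -> : n.+1 = (k.+1 + (n - k))%N by rewrite addSn subnKC.
      apply: (tens_homog mA mB); last exact: gpr_homog.
      by apply: dga_homog hdA _ _ (gpr_homog mA _ _).
    have -> : n.+1 = (k + (n - k).+1)%N by rewrite addnS subnKC.
    apply: (tens_homog mA mB).
      by rewrite (sg_homog mA _ (gpr_homog mA _ _)); apply: homogZ => //; apply: gpr_homog.
    by apply: dga_homog hdB _ _ (gpr_homog mB _ _).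
  move=> s t hs ht; rewrite (linD (lf_tpr_deg mA mB n)) (linD tl).
  exact: homogD.
- apply: tens_ext => [||v w].
  + exact: (lf_comp tl tl).
  + exact: lf_zero.
  rewrite tp (linD tl) !tp (dga_dd hdA) (dga_dd hdB) tens0l tens0r add0r addr0.
  by rewrite (dga_sg hA hdA) tensNl addrN.
- move=> x y; move: x; apply: (tens_phext mA mB) => [||ia ib a b aP bP].
  + exact: lf_comp tl (bl y).
  + apply: lf_add; first exact: lf_comp (bl y) tl.
    exact: lf_comp (bl _) (lf_sg mS true).
  move: y; apply: (tens_phext mA mB) => [||ic ie c e cP eP].
  + exact: lf_comp tl (br _).
  + apply: lf_add; first exact: br.
    exact: lf_comp (br _) tl.
  have dbP := dga_ph hB hdB bP; have dcP := dga_ph hA hdA cP.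
  rewrite /= (smul_ph hA hB _ _ bP cP) (linZ tl) !tp (sg_tens mA mB).
  rewrite (linD (bl _)) (linD (br _)) (dga_leib hA hdA) (dga_leib hB hdB).
  rewrite (sgM hA) tensDl tensDr addrACA !scalerDr.
  rewrite !(smul_ph hA hB _ _ bP cP) (smul_ph hA hB _ _ dbP cP).
  rewrite (smul_ph hA hB _ _ (ph_sg mB true bP) dcP).
  rewrite (smul_ph hA hB _ _ (ph_sg mB true bP) (ph_sg mA true cP)).
  congr (_ + _ + (_ + _)).
  + rewrite (sg_ph mA true cP) (gmulZr hA) tensZl scalerA signM.
    by case: ib bP dbP; case: ic cP dcP.
  + rewrite (sg_ph mB true bP) (gmulZl hB) tensZr scalerA signM.
    by case: ib bP dbP; case: ic cP dcP.
Qed.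

End Algebras.

(** * Super derivations as maps into triangular matrices *)

Section Triangular.
Variables (F : fieldType) (O : galg F) (hO : is_galg O).
Let mO := galg_is_gmod hO.

(* An algebra map x |-> (x, d x) into this algebra is the same thing as a super
   derivation d. *)
Definition tri_mul (u v : O * O) : O * O := (u.1 ∙ v.1, sg true u.1 ∙ v.2 + u.2 ∙ v.1).

(** The pair u stands for the upper triangular matrix with diagonal entries σ(u.1) and u.1 and
    corner u.2, where σ is the parity automorphism [sg true]; associativity uses only that σ is
    multiplicative. *)
Lemma tri_alg : is_alg tri_mul (gone O, 0).
Proof.
have ls := lf_sg mO true.
split=> [[y1 y2] a [u1 u2] [v1 v2]|[x1 x2] a [u1 u2] [v1 v2]|[x1 x2] [y1 y2] [z1 z2]|[x1 x2]|[x1 x2]];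
  rewrite /tri_mul /=.
- congr (_, _) => /=; first by rewrite (gmul_linearl hO).
  by rewrite ls !(gmul_linearl hO) scalerDr addrACA.
- congr (_, _) => /=; first by rewrite (gmul_linearr hO).
  by rewrite !(gmul_linearr hO) scalerDr addrACA.
- congr (_, _); first by rewrite (gmulA hO).
  by rewrite (sgM hO) (gmulDr hO) (gmulDl hO) !(gmulA hO) addrA.
- by rewrite (sg1 hO) !(gmul1l hO) (gmul0l hO) addr0.
- by rewrite !(gmul1r hO) (gmul0r hO) add0r.
Qed.
End Triangular.

(** * Convolution inverses on filtered coalgebras *)

Section Convolution.
Variables (F : fieldType) (C : lmodType F) (D : C -> tens C C) (e : C -> F).
Hypotheses (Dl : linear D) (el : linear (e : C -> F^o)).
Hypothesis DA : forall v, \sw_(v1, v2 <- D v) (D v1 ⊗ v2) =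
    \sw_(v1, v23 <- D v) \sw_(v2, v3 <- D v23) (v1 ⊗ v2 ⊗ v3).
Hypothesis eDl : forall v, \sw_(v1, v2 <- D v) (e v1 *: v2) = v.
Hypothesis eDr : forall v, \sw_(v1, v2 <- D v) (e v2 *: v1) = v.
Variables (U : lmodType F) (mul : U -> U -> U) (one : U) (aU : is_alg mul one).

Definition conv (f g : C -> U) (c : C) : U := \sw_(c1, c2 <- D c) mul (f c1) (g c2).
Definition cunit (c : C) : U := e c *: one.

Lemma lf_mull (T : lmodType F) (f : T -> U) y : linear f -> linear (fun x => mul (f x) y).
Proof. exact: lf_comp (alg_mull aU y). Qed.
Lemma lf_mulr (T : lmodType F) (f : T -> U) x : linear f -> linear (fun y => mul x (f y)).
Proof. exact: lf_comp (alg_mulr aU x). Qed.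

Lemma bilin_conv (f g : C -> U) : linear f -> linear g ->
  bilin (fun c1 c2 => mul (f c1) (g c2)).
Proof. by move=> fl gl; split=> ?; [apply: lf_mull|apply: lf_mulr]. Qed.

Lemma lf_conv (f g : C -> U) : linear f -> linear g -> linear (conv f g).
Proof. by move=> fl gl; apply: lf_tlift_arg => //; apply: bilin_conv. Qed.

Lemma lf_cunit : linear cunit.
Proof. exact: lf_scalel. Qed.

Lemma conv1l (f : C -> U) : linear f -> forall c, conv cunit f c = f c.
Proof.
move=> fl c; rewrite -[in RHS](eDl c) (lin_tlift _ _ fl); apply: eq_tlift => v w.
by rewrite /cunit (linZ (alg_mull aU _)) (alg_mul1l aU) (linZ fl).
Qed.

Lemma conv1r (f : C -> U) : linear f -> forall c, conv f cunit c = f c.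
Proof.
move=> fl c; rewrite -[in RHS](eDr c) (lin_tlift _ _ fl); apply: eq_tlift => v w.
by rewrite /cunit (linZ (alg_mulr aU _)) (alg_mul1r aU) (linZ fl).
Qed.

(** One trilinear map [T] sends the two sides of coassociativity at [c] to the two sides of the
    claim. *)
Lemma convA (f g h : C -> U) : linear f -> linear g -> linear h ->
  forall c, conv f (conv g h) c = conv (conv f g) h c.
Proof.
move=> fl gl hl c.
pose T t := tlift (fun (s : tens C C) z => mul (tlift (fun x y => mul (f x) (g y)) s) (h z)) t.
have b1 := bilin_conv fl gl.
have b2 : bilin (fun (s : tens C C) z => mul (tlift (fun x y => mul (f x) (g y)) s) (h z)).
  by split=> [z|s]; [apply: lf_mull; apply: lf_tlift|apply: lf_mulr].
have Tl : linear T by apply: lf_tlift.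
transitivity (T (\sw_(v1, v2 <- D c) (D v1 ⊗ v2))); last first.
  by rewrite (lin_tlift _ _ Tl); apply: eq_tlift => v w; rewrite /T tlift_pure.
rewrite DA (lin_tlift _ _ Tl); apply: eq_tlift => v w.
rewrite /conv (lin_tlift _ _ (alg_mulr aU _)) (lin_tlift _ _ Tl).
apply: eq_tlift => x y; rewrite /T tlift_pure // tlift_pure //.
by rewrite (alg_mulA aU).
Qed.

Lemma eq_conv (f f' g g' : C -> U) c : f =1 f' -> g =1 g' -> conv f g c = conv f' g' c.
Proof. by move=> ff gg; apply: eq_tlift => v w; rewrite ff gg. Qed.

Variable Fil : nat -> C -> Prop.
Inductive TFil (n : nat) : tens C C -> Prop :=
| TFil_pure i j a b : (i + j <= n)%N -> Fil i a -> Fil j b -> TFil n (a ⊗ b)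
| TFil_0 : TFil n 0
| TFil_D s t : TFil n s -> TFil n t -> TFil n (s + t).
Hypothesis FilD : forall n c, Fil n c -> TFil n (D c).
Hypothesis Fil_ex : forall c, exists n, Fil n c.

Lemma TFil_conv n (f g : C -> U) c : linear f -> linear g -> Fil n c ->
  (forall i j a b, (i + j <= n)%N -> Fil i a -> Fil j b -> mul (f a) (g b) = 0) ->
  conv f g c = 0.
Proof.
move=> fl gl /FilD; rewrite /conv => Dc fg0.
have b := bilin_conv fl gl.
elim: Dc => [i j x y ij xi yj||s t _ IHs _ IHt].
- by rewrite tlift_pure //; apply: fg0 ij xi yj.
- by rewrite (lin0 (lf_tlift b)).
- by rewrite (linD (lf_tlift b)) IHs IHt addr0.
Qed.

Section LeftInverse.
Variables (f g : C -> U) (fl : linear f) (gl : linear g).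
Hypothesis gf : forall c, Fil 0 c -> conv g f c = cunit c.

Let u c := cunit c - conv g f c.
Let ul : linear u.
Proof. by apply: lf_add (lf_cunit) _; apply: lf_opp; apply: lf_conv. Qed.

Fixpoint cpow n : C -> U := if n is n'.+1 then conv u (cpow n') else cunit.

Lemma lf_cpow n : linear (cpow n).
Proof. by elim: n => [|n IHn] /=; [apply: lf_cunit | apply: lf_conv]. Qed.

Lemma cpowSr n c : conv (cpow n) u c = cpow n.+1 c.
Proof.
elim: n c => [|n IHn] c; first by rewrite /= conv1l // conv1r.
rewrite /= -(convA ul (lf_cpow n) ul); exact: eq_conv.
Qed.

(** On filtration step 0 the map u = 1 - g*f vanishes. In a term of u*u^n the first leg therefore
    contributes only from a step i > 0, which leaves the second leg in a step below n, where
    induction applies. *)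
Lemma cpow_vanish n m c : (m < n)%N -> Fil m c -> cpow n c = 0.
Proof.
elim: n m c => // n IHn m c mn cm /=.
apply: (TFil_conv ul (lf_cpow n) cm) => i j a b ij ai bj.
case: (posnP i) => [i0|ipos].
  by rewrite /u gf ?subrr ?(lin0 (alg_mull aU _)) // -i0.
rewrite (IHn j) ?(lin0 (alg_mulr aU _)) //.
by rewrite -ltnS (leq_trans _ mn) // ltnS (leq_trans _ ij) // -add1n leq_add2r.
Qed.

(* For u = 1 - g * f, the partial sums of the left inverse (1 + u + u^2 + ...) * g
   of f; the powers of u vanish on each step of the filtration. *)
Definition cpart n (c : C) : U := \sum_(k < n) conv (cpow k) g c.

Lemma lf_cpart n : linear (cpart n).
Proof. by apply: lf_sum => k; apply: lf_conv => //; apply: lf_cpow. Qed.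

(** On step m the summands u^k*g with k > m vanish, since their first leg lies in a step at most
    m. *)
Lemma cpart_stable m n c : (m < n)%N -> Fil m c -> cpart n c = cpart m.+1 c.
Proof.
move=> mn cm; rewrite /cpart -(subnKC mn) big_split_ord /= [X in _ + X]big1 ?addr0 // => k _.
apply: (TFil_conv (lf_cpow (m.+1 + k)) gl cm) => i j a b ij ai _.
rewrite (cpow_vanish (m := i)) ?(lin0 (alg_mull aU _)) //.
by rewrite ltnS (leq_trans _ (leq_addr _ _)) // (leq_trans _ ij) ?leq_addr.
Qed.

(** The value at [c] is the partial sum at a filtration step chosen for [c]; stability of the
    partial sums makes the choice harmless and the limit linear. The last clause lets properties of
    the partial sums pass to the limit. *)
Lemma left_inverse_conv : exists S : C -> U,
  [/\ linear S, forall c, conv S f c = cunit c, forall c, Fil 0 c -> S c = g c &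
      forall c, exists N, forall n, (N <= n)%N -> S c = cpart n c].
Proof.
pose N c := projT1 (cid (Fil_ex c)).
have NP c : Fil (N c) c by rewrite /N; case: cid.
pose S c := cpart (N c).+1 c.
have SE c n : (N c < n)%N -> S c = cpart n c by move=> nc; rewrite (cpart_stable nc (NP c)).
have SE' c : exists N, forall n, (N <= n)%N -> S c = cpart n c by exists (N c).+1 => n /SE.
have Sl : linear S.
  (* The index exceeds the steps chosen for all three arguments, so all three values are given by
     one and the same linear partial sum. *)
  move=> a x y; set n := (N (a *: x + y) + N x + N y).+1.
  rewrite !(SE _ n) ?lf_cpart // /n ltnS.
  - exact: leq_addl.
  - by rewrite -addnA addnCA leq_addr.
  - by rewrite -addnA leq_addr.
exists S; split=> //.
- move=> c; set m := N c.
  have [M MP] : exists M, forall n, (M <= n)%N -> conv S f c = conv (cpart n) f c.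
    rewrite /conv; move: (D c); apply: tens_ind => [x y|s t [M1 h1] [M2 h2]].
      have [M hM] := SE' x; exists M => n /hM Sx.
      rewrite !tlift_pure ?Sx //; apply: bilin_conv => //; exact: lf_cpart.
    exists (maxn M1 M2) => n; rewrite geq_max => /andP[/h1 e1 /h2 e2].
    rewrite !(linD (lf_tlift (bilin_conv _ _))) ?e1 ?e2 //; exact: lf_cpart.
  rewrite (MP (maxn M m.+1)) ?leq_maxl //; set n := maxn M m.+1.
  (* Telescoping: u^k*(g*f) = u^k - u^(k+1), because g*f = 1 - u. *)
  have sumE k : conv (cpart k) f c = cunit c - cpow k c.
    elim: k => [|k IHk].
      rewrite /= subrr /conv /tlift big1 // => p _.
      by rewrite /cpart big_ord0 (lin0 (alg_mull aU _)).
    have -> : conv (cpart k.+1) f c = conv (cpart k) f c + conv (conv (cpow k) g) f c.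
      rewrite /conv /tlift -big_split /=; apply: eq_bigr => p _.
      by rewrite /cpart big_ord_recr /= (linD (alg_mull aU _)).
    rewrite IHk -(convA (lf_cpow k) gl fl).
    have -> : conv (cpow k) (conv g f) c = cpow k c - conv (cpow k) u c.
      rewrite -[in RHS](conv1r (lf_cpow k) c) /conv /tlift -sumrB; apply: eq_bigr => p _.
      by rewrite -(linB (alg_mulr aU _)) /u opprB addrC subrK.
    by rewrite cpowSr addrA subrK.
  rewrite sumE (cpow_vanish (m := m)) ?subr0 ?leq_maxr //; exact: NP.
- move=> c c0; rewrite (SE c (N c).+1) // (cpart_stable (m := 0)) // /cpart big_ord_recl big_ord0 addr0 /=.
  exact: conv1l.
Qed.

End LeftInverse.

(** The left inverse S agrees with g on step 0, so f is a left inverse of S there and S has a left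
    inverse T by the same lemma. Then T = T*(S*f) = (T*S)*f = f, which makes S a right inverse of f
    as well. *)
Lemma conv_inverse (f g : C -> U) (fl : linear f) (gl : linear g) :
  (forall c, Fil 0 c -> conv g f c = cunit c) ->
  (forall c, Fil 0 c -> conv f g c = cunit c) ->
  exists S : C -> U,
  [/\ linear S, forall c, conv S f c = cunit c, forall c, conv f S c = cunit c &
      forall c, exists N, forall n, (N <= n)%N -> S c = cpart f g n c].
Proof.
move=> gf fg; have [S [Sl Sf S0 SN]] := left_inverse_conv fl gl gf.
exists S; split=> //.
have fS c : Fil 0 c -> conv f S c = cunit c.
  move=> c0; rewrite -(fg c c0) /conv; have := FilD c0.
  have b1 := bilin_conv fl Sl; have b2 := bilin_conv fl gl.
  elim=> [i j a b ij _ bj||s t _ IHs _ IHt].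
  - by move: ij bj; rewrite leqn0 addn_eq0 => /andP[_ /eqP ->] /S0 Sb; rewrite !tlift_pure // Sb.
  - by rewrite !(lin0 (lf_tlift _)).
  - by rewrite (linD (lf_tlift b1)) (linD (lf_tlift b2)) IHs IHt.
have [T [Tl TS _ _]] := left_inverse_conv Sl fl fS.
have TE c : T c = f c.
  rewrite -(conv1r Tl) -(eq_conv _ (fun _ => erefl) Sf) (convA Tl Sl fl).
  by rewrite (eq_conv _ TS (fun _ => erefl)) conv1l.
by move=> c; rewrite -TS; apply: eq_conv => // x; rewrite TE.
Qed.

End Convolution.

(** * The bosonisation as an algebra *)

Section Coassociativity.
Variables (F : fieldType) (X Y Z : lmodType F).
Variables (t : tens X Z) (c1 : X -> tens X Y) (c2 : Z -> tens Y Z).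
Hypotheses (l1 : linear c1) (l2 : linear c2).
Hypothesis cE : \sw_(v, w <- t) (c1 v ⊗ w) = \sw_(v, s <- t) \sw_(a, b <- c2 s) (v ⊗ a ⊗ b).

(** Coassociativity evaluated under a trilinear map. With three different spaces it covers
    coproducts and coactions alike. *)
Lemma coassoc_trilin (U : lmodType F) (f : X -> Y -> Z -> U) :
  (forall y z, linear (fun x => f x y z)) -> (forall x z, linear (fun y => f x y z)) ->
  (forall x y, linear (f x y)) ->
  \sw_(v, w <- t) \sw_(a, b <- c1 v) f a b w = \sw_(v, s <- t) \sw_(a, b <- c2 s) f v a b.
Proof.
move=> f1 f2 f3.
pose G (s : tens X Y) (w : Z) := tlift (fun a b => f a b w) s.
have bG : bilin G.
  split=> [w|s]; first by apply: lf_tlift; split=> ?.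
  by apply: lf_tlift_par => a b; apply: f3.
transitivity (tlift G (\sw_(v, w <- t) (c1 v ⊗ w))).
  by rewrite (lin_tlift _ _ (lf_tlift bG)); apply: eq_tlift => v w; rewrite tlift_pure.
rewrite cE (lin_tlift _ _ (lf_tlift bG)); apply: eq_tlift => v w.
rewrite (lin_tlift _ _ (lf_tlift bG)); apply: eq_tlift => a b.
by rewrite tlift_pure // /G tlift_pure //; split=> ?.
Qed.
End Coassociativity.

Section SmashProduct.
Variables (F : fieldType) (K B : galg F) (H : hopf_ops K) (C : cmod K B).
Hypotheses (hH : is_shopf H) (hB : is_galg B).
Let hK := shopf_galg hH.
Let mK := galg_is_gmod hK.
Let mB := galg_is_gmod hB.

(** The part of the crossed module axioms that the product of the bosonisation needs. No coaction
    enters, so the algebra is available before the crossed module condition is known, and can serve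
    to prove it. *)
Record is_modalg : Prop := IsModalg {
  modalg_l : forall k, linear (fun v => act C v k);
  modalg_r : forall v, linear (fun k => act C v k);
  modalg_homog : forall m n (v : B) (k : K),
    homog m v -> homog n k -> homog (m + n) (act C v k);
  modalg_1 : forall v, act C v (gone K) = v;
  modalg_M : forall v k l, act C v (k ∙ l) = act C (act C v k) l;
  modalg_one : forall k, act C (gone B) k = cou H k *: gone B;
  modalg_mul : forall j u v k, ph j v ->
    act C (u ∙ v) k = \sw_(k1, k2 <- cop H k) (act C u (sg j k1) ∙ act C v k2)
}.
Hypothesis hM : is_modalg.

Lemma lf_actl (T : lmodType F) (f : T -> B) k : linear f -> linear (fun x => act C (f x) k).
Proof. exact: lf_comp (modalg_l hM k). Qed.
Lemma lf_actr (T : lmodType F) (f : T -> K) v : linear f -> linear (fun x => act C v (f x)).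
Proof. exact: lf_comp (modalg_r hM v). Qed.
Lemma lf_cop (T : lmodType F) (f : T -> K) : linear f -> linear (fun x => cop H (f x)).
Proof. exact: lf_comp (cop_glin (shopf_coalg hH)).1. Qed.
Let lf_gmullK := @lf_gmull _ K hK.
Let lf_gmulrK := @lf_gmulr _ K hK.
Let lf_gmullB := @lf_gmull _ B hB.
Let lf_gmulrB := @lf_gmulr _ B hB.
Let lf_sgK := fun (T : lmodType F) i (f : T -> K) => @lf_sgc _ T K mK i f.
Let lf_sgB := fun (T : lmodType F) i (f : T -> B) => @lf_sgc _ T B mB i f.

Ltac lin_hook ::= first
  [ apply: lf_gmullK | apply: lf_gmulrK | apply: lf_gmullB | apply: lf_gmulrB
  | apply: lf_sgK | apply: lf_sgB | apply: lf_actl | apply: lf_actr | apply: lf_cop ].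

Lemma ph_act i j (v : B) (k : K) : ph i v -> ph j k -> ph (i (+) j) (act C v k).
Proof.
move=> vi kj.
have -> : v = par i v by rewrite par_id.
have -> : k = par j k by rewrite (par_id mK).
have [N hN] := gpr_bound mB v; have [M hM'] := gpr_bound mK k.
rewrite (parE i hN) (parE j hM') (lin_sum (modalg_l hM _)).
apply: (big_ind (ph (i (+) j))); [exact: ph0|exact: phD|move=> m /eqP mi].
rewrite (lin_sum (modalg_r hM _)).
apply: (big_ind (ph (i (+) j))); [exact: ph0|exact: phD|move=> n /eqP nj].
rewrite -mi -nj -oddD; apply: homog_ph => //.
by apply: (modalg_homog hM); apply: gpr_homog.
Qed.

Local Notation bosm := (@bos_mul F K H B C).

Let bosm_out (t : tens K B) (j i : bool) : bilin (fun (w : K) (e : B) =>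
  \sw_(tau, xi <- t) \sw_(tau1 of j, tau2 of _ <- cop H tau)
    sign (i && j) *: ((w ∙ tau1) ⊗ (act C e tau2 ∙ xi))).
Proof.
by split=> ?; apply: lf_tlift_par => ? ?; apply: lf_tlift_par => ? ?;
  apply: lf_sum => ?; apply: lf_sum => ?; lin.
Qed.

(** Left multiplication by w ⊗ e in the bosonisation for e of parity i, with the Koszul sign moved
    into [sg]. *)
Definition smash (i : bool) (w : K) (e : B) (t : tens K B) : tens K B :=
  \sw_(tau, xi <- t) \sw_(tau1, tau2 <- cop H tau) ((w ∙ sg i tau1) ⊗ (act C e tau2 ∙ xi)).

Let smash_in i w e : bilin (fun tau xi =>
  \sw_(tau1, tau2 <- cop H tau) ((w ∙ sg i tau1) ⊗ (act C e tau2 ∙ xi))).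
Proof. lin. Qed.

Lemma lf_smash i w e : linear (smash i w e).
Proof. exact: lf_tlift. Qed.

Lemma smash_pure i w e tau xi : smash i w e (tau ⊗ xi) =
  \sw_(tau1, tau2 <- cop H tau) ((w ∙ sg i tau1) ⊗ (act C e tau2 ∙ xi)).
Proof. exact: tlift_pure. Qed.

Lemma bilin_bosm : bilin (@bos_mul F K H B C).
Proof.
split=> [t|s]; first exact: (lf_slift mK mB (bosm_out t)).
apply: lf_tlift_par => w e; apply: lf_sum => j; apply: lf_sum => i.
apply: lf_tlift; split=> [xi|tau].
- apply: lf_comp (cop_glin (shopf_coalg hH)).1.
  by apply: (lf_slift mK mK) => *; lin.
- by apply: lf_tlift_par => ? ?; apply: lf_sum => ?; apply: lf_sum => ?; lin.
Qed.

Lemma bosmE i w e t : ph i e -> @bos_mul F K H B C (w ⊗ e) t = smash i w e t.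
Proof.
move=> ei; move: w; apply: (ph_ext mK) => [||k w wk].
- apply: lf_comp (bilin_bosm.1 t) _; lin.
- rewrite /smash; lin.
rewrite /bos_mul (slift_ph mK mB (bosm_out t) wk ei) /smash.
apply: eq_tlift => tau xi; rewrite (slift_sgl mK mK); last by lin.
by [].
Qed.

Lemma bosm_inl w t : @bos_mul F K H B C (w ⊗ gone B) t =
  \sw_(tau, xi <- t) ((w ∙ tau) ⊗ xi).
Proof.
rewrite (bosmE _ _ (ph1 hB)); apply: eq_tlift => tau xi.
rewrite -[in RHS](cour (shopf_coalg hH) tau) (lin_tlift _ _ (gmul_linearr hK w)).
have hl : linear (fun v : K => v ⊗ xi) by lin.
rewrite (lin_tlift _ _ hl); apply: eq_tlift => a b.
rewrite (sg0 mK) (modalg_one hM) (gmulZl hB) (gmul1l hB) (gmulZr hK) tensZl.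
by rewrite tensZr.
Qed.

Lemma bosm_inl_pure w tau xi : @bos_mul F K H B C (w ⊗ gone B) (tau ⊗ xi) = (w ∙ tau) ⊗ xi.
Proof. by rewrite bosm_inl tlift_pure //; lin. Qed.

Lemma bosm_inr w e xi : @bos_mul F K H B C (w ⊗ e) (gone K ⊗ xi) = w ⊗ (e ∙ xi).
Proof.
move: e; apply: (ph_ext mB) => [||i e ei].
- apply: lf_comp (bilin_bosm.1 _) _; lin.
- lin.
have [_ cop1 _] := shopf_cop hH.
rewrite (bosmE _ _ ei) smash_pure cop1 tlift_pure; last by lin.
by rewrite (sg1 hK) (gmul1r hK) (modalg_1 hM).
Qed.

Lemma bos_split w e : w ⊗ e = @bos_mul F K H B C (w ⊗ gone B) (gone K ⊗ e).
Proof. by rewrite bosm_inl_pure (gmul1r hK). Qed.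

Let bl := bilin_bosm.1.
Let br := bilin_bosm.2.

Let mul_inl_assoc w s t :
  bosm (bosm (w ⊗ gone B) s) t = bosm (w ⊗ gone B) (bosm s t).
Proof.
move: s; apply: (tens_phext mK mB) => [||i j tau xi taui xij].
- exact: (lf_comp (bl t) (br _)).
- exact: (lf_comp (br _) (bl t)).
rewrite bosm_inl_pure !(bosmE _ _ xij) bosm_inl /smash.
rewrite (lin_tlift (h := fun x => \sw_(tau0, xi0 <- x) (w ∙ tau0) ⊗ xi0)); last first.
  by apply: lf_tlift; lin.
apply: eq_tlift => a b.
rewrite (lin_tlift (h := fun x => \sw_(tau0, xi0 <- x) (w ∙ tau0) ⊗ xi0)); last first.
  by apply: lf_tlift; lin.
apply: eq_tlift => x y; rewrite tlift_pure; last by lin.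
by rewrite (gmulA hK).
Qed.

Let mul_inr_assoc s t xi :
  bosm (bosm s t) (gone K ⊗ xi) = bosm s (bosm t (gone K ⊗ xi)).
Proof.
move: s; apply: (tens_phext mK mB) => [||i j w e wi ej].
- exact: (lf_comp (bl _) (bl t)).
- exact: bl.
move: t; apply: (tens_phext mK mB) => [||k l tau z tauk zl].
- exact: (lf_comp (bl _) (br _)).
- exact: (lf_comp (br _) (bl _)).
rewrite bosm_inr !(bosmE _ _ ej) !smash_pure (lin_tlift _ _ (bl _)).
by apply: eq_tlift => x y; rewrite bosm_inr (gmulA hB).
Qed.

(** The case of associativity with content: a factor from B on the left and one from K on the right.
    It combines the module algebra law, coassociativity and multiplicativity of the coproduct; the
    final case split compares the accumulated signs. *)
Let mul_mid_assoc e t rho :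
  bosm (bosm (gone K ⊗ e) t) (rho ⊗ gone B) = bosm (gone K ⊗ e) (bosm t (rho ⊗ gone B)).
Proof.
move: e; apply: (ph_ext mB) => [||i e ei].
- apply: lf_comp (bl _) _; apply: lf_comp (bl _) _; lin.
- apply: lf_comp (bl _) _; lin.
move: t; apply: (tens_phext mK mB) => [||k l tau z tauk zl].
- exact: (lf_comp (bl _) (br _)).
- exact: (lf_comp (br _) (bl _)).
have hC := shopf_coalg hH; have [copg cop1 copM] := shopf_cop hH.
have hKK := gtens_gmod mK mK.
rewrite !(bosmE _ _ ei) smash_pure (bosmE _ _ zl) smash_pure (lin_tlift _ _ (bl _)).
rewrite (lin_tlift _ _ (lf_smash _ _ _)).
under [LHS]eq_tlift => a b do rewrite (gmul1l hK).
transitivity (\sw_(r1, r2 <- cop H rho) \sw_(x, y <- smul (cop H tau) (cop H (sg l r1)))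
    (sg i x ⊗ (act C e y ∙ act C z r2))); last first.
  apply: eq_tlift => r1 r2; rewrite smash_pure copM.
  by apply: eq_tlift => x y; rewrite (gmul1l hK) (gmul1r hB).
have [sl sr] := bilin_smul hK hK.
move: (cop H tau); apply: (tens_phext mK mK) => [||ia ib a b aP bP].
- apply: lf_tlift; split=> [b|a]; apply: lf_comp (bl _) _; lin.
- apply: lf_tlift_par => r1 r2; apply: lf_comp (sl _); apply: lf_tlift; lin.
rewrite tlift_pure; last by split=> ?; apply: lf_comp (bl _) _; lin.
rewrite (bosmE _ _ (phM hB (ph_act ei bP) zl)) smash_pure.
pose f r1 r2 r3 := (sg i a ∙ sg (i (+) ib (+) l) r1) ⊗
   (act C (act C e b) (sg l r2) ∙ act C z r3).
transitivity (\sw_(r1, r23 <- cop H rho) \sw_(r2, r3 <- cop H r23) f r1 r2 r3).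
  apply: eq_tlift => r1 r2; rewrite (gmul1r hB) (modalg_mul hM _ _ zl).
  have hl : linear (fun x : B => (sg i a ∙ sg (i (+) ib (+) l) r1) ⊗ x) by lin.
  by rewrite (lin_tlift _ _ hl).
rewrite -(coassoc_trilin (copA hC rho)); try by rewrite /f => *; lin.
apply: eq_tlift => r1 r2; rewrite (glin_sg mK hKK _ _ copg).
move: (cop H r1); apply: (tens_phext mK mK) => [||ic id c d cP dP].
- rewrite /f; apply: lf_tlift; lin.
- by apply: lf_tlift_arg; [lin | exact: (lf_comp (sr _) (lf_sg hKK l))].
rewrite tlift_pure; last by rewrite /f; lin.
rewrite (sg_tens mK mK) (smul_ph hK hK _ _ bP (ph_sg mK l cP)).
rewrite (linZ (lf_tlift _)); last by lin.
rewrite tlift_pure; last by lin.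
rewrite /f (sgM hK) (modalg_M hM) !(sg_ph mK _ cP) (linZ (lf_sg mK i)) (sg_ph mK _ cP).
rewrite !(gmulZr hK) !tensZl !scalerA !signM; congr (sign _ *: _).
by clear f; case: i ei; case: l zl; case: ib bP; case: ic cP.
Qed.

(** A left factor w ⊗ e is (w ⊗ 1)(1 ⊗ e), and a right factor rho ⊗ xi is (rho ⊗ 1)(1 ⊗ xi).
    Stripping w on the left and xi on the right reduces associativity to [mul_mid_assoc]. *)
Lemma bos_galg : is_galg (bos H C).
Proof.
have hC := shopf_coalg hH; have [[copl coph] cop1 copM] := shopf_cop hH.
split=> //=.
- exact: gtens_gmod.
- move=> x y z; move: x; apply: tens_ext => [||w e].
  + exact: bl.
  + exact: (lf_comp (bl z) (bl y)).
  rewrite (bos_split w e) !mul_inl_assoc; congr (bosm _ _); clear w.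
  move: z; apply: tens_ext => [||rho xi].
  + exact: (lf_comp (br _) (br _)).
  + exact: br.
  by rewrite (bos_split rho xi) -!mul_inr_assoc mul_mid_assoc.
- by apply: tens_ext => [||w e]; [exact: br|exact: lf_id|rewrite bosm_inl_pure (gmul1l hK)].
- by apply: tens_ext => [||w e]; [exact: bl|exact: lf_id|rewrite bosm_inr (gmul1r hB)].
- exact: (tens_homog mK mB (gone_homog hK) (gone_homog hB)).
move=> m n x y xm yn.
have hT := gtens_gmod mK mB.
have sumh (V W : gmod F) (mV : is_gmod V) (mW : is_gmod W) k (x' : tens V W)
    (x'k : @homog F (gtens V W) k x') (P : tens V W -> Prop) :
    (forall s t, P s -> P t -> P (s + t)) -> P 0 ->
    (forall i j a b, homog i a -> homog j b -> k = (i + j)%N -> P (a ⊗ b)) -> P x'.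
  move=> PD P0 Pp; rewrite -x'k /=; move: (x').
  apply: tens_ind => [a b|s t Ps Pt]; last by rewrite (linD (lf_tpr_deg mV mW k)); apply: PD.
  rewrite (tpr_pure mV mW); apply: big_ind => // i _.
  apply: Pp (gpr_homog mV _ _) (gpr_homog mW _ _) _.
  by rewrite subnKC // -ltnS ltn_ord.
apply: (sumh _ _ mK mB _ _ xm (fun x => @homog F (gtens K B) (m + n)%N (bosm x y))).
- by move=> s t hs ht; rewrite (linD (bl y)); apply: homogD.
- by rewrite (lin0 (bl y)); apply: homog0.
move=> i j w e wi ej ->.
apply: (sumh _ _ mK mB _ _ yn (fun y => @homog F (gtens K B) (i + j + n)%N (bosm (w ⊗ e) y))).
- by move=> s t hs ht; rewrite (linD (br _)); apply: homogD.
- by rewrite (lin0 (br _)); apply: homog0.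
move=> k l tau xi tauk xil ->.
rewrite (bosmE _ _ (homog_ph mB ej)) smash_pure.
have ck : @homog F (gtens K K) k (cop H tau) by apply: (glin_homog (cop_glin hC)).
apply: (sumh _ _ mK mK _ _ ck (fun t => @homog F (gtens K B) (i + j + (k + l))%N
  (\sw_(tau1, tau2 <- t) (w ∙ sg (odd j) tau1) ⊗ (act C e tau2 ∙ xi)))).
- by move=> s t hs ht; rewrite (linD (lf_tlift _)); [apply: homogD | lin].
- by rewrite (lin0 (lf_tlift _)); [apply: homog0 | lin].
move=> p r a b ap br' ->; rewrite tlift_pure; last by lin.
have -> : (i + j + (p + r + l))%N = (i + p + (j + r + l))%N.
  by rewrite -!addnA; congr (_ + _)%N; rewrite addnCA.
apply: (tens_homog mK mB).
  apply: (gmul_homog hK) => //; rewrite (sg_homog mK _ ap); exact: homogZ.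
by apply: (gmul_homog hB) => //; apply: (modalg_homog hM).
Qed.

Let hW := bos_galg.

Lemma galg_map_bos_inl : @is_galg_map F K (bos H C) (bos_inl H C).
Proof.
split=> //; last by move=> x y; rewrite /= /bos_inl bosm_inl_pure.
apply: (glinI mK (galg_is_gmod hW)) => [|n v vn]; first by rewrite /bos_inl; lin.
by rewrite -[n]addn0; apply: (tens_homog mK mB vn (gone_homog hB)).
Qed.

Lemma galg_map_bos_inr : @is_galg_map F B (bos H C) (bos_inr H C).
Proof.
split=> //; last by move=> x y; rewrite /= /bos_inr bosm_inr.
apply: (glinI mB (galg_is_gmod hW)) => [|n v vn]; first by rewrite /bos_inr; lin.
by rewrite -[n]add0n; apply: (tens_homog mK mB (gone_homog hK) vn).
Qed.

Lemma bos_pureE w e : w ⊗ e = bos_inl H C w ∙ bos_inr H C e :> bos H C.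
Proof. exact: bos_split. Qed.

Lemma bos_cross i e k : ph i e -> bos_inr H C e ∙ bos_inl H C k =
  \sw_(k1, k2 <- cop H k) (sg i k1 ⊗ act C e k2) :> bos H C.
Proof.
move=> ei; rewrite /= /bos_inr /bos_inl (bosmE _ _ ei) smash_pure.
by apply: eq_tlift => a b; rewrite (gmul1l hK) (gmul1r hB).
Qed.

(** * Universal property of the smash product *)

Section Universal.
Variables (U : lmodType F) (mul : U -> U -> U) (one : U) (aU : is_alg mul one).
Variables (f : K -> U) (g : B -> U) (hf : alg_map mul one f) (hg : alg_map mul one g).
Definition bos_lift (t : bos H C) : U := \sw_(w, e <- t) mul (f w) (g e).

Let fl : linear f. Proof. by case: hf. Qed.
Let gl : linear g. Proof. by case: hg. Qed.
Let bfg : bilin (fun w e => mul (f w) (g e)).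
Proof. by split=> ?; [apply: (lf_mull aU)|apply: (lf_mulr aU)]. Qed.

Lemma lf_bos_lift : linear bos_lift.
Proof. exact: lf_tlift. Qed.

Lemma bos_lift_pure w e : bos_lift (w ⊗ e) = mul (f w) (g e).
Proof. exact: tlift_pure. Qed.

Lemma bos_lift_inl w : bos_lift (bos_inl H C w) = f w.
Proof. by rewrite /bos_inl bos_lift_pure; case: hg => _ -> _; rewrite (alg_mul1r aU). Qed.

Lemma bos_lift_inr e : bos_lift (bos_inr H C e) = g e.
Proof. by rewrite /bos_inr bos_lift_pure; case: hf => _ -> _; rewrite (alg_mul1l aU). Qed.

Variables (GK : K -> Prop) (V : B -> Prop).
Hypotheses (gK : generated GK) (gB : generated V).
Hypothesis Vact : forall v k, V v -> V (act C v k).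
Hypothesis fgV : forall v k, V v -> GK k ->
  mul (g v) (f k) = bos_lift (bos_inr H C v ∙ bos_inl H C k).

Let f1 : f (gone K) = one. Proof. by case: hf. Qed.
Let g1 : g (gone B) = one. Proof. by case: hg. Qed.
Let fM x y : f (x ∙ y) = mul (f x) (f y). Proof. by case: hf. Qed.
Let gM x y : g (x ∙ y) = mul (g x) (g y). Proof. by case: hg. Qed.

Let liftl w t : bos_lift (bos_inl H C w ∙ t) = mul (f w) (bos_lift t).
Proof.
move: t; apply: tens_ext => [||k e].
- exact: (lf_comp lf_bos_lift (br _)).
- exact: (lf_comp (alg_mulr aU _) lf_bos_lift).
by rewrite /= /bos_inl bosm_inl_pure !bos_lift_pure fM (alg_mulA aU).
Qed.

Let liftr t e : bos_lift (t ∙ bos_inr H C e) = mul (bos_lift t) (g e).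
Proof.
move: t; apply: tens_ext => [||k x].
- exact: (lf_comp lf_bos_lift (bl _)).
- exact: (lf_comp (alg_mull aU _) lf_bos_lift).
by rewrite /= /bos_inr bosm_inr !bos_lift_pure gM (alg_mulA aU).
Qed.

(** Moving a generator of B across K produces coefficients in K and again elements of V, since V is
    stable under the action. This keeps the cross relation for V applicable after each step. *)
Inductive Vcoef : tens K B -> Prop :=
| Vcoef_pure w v : V v -> Vcoef (w ⊗ v)
| Vcoef_0 : Vcoef 0
| Vcoef_D s t : Vcoef s -> Vcoef t -> Vcoef (s + t).

Hypothesis Vpar : forall i v, V v -> V (par i v).

Lemma crossV v k : V v -> Vcoef (bos_inr H C v ∙ bos_inl H C k).
Proof.
move=> vV; rewrite {1}(par_sum mB v).
have jl : linear (bos_inr H C) by rewrite /bos_inr; lin.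
rewrite (lin_sum jl) (lin_sum (gmul_linearl hW _)).
apply: (big_ind Vcoef) => [||i _]; [exact: Vcoef_0|exact: Vcoef_D|].
rewrite (bos_cross (i := i)); last exact: ph_par.
move: (cop H k).
apply: tens_ind => [a b|s t hs ht].
  by rewrite tlift_pure; [apply/Vcoef_pure/Vact/Vpar | lin].
by rewrite (linD (lf_tlift _)); [apply: Vcoef_D | lin].
Qed.

(** The cross relation on generators implies it everywhere. Induction over K comes before induction
    over B: for v in V a product of elements of K is crossed one factor at a time, as V is stable;
    products in B then need only associativity. *)
Lemma bos_lift_cross : forall e k, mul (g e) (f k) = bos_lift (bos_inr H C e ∙ bos_inl H C k).
Proof.
have inrl : linear (bos_inr H C) by rewrite /bos_inr; lin.
have inll : linear (bos_inl H C) by rewrite /bos_inl; lin.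
have [_ inl1 inlM] := galg_map_bos_inl; have [_ inr1 inrM] := galg_map_bos_inr.
have cl k : linear (fun e => bos_lift (bos_inr H C e ∙ bos_inl H C k)).
  exact: (lf_comp lf_bos_lift (lf_comp (bl _) inrl)).
have cr e : linear (fun k => bos_lift (bos_inr H C e ∙ bos_inl H C k)).
  exact: (lf_comp lf_bos_lift (lf_comp (br _) inll)).
have ml k : linear (fun e => mul (g e) (f k)) by exact: (lf_mull aU).
have mr e : linear (fun k => mul (g e) (f k)) by exact: (lf_mulr aU).
have onK k v : V v -> mul (g v) (f k) = bos_lift (bos_inr H C v ∙ bos_inl H C k).
  move: k v; apply: gK.
  - by move=> v _; rewrite f1 inl1 (gmul1r hW) bos_lift_inr (alg_mul1r aU).
  - by move=> c x IH v vV; rewrite (linZ (mr v)) (linZ (cr v)) IH.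
  - by move=> x y IHx IHy v vV; rewrite (linD (mr v)) (linD (cr v)) IHx // IHy.
  - move=> x y IHx IHy v vV.
    rewrite fM (alg_mulA aU) IHx // inlM (gmulA hW).
    elim: (crossV x vV) => [w u uV||s t _ IHs _ IHt].
    + rewrite bos_pureE -(gmulA hW) !liftl bos_lift_inr -(alg_mulA aU) IHy //.
    + by rewrite (gmul0l hW) (lin0 lf_bos_lift) (lin0 (alg_mull aU _)).
    + by rewrite (gmulDl hW) !(linD lf_bos_lift) (linD (alg_mull aU _)) IHs IHt.
  - by move=> x Gx v vV; apply: fgV.
apply: gB.
- by move=> k; rewrite g1 inr1 (gmul1l hW) bos_lift_inl (alg_mul1l aU).
- by move=> c x IH k; rewrite (linZ (ml k)) (linZ (cl k)) IH.
- by move=> x y IHx IHy k; rewrite (linD (ml k)) (linD (cl k)) IHx IHy.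
- move=> x y IHx IHy k.
  rewrite gM -(alg_mulA aU) IHy inrM -(gmulA hW).
  move: (bos_inr H C y ∙ _); apply: tens_ext => [||w e].
  + exact: (lf_comp (alg_mulr aU _) lf_bos_lift).
  + exact: (lf_comp lf_bos_lift (br _)).
  by rewrite (bos_pureE w e) (gmulA hW) !liftr -IHx bos_lift_inl (alg_mulA aU).
- by move=> v vV k; apply: onK.
Qed.

Lemma bos_lift_alg : alg_map mul one bos_lift.
Proof.
split; first exact: lf_bos_lift.
  by rewrite /= bos_lift_pure f1 g1 (alg_mul1l aU).
move=> x y; move: x; apply: tens_ext => [||w e].
- exact: (lf_comp lf_bos_lift (bl _)).
- exact: (lf_comp (alg_mull aU _) lf_bos_lift).
move: y; apply: tens_ext => [||k z].
- exact: (lf_comp lf_bos_lift (br _)).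
- exact: (lf_comp (alg_mulr aU _) lf_bos_lift).
rewrite (bos_pureE w e) (bos_pureE k z) (gmulA hW) liftr -(gmulA hW) liftl -bos_lift_cross.
by rewrite liftl bos_lift_inr liftr bos_lift_inl !(alg_mulA aU).
Qed.

End Universal.

Lemma bos_generated (GK : K -> Prop) (V : B -> Prop) : generated GK -> generated V ->
  generated (fun t : bos H C => (exists2 k, GK k & t = bos_inl H C k) \/
    (exists2 v, V v & t = bos_inr H C v)).
Proof.
have inrl : linear (bos_inr H C) by rewrite /bos_inr; lin.
have inll : linear (bos_inl H C) by rewrite /bos_inl; lin.
have [_ inl1 inlM] := galg_map_bos_inl; have [_ inr1 inrM] := galg_map_bos_inr.
move=> gK gB P P1 PZ PD PM PG.
have Pl k : P (bos_inl H C k).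
  move: k; apply: gK.
  - by rewrite inl1.
  - by move=> c x Px; rewrite (linZ inll); apply: PZ.
  - by move=> x y Px Py; rewrite (linD inll); apply: PD.
  - by move=> x y Px Py; rewrite inlM; apply: PM.
  - by move=> x Gx; apply: PG; left; exists x.
have Pr k : P (bos_inr H C k).
  move: k; apply: gB.
  - by rewrite inr1.
  - by move=> c x Px; rewrite (linZ inrl); apply: PZ.
  - by move=> x y Px Py; rewrite (linD inrl); apply: PD.
  - by move=> x y Px Py; rewrite inrM; apply: PM.
  - by move=> x Gx; apply: PG; right; exists x.
by apply: tens_ind => // w e; rewrite bos_pureE; apply: PM.
Qed.

End SmashProduct.

(** * Even characters and contractions of tensors *)

Section Characters.
Variable F : fieldType.

(** Vanishing on odd elements makes every Koszul sign in front of a value of the character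
    disappear, so that contracting a leg of a super tensor product with it is multiplicative. *)
Record is_char (A : galg F) (e : A -> F) : Prop := IsChar {
  char_lin : linear (e : A -> F^o);
  char_one : e (gone A) = 1;
  char_mul : forall x y, e (x ∙ y) = e x * e y;
  char_odd : forall x, ph true x -> e x = 0
}.

Lemma char_sg (A : galg F) (hA : is_galg A) (e : A -> F) i x : is_char e -> e (sg i x) = e x.
Proof.
move=> he; have mA := galg_is_gmod hA; have el := char_lin he.
have := @ph_ext _ _ mA F^o (fun x => e (sg i x)) e.
apply=> [|//|j y yj]; first exact: (lf_comp el (lf_sg mA i)).
rewrite (sg_ph mA i yj) (linZ el) /=; case: j yj => yj.
  by rewrite (char_odd he yj) scaler0.
by rewrite andbF scale1r.
Qed.

Lemma char_sign (A : galg F) (e : A -> F) i j x : is_char e -> ph i x ->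
  sign (i && j) * e x = e x.
Proof.
move=> he; case: i => xi; last by rewrite mul1r.
by rewrite (char_odd he xi) mulr0.
Qed.

Lemma charl_alg (A X : galg F) (hA : is_galg A) (hX : is_galg X) (e : A -> F) : is_char e ->
  @alg_map F (stens A X) X (@gmul F X) (gone X) (fun t => \sw_(a, x <- t) e a *: x).
Proof.
move=> he; have el := char_lin he.
have [mA mX] := (galg_is_gmod hA, galg_is_gmod hX).
have b : bilin (fun (a : A) (x : X) => e a *: x) by lin.
have tl := lf_tlift b; have [bl br] := bilin_smul hA hX.
split=> //; first by rewrite /= tlift_pure // (char_one he) scale1r.
move=> x y; move: x; apply: (tens_phext mA mX) => [||i j a x ai xj].
- exact: (lf_comp tl (bl y)).
- exact: (lf_comp (gmul_linearl hX _) tl).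
move: y; apply: (tens_phext mA mX) => [||k l c z ck zl].
- exact: (lf_comp tl (br _)).
- exact: (lf_comp (gmul_linearr hX _) tl).
rewrite /= (smul_ph hA hX _ _ xj ck) (linZ tl) !tlift_pure // (char_mul he).
rewrite (gmulZl hX) (gmulZr hX) !scalerA; congr (_ *: _).
by rewrite mulrCA andbC (char_sign _ he ck).
Qed.

Lemma charr_alg (A X : galg F) (hA : is_galg A) (hX : is_galg X) (e : A -> F) : is_char e ->
  @alg_map F (stens X A) X (@gmul F X) (gone X) (fun t => \sw_(x, a <- t) e a *: x).
Proof.
move=> he; have el := char_lin he.
have [mA mX] := (galg_is_gmod hA, galg_is_gmod hX).
have b : bilin (fun (x : X) (a : A) => e a *: x) by lin.
have tl := lf_tlift b; have [bl br] := bilin_smul hX hA.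
split=> //; first by rewrite /= tlift_pure // (char_one he) scale1r.
move=> x y; move: x; apply: (tens_phext mX mA) => [||j i x a xj ai].
- exact: (lf_comp tl (bl y)).
- exact: (lf_comp (gmul_linearl hX _) tl).
move: y; apply: (tens_phext mX mA) => [||l k z c zl ck].
- exact: (lf_comp tl (br _)).
- exact: (lf_comp (gmul_linearr hX _) tl).
rewrite /= (smul_ph hX hA _ _ ai zl) (linZ tl) !tlift_pure // (char_mul he).
rewrite (gmulZl hX) (gmulZr hX) !scalerA; congr (_ *: _).
by rewrite mulrA (char_sign _ he ai) mulrC.
Qed.

Lemma charI (A : galg F) (hA : is_galg A) (e : A -> F) : linear (e : A -> F^o) ->
  e (gone A) = 1 -> (forall x y, e (x ∙ y) = e x * e y) ->
  (forall n v, e (gpr n.+1 v) = 0) -> is_char e.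
Proof.
move=> el e1 eM eh; split=> // x xo.
have mA := galg_is_gmod hA; have [N hN] := gpr_bound mA x.
rewrite (gpr_sum mA hN) (lin_sum el) big1 // => -[[|n] nN] _ //=.
by rewrite xo // (lin0 el).
Qed.

Lemma shopf_char (A : galg F) (H : hopf_ops A) : is_shopf H -> is_char (cou H).
Proof.
move=> hH; have hC := shopf_coalg hH; apply: charI.
- exact: shopf_galg hH.
- exact: cou_linear hC.
- exact: shopf_cou1 hH.
- exact: shopf_couM hH.
- exact: cou_homog hC.
Qed.

Lemma alg_map_comp (A A' : galg F) (U : lmodType F) mul one (f : A' -> U) (g : A -> A') :
  alg_map mul one f -> is_galg_map g -> alg_map mul one (fun x => f (g x)).
Proof.
case=> fl f1 fM [[gl _] g1 gM]; split; [exact: lf_comp | by rewrite g1 |].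
by move=> x y; rewrite gM fM.
Qed.

Lemma tlift_tmap (V V' W W' U : lmodType F) (f : V -> V') (g : W -> W') (h : V' -> W' -> U) t :
  linear f -> linear g -> bilin h -> tlift h (tmap f g t) = tlift (fun v w => h (f v) (g w)) t.
Proof.
by move=> fl gl hb; rewrite (lin_tlift _ _ (lf_tlift hb)); apply: eq_tlift => v w; rewrite tlift_pure.
Qed.

Lemma galg_map_glin (A A' : galg F) (f : A -> A') : is_galg_map f -> is_glin f.
Proof. by case. Qed.

Lemma field_alg : @is_alg F F^o *%R 1.
Proof.
split; [move=> y|move=> x|exact: mulrA|exact: mul1r|exact: mulr1].
- by move=> a u v; rewrite /= mulrDl -mulrA.
- by move=> a u v; rewrite /= mulrDr /GRing.scale /= mulrCA.
Qed.

Lemma tassoc_tmap (V W U V' W' U' : lmodType F) (f : V -> V') (g : W -> W') (h : U -> U') :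
  linear f -> linear g -> linear h -> forall t : tens V (tens W U),
  tassoc (tmap f (tmap g h) t) = tmap (tmap f g) h (tassoc t).
Proof.
move=> fl gl hl; have fgl := lf_tmap fl gl; have ghl := lf_tmap gl hl.
apply: tens_ext => [||v s].
- by apply: lf_comp; [apply: lf_tassoc | apply: lf_tmap].
- by apply: lf_comp; [apply: lf_tmap | apply: lf_tassoc].
move: s; apply: tens_ext => [||w u].
- apply: (lf_comp (@lf_tassoc _ _ _ _)); apply: (lf_comp (lf_tmap fl ghl)); lin.
- apply: (lf_comp (lf_tmap fgl hl)); apply: (lf_comp (@lf_tassoc _ _ _ _)); lin.
by rewrite tmap_pure // tmap_pure // !tassoc_pure tmap_pure // tmap_pure.
Qed.

Lemma tassocE (V W U X : lmodType F) (f : X -> tens W U) (t : tens V X) : linear f ->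
  \sw_(v, x <- t) \sw_(w, u <- f x) (v ⊗ w ⊗ u) = tassoc (tmap (fun v => v) f t).
Proof.
move=> fl; rewrite (lin_tlift _ _ (@lf_tassoc _ _ _ _)); apply: eq_tlift => v x.
rewrite /tassoc tlift_pure //; split=> [s|v']; first by apply: lf_tlift_par => *; lin.
by apply: lf_tlift; lin.
Qed.

End Characters.

(** * Braided-Hopf algebras and their bosonisations *)

Section BraidedHopf.
Variables (F : fieldType) (K B : galg F) (H : hopf_ops K) (C : cmod K B).
Hypotheses (hH : is_shopf H) (hB : is_galg B) (hM : is_modalg H C).
Let hK := shopf_galg hH.
Let hC := shopf_coalg hH.
Let mK := galg_is_gmod hK.
Let mB := galg_is_gmod hB.
Local Notation W := (bos H C).
Local Notation inl := (bos_inl H C).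
Local Notation inr := (bos_inr H C).
Local Notation bosm := (@bos_mul F K H B C).
Let hW := bos_galg hH hB hM.
Let mW := galg_is_gmod hW.
Let hBK := stens_galg hB hK.
Let hBW := stens_galg hB hW.
Let hWW := stens_galg hW hW.
Let mBK := galg_is_gmod hBK.
Let mWW := galg_is_gmod hWW.
Let mKK := galg_is_gmod (stens_galg hK hK).
Let inlP := galg_map_bos_inl hH hB hM.
Let inrP := galg_map_bos_inr hH hB hM.

Variables (GK : K -> Prop) (V : B -> Prop).
Hypotheses (gK : generated GK) (gB : generated V).
Hypothesis VD : forall u v, V u -> V v -> V (u + v).
Hypothesis VZ : forall c v, V v -> V (c *: v).
Hypothesis Vact : forall v k, V v -> V (act C v k).
Hypothesis Vpar : forall i v, V v -> V (par i v).

Hypothesis coactP : @is_galg_map F B (stens B K) (coact C).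
Hypothesis coactA : forall v, \sw_(v0, v1 <- coact C v) (coact C v0 ⊗ v1) =
    \sw_(v0, v12 <- coact C v) \sw_(v1, v2 <- cop H v12) (v0 ⊗ v1 ⊗ v2).
Hypothesis coact_cou : forall v, \sw_(v0, v1 <- coact C v) (cou H v1 *: v0) = v.

Inductive Vtens : tens B K -> Prop :=
| Vtens_pure v w : V v -> Vtens (v ⊗ w)
| Vtens_0 : Vtens 0
| Vtens_D s t : Vtens s -> Vtens t -> Vtens (s + t).
Hypothesis Vcoact : forall v, V v -> Vtens (coact C v).

(** The canonical coaction of the bosonisation, v |-> v0 ⊗ v1 + 1 ⊗ v on generators. It is an
    algebra map into an ordinary super tensor product, hence easy to construct, whereas the braided
    coproduct is multiplicative only for the braided product. *)
Variable D : B -> stens B W.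
Hypothesis DP : @is_galg_map F B (stens B W) D.
Hypothesis DV : forall v, V v ->
  D v = tmap (fun x => x) inl (coact C v) + gone B ⊗ inr v.

Variable eB : B -> F.
Hypotheses (eBP : is_char eB) (eBV : forall v, V v -> eB v = 0).
Hypothesis eBh : forall n v, eB (gpr n.+1 v) = 0.

Definition copl (w : K) : stens W W := tmap inl inl (cop H w).
Definition copr (e : B) : stens W W := tmap inr (fun z => z) (D e).
Hypothesis cross : forall v k, V v -> GK k ->
  smul (copr v) (copl k) = bos_lift (@smul F W W) copl copr (inr v ∙ inl k).

Let eK := shopf_char hH.

Let inll : linear inl. Proof. by case: inlP => -[]. Qed.
Let inrl : linear inr. Proof. by case: inrP => -[]. Qed.
Let inl1 : inl (gone K) = gone W. Proof. by case: inlP. Qed.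
Let inr1 : inr (gone B) = gone W. Proof. by case: inrP. Qed.
Let inlM x y : inl (x ∙ y) = inl x ∙ inl y. Proof. by case: inlP. Qed.
Let inrM x y : inr (x ∙ y) = inr x ∙ inr y. Proof. by case: inrP. Qed.
Let coactl : linear (coact C). Proof. by case: coactP => -[]. Qed.
Let Dl : linear D. Proof. by case: DP => -[]. Qed.
Let copg : @is_glin F K (gtens K K) (cop H). Proof. exact: cop_glin hC. Qed.
Let copHl : linear (cop H). Proof. by case: copg. Qed.
Let eBl : linear (eB : B -> F^o). Proof. by case: eBP. Qed.
Let eKl : linear (cou H : K -> F^o). Proof. by case: eK. Qed.

Let h_gmulKl := @lf_gmull _ K hK.
Let h_gmulKr := @lf_gmulr _ K hK.
Let h_gmulBl := @lf_gmull _ B hB.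
Let h_gmulBr := @lf_gmulr _ B hB.
Let h_gmulWl := @lf_gmull _ W hW.
Let h_gmulWr := @lf_gmulr _ W hW.
Let h_sgK := fun (T : lmodType F) i (f : T -> K) => @lf_sgc _ T K mK i f.
Let h_sgB := fun (T : lmodType F) i (f : T -> B) => @lf_sgc _ T B mB i f.
Let h_sgW := fun (T : lmodType F) i (f : T -> W) => @lf_sgc _ T W mW i f.
Let h_actl := @lf_actl _ K B H C hM.
Let h_actr := @lf_actr _ K B H C hM.
Let h_cop (T : lmodType F) (f : T -> K) (h : linear f) := lf_comp copHl h.
Let h_coact (T : lmodType F) (f : T -> B) (h : linear f) := lf_comp coactl h.
Let h_D (T : lmodType F) (f : T -> B) (h : linear f) := lf_comp Dl h.
Let h_inl (T : lmodType F) (f : T -> K) (h : linear f) := lf_comp inll h.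
Let h_inr (T : lmodType F) (f : T -> B) (h : linear f) := lf_comp inrl h.
Let h_eB (T : lmodType F) (f : T -> B) (h : linear f) := lf_comp eBl h.
Let h_eK (T : lmodType F) (f : T -> K) (h : linear f) := lf_comp eKl h.
Ltac lin_hook ::= first
  [ apply: h_inl | apply: h_inr
  | apply: h_gmulKl | apply: h_gmulKr | apply: h_gmulBl | apply: h_gmulBr
  | apply: h_gmulWl | apply: h_gmulWr
  | apply: h_sgK | apply: h_sgB | apply: h_sgW | apply: h_actl | apply: h_actr
  | apply: h_cop | apply: h_coact | apply: h_D | apply: h_eB | apply: h_eK ].

Lemma tlift_sg (X Y : gmod F) (hX : is_gmod X) (hY : is_gmod Y) (U : lmodType F)
    (f : X -> Y -> U) i (t : tens X Y) : bilin f ->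
  tlift f (@sg _ (gtens X Y) i t) = tlift (fun a b => f (sg i a) (sg i b)) t.
Proof.
move=> fb; have [f1 f2] := fb.
have b : bilin (fun a b => f (sg i a) (sg i b)).
  by split=> ?; [apply: (lf_comp (f1 _))|apply: (lf_comp (f2 _))]; apply: lf_sg.
move: t; apply: tens_ext => [||x y].
- exact: (lf_comp (lf_tlift fb) (lf_sg (gtens_gmod hX hY) i)).
- exact: lf_tlift.
by rewrite sg_tens // !tlift_pure.
Qed.

Lemma smul_1l (X Y : galg F) (hX : is_galg X) (hY : is_galg Y) i (z : Y) (x : X) (y : Y) :
  ph i z -> smul (gone X ⊗ z) (x ⊗ y) = sg i x ⊗ (z ∙ y).
Proof.
move=> zi; have mX := galg_is_gmod hX.
move: x; apply: (ph_ext mX) => [||j x xj].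
- apply: lf_comp ((bilin_smul hX hY).2 _) _; lin.
- by apply: lf_tpl; apply: lf_sg.
by rewrite (smul_ph hX hY _ _ zi xj) (gmul1l hX) (sg_ph mX i xj) tensZl.
Qed.

Lemma smul_1r (X Y : galg F) (hX : is_galg X) (hY : is_galg Y) (z : Y) (x : X) (y : Y) :
  smul (x ⊗ z) (gone X ⊗ y) = x ⊗ (z ∙ y).
Proof. by rewrite (smul_sg hX hY _ _ _ (ph1 hX)) (gmul1r hX) (sg0 (galg_is_gmod hY)). Qed.

(* The injection of the braided tensor square of B into the super tensor product
   of B and W: it is multiplicative and carries the braided coproduct to D. *)
Definition bj (t : tens B B) : stens B W :=
  \sw_(e, e' <- t) \sw_(e0, e1 <- coact C e) (e0 ⊗ (e1 ⊗ e')).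

Let bj_in : bilin (fun e e' : B => \sw_(e0, e1 <- coact C e) (e0 ⊗ (e1 ⊗ e')) : tens B W).
Proof. by split=> ?; lin. Qed.

Lemma lf_bj : linear bj.
Proof. exact: lf_tlift bj_in. Qed.

Lemma bj_pure e e' : bj (e ⊗ e') = \sw_(e0, e1 <- coact C e) (e0 ⊗ (e1 ⊗ e')).
Proof. exact: tlift_pure bj_in _ _. Qed.

Definition coactW (e : B) : stens B W := tmap (fun x => x) inl (coact C e).

Lemma coactWP : @is_galg_map F B (stens B W) coactW.
Proof.
exact: (@galg_map_comp _ B (stens B K) (stens B W) (tmap (fun x => x) inl) (coact C)
  (galg_map_tmap hB hK hB hW (galg_map_id B) inlP) coactP).
Qed.

Let coactWl : linear coactW. Proof. by case: coactWP => -[]. Qed.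

Lemma bj_mul e e' : bj (e ⊗ e') = coactW e ∙ (gone B ⊗ inr e').
Proof.
rewrite bj_pure /coactW /=; have [bl br] := bilin_smul hB hW.
move: (coact C e); apply: tens_ext => [||x y].
- lin.
- exact: (lf_comp (bl _) (lf_tmap (@lf_id _ B) inll)).
rewrite tlift_pure; last by lin.
by rewrite tmap_pure // (smul_1r hB hW) /= -(bos_split hH hB hM).
Qed.

Lemma braidE i (e f : B) : ph i e ->
  braiding C C e f = \sw_(f0, f1 <- coact C f) (sg i f0 ⊗ act C e f1).
Proof.
move=> ei; rewrite /braiding (hlift_ph mB _ ei).
  by rewrite (slift_sgl mB mK); last by lin.
by move=> j; apply: lf_tlift_par => *; apply: lf_sum => ?; apply: lf_sum => ?; lin.
Qed.

Lemma lf_braid f : linear (fun e => braiding C C e f).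
Proof.
apply: lf_hlift => // j.
by apply: lf_tlift_par => *; apply: lf_sum => ?; apply: lf_sum => ?; lin.
Qed.

Lemma lf_braidr e : linear (braiding C C e).
Proof.
apply: lf_sum => i; apply: lf_tlift_arg => //.
apply: (@bilin_slift _ B K mB mK _
  (fun f0 i0 f1 _ => sign (i && i0) *: (f0 ⊗ act C (par i e) f1))) => *; lin.
Qed.

(** The braiding is what the cross relation of W produces when 1 ⊗ e is moved past the coaction of
    f: it turns e f1 into f1 times e acted upon by a further leg, and coassociativity of the
    coaction reassembles the first legs. *)
Lemma bj_braid e f : (gone B ⊗ inr e : stens B W) ∙ coactW f = bj (braiding C C e f).
Proof.
have [bl br] := bilin_smul hB hW.
move: e; apply: (ph_ext mB) => [||i e ei].
- apply: lf_comp (bl _) _; lin.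
- exact: (lf_comp lf_bj (lf_braid f)).
rewrite (braidE _ ei) (lin_tlift _ _ lf_bj).
transitivity (\sw_(f0, f1 <- coact C f) \sw_(a, b <- coact C f0)
    (sg i a ⊗ (sg i b ⊗ act C e f1))); last first.
  apply: eq_tlift => f0 f1; rewrite bj_pure (glin_sg mB mBK _ _ (galg_map_glin coactP)).
  by rewrite (tlift_sg mB mK) //; lin.
rewrite (coassoc_trilin (coactA f)); try by move=> *; lin.
rewrite /coactW /tmap /= (lin_tlift _ _ (br _)); apply: eq_tlift => f0 f1.
rewrite (smul_1l hB hW _ _ (glin_ph (galg_map_glin inrP) ei)) (bos_cross hH hB hM _ ei).
by rewrite (lin_tlift (h := fun x => sg i f0 ⊗ x)) //; lin.
Qed.

Let braided_in (t : tens B B) : bilin (fun u1 u2 : B =>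
  \sw_(v1, v2 <- t) \sw_(w, w' <- braiding C C u2 v1) ((u1 ∙ w) ⊗ (w' ∙ v2))).
Proof.
split=> x; first by lin.
by apply: lf_tlift_par => v1 v2; apply: lf_tlift_arg; [lin | apply: lf_braid].
Qed.

Let braided_in2 u1 u2 : bilin (fun v1 v2 : B =>
  \sw_(w, w' <- braiding C C u2 v1) ((u1 ∙ w) ⊗ (w' ∙ v2))).
Proof. by split=> x; [apply: lf_tlift_arg; [lin | apply: lf_braidr] | lin]. Qed.

Lemma bilin_braided_mul : bilin (@braided_mul F K B C).
Proof.
split=> t; first exact: lf_tlift (braided_in t).
by apply: lf_tlift_par => u1 u2; apply: lf_tlift.
Qed.

(** By [bj_mul] the map [bj] sends u ⊗ v to the coaction of u times 1 ⊗ v. In a product of two such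
    elements the middle factors are exchanged by [bj_braid]. *)
Lemma bj_braided s t : bj (braided_mul C s t) = bj s ∙ bj t.
Proof.
have [bl br] := bilin_smul hB hW; have [ml mr] := bilin_braided_mul.
move: s; apply: tens_ext => [||u1 u2].
- exact: (lf_comp lf_bj (ml t)).
- exact: (lf_comp (bl _) lf_bj).
move: t; apply: tens_ext => [||v1 v2].
- exact: (lf_comp lf_bj (mr _)).
- exact: (lf_comp (br _) lf_bj).
rewrite /braided_mul (tlift_pure (braided_in _)) (tlift_pure (braided_in2 _ _)).
have [[_ _] coW1 coWM] := coactWP.
have inrBM (x y : B) : gone B ⊗ inr (x ∙ y) = (gone B ⊗ inr x : stens B W) ∙ (gone B ⊗ inr y).
  by rewrite /= (smul_1r hB hW) inrM.
have key (s : tens B B) : bj (\sw_(w, w' <- s) (u1 ∙ w) ⊗ (w' ∙ v2)) =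
    coactW u1 ∙ (bj s ∙ (gone B ⊗ inr v2)).
  rewrite (lin_tlift _ _ lf_bj); move: s; apply: tens_ext => [||w w'].
  - apply: lf_tlift; split=> ?; apply: (lf_comp lf_bj); lin.
  - exact: (lf_comp (br _) (lf_comp (bl _) lf_bj)).
  rewrite tlift_pure; last by split=> ?; apply: (lf_comp lf_bj); lin.
  by rewrite !bj_mul coWM inrBM !(gmulA hBW).
by rewrite key -bj_braid !bj_mul !(gmulA hBW).
Qed.

(** * Projections of the bosonisation and the braided coproduct *)

Definition pB (z : W) : B := \sw_(w, e <- z) cou H w *: e.
Definition pK (z : W) : K := \sw_(w, e <- z) eB e *: w.

Lemma lf_pB : linear pB. Proof. by apply: lf_tlift; lin. Qed.
Lemma lf_pK : linear pK. Proof. by apply: lf_tlift; lin. Qed.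
Lemma pB_pure w e : pB (w ⊗ e) = cou H w *: e. Proof. by rewrite /pB tlift_pure //; lin. Qed.
Lemma pK_pure w e : pK (w ⊗ e) = eB e *: w. Proof. by rewrite /pK tlift_pure //; lin. Qed.
Lemma pB_inr e : pB (inr e) = e.
Proof. by rewrite pB_pure (shopf_cou1 hH) scale1r. Qed.
(** [pB] is in general not multiplicative; this linearity over the counit, together with [pB_cross],
    takes the place of multiplicativity. *)
Lemma pB_inl_mul w z : pB (inl w ∙ z) = cou H w *: pB z.
Proof.
move: z; apply: tens_ext => [||k e].
- exact: (lf_comp lf_pB (gmul_linearr hW _)).
- by apply: lf_scale; apply: lf_pB.
by rewrite /= /bos_inl (bosm_inl_pure hH hB hM) !pB_pure (shopf_couM hH) scalerA.
Qed.

Definition bcop (e : B) : tens B B := tmap (fun x => x) pB (D e).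

(** The counit applied to the K leg undoes the coaction; hence [bj] is injective and identities of
    braided tensors may be tested in B ⊗ W. *)
Lemma bj_ret t : tmap (fun x => x) pB (bj t) = t.
Proof.
have rl := lf_tmap (@lf_id _ B) lf_pB.
move: t; apply: tens_ext => [||e e'].
- exact: (lf_comp rl lf_bj).
- exact: lf_id.
rewrite bj_pure (lin_tlift _ _ rl) -[in RHS](coact_cou e).
rewrite (lin_tlift (h := fun x => x ⊗ e')); last by lin.
apply: eq_tlift => e0 e1; rewrite tmap_pure ?pB_pure //; last exact: lf_pB.
by rewrite tensZr tensZl.
Qed.

Lemma bj_prim v : bj (v ⊗ gone B + gone B ⊗ v) = coactW v + gone B ⊗ inr v.
Proof.
rewrite (linD lf_bj); congr (_ + _); first by rewrite bj_pure.
rewrite bj_pure; have [_ -> _] := coactP.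
by rewrite tlift_pure //; lin.
Qed.

(** [D] takes values in the image of [bj]: this holds on V by [DV], and the image is closed under
    products by [bj_braided]. The retraction then identifies the preimage with [bcop e]. *)
Lemma bcop_j e : D e = bj (bcop e).
Proof.
suff [t Dt] : exists t, D e = bj t by rewrite /bcop Dt bj_ret.
have [_ D1 DM] := DP; have [_ co1 _] := coactP.
move: e; apply: gB.
- exists (gone B ⊗ gone B); rewrite D1 bj_pure co1 tlift_pure //; lin.
- by move=> c x [t xt]; exists (c *: t); rewrite (linZ Dl) xt (linZ lf_bj).
- by move=> x y [s xs] [t yt]; exists (s + t); rewrite (linD Dl) xs yt (linD lf_bj).
- by move=> x y [s xs] [t yt]; exists (braided_mul C s t); rewrite DM xs yt bj_braided.
- by move=> v vV; exists (v ⊗ gone B + gone B ⊗ v); rewrite bj_prim DV.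
Qed.

Lemma bj_inj s t : bj s = bj t -> s = t.
Proof. by move=> st; rewrite -(bj_ret s) st bj_ret. Qed.

Lemma bcopM u v : bcop (u ∙ v) = braided_mul C (bcop u) (bcop v).
Proof. by apply: bj_inj; rewrite bj_braided -!bcop_j; case: DP. Qed.

Lemma bcop1 : bcop (gone B) = gone B ⊗ gone B.
Proof.
rewrite /bcop; have [_ -> _] := DP.
by rewrite /= tmap_pure ?pB_inr //; apply: lf_pB.
Qed.

Lemma bcopV v : V v -> bcop v = v ⊗ gone B + gone B ⊗ v.
Proof. by move=> vV; apply: bj_inj; rewrite -bcop_j bj_prim DV. Qed.

Lemma lf_bcop : linear bcop.
Proof. exact: (lf_comp (lf_tmap (@lf_id _ B) lf_pB) Dl). Qed.

Variable SB : B -> B.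
Definition bHB : hopf_ops B := HopfOps bcop eB SB.

(** * The bosonisation as a bialgebra *)

Lemma coplP : @is_galg_map F K (stens W W) copl.
Proof.
exact: (@galg_map_comp _ K (stens K K) (stens W W) (tmap inl inl) (cop H)
  (galg_map_tmap hK hK hW hW inlP inlP) (shopf_cop hH)).
Qed.

Lemma coprP : @is_galg_map F B (stens W W) copr.
Proof.
exact: (@galg_map_comp _ B (stens B W) (stens W W) (tmap inr (fun z => z)) D
  (galg_map_tmap hB hW hW hW inrP (galg_map_id W)) DP).
Qed.

Let coplA := galg_map_alg coplP.
Let coprA := galg_map_alg coprP.

Let bcop_in1 (e1 : B) (e2 : B) (w1 w2 : K) (i : bool) (j j' : bool) :
  bilin (fun e10 e11 => sign (i && j) *: (((w1 ⊗ e10) : W) ⊗ (((w2 ∙ e11) ⊗ e2) : W))).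
Proof. by lin. Qed.

Definition cW (z : W) : stens W W := bos_cop H C bHB z.

(** After writing D e as [bj] of the braided coproduct, the explicit formula for the coproduct of w
    ⊗ e is the product of the coproducts of w and of e in W ⊗ W, hence the map given by the
    universal property. *)
Lemma bos_copE (t : W) : cW t = bos_lift (@smul F W W) copl copr t.
Proof.
have [bl br] := bilin_smul hW hW.
apply: eq_tlift => w e /=.
rewrite /copr bcop_j /copl.
have trl : linear (tmap inr (fun z : W => z)) by apply: lf_tmap.
have tll : linear (tmap inl inl) by apply: lf_tmap.
move: (cop H w); apply: (tens_phext mK mK) => [||i' i w1 w2 w1P w2P].
- apply: (lf_slift mK mK) => i j; split=> ?;
  apply: lf_tlift_par => ? ?; apply: lf_tlift_par => ? ?;
  apply: lf_sum => ?; apply: lf_sum => ?; lin.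
- exact: (lf_comp (bl _) tll).
rewrite (slift_ph mK mK _ w1P w2P); last first.
  move=> i1 j1; split=> ?;
  apply: lf_tlift_par => ? ?; apply: lf_tlift_par => ? ?;
  apply: lf_sum => ?; apply: lf_sum => ?; lin.
rewrite tmap_pure // /bj (lin_tlift _ _ trl) (lin_tlift _ _ (br _)).
apply: eq_tlift => e1 e2; rewrite (lin_tlift _ _ trl) (lin_tlift _ _ (br _)).
move: (coact C e1); apply: (tens_phext mB mK) => [||j j' e10 e11 e10P e11P].
- by apply: (lf_slift mB mK) => *; lin.
- apply: lf_tlift; split=> ?; apply: (lf_comp (br _)); apply: (lf_comp trl); lin.
rewrite (slift_ph mB mK _ e10P e11P); last by move=> *; lin.
rewrite tlift_pure; last by split=> ?; apply: (lf_comp (br _)); apply: (lf_comp trl); lin.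
rewrite tmap_pure //.
rewrite (smul_ph hW hW _ _ (glin_ph (galg_map_glin inlP) w2P) (glin_ph (galg_map_glin inrP) e10P)).
by rewrite /= -(bos_split hH hB hM) /bos_inl (bosm_inl_pure hH hB hM).
Qed.

Lemma bos_copP : @is_galg_map F W (stens W W) cW.
Proof.
have [fl f1 fM] := bos_lift_alg hH hB hM (galg_alg hWW) coplA coprA gK gB Vact cross Vpar.
have Cl : linear cW by move=> a x y; rewrite !bos_copE fl.
split; last 2 first.
- by rewrite bos_copE f1.
- by move=> x y; rewrite !bos_copE fM.
split=> // n; apply: (tens_homext mK mB) => [||i j w e wi ej].
- by apply: (lf_comp Cl); apply: (lf_gpr mW).
- by apply: (lf_comp _ Cl); apply: (lf_gpr mWW).
rewrite /= (tpr_homog mK mB _ wi ej) !bos_copE.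
have wh := glin_homog (galg_map_glin coplP) wi.
have eh := glin_homog (galg_map_glin coprP) ej.
have [_ br] := bilin_smul hW hW.
have h := gmul_homog hWW wh eh.
have E : @bos_lift F K B H C _ (@smul F W W) copl copr (w ⊗ e) = copl w ∙ copr e.
  by have := bos_lift_pure H C (galg_alg hWW) coplA coprA w e.
rewrite E; transitivity (@gpr _ (stens W W) n (copl w ∙ copr e)); last by [].
rewrite (homog_gpr mWW _ h); case: eqP => // _.
exact: (lin0 fl).
Qed.

Let cWl : linear cW. Proof. by case: bos_copP => -[]. Qed.
Let cWM (x y : W) : cW (x ∙ y) = cW x ∙ cW y. Proof. by case: bos_copP. Qed.
Let coprl : linear copr. Proof. by case: coprP => -[]. Qed.
Let copll : linear copl. Proof. by case: coplP => -[]. Qed.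
Let idB := @lf_id F B.
Let idK := @lf_id F K.
Let idW := @lf_id F W.

Lemma bcop_inl k : cW (inl k) = copl k.
Proof. by rewrite bos_copE (bos_lift_inl _ _ (galg_alg hWW) coplA coprA). Qed.

Lemma bcop_inr e : cW (inr e) = copr e.
Proof. by rewrite bos_copE (bos_lift_inr _ _ (galg_alg hWW) coplA coprA). Qed.

Lemma coprV v : V v -> copr v = tmap inr inl (coact C v) + gone W ⊗ inr v.
Proof.
move=> vV; rewrite /copr DV // (linD (lf_tmap inrl idW)) tmap_comp //.
by rewrite tmap_pure // inr1.
Qed.

Lemma bos_copA (z : W) : tmap cW (fun y => y) (cW z) = tassoc (tmap (fun y => y) cW (cW z)).
Proof.
have hL : @is_galg_map F W (stens (stens W W) W) (fun z => tmap cW (fun y => y) (cW z)).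
  exact: (@galg_map_comp _ W (stens W W) (stens (stens W W) W) _ _
    (galg_map_tmap hW hW hWW hW bos_copP (galg_map_id W)) bos_copP).
have hR : @is_galg_map F W (stens (stens W W) W)
    (fun z => tassoc (tmap (fun y => y) cW (cW z))).
  apply: (@galg_map_comp _ W (stens W (stens W W)) (stens (stens W W) W) _ _
    (galg_map_tassoc hW hW hW)).
  exact: (@galg_map_comp _ W (stens W W) (stens W (stens W W)) _ _
    (galg_map_tmap hW hW hW hWW (galg_map_id W) bos_copP) bos_copP).
move: z; apply: (generated_eq (bos_generated hH hB hM gK gB)
  (galg_map_alg hL) (galg_map_alg hR)) => _ [[k _ ->]|[v vV ->]].
- rewrite bcop_inl /copl !tmap_comp //.
  have -> : tmap (fun v => cW (inl v)) (fun w => inl w) (cop H k) =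
      tmap (tmap inl inl) inl (tmap (cop H) (fun x => x) (cop H k)).
    by rewrite tmap_comp //; [apply: eq_tmap => // x; apply: bcop_inl | apply: lf_tmap].
  have -> : tmap (fun v => inl v) (fun w => cW (inl w)) (cop H k) =
      tmap inl (tmap inl inl) (tmap (fun x => x) (cop H) (cop H k)).
    by rewrite tmap_comp //; [apply: eq_tmap => // x; apply: bcop_inl | apply: lf_tmap].
  rewrite tassoc_tmap //; congr (tmap _ _ _).
  by rewrite {1}/tmap (copA hC) tassocE.
rewrite bcop_inr coprV //.
have l1 : linear (tmap cW (fun y : W => y)) by apply: lf_tmap.
have l2 := lf_comp (@lf_tassoc F W W W) (lf_tmap idW cWl).
rewrite (linD l1) (linD l2) !tmap_pure // bcop_inr coprV //.
rewrite tensDr (linD (@lf_tassoc F W W W)) tassoc_pure.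
have [_ -> _] := bos_copP; rewrite addrA; congr (_ + _).
rewrite !tmap_comp //.
have -> : tmap (fun w => inr w) (fun w => cW (inl w)) (coact C v) =
    tmap inr (tmap inl inl) (tmap (fun x => x) (cop H) (coact C v)).
  by rewrite tmap_comp //; [apply: eq_tmap => // x; apply: bcop_inl | apply: lf_tmap].
rewrite tassoc_tmap // -tassocE // -coactA.
have -> : (\sw_(v0, v1 <- coact C v) coact C v0 ⊗ v1) = tmap (coact C) (fun x => x) (coact C v) by [].
rewrite tmap_comp //; last by apply: lf_tmap.
have tl1 : linear (fun t : tens B K => tassoc (gone W ⊗ tmap inr inl t)).
  apply: (lf_comp (@lf_tassoc F W W W)); apply: lf_tpr; exact: lf_tmap.
have tl2 : linear (tmap (fun w => cW (inr w)) inl).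
  by apply: lf_tmap => //; apply: (lf_comp cWl).
have tl3 : linear (tmap (fun x => tmap inr inl (coact C x)) inl).
  by apply: lf_tmap => //; apply: (lf_comp (lf_tmap inrl inll)).
(* The coaction of v has its first legs in V, so the formula [coprV] for the coproduct of a
   generator applies to them again. *)
elim: (Vcoact vV) => [u w uV||s t _ IHs _ IHt].
- rewrite (tmap_pure (lf_comp cWl inrl) inll) (tmap_pure (lf_comp (lf_tmap inrl inll) coactl) inll).
  by rewrite (tmap_pure inrl inll) bcop_inr coprV // tensDl tassoc_pure.
- by rewrite (lin0 tl1) (lin0 tl2) (lin0 tl3) addr0.
- by rewrite (linD tl1) (linD tl2) (linD tl3) IHs IHt addrACA.
Qed.

Definition eW : W -> F := bos_cou H bHB.

Let eKA : @alg_map F K F^o *%R 1 (cou H).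
Proof. by case: eK => *; split. Qed.
Let eBA : @alg_map F B F^o *%R 1 eB.
Proof. by case: eBP => *; split. Qed.

Lemma eW_pure w e : eW (w ⊗ e) = cou H w * eB e.
Proof. exact: (bos_lift_pure H C (field_alg F) eKA eBA). Qed.

Lemma eW_inl w : eW (inl w) = cou H w.
Proof. exact: (bos_lift_inl H C (field_alg F) eKA eBA). Qed.

Lemma eW_inr e : eW (inr e) = eB e.
Proof. exact: (bos_lift_inr H C (field_alg F) eKA eBA). Qed.

Lemma eWP : is_char eW.
Proof.
have [l1 e1 eM] : alg_map (U := F^o) *%R 1 eW.
  apply: (bos_lift_alg hH hB hM (field_alg F) eKA eBA gK gB Vact _ Vpar) => v k vV _.
  rewrite eBV // mul0r; elim: (crossV hH hB hM Vact Vpar k vV) => [w u uV||s t _ IHs _ IHt].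
  - by rewrite (bos_lift_pure H C (field_alg F) eKA eBA) eBV // mulr0.
  - by rewrite (lin0 (lf_bos_lift (field_alg F) eKA eBA)).
  - by rewrite (linD (lf_bos_lift (field_alg F) eKA eBA)) -IHs -IHt addr0.
apply: (charI hW) => // n.
apply: (@tens_ext F F^o K B (fun v => eW (gpr n.+1 (v : W))) (fun=> 0)) => [||w e].
- exact: (lf_comp l1 (lf_gpr mW n.+1)).
- exact: (@lf_zero _ _ F^o).
rewrite /= (tpr_pure mK mB) (lin_sum l1) big1 // => -[[|k] kn] _ /=.
  by rewrite eW_pure subn0 eBh mulr0.
by rewrite eW_pure (cou_homog hC) mul0r.
Qed.

Let eWl : linear (eW : W -> F^o). Proof. by case: eWP. Qed.
Let eW1 : eW (gone W) = 1. Proof. by case: eWP. Qed.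

Lemma Vtens_eB v : V v -> \sw_(v0, v1 <- coact C v) (eB v0 *: v1) = 0.
Proof.
have tl : linear (tlift (fun (v0 : B) (v1 : K) => eB v0 *: v1)) by apply: lf_tlift; lin.
move=> vV; elim: (Vcoact vV) => [u w uV||s t _ IHs _ IHt].
- by rewrite tlift_pure ?eBV ?scale0r //; lin.
- by rewrite (lin0 tl).
- by rewrite (linD tl) IHs IHt addr0.
Qed.

Lemma bos_coul (z : W) : \sw_(z1, z2 <- cW z) (eW z1 *: z2) = z.
Proof.
have b : bilin (fun z1 z2 : W => eW z1 *: z2) by lin.
move: z; apply: (generated_eq (bos_generated hH hB hM gK gB)
  (alg_map_comp (charl_alg hW hW eWP) bos_copP) (galg_map_alg (galg_map_id W))).
move=> _ [[k _ ->]|[v vV ->]].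
- rewrite bcop_inl /copl tlift_tmap // -[in RHS](coul hC k) (lin_tlift _ _ inll).
  by apply: eq_tlift => x y; rewrite eW_inl (linZ inll).
- rewrite bcop_inr coprV // (linD (lf_tlift b)) tlift_tmap // tlift_pure // eW1 scale1r.
  rewrite -[RHS]add0r; congr (_ + _).
  rewrite -[RHS](lin0 inll) -(Vtens_eB vV) (lin_tlift _ _ inll).
  by apply: eq_tlift => x y; rewrite eW_inr (linZ inll).
Qed.

Lemma bos_cour (z : W) : \sw_(z1, z2 <- cW z) (eW z2 *: z1) = z.
Proof.
have b : bilin (fun z1 z2 : W => eW z2 *: z1) by lin.
move: z; apply: (generated_eq (bos_generated hH hB hM gK gB)
  (alg_map_comp (charr_alg hW hW eWP) bos_copP) (galg_map_alg (galg_map_id W))).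
move=> _ [[k _ ->]|[v vV ->]].
- rewrite bcop_inl /copl tlift_tmap // -[in RHS](cour hC k) (lin_tlift _ _ inll).
  by apply: eq_tlift => x y; rewrite eW_inl (linZ inll).
- rewrite bcop_inr coprV // (linD (lf_tlift b)) tlift_tmap // tlift_pure // eW_inr eBV // scale0r addr0.
  rewrite -[in RHS](coact_cou v) (lin_tlift _ _ inrl).
  by apply: eq_tlift => x y; rewrite eW_inl (linZ inrl).
Qed.

(** The counit axiom of W at the element e of B, whose coproduct is D e with its first leg included
    into W. *)
Lemma D_coul e : \sw_(b, z <- D e) (eB b *: z) = inr e.
Proof.
have b : bilin (fun z1 z2 : W => eW z1 *: z2) by lin.
rewrite -[RHS]bos_coul bcop_inr /copr tlift_tmap //.
by apply: eq_tlift => x y; rewrite eW_inr.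
Qed.

Lemma D_cour e : \sw_(b, z <- D e) (eW z *: b) = e.
Proof.
have b : bilin (fun z1 z2 : W => eW z2 *: z1) by lin.
rewrite -[RHS]pB_inr -[X in _ = pB X]bos_cour bcop_inr /copr tlift_tmap //.
rewrite (lin_tlift _ _ lf_pB).
by apply: eq_tlift => x y; rewrite (linZ lf_pB) pB_inr.
Qed.

Lemma eB_pB z : eB (pB z) = eW z.
Proof.
move: z; apply: (@tens_ext F F^o K B (fun z => eB (pB z)) eW) => [||w e].
- exact: (lf_comp eBl lf_pB).
- exact: eWl.
by rewrite pB_pure eW_pure (linZ eBl).
Qed.

Lemma bcop_coul e : \sw_(e1, e2 <- bcop e) (eB e1 *: e2) = e.
Proof.
rewrite /bcop tlift_tmap ?lf_pB //; try exact: lf_pB; last by lin.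
rewrite -[RHS]pB_inr -D_coul (lin_tlift _ _ lf_pB).
by apply: eq_tlift => x y; rewrite (linZ lf_pB).
Qed.

Lemma bcop_cour e : \sw_(e1, e2 <- bcop e) (eB e2 *: e1) = e.
Proof.
rewrite /bcop tlift_tmap //; [|exact: lf_pB|lin].
rewrite -[RHS]D_cour.
by apply: eq_tlift => x y; rewrite eB_pB.
Qed.

Lemma glin_pB : is_glin pB.
Proof.
split=> [|n]; first exact: lf_pB.
apply: (tens_homext mK mB) => [||i j w e wi ej].
- exact: (lf_comp lf_pB (lf_gpr mW n)).
- exact: (lf_comp (lf_gpr mB n) lf_pB).
rewrite /= (tpr_homog mK mB _ wi ej) pB_pure (linZ (lf_gpr mB n)) (homog_gpr mB _ ej).
case: i wi => [|i] wi; first by rewrite add0n; case: eqP => _; rewrite ?pB_pure ?(lin0 lf_pB) ?scaler0.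
rewrite -[w in RHS]wi (cou_homog hC) scale0r.
by case: eqP => _; rewrite ?(lin0 lf_pB) // pB_pure -wi (cou_homog hC) scale0r.
Qed.

Lemma glin_pK : is_glin pK.
Proof.
split=> [|n]; first exact: lf_pK.
apply: (tens_homext mK mB) => [||i j w e wi ej].
- exact: (lf_comp lf_pK (lf_gpr mW n)).
- exact: (lf_comp (lf_gpr mK n) lf_pK).
rewrite /= (tpr_homog mK mB _ wi ej) pK_pure (linZ (lf_gpr mK n)) (homog_gpr mK _ wi).
case: j ej => [|j] ej; first by rewrite addn0; case: eqP => _; rewrite ?pK_pure ?(lin0 lf_pK) ?scaler0.
rewrite -[e in RHS]ej eBh scale0r.
by case: eqP => _; rewrite ?(lin0 lf_pK) // pK_pure -ej eBh scale0r.
Qed.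

Lemma pK_inl w : pK (inl w) = w.
Proof. by rewrite pK_pure (char_one eBP) scale1r. Qed.

(** This is the algebra map out of W induced by the identity of K and the counit of B. Both sides of
    the cross relations are sent to 0, because V is stable under the action and killed by the
    counit. *)
Lemma pKP : is_galg_map pK.
Proof.
pose g (e : B) : K := eB e *: gone K.
have gA : alg_map (@gmul F K) (gone K) g.
  split; first by rewrite /g; lin.
    by rewrite /g (char_one eBP) scale1r.
  by move=> x y; rewrite /g (char_mul eBP) (gmulZl hK) (gmulZr hK) (gmul1l hK) scalerA.
have iA := galg_map_alg (galg_map_id K).
have E z : pK z = bos_lift (@gmul F K) (fun x : K => x) g z.
  by apply: eq_tlift => w e; rewrite (gmulZr hK) (gmul1r hK).
have [l e1 eM] : alg_map (@gmul F K) (gone K) (bos_lift (H := H) (C := C) (@gmul F K) (fun x : K => x) g).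
  apply: (bos_lift_alg hH hB hM (galg_alg hK) iA gA gK gB Vact _ Vpar) => v k vV _.
  rewrite /g eBV // scale0r (gmul0l hK).
  elim: (crossV hH hB hM Vact Vpar k vV) => [w u uV||s t _ IHs _ IHt].
  - by rewrite (bos_lift_pure H C (galg_alg hK) iA gA) /g eBV // scale0r (gmul0r hK).
  - by rewrite (lin0 (lf_bos_lift (galg_alg hK) iA gA)).
  - by rewrite (linD (lf_bos_lift (galg_alg hK) iA gA)) -IHs -IHt addr0.
split; first exact: glin_pK.
  by rewrite E e1.
by move=> x y; rewrite !E eM.
Qed.

(** Both sides are algebra maps, and on V the extra term 1 ⊗ v of D is killed by the counit. The
    K-coaction is thus recovered from D. *)
Lemma D_coact e : tmap (fun x => x) pK (D e) = coact C e.
Proof.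
have hL : @is_galg_map F B (stens B K) (fun e => tmap (fun x => x) pK (D e)).
  exact: (@galg_map_comp _ B (stens B W) (stens B K) _ _
    (galg_map_tmap hB hW hB hK (galg_map_id B) pKP) DP).
move: e; apply: (generated_eq gB (galg_map_alg hL) (galg_map_alg coactP)) => v vV.
rewrite DV // (linD (lf_tmap idB lf_pK)) tmap_comp //; last exact: lf_pK.
rewrite tmap_pure //; last exact: lf_pK.
rewrite pK_pure eBV // scale0r tens0r addr0 -[RHS]tmap_id.
by apply: eq_tmap => // w; rewrite pK_inl.
Qed.

Let bsWW := bilin_smul hW hW.
Let pBl := lf_pB.
Let pKl := lf_pK.
Let pBBl := lf_tmap pBl pBl.

Lemma pB_copl_mul w (t : stens W W) : tmap pB pB (copl w ∙ t) = cou H w *: tmap pB pB t.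
Proof.
have [bl br] := bsWW.
move: t; apply: (tens_phext mW mW) => [||j j' z1 z2 z1P z2P].
- exact: (lf_comp pBBl (br _)).
- exact: lf_scale.
have -> : cou H w = \sw_(w1, w2 <- cop H w) (cou H w1 * cou H w2 : F^o).
  rewrite -[in LHS](coul hC w) (lin_tlift _ _ eKl).
  by apply: eq_bigr => p _; rewrite (linZ eKl).
have bmul : bilin (fun w1 w2 => cou H w1 * cou H w2 : F^o).
  by split=> ?; [apply: (lf_comp (alg_mull (field_alg F) _)) | apply: (lf_comp (alg_mulr (field_alg F) _))].
rewrite /copl; move: (cop H w); apply: (tens_phext mK mK) => [||i' i w1 w2 w1P w2P].
- exact: (lf_comp pBBl (lf_comp (bl _) (lf_tmap inll inll))).
- by apply: lf_scalel; apply: lf_tlift.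
rewrite (tmap_pure inll inll) /= tlift_pure //.
rewrite (smul_ph hW hW _ _ (glin_ph (galg_map_glin inlP) w2P) z1P) (linZ pBBl).
rewrite !(tmap_pure pBl pBl) !pB_inl_mul tensZl tensZr !scalerA.
by rewrite mulrCA (char_sign _ eK w2P).
Qed.

Lemma pBB_copr e : tmap pB pB (copr e) = bcop e.
Proof. by rewrite /copr tmap_comp //; apply: eq_tmap => // x; apply: pB_inr. Qed.

Lemma cW_pure w e : cW (w ⊗ e) = copl w ∙ copr e.
Proof. by rewrite bos_copE (bos_lift_pure H C (galg_alg hWW) coplA coprA). Qed.

(** Compatibility of the projection with the coproducts, by which coassociativity descends from W to
    the braided coproduct. *)
Lemma pBB_cW z : tmap pB pB (cW z) = bcop (pB z).
Proof.
move: z; apply: tens_ext => [||w e].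
- exact: (lf_comp pBBl cWl).
- exact: (lf_comp lf_bcop pBl).
by rewrite cW_pure pB_copl_mul pBB_copr pB_pure (linZ lf_bcop).
Qed.

(** Coassociativity of W at an element of B, with the first leg projected back to B. *)
Lemma D_coassoc e : tmap D (fun z => z) (D e) = tassoc (tmap (fun b => b) cW (D e)).
Proof.
have := congr1 (tmap (tmap pB (fun z : W => z)) (fun z : W => z)) (bos_copA (inr e)).
have pl : linear (tmap pB (fun z : W => z)) by apply: lf_tmap.
have ql : linear (tmap inr (fun z : W => z)) by apply: lf_tmap.
rewrite bcop_inr {1}/copr (tmap_comp (f := inr) (f' := cW)) // tmap_comp //; last exact: (lf_comp cWl).
rewrite (eq_tmap (f' := D) (g' := fun w => w)) //; last first.
  move=> b; rewrite bcop_inr /copr tmap_comp // -[RHS]tmap_id.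
  by apply: eq_tmap => // x; apply: pB_inr.
move=> ->; rewrite /copr (tmap_comp (f := inr)) //.
have -> : tmap (fun v => inr v) (fun w => cW w) (D e) =
    tmap inr (tmap (fun w => w) (fun w => w)) (tmap (fun b => b) cW (D e)).
  rewrite tmap_comp //; last exact: lf_tmap.
  by apply: eq_tmap => // w; rewrite tmap_id.
rewrite tassoc_tmap // tmap_comp // -[RHS]tmap_id.
apply: eq_tmap => // t; rewrite tmap_comp // -[RHS]tmap_id.
by apply: eq_tmap => // x; apply: pB_inr.
Qed.

Lemma bcopA e : tmap bcop (fun b => b) (bcop e) = tassoc (tmap (fun b => b) bcop (bcop e)).
Proof.
have rl := lf_tmap idB pBl.
rewrite {2 4}/bcop tmap_comp //; last exact: lf_bcop.
rewrite (tmap_comp idB pBl idB lf_bcop).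
have -> : tmap (fun v => bcop v) (fun w => pB w) (D e) =
    tmap (tmap (fun b => b) pB) pB (tmap D (fun z => z) (D e)).
  by rewrite tmap_comp.
rewrite D_coassoc -tassoc_tmap //; congr tassoc.
rewrite tmap_comp //.
by apply: eq_tmap => // z; rewrite pBB_cW.
Qed.

(** The action is read off from the product of W, so its compatibilities with coproduct, counit and
    coaction become consequences of multiplicativity in W. *)
Lemma pB_cross e k : pB (inr e ∙ inl k) = act C e k.
Proof.
have [bl br] := bilin_bosm hH hB hM.
move: e; apply: (ph_ext mB) => [||i e ei].
- exact: (lf_comp pBl (lf_comp (bl _) inrl)).
- exact: modalg_l hM _.
rewrite (bos_cross hH hB hM _ ei) (lin_tlift _ _ pBl) -[k in RHS](coul hC).
rewrite (lin_tlift _ _ (modalg_r hM e)); apply: eq_tlift => x y.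
by rewrite pB_pure (char_sg hK _ _ eK) (linZ (modalg_r hM e)).
Qed.

Lemma cW_cross e k : cW (inr e ∙ inl k) = copr e ∙ copl k.
Proof. by rewrite cWM bcop_inr bcop_inl. Qed.

Let acttens_in k : forall i r : bool, bilin (fun v w : B => \sw_(k1 of i, k2 of _ <- cop H k)
       sign (r && i) *: (act C v k1 ⊗ act C w k2)).
Proof.
move=> i r; split=> x; apply: lf_tlift_par => ? ?; apply: lf_sum => ?; apply: lf_sum => ?; lin.
Qed.

Lemma acttens_pure r v w k : ph r w -> act (cmod_tens H C C) (v ⊗ w) k =
  \sw_(k1, k2 <- cop H k) (act C v (sg r k1) ⊗ act C w k2).
Proof.
move=> wr /=; move: v; apply: (ph_ext mB) => [||i v vi].
- apply: lf_comp (lf_slift mB mB (acttens_in k)) _; lin.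
- by lin.
rewrite (slift_ph mB mB (acttens_in k) vi wr) (slift_sgl mK mK) //; lin.
Qed.

Lemma lf_acttensl k : linear (fun t => act (cmod_tens H C C) t k).
Proof. exact: (lf_slift mB mB (acttens_in k)). Qed.

(** Project both legs of the coproduct of e k to B. By [pBB_cW] this is the braided coproduct of e
    acted upon by k; multiplicativity of the coproduct of W and [pB_cross] on each leg give the
    diagonal action. *)
Lemma bcop_act e k : bcop (act C e k) = act (cmod_tens H C C) (bcop e) k.
Proof.
rewrite -pB_cross -pBB_cW cW_cross {1}/copr bcop_j.
have [bl br] := bsWW.
have trl := lf_tmap inrl idW.
have Ll x : linear (fun t => tmap pB pB (smul t x)) by exact: (lf_comp pBBl (bl _)).
move: (bcop e); apply: (tens_phext mB mB) => [||i j e1 e2 e1P e2P].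
- exact: (lf_comp (Ll _) (lf_comp trl lf_bj)).
- exact: lf_acttensl.
rewrite (acttens_pure _ _ e2P) bj_pure -[e1 in RHS]coact_cou.
have E0 : bilin (fun (e0 : B) (e3 : K) => e0 ⊗ (e3 ⊗ e2) : tens B W) by lin.
move: (coact C e1); apply: (tens_phext mB mK) => [||p r u m uP mP].
- exact: (lf_comp (Ll _) (lf_comp trl (lf_tlift E0))).
- by apply: lf_tlift_par => a b; lin.
rewrite !tlift_pure //; last by lin.
rewrite (tmap_pure inrl idW) /copl; move: (cop H k).
apply: (tens_phext mK mK) => [||a a' k1 k2 k1P k2P].
- exact: (lf_comp pBBl (lf_comp (br _) (lf_tmap inll inll))).
- by apply: lf_tlift; lin.
rewrite (tmap_pure inll inll) tlift_pure; last by lin.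
have zP : @ph _ W (r (+) j) (m ⊗ e2) by apply: ph_tens.
rewrite /= (smul_ph hW hW _ _ zP (glin_ph (galg_map_glin inlP) k1P)) (linZ pBBl).
rewrite (tmap_pure pBl pBl) -/(inr _) pB_cross.
have -> : (m ⊗ e2 : W) ∙ inl k2 = inl m ∙ (inr e2 ∙ inl k2).
  by rewrite (bos_pureE hH hB hM) (gmulA hW).
rewrite pB_inl_mul pB_cross (sg_ph mK j k1P) (linZ (modalg_r hM _)).
rewrite (linZ (modalg_l hM _)) !tensZl tensZr !scalerA; congr (_ *: _).
by clear zP; case: r mP => mP; [rewrite (char_odd eK mP) !mulr0 | rewrite addFb].
Qed.

Let idWK := galg_map_tmap hW hW hW hK (galg_map_id W) pKP.
Let hWK := stens_galg hW hK.

Lemma pBK_mul (x y : stens W W) : tmap pB pK (x ∙ y) =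
  tmap pB (fun k => k) (smul (tmap (fun z => z) pK x) (tmap (fun z => z) pK y)).
Proof.
have [_ _ M] := idWK; rewrite -[smul _ _]M tmap_comp //.
Qed.

Lemma pK_copl w : tmap (fun z => z) pK (copl w) = tmap inl (fun k => k) (cop H w).
Proof. by rewrite /copl tmap_comp //; apply: eq_tmap => // k; apply: pK_inl. Qed.

Lemma pK_copr e : tmap (fun z => z) pK (copr e) = tmap inr (fun k => k) (coact C e).
Proof. by rewrite /copr tmap_comp // -D_coact tmap_comp. Qed.

Lemma pBK_cW i w e : ph i w -> tmap pB pK (cW (w ⊗ e)) =
  \sw_(e0, e1 <- coact C e) (sg i e0 ⊗ (w ∙ e1)).
Proof.
move=> wi; rewrite cW_pure pBK_mul pK_copl pK_copr.
have [bl br] := bilin_smul hW hK.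
have pl := lf_tmap pBl idK.
move: (coact C e); apply: (tens_phext mB mK) => [||p r e0 e1 e0P e1P].
- exact: (lf_comp pl (lf_comp (br _) (lf_tmap inrl idK))).
- by apply: lf_tlift; lin.
rewrite (tmap_pure inrl idK) tlift_pure; last by lin.
rewrite (sg_ph mB i e0P) tensZl -tensZr andbC -(gmulZl hK) -(sg_ph mK p wi).
rewrite -[w in RHS](coul hC) (lin_tlift _ _ (lf_sg mK p)) (lin_tlift _ _ (gmul_linearl hK e1)).
rewrite (lin_tlift (h := fun x => e0 ⊗ x)); last by lin.
have -> : tmap inl (fun k => k) (cop H w) = tlift (fun a b => inl a ⊗ b) (cop H w) by [].
rewrite (lin_tlift _ _ (bl _)) (lin_tlift _ _ pl); apply: eq_tlift => a b.
rewrite (smul_sg hW hK _ _ _ (glin_ph (galg_map_glin inrP) e0P)) (tmap_pure pBl idK).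
by rewrite pB_inl_mul pB_inr (linZ (lf_sg mK p)) (gmulZl hK) tensZl tensZr.
Qed.

Let coacttens_in : bilin (fun v w : B =>
       \sw_(v0 of _, v1 of i <- coact C v) \sw_(w0 of j, w1 of _ <- coact C w)
       sign (i && j) *: (v0 ⊗ w0 ⊗ (v1 ∙ w1))).
Proof.
split=> x.
- apply: lf_tlift_arg => //.
  apply: (@bilin_slift _ B K mB mK _ (fun v0 _ v1 i => \sw_(w0 of j, w1 of _ <- coact C x)
       sign (i && j) *: (v0 ⊗ w0 ⊗ (v1 ∙ w1)))) => i i'.
  by split=> ?; apply: lf_tlift_par => ? ?; apply: lf_sum => ?; apply: lf_sum => ?; lin.
- apply: lf_tlift_par => v0 v1; apply: lf_sum => j; apply: lf_sum => i.
  apply: lf_tlift_arg => //.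
  apply: (@bilin_slift _ B K mB mK _ (fun w0 j w1 _ =>
       sign (i && j) *: (_ ⊗ w0 ⊗ (_ ∙ w1)))) => *; lin.
Qed.

Lemma lf_coacttens : linear (coact (cmod_tens H C C)).
Proof. exact: lf_tlift coacttens_in. Qed.

Lemma coacttens_pure v w : coact (cmod_tens H C C) (v ⊗ w) =
  \sw_(v0 of _, v1 of i <- coact C v) \sw_(w0 of j, w1 of _ <- coact C w)
       sign (i && j) *: (v0 ⊗ w0 ⊗ (v1 ∙ w1)).
Proof. exact: tlift_pure coacttens_in _ _. Qed.

(** By [D_coact] the K-coaction is D with its W leg projected to K, so the claim is [D_coassoc] with
    the two W legs projected to B and to K; [pBK_cW] recognises the diagonal coaction. *)
Lemma bcop_coact e : coact (cmod_tens H C C) (bcop e) = \sw_(e0, e1 <- coact C e) (bcop e0 ⊗ e1).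
Proof.
have rl := lf_tmap idB pBl.
transitivity (tmap bcop (fun k => k) (coact C e)); last by [].
rewrite -D_coact tmap_comp //; last exact: lf_bcop.
have -> : tmap (fun v => bcop v) (fun w => pK w) (D e) =
    tmap (tmap (fun b => b) pB) pK (tmap D (fun z => z) (D e)) by rewrite tmap_comp.
rewrite D_coassoc -tassoc_tmap // tmap_comp //; last exact: lf_tmap.
have cl : linear (fun z => tmap pB pK (cW z)) by apply: (lf_comp (lf_tmap pBl pKl)).
rewrite [D e]bcop_j.
move: (bcop e); apply: (tens_phext mB mB) => [||i j e1 e2 e1P e2P].
- exact: lf_coacttens.
- exact: (lf_comp (@lf_tassoc F B B K) (lf_comp (lf_tmap idB cl) lf_bj)).
rewrite coacttens_pure bj_pure.
have E0 : bilin (fun (e0 : B) (e3 : K) => e0 ⊗ (e3 ⊗ e2) : tens B W) by lin.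
have E1 : forall _ i : bool, bilin (fun (v0 : B) (v1 : K) => \sw_(w0 of j, w1 of _ <- coact C e2)
       sign (i && j) *: (v0 ⊗ w0 ⊗ (v1 ∙ w1))).
  by move=> _ i'; split=> ?; apply: lf_tlift_par => ? ?; apply: lf_sum => ?; apply: lf_sum => ?; lin.
move: (coact C e1); apply: (tens_phext mB mK) => [||p r u m uP mP].
- exact: (lf_slift mB mK E1).
- exact: (lf_comp (@lf_tassoc F B B K) (lf_comp (lf_tmap idB cl) (lf_tlift E0))).
rewrite (slift_ph mB mK E1 uP mP) tlift_pure // (tmap_pure idB cl) (pBK_cW _ mP).
rewrite (slift_sgl mB mK); last by lin.
rewrite (lin_tlift (h := fun x => tassoc (u ⊗ x))); last first.
  by apply: (lf_comp (@lf_tassoc F B B K)); lin.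
by apply: eq_tlift => a b; rewrite tassoc_pure.
Qed.

(** * The crossed module condition *)

Definition twist_mul (l : K) (T : tens B K) : tens B K :=
  \sw_(u, m <- T) \sum_(a : bool) (sg a u ⊗ (par a l ∙ m)).

Let twist_in (l : K) : bilin (fun (u : B) (m : K) => \sum_(a : bool) (sg a u ⊗ (par a l ∙ m))).
Proof. by split=> ?; apply: lf_sum => ?; lin. Qed.

Lemma lf_twistr l : linear (twist_mul l).
Proof. exact: lf_tlift. Qed.

Lemma lf_twistl T : linear (fun l => twist_mul l T).
Proof. by apply: lf_tlift_par => u m; apply: lf_sum => a; lin; apply: lf_par. Qed.

Lemma twist_ph a (l : K) T : ph a l -> twist_mul l T = \sw_(u, m <- T) (sg a u ⊗ (l ∙ m)).
Proof.
move=> la; apply: eq_tlift => u m; rewrite big_bool /=; case: a la => la.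
  by rewrite (par_id mK la) (par_neq mK la) // (gmul0l hK) tens0r addr0.
by rewrite (par_id mK la) (par_neq mK la) // (gmul0l hK) tens0r add0r.
Qed.

Lemma twist_1 T : twist_mul (gone K) T = T.
Proof.
rewrite (twist_ph _ (ph1 hK)) -[RHS]tlift_id; apply: eq_tlift => u m.
by rewrite (sg0 mB) (gmul1l hK).
Qed.

Lemma twist_M (l l' : K) T : twist_mul (l ∙ l') T = twist_mul l (twist_mul l' T).
Proof.
move: l; apply: (ph_ext mK) => [||a l la].
- exact: (lf_comp (lf_twistl T) (gmul_linearl hK l')).
- exact: lf_twistl.
move: l'; apply: (ph_ext mK) => [||b l' lb].
- exact: (lf_comp (lf_twistl T) (gmul_linearr hK l)).
- exact: (lf_comp (lf_twistr l) (lf_twistl T)).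
rewrite (twist_ph _ (phM hK la lb)) [in RHS](twist_ph _ lb) (lin_tlift _ _ (lf_twistr l)).
apply: eq_tlift => u m; rewrite (twist_ph _ la) tlift_pure; last by lin.
rewrite (gmulA hK); congr (_ ⊗ _); move: u; apply: (ph_ext mB) => [||c u uc].
- exact: lf_sg.
- exact: (lf_comp (lf_sg mB _) (lf_sg mB _)).
rewrite !(sg_ph mB _ uc) (linZ (lf_sg mB a)) (sg_ph mB _ uc) scalerA signM.
by clear; case: a; case: b; case: c.
Qed.

(** The right action on B ⊗ K through a coproduct: the first leg acts on B, the second multiplies K
    from the right. *)
Definition act_mul (T : tens B K) (S : tens K K) : tens B K :=
  \sw_(e0 of _, e1 of r <- T) \sw_(k1, k2 <- S) (act C e0 (sg r k1) ⊗ (e1 ∙ k2)).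

Let act_mul_in (S : tens K K) : forall i r : bool, bilin (fun (e0 : B) (e1 : K) =>
  \sw_(k1, k2 <- S) (act C e0 (sg r k1) ⊗ (e1 ∙ k2))).
Proof. by move=> _ r; lin. Qed.

Lemma lf_act_mull S : linear (fun T => act_mul T S).
Proof. exact: (lf_slift mB mK (act_mul_in S)). Qed.

Lemma act_mul_pure r u (m : K) S : ph r m -> act_mul (u ⊗ m) S =
  \sw_(k1, k2 <- S) (act C u (sg r k1) ⊗ (m ∙ k2)).
Proof.
move=> mr; move: u; apply: (ph_ext mB) => [||i u ui].
- apply: lf_comp (lf_act_mull S) _; lin.
- lin.
by rewrite /act_mul (slift_ph mB mK (act_mul_in S) ui mr).
Qed.

(** The crossed module condition without antipode. Both sides are the image of the coproduct of e k
    with its first leg projected to B and its second to K: the left side by multiplicativity, the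
    right side after rewriting e k by the cross relation. *)
Lemma crossed_cond i (e : B) k : ph i e -> act_mul (coact C e) (cop H k) =
  \sw_(k1, k2 <- cop H k) twist_mul (sg i k1) (coact C (act C e k2)).
Proof.
move=> ei; have [bl br] := bilin_smul hW hK.
have pl := lf_tmap pBl idK; have il := lf_tmap inrl idK; have ll := lf_tmap inll idK.
transitivity (tmap pB pK (cW (inr e ∙ inl k))).
  rewrite cW_cross pBK_mul pK_copr pK_copl.
  move: (coact C e); apply: (tens_phext mB mK) => [||p r e0 e1 e0P e1P].
  - exact: lf_act_mull.
  - exact: (lf_comp pl (lf_comp (bl _) il)).
  rewrite (act_mul_pure _ _ e1P) (tmap_pure inrl idK).
  move: (cop H k); apply: (tens_phext mK mK) => [||a b k1 k2 k1P k2P].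
  - by apply: lf_tlift; lin.
  - exact: (lf_comp pl (lf_comp (br _) ll)).
  rewrite tlift_pure; last by lin.
  rewrite (tmap_pure inll idK) (smul_ph hW hK _ _ e1P (glin_ph (galg_map_glin inlP) k1P)).
  rewrite (linZ pl) (tmap_pure pBl idK) pB_cross (sg_ph mK r k1P).
  by rewrite (linZ (modalg_r hM _)) tensZl.
have pcl : linear (fun z => tmap pB pK (cW z)) by apply: (lf_comp (lf_tmap pBl pKl)).
rewrite (bos_cross hH hB hM _ ei) (lin_tlift _ _ pcl).
have tb : bilin (fun k1 k2 : K => twist_mul (sg i k1) (coact C (act C e k2))).
  split=> x; first exact: (lf_comp (lf_twistl _) (lf_sg mK i)).
  exact: (lf_comp (lf_twistr _) (lf_comp coactl (modalg_r hM e))).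
move: (cop H k); apply: (tens_phext mK mK) => [||a b k1 k2 k1P k2P].
- by apply: lf_tlift; split=> ?; apply: (lf_comp pcl); lin.
- exact: lf_tlift.
rewrite !tlift_pure //; last by split=> ?; apply: (lf_comp pcl); lin.
by rewrite (pBK_cW _ (ph_sg mK i k1P)) (twist_ph _ (ph_sg mK i k1P)).
Qed.

(** [crossed_cond] is solved for the coaction of the acted element by multiplying from the left with
    the antipode of a further leg of k, whose product with the adjacent leg collapses to the
    counit. *)
Lemma coact_actP v k : coact C (act C v k) =
    \sw_(v0 of _, v1 of r <- coact C v)
    \sw_(k12, k3 <- cop H k) \sw_(k1 of i, k2 of j <- cop H k12)
      sign ((r && (i (+) j)) (+) (i && j)) *:
        (act C v0 k2 ⊗ (anti H k1 ∙ v1 ∙ k3)).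
Proof.
have hS := shopf_anti hH; have [Sg Sl Sr] := hS; have Sli := Sg.1.
have h_S (T : lmodType F) (f : T -> K) (h : linear f) := lf_comp Sli h.
have Zin r : forall (k3 : K) (v0 : B) (v1 : K) (i j : bool), bilin (fun k1 k2 : K =>
   sign ((r && (i (+) j)) (+) (i && j)) *: (act C v0 k2 ⊗ (anti H k1 ∙ v1 ∙ k3))).
  by move=> k3 v0 v1 i j; split=> x; lin.
have Zout : forall (p r : bool), bilin (fun (v0 : B) (v1 : K) =>
    \sw_(k12, k3 <- cop H k) \sw_(k1 of i, k2 of j <- cop H k12)
      sign ((r && (i (+) j)) (+) (i && j)) *: (act C v0 k2 ⊗ (anti H k1 ∙ v1 ∙ k3))).
  by move=> _ r; split=> x; apply: lf_tlift_par => ? ?; apply: lf_tlift_par => ? ?;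
    apply: lf_sum => ?; apply: lf_sum => ?; lin.
move: v; apply: (ph_ext mB) => [||i e ei].
- exact: (lf_comp coactl (modalg_l hM k)).
- exact: (lf_comp (lf_slift mB mK Zout) coactl).
have El : linear (fun x => coact C (act C e x)) by exact: (lf_comp coactl (modalg_r hM e)).
rewrite -[k in LHS](coul hC) (lin_tlift _ _ El).
transitivity (\sw_(k1, k2 <- cop H k) \sw_(a, b <- cop H k1)
    twist_mul (sg i (anti H a) ∙ sg i b) (coact C (act C e k2))).
  apply: eq_tlift => k1 k2; rewrite (linZ El).
  have hl : linear (fun x => twist_mul (sg i x) (coact C (act C e k2))).
    exact: (lf_comp (lf_twistl _) (lf_sg mK i)).
  transitivity (twist_mul (sg i (cou H k1 *: gone K)) (coact C (act C e k2))).
    by rewrite (linZ hl) (sg1 hK) twist_1.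
  rewrite -Sl (lin_tlift _ _ hl); apply: eq_tlift => a b.
  by rewrite (sgM hK).
rewrite (coassoc_trilin (copA hC k)); last 3 first.
- move=> y z; apply: (lf_comp (lf_twistl _)); apply: lf_gmull => //.
  exact: (lf_comp (lf_sg mK i) Sli).
- move=> x z; apply: (lf_comp (lf_twistl _)); apply: lf_gmulr => //; exact: lf_sg.
- by move=> x y; apply: (lf_comp (lf_twistr _)).
transitivity (\sw_(a, k' <- cop H k) \sum_(p : bool)
    twist_mul (anti H (par p a)) (act_mul (@sg _ (gtens B K) p (coact C e)) (cop H k'))).
  apply: eq_tlift => a k'.
  rewrite (eq_tlift (g := fun b c => twist_mul (sg i (anti H a)) (twist_mul (sg i b) (coact C (act C e c))))).
    rewrite -(lin_tlift _ _ (lf_twistr _)) -crossed_cond //.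
    move: a; apply: (ph_ext mK) => [||p a ap].
    + exact: (lf_comp (lf_twistl _) (lf_comp (lf_sg mK i) Sli)).
    + by apply: lf_sum => p; apply: (lf_comp (lf_twistl _) (lf_comp Sli (lf_par mK p))).
    rewrite (sg_ph mK i (glin_ph Sg ap)) (linZ (lf_twistl _)).
    have Te : @ph _ (gtens B K) i (coact C e) by apply: (glin_ph (galg_map_glin coactP)).
    have E p' : @sg _ (gtens B K) p' (coact C e) = sign (p' && i) *: coact C e.
      exact: (sg_ph mBK).
    rewrite big_bool /= !E !(linZ (lf_act_mull _)) !(linZ (lf_twistr _)) andbC.
    case: p ap => ap; rewrite (par_id mK ap) (par_neq mK ap) //.
      by rewrite (lin0 Sli) (lin0 (lf_twistl _)) scaler0 addr0.
    by rewrite (lin0 Sli) (lin0 (lf_twistl _)) scaler0 add0r.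
  by move=> b c; rewrite twist_M.
have sgl p : linear (@sg _ (gtens B K) p) by exact: (lf_sg mBK).
move: (coact C e); apply: (tens_phext mB mK) => [||p0 r e0 e1 e0P e1P].
- apply: lf_tlift_par => a k'; apply: lf_sum => p.
  exact: (lf_comp (lf_twistr _) (lf_comp (lf_act_mull _) (sgl p))).
- exact: (lf_slift mB mK Zout).
rewrite (slift_ph mB mK Zout e0P e1P).
(* The summand as a map linear in each leg of k, with the parity of the first leg summed over, so
   that coassociativity can rebracket the three legs. *)
pose phi a b c := \sum_(p : bool) sign (p && (p0 (+) r)) *:
  twist_mul (anti H (par p a)) (act C e0 (sg r b) ⊗ (e1 ∙ c)).
have phi1 b c : linear (fun a => phi a b c).
  apply: lf_sum => p; apply: lf_scale.
  exact: (lf_comp (lf_twistl _) (lf_comp Sli (lf_par mK p))).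
have phi2 a c : linear (fun b => phi a b c).
  by apply: lf_sum => p; apply: lf_scale; apply: (lf_comp (lf_twistr _)); lin.
have phi3 a b : linear (phi a b).
  by apply: lf_sum => p; apply: lf_scale; apply: (lf_comp (lf_twistr _)); lin.
transitivity (\sw_(a, k' <- cop H k) \sw_(b, c <- cop H k') phi a b c).
  apply: eq_tlift => a k'; rewrite /phi /tlift exchange_big /=; apply: eq_bigr => p _.
  have -> : @sg _ (gtens B K) p (e0 ⊗ e1) = sign (p && (p0 (+) r)) *: (e0 ⊗ e1).
    exact: (sg_ph mBK p (ph_tens mB mK e0P e1P)).
  rewrite (linZ (lf_act_mull _)) (act_mul_pure _ _ e1P) (linZ (lf_twistr _)).
  rewrite (lin_tlift _ _ (lf_twistr _)) /tlift scaler_sumr.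
  by [].
rewrite -(coassoc_trilin (copA hC k)) //; apply: eq_tlift => k12 k3.
move: (cop H k12); apply: (tens_phext mK mK) => [||a b k1 k2 k1P k2P].
- by apply: lf_tlift; split=> ?.
- exact: (lf_slift mK mK (Zin _ _ _ _)).
rewrite (slift_ph mK mK (Zin _ _ _ _) k1P k2P) tlift_pure; last by split=> ?.
have -> : phi k1 k2 k3 = sign (a && (p0 (+) r)) *:
    twist_mul (anti H k1) (act C e0 (sg r k2) ⊗ (e1 ∙ k3)).
  rewrite /phi big_bool /=.
  case: a k1P => k1P; rewrite (par_id mK k1P) (par_neq mK k1P) //.
    by rewrite (lin0 Sli) (lin0 (lf_twistl _)) scaler0 addr0.
  by rewrite (lin0 Sli) (lin0 (lf_twistl _)) scaler0 add0r.
rewrite (twist_ph _ (glin_ph Sg k1P)) tlift_pure; last by lin.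
rewrite (sg_ph mK r k2P) (linZ (modalg_r hM _)) (linZ (lf_sg mB a)).
rewrite (sg_ph mB a (ph_act hH hB hM e0P k2P)) !tensZl !scalerA !signM (gmulA hK).
by congr (sign _ *: _); clear; case: a; case: b; case: p0; case: r.
Qed.

Lemma braided_cmod : is_cmod H C.
Proof.
have [[cl cg] _ _] := coactP.
split=> //.
- exact: modalg_l hM.
- exact: modalg_r hM.
- exact: modalg_homog hM.
- exact: modalg_1 hM.
- exact: modalg_M hM.
- exact: coact_actP.
Qed.

(** * Morphisms of crossed modules and their convolution *)

Definition gmulT (t : tens B B) : B := \sw_(u, v <- t) u ∙ v.

Let gmulT_in : bilin (fun u v : B => u ∙ v).
Proof. by split; [apply: gmul_linearl hB | apply: gmul_linearr hB]. Qed.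

Lemma lf_gmulT : linear gmulT.
Proof. exact: lf_tlift gmulT_in. Qed.

Lemma gmulT_pure u v : gmulT (u ⊗ v) = u ∙ v.
Proof. exact: tlift_pure gmulT_in u v. Qed.

Lemma gmulT_cmod : is_cmod_map (cmod_tens H C C) C gmulT.
Proof.
have gl := lf_gmulT; have mBB := gtens_gmod mB mB.
split.
- split=> // n; apply: (tens_homext mB mB) => [||i j u v ui vj].
  + exact: (lf_comp gl (lf_tpr_deg mB mB n)).
  + exact: (lf_comp (lf_gpr mB n) gl).
  rewrite /= (tpr_homog mB mB _ ui vj) gmulT_pure (homog_gpr mB _ (gmul_homog hB ui vj)).
  by case: eqP => _; rewrite ?gmulT_pure ?(lin0 gl).
- move=> t k; move: t; apply: (tens_phext mB mB) => [||i r v w vi wr].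
  + exact: (lf_comp gl (lf_acttensl k)).
  + exact: (lf_comp (modalg_l hM k) gl).
  rewrite (acttens_pure _ _ wr) (lin_tlift _ _ gl) gmulT_pure (modalg_mul hM _ _ wr).
  by apply: eq_tlift => a b; rewrite gmulT_pure.
- have [[cl _] _ cM] := coactP.
  have tl : linear (fun t : tens (tens B B) K => \sw_(v0, v1 <- t) (gmulT v0 ⊗ v1)).
    by apply: lf_tlift; split=> ?; lin; apply: (lf_comp gl); lin.
  apply: tens_ext => [||v w].
  + exact: (lf_comp cl gl).
  + exact: (lf_comp tl lf_coacttens).
  rewrite gmulT_pure cM coacttens_pure; have [bl br] := bilin_smul hB hK.
  have E1 : forall _ i : bool, bilin (fun (v0 : B) (v1 : K) => \sw_(w0 of j, w1 of _ <- coact C w)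
       sign (i && j) *: (v0 ⊗ w0 ⊗ (v1 ∙ w1))).
    by move=> _ i'; split=> ?; apply: lf_tlift_par => ? ?; apply: lf_sum => ?; apply: lf_sum => ?; lin.
  move: (coact C v); apply: (tens_phext mB mK) => [||p r u m uP mP].
  + exact: bl.
  + exact: (lf_comp tl (lf_slift mB mK E1)).
  rewrite (slift_ph mB mK E1 uP mP).
  have E2 : forall j i : bool, bilin (fun (w0 : B) (w1 : K) => sign (r && j) *: (u ⊗ w0 ⊗ (m ∙ w1))).
    by move=> j i; lin.
  move: (coact C w); apply: (tens_phext mB mK) => [||j i w0 w1 w0P w1P].
  + exact: br.
  + exact: (lf_comp tl (lf_slift mB mK E2)).
  rewrite (slift_ph mB mK E2 w0P w1P) (linZ tl) tlift_pure; last first.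
    by split=> ?; lin; apply: (lf_comp gl); lin.
  by rewrite gmulT_pure /= (smul_ph hB hK _ _ mP w0P).
Qed.

Lemma gmul_cmod : is_cmod_map (cmod_tens H C C) C (fun t => \sw_(u, v <- t) u ∙ v).
Proof. exact: gmulT_cmod. Qed.

Local Notation CB := (cmod_tens H C C).
Local Notation Cmap := (is_cmod_map C C).

Lemma glin_bcop : @is_glin F B (gtens B B) bcop.
Proof.
have [Dg _ _] := DP; have [l g] := glin_tmap mB mW mB mB (conj idB (fun n v => erefl)) glin_pB.
split; first exact: lf_bcop.
by move=> n v; rewrite /bcop Dg.2 -g.
Qed.

Lemma bcop_cmod : is_cmod_map C CB bcop.
Proof.
split; [exact: glin_bcop | exact: bcop_act |].
by move=> v; rewrite bcop_coact.
Qed.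

Lemma tmap_cmod f g : Cmap f -> Cmap g -> is_cmod_map CB CB (tmap f g).
Proof.
move=> [fg fa fc] [gg ga gc]; have fl := fg.1; have gl := gg.1.
have tl := lf_tmap fl gl.
split; first exact: (glin_tmap mB mB mB mB).
- move=> t k; move: t; apply: (tens_phext mB mB) => [||i r v w vi wr].
  + exact: (lf_comp tl (lf_acttensl k)).
  + exact: (lf_comp (lf_acttensl k) tl).
  rewrite (acttens_pure _ _ wr) (lin_tlift _ _ tl) (tmap_pure fl gl).
  rewrite (acttens_pure _ _ (glin_ph gg wr)).
  by apply: eq_tlift => a b; rewrite (tmap_pure fl gl) fa ga.
- have tl2 : linear (fun t : tens (tens B B) K => \sw_(v0, v1 <- t) (tmap f g v0 ⊗ v1)).
    by apply: lf_tlift; split=> ?; lin; apply: (lf_comp tl); lin.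
  apply: tens_ext => [||v w].
  + exact: (lf_comp lf_coacttens tl).
  + exact: (lf_comp tl2 lf_coacttens).
  rewrite (tmap_pure fl gl) !coacttens_pure fc gc.
  have E1 (w' : tens B K) : forall _ i : bool, bilin (fun (v0 : B) (v1 : K) => \sw_(w0 of j, w1 of _ <- w')
       sign (i && j) *: (v0 ⊗ w0 ⊗ (v1 ∙ w1))).
    by move=> _ i'; split=> ?; apply: lf_tlift_par => ? ?; apply: lf_sum => ?; apply: lf_sum => ?; lin.
  have fkl : linear (tmap f (fun k : K => k)) by apply: lf_tmap.
  have gkl : linear (tmap g (fun k : K => k)) by apply: lf_tmap.
  rewrite -/(tmap f (fun k : K => k) _) -/(tmap g (fun k : K => k) _).
  move: (coact C v); apply: (tens_phext mB mK) => [||p r u m uP mP].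
  + exact: (lf_comp (lf_slift mB mK (E1 _)) fkl).
  + exact: (lf_comp tl2 (lf_slift mB mK (E1 _))).
  rewrite (tmap_pure fl idK) (slift_ph mB mK (E1 _) (glin_ph fg uP) mP) (slift_ph mB mK (E1 _) uP mP).
  have E2 (u' : B) : forall j i : bool, bilin (fun (w0 : B) (w1 : K) => sign (r && j) *: (u' ⊗ w0 ⊗ (m ∙ w1))).
    by move=> j i; lin.
  move: (coact C w); apply: (tens_phext mB mK) => [||j i w0 w1 w0P w1P].
  + exact: (lf_comp (lf_slift mB mK (E2 _)) gkl).
  + exact: (lf_comp tl2 (lf_slift mB mK (E2 _))).
  rewrite (tmap_pure gl idK) (slift_ph mB mK (E2 _) (glin_ph gg w0P) w1P).
  rewrite (slift_ph mB mK (E2 _) w0P w1P) (linZ tl2) tlift_pure; last first.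
    by split=> ?; lin; apply: (lf_comp tl); lin.
  by rewrite (tmap_pure fl gl).
Qed.

(** Coproduct, tensor product of maps and multiplication are all morphisms of crossed modules. With
    the stability under sums this covers the partial sums approximating the braided antipode. *)
Lemma conv_cmod f g : Cmap f -> Cmap g -> Cmap (conv bcop (@gmul F B) f g).
Proof.
move=> hf hg; have [[fl _] _ _] := hf; have [[gl _] _ _] := hg.
have E v : conv bcop (@gmul F B) f g v = gmulT (tmap f g (bcop v)).
  by rewrite /tmap (lin_tlift _ _ lf_gmulT); apply: eq_tlift => a b; rewrite gmulT_pure.
have [[g1 g2] g3 g4] := gmulT_cmod; have [[t1 t2] t3 t4] := tmap_cmod hf hg.
have [[b1 b2] b3 b4] := bcop_cmod.
split.
- split=> [|n v]; last by rewrite !E b2 t2 g2.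
  by move=> a x y; rewrite !E b1 t1 g1.
- by move=> v k; rewrite !E b3 t3 g3.
- move=> v; rewrite E g4 t4 b4.
  have tg : linear (fun t : tens (tens B B) K => \sw_(v0, v1 <- t) (gmulT v0 ⊗ v1)).
    by apply: lf_tlift; split=> ?; lin; apply: (lf_comp g1); lin.
  rewrite (lin_tlift (h := fun t : tens (tens B B) K => \sw_(v0, v1 <- t) (gmulT v0 ⊗ v1))) //.
  have gt := lf_comp g1 t1.
  transitivity (\sw_(v0, w <- \sw_(v0, v1 <- coact C v) bcop v0 ⊗ v1) (gmulT (tmap f g v0) ⊗ w)).
    apply: eq_tlift => a b; rewrite tlift_pure //.
    by split=> ?; lin; apply: (lf_comp g1); lin.
  have bt : bilin (fun v0 w => gmulT (tmap f g v0) ⊗ w : tens B K).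
    by split=> ?; lin; apply: (lf_comp gt); lin.
  rewrite (lin_tlift _ _ (lf_tlift bt)); apply: eq_tlift => a b.
  by rewrite tlift_pure // E.
Qed.

Lemma sub_cmod f g : Cmap f -> Cmap g -> Cmap (fun v => f v - g v).
Proof.
move=> [[fl fg] fa fc] [[gl gg] ga gc]; split.
- split=> [|n v]; last by rewrite fg gg (linB (lf_gpr mB n)).
  by apply: lf_add => //; apply: lf_opp.
- by move=> v k; rewrite fa ga (linB (modalg_l hM k)).
- move=> v; rewrite (linB coactl) fc gc -/(tmap f (fun k : K => k) _) -/(tmap g (fun k : K => k) _).
  rewrite /tmap /tlift -sumrB; apply: eq_bigr => p _.
  by rewrite tensDl tensNl.
Qed.

Lemma zero_cmod : Cmap (fun _ => 0).
Proof.
split; first by split=> [|n v]; [apply: lf_zero | rewrite (lin0 (lf_gpr mB n))].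
  by move=> v k; rewrite (lin0 (modalg_l hM k)).
by move=> v; rewrite (lin0 coactl) /tlift big1 // => p _; rewrite tens0l.
Qed.

Lemma add_cmod f g : Cmap f -> Cmap g -> Cmap (fun v => f v + g v).
Proof.
move=> hf hg; have h := sub_cmod hf (sub_cmod zero_cmod hg).
have E v : f v - (0 - g v) = f v + g v by rewrite sub0r opprK.
have <- : (fun v => f v - (0 - g v)) = (fun v => f v + g v) by apply: funext.
exact: h.
Qed.

Lemma id_cmod : Cmap (fun v => v).
Proof. by split=> // v; rewrite tlift_id. Qed.

Lemma eB_act e k : eB (act C e k) = eB e * cou H k.
Proof.
rewrite -pB_cross eB_pB; case: eWP => _ _ -> _.
by rewrite eW_inr eW_inl.
Qed.

Lemma eB_coact e : \sw_(e0, e1 <- coact C e) (eB e0 *: e1) = eB e *: gone K.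
Proof.
pose g (e : B) : K := eB e *: gone K.
have gA : alg_map (@gmul F K) (gone K) g.
  split; first by rewrite /g; lin.
    by rewrite /g (char_one eBP) scale1r.
  by move=> x y; rewrite /g (char_mul eBP) (gmulZl hK) (gmulZr hK) (gmul1l hK) scalerA.
apply: (generated_eq gB (alg_map_comp (charl_alg hB hK eBP) coactP) gA) => v vV.
by rewrite /g (Vtens_eB vV) eBV // scale0r.
Qed.

Local Notation uB := (cunit eB (gone B)).

Lemma unit_cmod : Cmap uB.
Proof.
have ul : linear uB by rewrite /cunit; lin.
split.
- split=> // n; apply: (homog_ext mB) => [||[|m] v vm].
  + exact: (lf_comp ul (lf_gpr mB n)).
  + exact: (lf_comp (lf_gpr mB n) ul).
  + rewrite /cunit (linZ (lf_gpr mB n)) (homog_gpr mB _ vm) (homog_gpr mB _ (gone_homog hB)).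
    by case: eqP => // _; rewrite (lin0 eBl) scale0r scaler0.
  + rewrite /cunit -{2}vm eBh scale0r (lin0 (lf_gpr mB n)) (homog_gpr mB _ vm).
    by case: eqP => _; rewrite ?(lin0 eBl) ?scale0r // -vm eBh scale0r.
- by move=> v k; rewrite /cunit eB_act (linZ (modalg_l hM k)) (modalg_one hM) scalerA.
- move=> v; rewrite /cunit (linZ coactl); have [_ -> _] := coactP.
  rewrite /= -tensZr -eB_coact (lin_tlift (h := fun x => gone B ⊗ x)); last by lin.
  by apply: eq_tlift => a b; rewrite tensZr tensZl.
Qed.

(** * Word-length filtration and antipodes *)

Inductive FilB : nat -> B -> Prop :=
| FilB_1 n c : FilB n (c *: gone B)
| FilB_D n x y : FilB n x -> FilB n y -> FilB n (x + y)
| FilB_S n x : FilB n x -> FilB n.+1 x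
| FilB_M n x v : FilB n x -> V v -> FilB n.+1 (x ∙ v).

Lemma FilB_0 n : FilB n 0.
Proof. by rewrite -(scale0r (gone B)); apply: FilB_1. Qed.

Lemma FilB_le m n x : (m <= n)%N -> FilB m x -> FilB n x.
Proof.
move=> /subnKC <-; elim: (n - m)%N => [|k IHk]; first by rewrite addn0.
by rewrite addnS => /IHk; apply: FilB_S.
Qed.

Lemma FilB_Z n c x : FilB n x -> FilB n (c *: x).
Proof.
elim=> {n x} [n d|n x y _ IHx _ IHy|n x _ IHx|n x v _ IHx vV].
- by rewrite scalerA; apply: FilB_1.
- by rewrite scalerDr; apply: FilB_D.
- exact: FilB_S.
- by rewrite -(gmulZl hB); apply: FilB_M.
Qed.

Lemma FilB_MM m n x y : FilB m x -> FilB n y -> FilB (m + n) (x ∙ y).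
Proof.
move=> xm; elim=> {n y} [n c|n y z _ IHy _ IHz|n y _ IHy|n y v _ IHy vV].
- rewrite (gmulZr hB) (gmul1r hB); apply/FilB_Z/(FilB_le _ xm); exact: leq_addr.
- by rewrite (gmulDr hB); apply: FilB_D.
- by rewrite addnS; apply: FilB_S.
- by rewrite (gmulA hB) addnS; apply: FilB_M.
Qed.

Lemma FilB_V v : V v -> FilB 1 v.
Proof.
by move=> vV; rewrite -(gmul1l hB v) -(scale1r (gone B)); apply: FilB_M (FilB_1 _ _) vV.
Qed.

Lemma FilB_ex x : exists n, FilB n x.
Proof.
move: x; apply: gB.
- by exists 0%N; rewrite -(scale1r (gone B)); apply: FilB_1.
- by move=> c x [n xn]; exists n; apply: FilB_Z.
- move=> x y [n xn] [m ym]; exists (n + m)%N; apply: FilB_D.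
    exact: FilB_le (leq_addr _ _) xn.
  exact: FilB_le (leq_addl _ _) ym.
- by move=> x y [n xn] [m ym]; exists (n + m)%N; apply: FilB_MM.
- by move=> v /FilB_V; exists 1%N.
Qed.

Lemma par_mul i (x y : B) : par i (x ∙ y) = \sum_(j : bool) par (i (+) j) x ∙ par j y.
Proof.
have [bl br] := gmulT_in.
move: x; apply: (ph_ext mB) => [||k x xk].
- exact: (lf_comp (lf_par mB i) (bl y)).
- by apply: lf_sum => j; apply: (lf_comp (bl _)); apply: lf_par.
move: y; apply: (ph_ext mB) => [||l y yl].
- exact: (lf_comp (lf_par mB i) (br x)).
- by apply: lf_sum => j; apply: (lf_comp (br _)); apply: lf_par.
have xyP := phM hB xk yl.
rewrite big_bool /=; case: (altP (i =P k (+) l)) => [->|nikl].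
  rewrite (par_id mB xyP); case: l yl xyP => yl _; rewrite (par_id mB yl) (par_neq mB yl) //.
    by rewrite addbK (par_id mB xk) (gmul0r hB) addr0.
  by rewrite !addbF (par_id mB xk) (gmul0r hB) add0r.
rewrite (par_neq mB xyP) //; case: l yl nikl {xyP} => yl nikl;
  rewrite (par_id mB yl) (par_neq mB yl) // (gmul0r hB) ?addr0 ?add0r (par_neq mB xk) ?(gmul0l hB) //.
  by apply: contra nikl => /eqP <-; rewrite addbK.
by rewrite addbF; apply: contra nikl => /eqP ->; rewrite addbF.
Qed.

Lemma FilB_par n i x : FilB n x -> FilB n (par i x).
Proof.
move=> xn; elim: xn i => {n x} [n c|n x y _ IHx _ IHy|n x _ IHx|n x v _ IHx vV] i.
- rewrite (linZ (lf_par mB i)); case: i.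
    by rewrite (par_neq mB (ph1 hB)) // scaler0; apply: FilB_0.
  by rewrite (par_id mB (ph1 hB)); apply: FilB_1.
- by rewrite (linD (lf_par mB i)); apply: FilB_D.
- exact: FilB_S.
- by rewrite par_mul big_bool /=; apply: FilB_D; apply: FilB_M => //; apply: Vpar.
Qed.

Lemma FilB_sg n i x : FilB n x -> FilB n (sg i x).
Proof. by move=> xn; apply: FilB_D; [|apply: FilB_Z]; apply: FilB_par. Qed.

Lemma FilB_act n x k : FilB n x -> FilB n (act C x k).
Proof.
move=> xn; elim: xn k => {n x} [n c|n x y _ IHx _ IHy|n x _ IHx|n x v _ IHx vV] k.
- by rewrite (linZ (modalg_l hM k)) (modalg_one hM) scalerA; apply: FilB_1.
- by rewrite (linD (modalg_l hM k)); apply: FilB_D.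
- exact: FilB_S.
- rewrite (par_sum mB v) (lin_sum (gmul_linearr hB x)) (lin_sum (modalg_l hM k)).
  apply: (big_ind (FilB n.+1)) => [||i _]; [exact: FilB_0|exact: FilB_D|].
  rewrite (modalg_mul hM _ _ (ph_par mB v)).
  have b : bilin (fun k1 k2 : K => act C x (sg i k1) ∙ act C (par i v) k2) by lin.
  move: (cop H k); apply: tens_ind => [a b'|s t hs ht].
    by rewrite tlift_pure //; apply: FilB_M (IHx _) _; apply/Vact/Vpar.
  by rewrite (linD (lf_tlift b)); apply: FilB_D.
Qed.

Inductive FilBK (n : nat) : tens B K -> Prop :=
| FilBK_pure x m : FilB n x -> FilBK n (x ⊗ m)
| FilBK_0 : FilBK n 0
| FilBK_D s t : FilBK n s -> FilBK n t -> FilBK n (s + t).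

Lemma FilB_coact n x : FilB n x -> FilBK n (coact C x).
Proof.
have [_ c1 cM] := coactP; have [bl br] := bilin_smul hB hK.
have FZ m c s : FilBK m s -> FilBK m (c *: s).
  elim=> [y l ym||s' t' _ IHs _ IHt]; last by rewrite scalerDr; apply: FilBK_D.
    by rewrite -tensZl; apply/FilBK_pure/FilB_Z.
  by rewrite scaler0; apply: FilBK_0.
elim=> {n x} [n c|n x y _ IHx _ IHy|n x _ IHx|n x v _ IHx vV].
- by rewrite (linZ coactl) c1; apply/FZ/FilBK_pure; rewrite -(scale1r (gone B)); apply: FilB_1.
- by rewrite (linD coactl); apply: FilBK_D.
- elim: IHx => [y l yn||s t _ IHs _ IHt]; [|exact: FilBK_0|exact: FilBK_D].
  by apply/FilBK_pure/FilB_S.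
rewrite cM /=; elim: IHx => [y l yn||s t _ IHs _ IHt].
- elim: (Vcoact vV) => [u w uV||s t _ IHs _ IHt].
  + rewrite (par_sum mB u) tens_suml (lin_sum (br _)).
    apply: (big_ind (FilBK n.+1)) => [||i _]; [exact: FilBK_0|exact: FilBK_D|].
    rewrite (smul_sg hB hK _ _ _ (ph_par mB u)).
    by apply: FilBK_pure; apply: FilB_M => //; apply: Vpar.
  + by rewrite (lin0 (br _)); apply: FilBK_0.
  + by rewrite (linD (br _)); apply: FilBK_D.
- by rewrite (lin0 (bl _)); apply: FilBK_0.
- by rewrite (linD (bl _)); apply: FilBK_D.
Qed.

Local Notation TB := (TFil FilB).

Lemma TFilB_le m n t : (m <= n)%N -> TB m t -> TB n t.
Proof.
move=> mn; elim=> [i j a b ij ai bj||s s' _ IHs _ IHt]; [|exact: TFil_0|exact: TFil_D].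
exact: TFil_pure (leq_trans ij mn) ai bj.
Qed.

(** A further letter v multiplies the coproduct by v ⊗ 1 + 1 ⊗ v in the braided square. Braiding a
    second leg past v leaves an element of V in front and only acts on that leg, which stays in its
    step, so the total length grows by at most one. *)
Lemma FilB_bcop n x : FilB n x -> TB n (bcop x).
Proof.
have [ml mr] := bilin_braided_mul.
elim=> {n x} [n c|n x y _ IHx _ IHy|n x _ IHx|n x v _ IHx vV].
- rewrite (linZ lf_bcop) bcop1 -tensZl.
  have one0 : FilB 0 (gone B) by rewrite -(scale1r (gone B)); apply: FilB_1.
  exact: (@TFil_pure _ _ _ _ 0 0 _ _ (leq0n _) (FilB_1 _ _) one0).
- by rewrite (linD lf_bcop); apply: TFil_D.
- exact: TFilB_le (leqnSn n) IHx.
rewrite bcopM (bcopV vV) (linD (mr _)).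
elim: IHx => [i j a b ij ai bj||s t _ IHs _ IHt].
- have [_ c1 _] := coactP.
  apply: TFil_D.
    rewrite /braided_mul (tlift_pure (braided_in _)) (tlift_pure (braided_in2 _ _)).
    rewrite (par_sum mB b) (lin_sum (lf_braid v)).
    have bb : bilin (fun w w' : B => (a ∙ w) ⊗ (w' ∙ gone B)) by lin.
    rewrite (lin_sum (lf_tlift bb)).
    apply: (big_ind (TB n.+1)) => [||l _]; [exact: TFil_0|exact: TFil_D|].
    rewrite (braidE _ (ph_par mB b)).
    have b2 : bilin (fun (f0 : B) (f1 : K) => sg l f0 ⊗ act C (par l b) f1 : tens B B) by lin.
    elim: (Vcoact vV) => [u w uV||s t _ IHs _ IHt].
    + rewrite tlift_pure // tlift_pure // (gmul1r hB).
      apply: (@TFil_pure _ _ _ _ i.+1 j); first by rewrite addSn ltnS.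
        apply: FilB_M => //; apply: VD; first exact: Vpar.
        exact/VZ/Vpar.
      exact/FilB_act/FilB_par.
    + by rewrite (lin0 (lf_tlift b2)) (lin0 (lf_tlift bb)); apply: TFil_0.
    + by rewrite (linD (lf_tlift b2)) (linD (lf_tlift bb)); apply: TFil_D.
  rewrite /braided_mul (tlift_pure (braided_in _)) (tlift_pure (braided_in2 _ _)).
  have bb : bilin (fun w w' : B => (a ∙ w) ⊗ (w' ∙ v)) by lin.
  have -> : braiding C C b (gone B) = gone B ⊗ b.
    move: b {bj}; apply: (ph_ext mB) => [||l b bl]; [exact: lf_braid|by lin|].
    rewrite (braidE _ bl) c1 tlift_pure; last by lin.
    by rewrite (sg1 hB) (modalg_1 hM).
  rewrite tlift_pure // (gmul1r hB).
  by apply: (@TFil_pure _ _ _ _ i j.+1); rewrite ?addnS ?ltnS //; apply: FilB_M.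
- by rewrite !(lin0 (ml _)) addr0; apply: TFil_0.
- by rewrite !(linD (ml _)) addrACA; apply: TFil_D.
Qed.

Lemma FilB_0E x : FilB 0 x -> exists c, x = c *: gone B.
Proof.
move=> h; have : FilB 0 x -> forall n, n = 0%N -> FilB n x -> exists c, x = c *: gone B.
  move=> _ n n0 xn; move: n0; elim: xn => {n x h} [n c|n x y _ IHx _ IHy|//|//] n0.
    by exists c.
  have [c ->] := IHx n0; have [d ->] := IHy n0.
  by exists (c + d); rewrite scalerDl.
by move/(_ h 0%N erefl h).
Qed.

(** The starting point of the geometric series is the convolution unit, which inverts the identity
    on scalars. Its partial sums are morphisms of crossed modules, and each value of S is a value of
    some partial sum; for the coaction a partial sum serving all finitely many legs is taken. *)
Lemma braided_antipode : exists S : B -> B,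
  is_antipode (HopfOps bcop eB S) /\ is_cmod_map C C S.
Proof.
have aB := galg_alg hB.
have ul : linear uB by rewrite /cunit; lin.
have bA e : \sw_(v1, v2 <- bcop e) (bcop v1 ⊗ v2) =
    \sw_(v1, v23 <- bcop e) \sw_(v2, v3 <- bcop v23) (v1 ⊗ v2 ⊗ v3).
  rewrite tassocE; last exact: lf_bcop.
  exact: bcopA.
have h1 c : FilB 0 c -> conv bcop (@gmul F B) uB (fun x => x) c = uB c.
  move=> /FilB_0E[d ->]; rewrite (conv1l bcop_coul aB) // /cunit.
  by rewrite (linZ eBl) (char_one eBP) /GRing.scale /= mulr1.
have h2 c : FilB 0 c -> conv bcop (@gmul F B) (fun x => x) uB c = uB c.
  move=> /FilB_0E[d ->]; rewrite (conv1r bcop_cour aB) // /cunit.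
  by rewrite (linZ eBl) (char_one eBP) /GRing.scale /= mulr1.
have [S [Sl SI IS SN]] := conv_inverse lf_bcop eBl bA bcop_coul bcop_cour aB
  FilB_bcop FilB_ex idB ul h1 h2.
exists S; set P := cpart _ _ _ _ _ _ in SN.
have PC n : Cmap (P n).
  have powC m : Cmap (cpow bcop eB (@gmul F B) (gone B) (fun x => x) uB m).
    elim: m => [|m IHm]; first exact: unit_cmod.
    apply: conv_cmod IHm; apply: sub_cmod; first exact: unit_cmod.
    by apply: conv_cmod; [apply: unit_cmod | apply: id_cmod].
  elim: n => [|n IHn].
    have -> : P 0%N = (fun _ => 0) by apply: funext => x; rewrite /P /cpart big_ord0.
    exact: zero_cmod.
  have -> : P n.+1 = (fun x => P n x + conv bcop (@gmul F B)
      (cpow bcop eB (@gmul F B) (gone B) (fun x => x) uB n) uB x).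
    by apply: funext => x; rewrite /P /cpart big_ord_recr.
  by apply: add_cmod => //; apply: conv_cmod => //; apply: unit_cmod.
have SC : Cmap S.
  split.
  - split=> // n v; have [N1 h] := SN v; have [N2 h'] := SN (gpr n v).
    rewrite (h (maxn N1 N2)) ?leq_maxl // (h' (maxn N1 N2)) ?leq_maxr //.
    by have [[_ ->] _ _] := PC (maxn N1 N2).
  - move=> v k; have [N1 h] := SN v; have [N2 h'] := SN (act C v k).
    rewrite (h (maxn N1 N2)) ?leq_maxl // (h' (maxn N1 N2)) ?leq_maxr //.
    by have [_ -> _] := PC (maxn N1 N2).
  - move=> v; have [N1 h] := SN v.
    have [N2 h'] : exists N, forall n, (N <= n)%N ->
        tmap S (fun k : K => k) (coact C v) = tmap (P n) (fun k : K => k) (coact C v).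
      move: (coact C v); apply: tens_ind => [x k|s t [M1 m1] [M2 m2]].
        have [M hM'] := SN x; exists M => n /hM' Sx.
        by rewrite !tmap_pure ?Sx //; have [[]] := PC n.
      exists (maxn M1 M2) => n; rewrite geq_max => /andP[/m1 e1 /m2 e2].
      have [[Pl _] _ _] := PC n.
      by rewrite (linD (lf_tmap Sl idK)) (linD (lf_tmap Pl idK)) e1 e2.
    rewrite (h (maxn N1 N2)) ?leq_maxl //; have [_ _ ->] := PC (maxn N1 N2).
    by apply/esym/h'; apply: leq_maxr.
split=> //; split=> //; by case: SC.
Qed.

Hypotheses (SBP : is_antipode bHB) (SBm : is_cmod_map C C SB).

Lemma braided_bhopf : is_bhopf H C bHB.
Proof.
have [_ c1 _] := coactP.
split=> //.
- exact: braided_cmod.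
- split=> //.
  + exact: glin_bcop.
  + by move=> v; rewrite /= tassocE; [exact: bcopA | exact: lf_bcop].
  + exact: bcop_coul.
  + exact: bcop_cour.
- exact: gmul_cmod.
- exact: modalg_one hM.
- exact: bcop_cmod.
- exact: eB_act.
- exact: eB_coact.
- exact: bcopM.
- exact: bcop1.
- exact: char_mul eBP.
- exact: char_one eBP.
Qed.

Inductive FilW (n : nat) : W -> Prop :=
| FilW_pure k x : FilB n x -> FilW n (k ⊗ x)
| FilW_0 : FilW n 0
| FilW_D s t : FilW n s -> FilW n t -> FilW n (s + t).

Lemma FilW_inl n k z : FilW n z -> FilW n (inl k ∙ z).
Proof.
elim=> [l x xn||s t _ IHs _ IHt].
- by rewrite /= /bos_inl (bosm_inl_pure hH hB hM); apply: FilW_pure.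
- by rewrite (gmul0r hW); apply: FilW_0.
- by rewrite (gmulDr hW); apply: FilW_D.
Qed.

Lemma FilW_sg n i z : FilW n z -> FilW n (sg i z).
Proof.
elim=> [l x xn||s t _ IHs _ IHt].
- by rewrite (sg_tens mK mB); apply/FilW_pure/FilB_sg.
- by rewrite (lin0 (lf_sg mW i)); apply: FilW_0.
- by rewrite (linD (lf_sg mW i)); apply: FilW_D.
Qed.

Lemma FilW_cop n z : FilW n z -> TFil FilW n (cW z).
Proof.
have [bl br] := bsWW.
elim=> [k x xn||s t _ IHs _ IHt]; last 2 first.
- by rewrite (lin0 cWl); apply: TFil_0.
- by rewrite (linD cWl); apply: TFil_D.
rewrite cW_pure /copr bcop_j.
have trl := lf_tmap inrl idW.
have E0 e2 : bilin (fun (e0 : B) (e3 : K) => e0 ⊗ (e3 ⊗ e2) : tens B W) by lin.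
elim: (FilB_bcop xn) => [i j a b ij ai bj||s t _ IHs _ IHt]; last 2 first.
- by rewrite (lin0 lf_bj) (lin0 trl) (gmul0r hWW); apply: TFil_0.
- by rewrite (linD lf_bj) (linD trl) (gmulDr hWW); apply: TFil_D.
rewrite bj_pure; elim: (FilB_coact ai) => [y m yi||s t _ IHs _ IHt]; last 2 first.
- by rewrite (lin0 (lf_tlift (E0 b))) (lin0 trl) (gmul0r hWW); apply: TFil_0.
- by rewrite (linD (lf_tlift (E0 b))) (linD trl) (gmulDr hWW); apply: TFil_D.
rewrite tlift_pure // (tmap_pure inrl idW) /copl.
have Tind (s : tens K K) : TFil FilW n (smul (tmap inl inl s) (inr y ⊗ (m ⊗ b : W))); last exact: Tind.
move: s; apply: tens_ind => [w1 w2|s t hs ht]; last first.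
  by rewrite (linD (lf_tmap inll inll)) (linD (bl _)); apply: TFil_D.
rewrite (par_sum mK w2) tens_sumr (lin_sum (lf_tmap inll inll)) (lin_sum (bl _)).
apply: (big_ind (TFil FilW n)) => [||l _]; [exact: TFil_0|exact: TFil_D|].
rewrite (tmap_pure inll inll).
have -> : smul (inl w1 ⊗ inl (par l w2)) (inr y ⊗ (m ⊗ b : W)) =
    (inl w1 ∙ sg l (inr y)) ⊗ (inl (par l w2) ∙ (m ⊗ b : W)).
  have wP := glin_ph (galg_map_glin inlP) (ph_par mK (i := l) w2).
  move: (inr y); apply: (ph_ext mW) => [||p y' yp].
  - apply: (lf_comp (br _)); lin.
  - by lin.
  by rewrite (smul_ph hW hW _ _ wP yp) (sg_ph mW l yp) (gmulZr hW) tensZl.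
apply: (@TFil_pure _ _ _ _ i j) => //; apply: FilW_inl; last exact: FilW_pure.
by apply: FilW_sg; apply: FilW_pure.
Qed.

Lemma FilW_ex z : exists n, FilW n z.
Proof.
have le m n t : (m <= n)%N -> FilW m t -> FilW n t.
  move=> mn; elim=> [k x xm||s s' _ IHs _ IHt]; [|exact: FilW_0|exact: FilW_D].
  by apply: FilW_pure; apply: FilB_le xm.
move: z; apply: tens_ind => [k e|s t [m sm] [n tn]].
  by have [n en] := FilB_ex e; exists n; apply: FilW_pure.
exists (m + n)%N; apply: FilW_D; first exact: le (leq_addr _ _) sm.
exact: le (leq_addl _ _) tn.
Qed.

(** Step 0 of the filtration of W is K, on which the antipode of K inverts the identity; projecting
    to K, applying that antipode and including back into W is the starting point of the series. *)
Lemma bos_shopf : exists S : W -> W, is_shopf (bos_hopf bHB S).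
Proof.
have [[Sg Sl Sr] aW] := (shopf_anti hH, galg_alg hW); have [Sli SgG] := Sg.
pose g (z : W) : W := inl (anti H (pK z)).
have gl : linear g by exact: (lf_comp inll (lf_comp Sli pKl)).
have gg n z : g (gpr n z) = gpr n (g z).
  have [[_ ig] _ _] := inlP; have [[_ pg] _ _] := pKP.
  by rewrite /g pg SgG ig.
have bA (z : W) : \sw_(v1, v2 <- cW z) (cW v1 ⊗ v2) =
    \sw_(v1, v23 <- cW z) \sw_(v2, v3 <- cW v23) (v1 ⊗ v2 ⊗ v3).
  rewrite tassocE; last exact: cWl.
  exact: bos_copA.
have F0 z : FilW 0 z -> exists k, z = inl k.
  elim=> [k x /FilB_0E[c ->]||s t _ [k ->] _ [l ->]].
  - by exists (c *: k); rewrite (linZ inll) /bos_inl tensZr.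
  - by exists 0; rewrite (lin0 inll).
  - by exists (k + l); rewrite (linD inll).
have b1 : bilin (fun c1 c2 : W => g c1 ∙ c2) by split=> ?; lin.
have b2 : bilin (fun c1 c2 : W => c1 ∙ g c2) by split=> ?; lin.
have h1 c : FilW 0 c -> conv cW (@gmul F W) g (fun x => x) c = cunit eW (gone W) c.
  move=> /F0[k ->]; rewrite /conv bcop_inl /copl tlift_tmap // /cunit eW_inl.
  rewrite -inl1 -(linZ inll) -Sl (lin_tlift _ _ inll); apply: eq_tlift => a b.
  by rewrite /g pK_inl inlM.
have h2 c : FilW 0 c -> conv cW (@gmul F W) (fun x => x) g c = cunit eW (gone W) c.
  move=> /F0[k ->]; rewrite /conv bcop_inl /copl tlift_tmap // /cunit eW_inl.
  rewrite -inl1 -(linZ inll) -Sr (lin_tlift _ _ inll); apply: eq_tlift => a b.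
  by rewrite /g pK_inl inlM.
have [S [SlW SI IS SN]] := conv_inverse cWl eWl bA bos_coul bos_cour aW
  FilW_cop FilW_ex idW gl h1 h2.
exists S; set P := cpart _ _ _ _ _ _ in SN.
pose gr (f : W -> W) := is_glin f.
have convG f f' : gr f -> gr f' -> gr (conv cW (@gmul F W) f f').
  move=> fg fg'; have [fl _] := fg; have [fl' _] := fg'.
  have bb : bilin (fun c1 c2 => f c1 ∙ f' c2) by split=> ?; lin.
  have cg := galg_map_glin bos_copP; have mg := mWW.
  apply: (glinI mW mW) => [|n v vn]; first exact: (lf_comp (lf_tlift bb)).
  have := glin_homog cg vn; rewrite /conv; move: (cW v) => t tn.
  rewrite -tn /=; move: t {tn}; apply: tens_ind => [a b|s t hs ht].
    rewrite (tpr_pure mW mW) (lin_sum (lf_tlift bb)); apply: homog_sum => // i.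
    rewrite tlift_pure //; have iN : (i <= n)%N by rewrite -ltnS.
    rewrite -{1}(subnKC iN); apply: (gmul_homog hW); apply: glin_homog => //; exact: gpr_homog.
  by rewrite (linD (lf_tpr_deg mW mW n)) (linD (lf_tlift bb)); apply: homogD.
have unitG : gr (cunit eW (gone W)).
  apply: (glinI mW mW) => [|[|n] v vn]; first by rewrite /cunit; lin.
    by rewrite /cunit; apply: homogZ => //; apply: gone_homog.
  rewrite /cunit -vn.
  have -> : eW (gpr n.+1 v) = 0.
    move: v {vn}; apply: (@tens_ext F F^o K B (fun v => eW (gpr n.+1 (v : W))) (fun=> 0)) => [||w e].
    - exact: (lf_comp eWl (lf_gpr mW n.+1)).
    - exact: (@lf_zero _ _ F^o).
    rewrite /= (tpr_pure mK mB) (lin_sum eWl) big1 // => -[[|k] kn] _ /=.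
      by rewrite eW_pure subn0 eBh mulr0.
    by rewrite eW_pure (cou_homog hC) mul0r.
  by rewrite scale0r; apply: homog0.
have PG n : gr (P n).
  have powG m : gr (cpow cW eW (@gmul F W) (gone W) (fun x => x) g m).
    elim: m => [|m IHm] //=; apply: (convG _ _ _ IHm).
    have gU : gr (conv cW (@gmul F W) g (fun x => x)) by apply: (convG).
    case: unitG gU => u1 u2 [c1 c2]; split; first by apply: lf_add => //; apply: lf_opp.
    by move=> k v; rewrite u2 c2 (linB (lf_gpr mW k)).
  split; first by apply: lf_sum => k; have [] : gr (conv cW (@gmul F W) (cpow cW eW (@gmul F W) (gone W) (fun x => x) g k) g) by apply: (convG).
  move=> k v; rewrite /P /cpart (lin_sum (lf_gpr mW k)); apply: eq_bigr => j _.
  by have [_ ->] : gr (conv cW (@gmul F W) (cpow cW eW (@gmul F W) (gone W) (fun x => x) g j) g) by apply: (convG).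
have SG : gr S.
  split=> // n v; have [N1 h] := SN v; have [N2 h'] := SN (gpr n v).
  rewrite (h (maxn N1 N2)) ?leq_maxl // (h' (maxn N1 N2)) ?leq_maxr //.
  by have [_ ->] := PG (maxn N1 N2).
have eWh n (v : W) : eW (gpr n.+1 v) = 0.
  move: v; apply: (@tens_ext F F^o K B (fun v => eW (gpr n.+1 (v : W))) (fun=> 0)) => [||w e].
  - exact: (lf_comp eWl (lf_gpr mW n.+1)).
  - exact: (@lf_zero _ _ F^o).
  rewrite /= (tpr_pure mK mB) (lin_sum eWl) big1 // => -[[|k] kn] _ /=.
    by rewrite eW_pure subn0 eBh mulr0.
  by rewrite eW_pure (cou_homog hC) mul0r.
split=> //.
- split=> //.
  + exact: galg_map_glin bos_copP.
  + exact: bos_coul.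
  + exact: bos_cour.
- exact: bos_copP.
- exact: char_mul eWP.
Qed.

End BraidedHopf.

(** * Presented algebras *)

Section Presented.
Variables (F : fieldType) (I : Type) (rel : pterm F I -> pterm F I -> Prop).
Local Notation A := (presAlg rel).
Local Notation pi := (pres_pi rel).

Lemma pres_piD s t : pi (s + t)%P = pi s + pi t.
Proof. by rewrite [RHS]paddE. Qed.
Lemma pres_piM s t : pi (s * t)%P = pi s * pi t.
Proof. by rewrite [RHS]pmulE. Qed.
Lemma pres_piZ c t : pi (c *: t)%P = c *: pi t.
Proof. by rewrite [RHS]pscaleE. Qed.
Lemma pres_pi0 : pi 0%P = 0. Proof. by []. Qed.
Lemma pres_pi1 : pi 1%P = 1. Proof. by []. Qed.
Lemma pres_piC c : pi (TConst c) = c *: (1 : A).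
Proof.
rewrite -pres_pi1 -pres_piZ; apply/pres_piP/pres_sym/pres_mul1r.
Qed.
Lemma pres_pi_sum (J : Type) (r : seq J) (P : pred J) (f : J -> pterm F I) :
  pi (\big[@TAdd F I/0%P]_(j <- r | P j) f j) = \sum_(j <- r | P j) pi (f j).
Proof. by elim/big_rec2: _ => // j x y _ <-; rewrite pres_piD. Qed.

Lemma pres_scaleAl c (x y : A) : c *: (x * y) = (c *: x) * y.
Proof.
rewrite (pres_piS x) (pres_piS y) -pres_piM -!pres_piZ -pres_piM.
exact/pres_piP/pres_mulA.
Qed.
Lemma pres_scaleAr c (x y : A) : c *: (x * y) = x * (c *: y).
Proof.
rewrite (pres_piS x) (pres_piS y) -pres_piM -!pres_piZ -pres_piM.
apply/pres_piP.
apply: pres_trans (pres_mulA _ _ _ _) _.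
apply: pres_trans (pres_mul (pres_constC _ _ _) (pres_refl _ _)) _.
exact/pres_sym/pres_mulA.
Qed.

(** * Modules over a presented algebra *)

Section Action.
Variables (M : lmodType F) (op : I -> M -> M).
(** Terms act on a module directly, so operators satisfying the relations yield a module without any
    endomorphism algebra being formed. *)
Fixpoint tact (t : pterm F I) (z : M) : M :=
  match t with
  | TGen i => op i z
  | TConst c => c *: z
  | TAdd s u => tact s z + tact u z
  | TMul s u => tact s (tact u z)
  end.
Hypothesis opl : forall i, linear (op i).

Lemma lf_tact t : linear (tact t).
Proof.
elim: t => [i|c|s IHs u IHu|s IHs u IHu] /=.
- exact: opl.
- by apply: lf_scale; apply: lf_id.
- exact: lf_add.
- exact: lf_comp.
Qed.

Hypothesis oprel : forall s t z, rel s t -> tact s z = tact t z.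

Lemma tact_eq s t : pres_eq rel s t -> forall z, tact s z = tact t z.
Proof.
elim=> {s t} //=.
- by move=> s t u _ e1 _ e2 z; rewrite e1.
- by move=> s s' t t' _ e1 _ e2 z; rewrite e1 e2.
- by move=> s s' t t' _ e1 _ e2 z; rewrite e1 e2.
- by move=> s t u z; rewrite addrA.
- by move=> s t z; rewrite addrC.
- by move=> s z; rewrite scale0r add0r.
- by move=> s z; rewrite scale1r.
- by move=> s z; rewrite scale1r.
- by move=> s z; rewrite !scale0r.
- by move=> s t u z; rewrite (linD (lf_tact u)).
- by move=> c c' z; rewrite scalerDl.
- by move=> c c' z; rewrite scalerA.
- by move=> c s z; rewrite (linZ (lf_tact s)).
- by move=> s t st z; apply: oprel.
Qed.

Definition pact (x : A) (z : M) : M := tact (repr x) z.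

Lemma pactE t z : pact (pi t) z = tact t z.
Proof. by apply: tact_eq; apply: pres_reprK. Qed.

Lemma lf_pactl z : linear (fun x => pact x z).
Proof.
move=> a x y; rewrite (pres_piS x) (pres_piS y) -pres_piZ -pres_piD !pactE /=.
by [].
Qed.

Lemma lf_pactr x : linear (pact x).
Proof. exact: lf_tact. Qed.

Lemma pactM x y z : pact (x * y) z = pact x (pact y z).
Proof. by rewrite (pres_piS x) (pres_piS y) -pres_piM !pactE. Qed.

Lemma pact1 z : pact 1 z = z.
Proof. by rewrite -pres_pi1 pactE /= scale1r. Qed.

Lemma pact_gen i z : pact (pgen rel i) z = op i z.
Proof. by rewrite /pgen pactE. Qed.

End Action.

(** * Grading of a presented algebra *)

Section Grading.
Variable deg : I -> nat.
Definition pres_comp n t : A := pi (tcomp deg t n).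

Lemma compM n s u : pres_comp n (s * u)%P = \sum_(k < n.+1) pres_comp k s * pres_comp (n - k) u.
Proof. by rewrite /pres_comp /= pres_pi_sum; apply: eq_bigr => k _; rewrite pres_piM. Qed.

Lemma compD n s u : pres_comp n (s + u)%P = pres_comp n s + pres_comp n u.
Proof. by rewrite /pres_comp /= pres_piD. Qed.

Lemma compC n c : pres_comp n (TConst c) = if n == 0%N then c *: (1 : A) else 0.
Proof. by rewrite /pres_comp /=; case: ifP => _; rewrite pres_piC ?scale0r. Qed.

Lemma sum_antidiag (R : nmodType) n N (g : nat -> nat -> R) : (n < N)%N ->
  \sum_(k < n.+1) g k (n - k)%N = \sum_(a < N) \sum_(b < N | (a + b == n)%N) g a b.
Proof.
move=> nN; rewrite (big_ord_widen N (fun k => g k (n - k)%N) nN) big_mkcond /=.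
apply: eq_bigr => a _; case: ltnP => [an|na].
  have bN : (n - a < N)%N by apply: leq_ltn_trans nN; apply: leq_subr.
  rewrite (big_pred1 (Ordinal bN)) // => b; apply/eqP/eqP => [ab|->] /=.
    by apply: val_inj; rewrite /= -ab addKn.
  by rewrite subnKC.
rewrite big_pred0 // => b; apply/negbTE/eqP => ab.
by move: na; rewrite -ab ltnNge leq_addr.
Qed.

(** Associativity of the Cauchy product. Both sides sum over all a, b, c with a + b + c = n; padding
    every range to the same N makes the dependent bounds into conditions, and sums can be
    exchanged. *)
Lemma cauchyA n (x y z : nat -> A) :
  \sum_(k < n.+1) x k * (\sum_(l < (n - k).+1) y l * z (n - k - l)%N) =
  \sum_(k < n.+1) (\sum_(l < k.+1) x l * y (k - l)%N) * z (n - k)%N.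
Proof.
pose N := n.+1.
transitivity (\sum_(a < N) \sum_(b < N) \sum_(c < N | (a + b + c == n)%N) x a * (y b * z c)).
  apply: eq_bigr => a _.
  have an : (a <= n)%N by rewrite -ltnS.
  rewrite (@sum_antidiag _ _ N (fun l m => y l * z m)); last by rewrite ltnS leq_subr.
  rewrite mulr_sumr; apply: eq_bigr => b _; rewrite mulr_sumr; apply: eq_bigl => c.
  by rewrite -(eqn_add2l a) addnA subnKC.
rewrite (@sum_antidiag _ n N (fun k m => (\sum_(l < k.+1) x l * y (k - l)%N) * z m)) //.
transitivity (\sum_(a < N) \sum_(b < N) \sum_(c < N) \sum_(m < N | (a + b == m)%N && (m + c == n)%N)
   x a * (y b * z c)).
  apply: eq_bigr => a _; apply: eq_bigr => b _; rewrite big_mkcond /=; apply: eq_bigr => c _.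
  case: eqP => [abc|abc].
    have abN : (a + b < N)%N by rewrite ltnS -abc leq_addr.
    rewrite (big_pred1 (Ordinal abN)) // => m.
    apply/andP/eqP => [[/eqP ab _]|->]; first exact: val_inj.
    by rewrite /= eqxx abc eqxx.
  rewrite big_pred0 // => m; apply/negbTE/negP => /andP[/eqP <- /eqP]; exact: abc.
transitivity (\sum_(m < N) \sum_(c < N | (m + c == n)%N) \sum_(a < N) \sum_(b < N | (a + b == m)%N)
   x a * (y b * z c)); last first.
  apply: eq_bigr => m _; apply: eq_bigr => c _.
  rewrite (@sum_antidiag _ m N (fun l p => x l * y p)) // mulr_suml.
  by apply: eq_bigr => a _; rewrite mulr_suml; apply: eq_bigr => b _; rewrite mulrA.
under [RHS]eq_bigr => m _ do rewrite (big_mkcond (fun c : 'I_N => (m + c == n)%N)).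
rewrite [RHS]exchange_big /=.
transitivity (\sum_(c < N) \sum_(a < N) \sum_(b < N) \sum_(m < N | (a + b == m)%N && (m + c == n)%N)
   x a * (y b * z c)).
  rewrite [RHS]exchange_big; apply: eq_bigr => a _; exact: exchange_big.
apply: eq_bigr => c _.
transitivity (\sum_(m < N) \sum_(a < N) \sum_(b < N) (if (a + b == m)%N && (m + c == n)%N
   then x a * (y b * z c) else 0)).
  rewrite [RHS]exchange_big; apply: eq_bigr => a _; rewrite [RHS]exchange_big.
  by apply: eq_bigr => b _; rewrite big_mkcond.
apply: eq_bigr => m _; case: eqP => _.
  apply: eq_bigr => a _; rewrite [RHS]big_mkcond; apply: eq_bigr => b _.
  by rewrite andbT.
by rewrite big1 // => a _; rewrite big1 // => b _; rewrite andbF.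
Qed.

Hypothesis hrel : forall s t n, rel s t -> pres_comp n s = pres_comp n t.

(** The grading descends to the quotient as soon as each defining relation holds component by
    component; the algebra laws themselves are laws of Cauchy products. *)
Lemma comp_eq s t : pres_eq rel s t -> forall n, pres_comp n s = pres_comp n t.
Proof.
elim=> {s t}.
- by [].
- by move=> s t _ e n.
- by move=> s t u _ e1 _ e2 n; rewrite e1.
- by move=> s s' t t' _ e1 _ e2 n; rewrite !compD e1 e2.
- by move=> s s' t t' _ e1 _ e2 n; rewrite !compM; apply: eq_bigr => k _; rewrite e1 e2.
- by move=> s t u n; rewrite !compD addrA.
- by move=> s t n; rewrite !compD addrC.
- by move=> s n; rewrite compD compC scale0r if_same add0r.
- move=> s t u n; rewrite !compM.
  under eq_bigr => k _ do rewrite compM.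
  under [RHS]eq_bigr => k _ do rewrite compM.
  exact: (cauchyA n (fun k => pres_comp k s) (fun k => pres_comp k t) (fun k => pres_comp k u)).
- move=> s n; rewrite compM big_ord_recl subn0 compC scale1r mul1r big1 ?addr0 // => k _.
  by rewrite compC mul0r.
- move=> s n; rewrite compM big_ord_recr /= subnn compC scale1r mulr1 big1 ?add0r // => k _.
  by rewrite compC subn_eq0 leqNgt ltn_ord mulr0.
- by move=> s n; rewrite compM big1 ?compC ?scale0r ?if_same // => k _; rewrite compC scale0r if_same mul0r.
- by move=> s t u n; rewrite compD !compM -big_split /=; apply: eq_bigr => k _; rewrite compD mulrDl.
- by move=> s t u n; rewrite compD !compM -big_split /=; apply: eq_bigr => k _; rewrite compD mulrDr.
- by move=> c c' n; rewrite compD !compC; case: ifP => _; rewrite ?addr0 // scalerDl.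
- move=> c c' n; rewrite compM compC big_ord_recl subn0 !compC big1 ?addr0.
    by case: ifP => _; rewrite ?mulr0 // -pres_scaleAl mul1r scalerA.
  by move=> k _; rewrite compC mul0r.
- move=> c s n; rewrite !compM big_ord_recl subn0 compC big1 ?addr0.
    rewrite big_ord_recr /= subnn compC big1 ?add0r /=.
      by rewrite -pres_scaleAl -pres_scaleAr mul1r mulr1.
    by move=> k _; rewrite compC subn_eq0 leqNgt ltn_ord mulr0.
  by move=> k _; rewrite compC mul0r.
- by move=> s t st n; apply: hrel.
Qed.

Local Notation G := (presGalg deg rel).

Lemma gpr_pi n t : @gpr F G n (pi t) = pres_comp n t.
Proof. by apply: comp_eq; apply: pres_reprK. Qed.

Lemma comp_tcomp m n t : pres_comp m (tcomp deg t n) = if m == n then pres_comp n t else 0.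
Proof.
elim: t m n => [i|c|s IHs u IHu|s IHs u IHu] m n.
- rewrite /pres_comp /=; case: (deg i =P n) => [<-|ni] /=.
    by rewrite eq_sym; case: ifP.
  by case: (m == 0%N); rewrite ?if_same // pres_pi0 if_same.
- rewrite /= (fun_if (pres_comp m)) !compC; case: (n =P 0%N) => [->|_] //.
  by rewrite scale0r !if_same.
- by rewrite /= compD IHs IHu compD; case: ifP => // _; rewrite addr0.
rewrite [tcomp _ _ _]/=; set T := \big[_/_]_(_ < _) _.
have -> : pres_comp m T = \sum_(k < n.+1) pres_comp m (TMul (tcomp deg s k) (tcomp deg u (n - k))).
  rewrite /T; elim/big_rec2: _ => [|k y x _ <-]; first by rewrite compC scale0r if_same.
  by rewrite compD.
rewrite compM; case: (m =P n) => [->|mn].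
  apply: eq_bigr => k _; rewrite compM.
  have kn : (k < n.+1)%N by [].
  rewrite (bigD1 k) //= IHs IHu !eqxx big1 ?addr0 // => l lk.
  rewrite IHs; case: eqP => [e|]; last by rewrite mul0r.
  by case/eqP: lk; apply: val_inj.
rewrite big1 // => k _; rewrite compM big1 // => l _.
rewrite IHs IHu; case: eqP => [e|]; last by rewrite mul0r.
case: eqP => [e'|]; last by rewrite mulr0.
have kn : (k <= n)%N by rewrite -ltnS.
have lm : (l <= m)%N by rewrite -ltnS.
by case: mn; rewrite -(subnKC lm) e' e subnKC.
Qed.

Lemma comp_fin t : exists N, (forall n, (N <= n)%N -> pres_comp n t = 0) /\
  pi t = \sum_(n < N) pres_comp n t.
Proof.
elim: t => [i|c|s [N [hN sN]] u [M [hM uM]]|s [N [hN sN]] u [M [hM uM]]].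
- exists (deg i).+1; split=> [n /ltn_eqF ni|]; first by rewrite /pres_comp /= ni.
  rewrite big_ord_recr /= big1 ?add0r.
    by rewrite /pres_comp /= eqxx.
  by move=> k _; rewrite /pres_comp /= gtn_eqF.
- exists 1%N; split=> [[|n]|]; [by []|by move=> _; rewrite compC|].
  by rewrite big_ord1 compC pres_piC.
- exists (maxn N M); split=> [n|].
    by rewrite geq_max compD => /andP[/hN -> /hM ->]; rewrite addr0.
  rewrite pres_piD sN uM.
  rewrite (big_ord_widen (maxn N M) (fun n => pres_comp n s) (leq_maxl _ _)).
  rewrite (big_ord_widen (maxn N M) (fun n => pres_comp n u) (leq_maxr _ _)).
  rewrite big_mkcond [X in _ + X]big_mkcond -big_split /=.
  apply: eq_bigr => i _; rewrite compD.
  by case: ltnP => [_|/hN ->]; case: ltnP => [_|/hM ->].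
- have E n : pres_comp n (s * u)%P = \sum_(a < N + M) \sum_(b < N + M | (a + b == n)%N) pres_comp a s * pres_comp b u.
    rewrite compM; set L := maxn n.+1 (N + M).
    rewrite (@sum_antidiag _ _ L (fun a b => pres_comp a s * pres_comp b u)) ?leq_maxl //.
    rewrite [RHS](big_ord_widen L (fun a => \sum_(b < N + M | (a + b == n)%N) pres_comp a s * pres_comp b u)) ?leq_maxr //.
    rewrite [RHS]big_mkcond; apply: eq_bigr => a _; case: ltnP => [aN|/(leq_trans (leq_addr M N)) /hN a0].
      rewrite big_mkcond [RHS]big_mkcond /=.
      rewrite [RHS](big_ord_widen L (fun b => if (a + b == n)%N then pres_comp a s * pres_comp b u else 0)) ?leq_maxr //.
      rewrite [RHS]big_mkcond; apply: eq_bigr => b _.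
      case: ltnP => // /(leq_trans (leq_addl N M)) /hM b0.
      by rewrite b0 mulr0 if_same.
    by rewrite big1 // => b _; rewrite a0 mul0r.
  exists (N + M)%N; split=> [n NMn|].
    rewrite E big1 // => a _; rewrite big1 // => b /eqP ab.
    case: (leqP N a) => [/hN ->|aN]; first by rewrite mul0r.
    case: (leqP M b) => [/hM ->|bM]; first by rewrite mulr0.
    have : (a + b < N + M)%N by rewrite -addSn leq_add // ltnW.
    by rewrite ab ltnNge NMn.
  rewrite pres_piM sN uM; under [RHS]eq_bigr => n _ do rewrite E.
  rewrite [RHS]exchange_big /= mulr_suml.
  rewrite (big_ord_widen (N + M) (fun a => pres_comp a s * \sum_(b < M) pres_comp b u)) ?leq_addr //.
  rewrite big_mkcond; apply: eq_bigr => a _.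
  under [RHS]eq_bigr => n _ do rewrite big_mkcond.
  rewrite [RHS]exchange_big /=; case: ltnP => [aN|/hN a0]; last first.
    by rewrite big1 // => b _; rewrite big1 // => n _; rewrite a0 mul0r if_same.
  rewrite mulr_sumr (big_ord_widen (N + M) (fun b => pres_comp a s * pres_comp b u)) ?leq_addl //.
  rewrite big_mkcond; apply: eq_bigr => b _; case: ltnP => [bM|/hM b0]; last first.
    by rewrite big1 // => n _; rewrite b0 mulr0 if_same.
  have abN : (a + b < N + M)%N by rewrite -addSn leq_add // ltnW.
  rewrite (bigD1 (Ordinal abN)) //= eqxx big1 ?addr0 // => n nab.
  by case: eqP => // e; case/eqP: nab; apply: val_inj.
Qed.

Lemma pres_gmod : is_gmod G.
Proof.
split.
- move=> n a x y; rewrite (pres_piS x) (pres_piS y).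
  rewrite -[a *: _]pres_piZ -[_ + _]pres_piD !gpr_pi compD; congr (_ + _).
  rewrite compM big_ord_recl subn0 compC big1 ?addr0.
    by rewrite -pres_scaleAl mul1r.
  by move=> k _; rewrite compC mul0r.
- move=> m n x; rewrite (pres_piS x) gpr_pi /pres_comp gpr_pi -/(pres_comp n _).
  exact: comp_tcomp.
- move=> x; rewrite (pres_piS x); have [N [_ E]] := comp_fin (repr x).
  by exists N; rewrite {1}E; apply: eq_bigr => n _; rewrite gpr_pi.
Qed.

Lemma pres_galg : is_galg G.
Proof.
have mG := pres_gmod.
have gM n (x y : A) : @gpr F G n (x * y) = \sum_(k < n.+1) @gpr F G k x * @gpr F G (n - k) y.
  rewrite (pres_piS x) (pres_piS y) -pres_piM gpr_pi compM.
  by apply: eq_bigr => k _; rewrite !gpr_pi.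
split=> //.
- by move=> y a u v; rewrite /= mulrDl pres_scaleAl.
- by move=> y a u v; rewrite /= mulrDr pres_scaleAr.
- exact: mulrA.
- exact: mul1r.
- exact: mulr1.
- by rewrite /homog -[gone G]/(pi 1%P) gpr_pi compC scale1r.
move=> m n x y xm yn; rewrite /homog -[gmul x y]/((x : A) * (y : A)) gM.
have mn : (m < (m + n).+1)%N by rewrite ltnS leq_addr.
have E k : (k < (m + n).+1)%N -> k <> m -> @gpr F G k x = 0.
  by move=> _ km; rewrite (homog_gpr mG k xm); case: eqP.
have E0 : \sum_(k < (m + n).+1 | k != Ordinal mn) @gpr F G k x * @gpr F G (m + n - k) y = 0.
  apply: big1 => k km; rewrite (E k) ?mul0r //.
  by move=> e; case/eqP: km; apply: val_inj.
rewrite (bigD1 (Ordinal mn)) // E0.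
have -> : (m + n - Ordinal mn)%N = n by rewrite addKn.
by apply: etrans (addr0 _) _; congr (_ * _).
Qed.

Lemma pgen_homog i : @homog F G (deg i) (pgen rel i).
Proof. by rewrite /homog /pgen gpr_pi /pres_comp /= eqxx. Qed.

Lemma pres_generated : generated (A := G) (fun x => exists i, x = pgen rel i).
Proof.
move=> P P1 PZ PD PM PG x; rewrite (pres_piS x); elim: (repr x) => [i|c|s IHs u IHu|s IHs u IHu].
- by apply: PG; exists i.
- by rewrite pres_piC; apply: PZ.
- by rewrite pres_piD; apply: PD.
- by rewrite pres_piM; apply: PM.
Qed.

End Grading.
End Presented.

(** * Rewriting to normal form in algebras with quadratic relations *)

(* A monomial (c, e, w) stands for c q^e times the word w in letters coded by
   natural numbers. *)
Definition mono := (int * int * seq nat)%type.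
Definition lpoly := seq mono.

Fixpoint pins (c e : int) (w : seq nat) (p : lpoly) : lpoly :=
  if p is (c', e', w') :: p' then
    if (e == e') && (w == w') then
      if c + c' == 0 then p' else (c + c', e, w) :: p'
    else (c', e', w') :: pins c e w p'
  else [:: (c, e, w)].

Definition paddm (c e : int) (t p : lpoly) : lpoly :=
  foldr (fun (m : mono) acc => pins (c * m.1.1) (e + m.1.2) m.2 acc) p t.

Section Normalise.
(* rt a b l is the rewriting rule, if any, for the product of letters ab; l
   tells whether ab ends the word. *)
Variable rt : nat -> nat -> bool -> option lpoly.

(** Left multiplication of a polynomial by the letter x, rewriting the leading pair and pushing the
    letters of the replacement onto the rest in turn. The argument n is fuel: when it runs out the
    product is merely left unreduced, which is still sound. *)
Fixpoint push (n x : nat) (p : lpoly) : lpoly :=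
  if n is n'.+1 then
    foldr (fun (m : mono) acc =>
      if m.2 is y :: w then
        if rt x y (nilp w) is Some r then
          foldr (fun (m' : mono) acc' =>
            paddm (m.1.1 * m'.1.1) (m.1.2 + m'.1.2)
              (foldr (push n') [:: (1, 0, w)] m'.2) acc') acc r
        else pins m.1.1 m.1.2 (x :: m.2) acc
      else pins m.1.1 m.1.2 [:: x] acc) [::] p
  else [seq (m.1.1, m.1.2, x :: m.2) | m : mono <- p].

Definition nfact (n : nat) (t p : lpoly) : lpoly :=
  foldr (fun (m : mono) acc => paddm m.1.1 m.1.2 (foldr (push n) p m.2) acc) [::] t.

Definition snf (n : nat) (s : nat -> lpoly) (l : lpoly) : lpoly :=
  foldr (fun (m : mono) acc =>
    paddm m.1.1 m.1.2 (foldr (fun x => nfact n (s x)) [:: (1, 0, [::])] m.2) acc) [::] l.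

(** The fuel 40 only has to suffice for the checks below: too little could make a check fail, never
    succeed wrongly. *)
Definition vanishes (s : nat -> lpoly) (l : lpoly) : bool := nilp (snf 40 s l).
End Normalise.

Definition letter (n : nat) : lpoly := [:: (1, 0, [:: n])].

Section Evaluation.
Variables (F : fieldType) (q : F) (q0 : q != 0).

Definition zc (c e : int) : F := c%:~R * q ^ e.

Lemma zcM c e c' e' : zc (c * c') (e + e') = zc c e * zc c' e'.
Proof. by rewrite /zc rmorphM /= expfzDr // mulrACA. Qed.
Lemma zcD c c' e : zc (c + c') e = zc c e + zc c' e.
Proof. by rewrite /zc rmorphD /= mulrDl. Qed.
Lemma zc0 e : zc 0 e = 0. Proof. by rewrite /zc mul0r. Qed.
Lemma zc1 : zc 1 0 = 1. Proof. by rewrite /zc expr0z mul1r. Qed.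

Section Module.
Variables (M : lmodType F) (op : nat -> M -> M).

(** Letters are evaluated as operators on a module and not as elements of an algebra, so that one
    evaluation serves algebras, through left multiplication, and modules. *)
Definition pev (p : lpoly) (z : M) : M :=
  \sum_(m <- p) zc m.1.1 m.1.2 *: foldr op z m.2.

Lemma pev_nil z : pev [::] z = 0. Proof. exact: big_nil. Qed.
Lemma pev_cons c e w p z : pev ((c, e, w) :: p) z = zc c e *: foldr op z w + pev p z.
Proof. exact: big_cons. Qed.
Lemma pev_cat p p' z : pev (p ++ p') z = pev p z + pev p' z.
Proof. exact: big_cat. Qed.
Lemma pev1 z : pev [:: (1, 0, [::])] z = z.
Proof. by rewrite pev_cons pev_nil zc1 scale1r addr0. Qed.
Lemma pev_letter n z : pev (letter n) z = op n z.
Proof. by rewrite pev_cons pev_nil zc1 scale1r addr0. Qed.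

Lemma pev_pins c e w p z : pev (pins c e w p) z = zc c e *: foldr op z w + pev p z.
Proof.
elim: p => [|[[c' e'] w'] p IHp] /=; first by rewrite pev_cons.
rewrite pev_cons; case: ifP => [/andP[/eqP <- /eqP <-]|_].
  rewrite addrA -scalerDl -zcD; case: eqP => [->|_]; last by rewrite pev_cons.
  by rewrite zc0 scale0r add0r.
by rewrite pev_cons IHp addrCA.
Qed.

Lemma pev_paddm c e t p z : pev (paddm c e t p) z = zc c e *: pev t z + pev p z.
Proof.
elim: t => [|[[c' e'] w'] t IHt] /=; first by rewrite pev_nil scaler0 add0r.
by rewrite pev_pins IHt pev_cons scalerDr scalerA -zcM addrA.
Qed.

Hypothesis opl : forall n, linear (op n).

Lemma lf_foldr w : linear (foldr op ^~ w).
Proof.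
elim: w => [|x w IHw] /=; first exact: lf_id.
by apply: lf_comp (opl x) IHw.
Qed.

Lemma lf_pev p : linear (pev p).
Proof. by apply: lf_sum => m; apply: lf_scale; apply: lf_foldr. Qed.

Variables (rt : nat -> nat -> bool -> option lpoly) (z0 : M).
Hypothesis rtP : forall a b p, rt a b false = Some p -> forall z, op a (op b z) = pev p z.
Hypothesis rtP0 : forall a b p, rt a b true = Some p -> op a (op b z0) = pev p z0.

Lemma pev_push n x p : pev (push rt n x p) z0 = op x (pev p z0).
Proof.
elim: n x p => [|n IHn] x p /=.
  rewrite /pev big_map [RHS](lin_sum (opl x)).
  by apply: eq_bigr => m _; rewrite /= (linZ (opl x)).
have IHw w t : pev (foldr (push rt n) t w) z0 = foldr op (pev t z0) w.
  by elim: w => //= y w IHw; rewrite IHn IHw.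
elim: p => [|[[c e] w] p IHp] /=; first by rewrite pev_nil (lin0 (opl x)).
rewrite pev_cons (linD (opl x)) (linZ (opl x)) -IHp.
case: w => [|y w] /=; first by rewrite pev_pins.
case E: (rt x y _) => [r|]; last by rewrite pev_pins.
have -> : op x (op y (foldr op z0 w)) = pev r (foldr op z0 w).
  by case: w E => [|y' w] E /=; [apply: rtP0 | apply: rtP].
elim: r {E} => [|[[c' e'] w'] r IHr] /=; first by rewrite pev_nil scaler0 add0r.
rewrite pev_paddm IHr IHw [pev [:: _] _]pev_cons pev_nil addr0 zc1 scale1r.
by rewrite [pev (_ :: r) _]pev_cons scalerDr addrA scalerA zcM.
Qed.

Lemma pev_foldr_push n t w : pev (foldr (push rt n) t w) z0 = foldr op (pev t z0) w.
Proof. by elim: w => //= y w IHw; rewrite pev_push IHw. Qed.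

Lemma pev_nfact n t p : pev (nfact rt n t p) z0 = pev t (pev p z0).
Proof.
elim: t => [|[[c e] w] t IHt] /=; first by rewrite !pev_nil.
by rewrite pev_paddm IHt pev_foldr_push pev_cons.
Qed.

End Module.

Lemma eq_pev (M : lmodType F) (op op' : nat -> M -> M) p z :
  (forall n z, op n z = op' n z) -> pev op p z = pev op' p z.
Proof.
move=> E; apply: eq_bigr => m _; congr (_ *: _).
by elim: m.2 => //= x w ->.
Qed.

Lemma pev_snf (M : lmodType F) (op : nat -> M -> M) rt z0 n s l :
  (forall n, linear (op n)) ->
  (forall a b p, rt a b false = Some p -> forall z, op a (op b z) = pev op p z) ->
  (forall a b p, rt a b true = Some p -> op a (op b z0) = pev op p z0) ->
  pev op (snf rt n s l) z0 = pev (fun n => pev op (s n)) l z0.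
Proof.
move=> opl H1 H2.
have IHw w : pev op (foldr (fun x => nfact rt n (s x)) [:: (1, 0, [::])] w) z0 =
    foldr (fun n => pev op (s n)) z0 w.
  by elim: w => [|y w IHw] /=; [apply: pev1 | rewrite pev_nfact // IHw].
elim: l => [|[[c e] w] l IHl] /=; first by rewrite !pev_nil.
by rewrite pev_paddm IHl IHw [RHS]pev_cons.
Qed.

Lemma vanishesP (M : lmodType F) (op : nat -> M -> M) rt z0 s l :
  (forall n, linear (op n)) ->
  (forall a b p, rt a b false = Some p -> forall z, op a (op b z) = pev op p z) ->
  (forall a b p, rt a b true = Some p -> op a (op b z0) = pev op p z0) ->
  vanishes rt s l -> pev (fun n => pev op (s n)) l z0 = 0.
Proof.
by move=> opl H1 H2 /nilP v; rewrite -(pev_snf (rt := rt) 40) // v pev_nil.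
Qed.

Lemma pev_map (M N : lmodType F) (op : nat -> M -> M) (op' : nat -> N -> N) (f : M -> N) p z :
  linear f -> (forall n z, f (op n z) = op' n (f z)) -> f (pev op p z) = pev op' p (f z).
Proof.
move=> fl fM; rewrite (lin_sum fl); apply: eq_bigr => m _.
by rewrite (linZ fl); congr (_ *: _); elim: m.2 => //= x w <-.
Qed.

Definition rules (U : lmodType F) (mul : U -> U -> U) (ev : nat -> U)
    (r : nat -> nat -> option lpoly) : Prop :=
  forall a b p, r a b = Some p ->
    forall z, mul (ev a) (mul (ev b) z) = pev (fun n => mul (ev n)) p z.

(* The rules need not be confluent: only soundness of the reduction to zero is
   used.  Letter n of l stands for the polynomial s n. *)
Definition reduces (r : nat -> nat -> option lpoly) s l :=
  vanishes (fun a b _ => r a b) s l.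

Lemma reducesP (U : lmodType F) (mul : U -> U -> U) one (ev g : nat -> U) r s l :
  is_alg mul one -> rules mul ev r ->
  (forall n z, mul (g n) z = pev (fun n => mul (ev n)) (s n) z) ->
  reduces r s l -> forall z, pev (fun n => mul (g n)) l z = 0.
Proof.
move=> aU hr gE hv z; rewrite (eq_pev (op' := fun n => pev (fun n => mul (ev n)) (s n))) //.
apply: vanishesP hv => [n|a b p E y|a b p E]; first exact: alg_mulr aU _.
  exact: hr.
exact: hr.
Qed.

Lemma pev_alg (U : lmodType F) (mul : U -> U -> U) one (ev : nat -> U) p z :
  is_alg mul one -> mul (pev (fun n => mul (ev n)) p one) z = pev (fun n => mul (ev n)) p z.
Proof.
move=> aU; rewrite -[in RHS](alg_mul1l aU z).
apply: (pev_map (f := fun x => mul x z)) => [|n y]; first exact: alg_mull aU _.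
by rewrite (alg_mulA aU).
Qed.

Lemma pev_alg0 (U : lmodType F) (mul : U -> U -> U) one (ev : nat -> U) p :
  is_alg mul one -> pev (fun n => mul (ev n)) p one = 0 ->
  forall z, pev (fun n => mul (ev n)) p z = 0.
Proof. by move=> aU E z; rewrite -(pev_alg _ _ _ aU) E (lin0 (alg_mull aU z)). Qed.

End Evaluation.

(** * Linear identities in a module *)

Section ModuleReflection.
Variables (F : fieldType) (M : lmodType F).
Inductive mexp :=
  MVar of nat | MZero | MAdd of mexp & mexp | MOpp of mexp | MScale of F & mexp.

Fixpoint mev (env : seq M) (e : mexp) : M :=
  match e with
  | MVar n => nth 0 env n
  | MZero => 0
  | MAdd a b => mev env a + mev env b
  | MOpp a => - mev env a
  | MScale c a => c *: mev env a
  end.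

Fixpoint mco (e : mexp) (i : nat) : F :=
  match e with
  | MVar n => if n == i then 1 else 0
  | MZero => 0
  | MAdd a b => mco a i + mco b i
  | MOpp a => - mco a i
  | MScale c a => c * mco a i
  end.

Lemma mevE env e : mev env e = \sum_(i < size env) mco e i *: env`_i.
Proof.
elim: e => [n||a IHa b IHb|a IHa|c a IHa] /=.
- have [ne|ne] := ltnP n (size env).
    rewrite (bigD1 (Ordinal ne)) //= eqxx scale1r big1 ?addr0 // => i ni.
    by case: eqP => [e|]; [case/eqP: ni; apply: val_inj | rewrite scale0r].
  rewrite nth_default // big1 // => i _; case: eqP => [e|]; last by rewrite scale0r.
  by move: (ltn_ord i); rewrite -e ltnNge ne.
- by rewrite big1 // => i _; rewrite scale0r.
- by rewrite IHa IHb -big_split; apply: eq_bigr => i _; rewrite scalerDl.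
- by rewrite IHa -sumrN; apply: eq_bigr => i _; rewrite scaleNr.
- by rewrite IHa scaler_sumr; apply: eq_bigr => i _; rewrite scalerA.
Qed.

Fixpoint meqs (a b : mexp) (n : nat) : Prop :=
  if n is n'.+1 then mco a n' = mco b n' /\ meqs a b n' else True.

(** Comparing the coefficient of each atom is sufficient, not necessary: possible linear relations
    between atoms are ignored, and only scalar identities remain. *)
Lemma meqsP env a b : meqs a b (size env) -> mev env a = mev env b.
Proof.
move=> h; rewrite !mevE; apply: eq_bigr => i _; congr (_ *: _).
elim: (size env) (nat_of_ord i) (ltn_ord i) h => // n IHn j jn /= [h0 h].
by move: jn; rewrite ltnS leq_eqVlt => /orP[/eqP->//|jn]; apply: IHn.
Qed.
End ModuleReflection.

Ltac atom_in x l :=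
  lazymatch l with
  | nil => constr:(false)
  | x :: _ => constr:(true)
  | _ :: ?l' => atom_in x l'
  end.
Ltac atom_idx x l :=
  lazymatch l with
  | x :: _ => constr:(O)
  | _ :: ?l' => let n := atom_idx x l' in constr:(S n)
  end.
Ltac matoms l e :=
  lazymatch e with
  | GRing.add ?a ?b => let l1 := matoms l a in matoms l1 b
  | GRing.opp ?a => matoms l a
  | GRing.scale _ ?a => matoms l a
  | GRing.zero => l
  | _ => lazymatch atom_in e l with true => l | false => constr:(cons e l) end
  end.
Ltac mreify F l e :=
  lazymatch e with
  | GRing.add ?a ?b => let a' := mreify F l a in let b' := mreify F l b in constr:(@MAdd F a' b')
  | GRing.opp ?a => let a' := mreify F l a in constr:(@MOpp F a')
  | GRing.scale ?c ?a => let a' := mreify F l a in constr:(@MScale F c a')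
  | GRing.zero => constr:(@MZero F)
  | _ => let n := atom_idx e l in constr:(@MVar F n)
  end.
Ltac modred F M :=
  lazymatch goal with |- ?a = ?b =>
    let l0 := matoms (@nil M) a in let l := matoms l0 b in
    let a' := mreify F l a in let b' := mreify F l b in
    apply: (@meqsP F M l a' b'); rewrite /=; repeat split
  end.
(* Decides equalities between linear combinations, up to identities between
   their coefficients. *)
Ltac modeq M :=
  lazymatch type of M with
  | GRing.Lmodule.type ?F => modred F M; try by [ring | field; assumption]
  end.

(** * The generators and relations of both calculi *)

Section Tables.
Local Open Scope nat_scope.
Local Notation mk c e w := (c%Z, e%Z, w) (only parsing).

(* The letters 0, 1, 2, 3 are a, b, c, d, 4 is the inverse of the quantum
   determinant 9, 5, 6, 7, 8 are the differentials of a, b, c, d, and 10, 11,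
   12, 13 are x_1, x_2, dx_1, dx_2.  Row number n of a table of rules has the
   pairs (m, p) such that the product nm is rewritten to p; the rows of RBtab
   and rhotab are shifted by 10. *)
Definition RKtab : seq (seq (nat * lpoly)) := [::
  [:: (1, [:: mk 1 (-1) [:: 1; 0]]);
    (2, [:: mk 1 (-1) [:: 2; 0]]);
    (3, [:: mk 1 (-1) [:: 1; 2]; mk 1 0 [:: 9]]);
    (4, [:: mk 1 0 [:: 4; 0]]);
    (9, [:: mk 1 0 [:: 9; 0]])];
  [:: (4, [:: mk 1 0 [:: 4; 1]]);
    (9, [:: mk 1 0 [:: 9; 1]])];
  [:: (1, [:: mk 1 0 [:: 1; 2]]);
    (4, [:: mk 1 0 [:: 4; 2]]);
    (9, [:: mk 1 0 [:: 9; 2]])];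
  [:: (0, [:: mk 1 1 [:: 1; 2]; mk 1 0 [:: 9]]);
    (1, [:: mk 1 1 [:: 1; 3]]);
    (2, [:: mk 1 1 [:: 2; 3]]);
    (4, [:: mk 1 0 [:: 4; 3]]);
    (9, [:: mk 1 0 [:: 9; 3]])];
  [:: (9, [:: mk 1 0 [::]])];
  [:: (0, [:: mk 1 2 [:: 0; 5]]);
    (1, [:: mk 1 1 [:: 1; 5]]);
    (2, [:: mk 1 1 [:: 2; 5]]);
    (3, [:: mk 1 0 [:: 3; 5]]);
    (4, [:: mk 1 (-2) [:: 4; 5]]);
    (5, [::]);
    (6, [:: mk (-1) 1 [:: 6; 5]]);
    (7, [:: mk (-1) 1 [:: 7; 5]]);
    (8, [:: mk (-1) 0 [:: 8; 5]]);
    (9, [:: mk 1 2 [:: 9; 5]])];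
  [:: (0, [:: mk 1 1 [:: 0; 6]; mk (-1) 0 [:: 1; 5]; mk 1 2 [:: 1; 5]]);
    (1, [:: mk 1 2 [:: 1; 6]]);
    (2, [:: mk 1 0 [:: 2; 6]; mk (-1) (-1) [:: 3; 5]; mk 1 1 [:: 3; 5]]);
    (3, [:: mk 1 1 [:: 3; 6]]);
    (4, [:: mk 1 (-2) [:: 4; 6]]);
    (6, [::]);
    (7, [:: mk (-1) 0 [:: 7; 6]; mk 1 (-1) [:: 8; 5]; mk (-1) 1 [:: 8; 5]]);
    (8, [:: mk (-1) 1 [:: 8; 6]]);
    (9, [:: mk 1 2 [:: 9; 6]])];
  [:: (0, [:: mk 1 1 [:: 0; 7]; mk (-1) 0 [:: 2; 5]; mk 1 2 [:: 2; 5]]);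
    (1, [:: mk 1 0 [:: 1; 7]; mk (-1) (-1) [:: 3; 5]; mk 1 1 [:: 3; 5]]);
    (2, [:: mk 1 2 [:: 2; 7]]);
    (3, [:: mk 1 1 [:: 3; 7]]);
    (4, [:: mk 1 (-2) [:: 4; 7]]);
    (7, [::]);
    (8, [:: mk (-1) 1 [:: 8; 7]]);
    (9, [:: mk 1 2 [:: 9; 7]])];
  [:: (0, [:: mk 1 0 [:: 0; 8]; mk (-1) (-1) [:: 1; 7]; mk 1 1 [:: 1; 7]; mk (-1) (-1) [:: 2; 6]; mk 1 1 [:: 2; 6]; mk 1 (-2) [:: 3; 5]; mk (-2) 0 [:: 3; 5]; mk 1 2 [:: 3; 5]]);
    (1, [:: mk 1 1 [:: 1; 8]; mk (-1) 0 [:: 3; 6]; mk 1 2 [:: 3; 6]]);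
    (2, [:: mk 1 1 [:: 2; 8]; mk (-1) 0 [:: 3; 7]; mk 1 2 [:: 3; 7]]);
    (3, [:: mk 1 2 [:: 3; 8]]);
    (4, [:: mk 1 (-2) [:: 4; 8]]);
    (8, [::]);
    (9, [:: mk 1 2 [:: 9; 8]])];
  [:: (4, [:: mk 1 0 [::]])]].

Definition RBtab : seq (seq (nat * lpoly)) := [::
  [::];
  [:: (10, [:: mk 1 1 [:: 10; 11]])];
  [:: (10, [:: mk 1 2 [:: 10; 12]]);
    (11, [:: mk 1 1 [:: 11; 12]]);
    (12, [::])];
  [:: (10, [:: mk 1 1 [:: 10; 13]; mk (-1) 0 [:: 11; 12]; mk 1 2 [:: 11; 12]]);
    (11, [:: mk 1 2 [:: 11; 13]]);
    (12, [:: mk (-1) (-1) [:: 12; 13]]);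
    (13, [::])]].

(* The rules that can be read off the relations one at a time; RKtab, in which
   the determinant is a letter, is derived from them. *)
Definition RK0tab : seq (seq (nat * lpoly)) := [::
  [::];
  [:: (0, [:: mk 1 1 [:: 0; 1]])];
  [:: (0, [:: mk 1 1 [:: 0; 2]]);
    (1, [:: mk 1 0 [:: 1; 2]])];
  [:: (0, [:: mk 1 0 [:: 0; 3]; mk (-1) (-1) [:: 1; 2]; mk 1 1 [:: 1; 2]]);
    (1, [:: mk 1 1 [:: 1; 3]]);
    (2, [:: mk 1 1 [:: 2; 3]])];
  [::];
  [:: (0, [:: mk 1 2 [:: 0; 5]]);
    (1, [:: mk 1 1 [:: 1; 5]]);
    (2, [:: mk 1 1 [:: 2; 5]]);
    (3, [:: mk 1 0 [:: 3; 5]]);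
    (5, [::]);
    (6, [:: mk (-1) 1 [:: 6; 5]]);
    (7, [:: mk (-1) 1 [:: 7; 5]]);
    (8, [:: mk (-1) 0 [:: 8; 5]])];
  [:: (0, [:: mk 1 1 [:: 0; 6]; mk (-1) 0 [:: 1; 5]; mk 1 2 [:: 1; 5]]);
    (1, [:: mk 1 2 [:: 1; 6]]);
    (2, [:: mk 1 0 [:: 2; 6]; mk (-1) (-1) [:: 3; 5]; mk 1 1 [:: 3; 5]]);
    (3, [:: mk 1 1 [:: 3; 6]]);
    (6, [::]);
    (7, [:: mk (-1) 0 [:: 7; 6]; mk 1 (-1) [:: 8; 5]; mk (-1) 1 [:: 8; 5]]);
    (8, [:: mk (-1) 1 [:: 8; 6]])];
  [:: (0, [:: mk 1 1 [:: 0; 7]; mk (-1) 0 [:: 2; 5]; mk 1 2 [:: 2; 5]]);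
    (1, [:: mk 1 0 [:: 1; 7]; mk (-1) (-1) [:: 3; 5]; mk 1 1 [:: 3; 5]]);
    (2, [:: mk 1 2 [:: 2; 7]]);
    (3, [:: mk 1 1 [:: 3; 7]]);
    (7, [::]);
    (8, [:: mk (-1) 1 [:: 8; 7]])];
  [:: (0, [:: mk 1 0 [:: 0; 8]; mk (-1) (-1) [:: 1; 7]; mk 1 1 [:: 1; 7]; mk (-1) (-1) [:: 2; 6]; mk 1 1 [:: 2; 6]; mk 1 (-2) [:: 3; 5]; mk (-2) 0 [:: 3; 5]; mk 1 2 [:: 3; 5]]);
    (1, [:: mk 1 1 [:: 1; 8]; mk (-1) 0 [:: 3; 6]; mk 1 2 [:: 3; 6]]);
    (2, [:: mk 1 1 [:: 2; 8]; mk (-1) 0 [:: 3; 7]; mk 1 2 [:: 3; 7]]);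
    (3, [:: mk 1 2 [:: 3; 8]]);
    (8, [::])]].

(** The relations of [gl2_rel], in the order of its constructors, each as a polynomial that is to
    vanish. *)
Definition gl2l : seq lpoly := [::
  [:: mk (-1) 1 [:: 0; 1]; mk 1 0 [:: 1; 0]];
  [:: mk (-1) 1 [:: 0; 2]; mk 1 0 [:: 2; 0]];
  [:: mk (-1) 1 [:: 1; 3]; mk 1 0 [:: 3; 1]];
  [:: mk (-1) 1 [:: 2; 3]; mk 1 0 [:: 3; 2]];
  [:: mk (-1) 0 [:: 1; 2]; mk 1 0 [:: 2; 1]];
  [:: mk (-1) 0 [:: 0; 3]; mk 1 (-1) [:: 1; 2]; mk (-1) 1 [:: 1; 2]; mk 1 0 [:: 3; 0]];
  [:: mk (-1) 0 [::]; mk 1 0 [:: 0; 3; 4]; mk (-1) (-1) [:: 1; 2; 4]];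
  [:: mk (-1) 0 [::]; mk 1 0 [:: 4; 0; 3]; mk (-1) (-1) [:: 4; 1; 2]]].

Definition relB : seq lpoly := [::
  [:: mk (-1) 1 [:: 10; 11]; mk 1 0 [:: 11; 10]];
  [:: mk (-1) 2 [:: 10; 12]; mk 1 0 [:: 12; 10]];
  [:: mk (-1) 2 [:: 11; 13]; mk 1 0 [:: 13; 11]];
  [:: mk (-1) 1 [:: 11; 12]; mk 1 0 [:: 12; 11]];
  [:: mk (-1) 1 [:: 10; 13]; mk 1 0 [:: 11; 12]; mk (-1) 2 [:: 11; 12]; mk 1 0 [:: 13; 10]];
  [:: mk 1 0 [:: 12; 12]];
  [:: mk 1 0 [:: 13; 13]];
  [:: mk 1 (-1) [:: 12; 13]; mk 1 0 [:: 13; 12]]].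

(* Row v, column g: the letter v acted upon by the letter g; the values at 4
   and 9 are forced by the others. *)
Definition rhotab : seq (seq lpoly) := [::
  [:: [:: mk 1 (-2) [:: 10]]; [:: mk 1 (-2) [:: 11]; mk (-1) 0 [:: 11]]; [::]; [:: mk 1 (-1) [:: 10]]; [:: mk 1 3 [:: 10]]; [:: mk 1 (-2) [:: 12]; mk (-1) 0 [:: 12]]; [:: mk 1 (-2) [:: 13]; mk (-1) 0 [:: 13]]; [::]; [::]; [:: mk 1 (-3) [:: 10]]];
  [:: [:: mk 1 (-1) [:: 11]]; [::]; [::]; [:: mk 1 (-2) [:: 11]]; [:: mk 1 3 [:: 11]]; [::]; [::]; [:: mk 1 (-2) [:: 12]; mk (-1) 0 [:: 12]]; [:: mk 1 (-2) [:: 13]; mk (-1) 0 [:: 13]]; [:: mk 1 (-3) [:: 11]]];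
  [:: [:: mk 1 0 [:: 12]]; [::]; [::]; [:: mk 1 (-1) [:: 12]]; [:: mk 1 1 [:: 12]]; [::]; [::]; [::]; [::]; [:: mk 1 (-1) [:: 12]]];
  [:: [:: mk 1 (-1) [:: 13]]; [::]; [:: mk (-1) (-2) [:: 12]; mk 1 0 [:: 12]]; [:: mk 1 0 [:: 13]]; [:: mk 1 1 [:: 13]]; [::]; [::]; [::]; [::]; [:: mk 1 (-1) [:: 13]]]].

(* The antipode of each letter; for the differentials,
   S(dt) = d S(t) = - S(t) (dt) S(t). *)
Definition antitab : seq lpoly := [::
  [:: mk 1 0 [:: 4; 3]];
  [:: mk (-1) 1 [:: 4; 1]];
  [:: mk (-1) (-1) [:: 4; 2]];
  [:: mk 1 0 [:: 4; 0]];
  [:: mk 1 0 [:: 9]];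
  [:: mk (-1) (-1) [:: 4; 4; 1; 2; 8]; mk 1 (-2) [:: 4; 4; 1; 3; 7]; mk 1 (-2) [:: 4; 4; 2; 3; 6]; mk (-1) (-4) [:: 4; 4; 3; 3; 5]];
  [:: mk 1 (-1) [:: 4; 4; 1; 0; 8]; mk (-1) (-2) [:: 4; 4; 1; 1; 7]; mk (-1) (-2) [:: 4; 4; 1; 2; 6]; mk 1 (-3) [:: 4; 4; 1; 3; 5]; mk (-1) (-1) [:: 4; 6]];
  [:: mk (-1) (-4) [:: 4; 4; 1; 2; 7]; mk 1 (-3) [:: 4; 4; 2; 0; 8]; mk (-1) (-4) [:: 4; 4; 2; 2; 6]; mk 1 (-5) [:: 4; 4; 2; 3; 5]; mk (-1) (-3) [:: 4; 7]];
  [:: mk (-1) (-2) [:: 4; 4; 0; 0; 8]; mk 1 (-4) [:: 4; 4; 1; 0; 7]; mk (-1) (-5) [:: 4; 4; 1; 2; 5]; mk 1 (-4) [:: 4; 4; 2; 0; 6]; mk (-1) (-4) [:: 4; 5]; mk 1 (-2) [:: 4; 5]]].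

End Tables.

Definition tlook (T : seq (seq (nat * lpoly))) (a b : nat) : option lpoly :=
  (fix find (s : seq (nat * lpoly)) :=
     if s is e :: s' then if e.1 == b then Some e.2 else find s' else None) (nth [::] T a).

Definition tall (T : seq (seq (nat * lpoly))) (P : nat -> nat -> lpoly -> bool) : bool :=
  all (fun a => all (fun e => P a e.1 e.2) (nth [::] T a)) (iota 0 (size T)).

Lemma tallP T P : tall T P -> forall a b p, tlook T a b = Some p -> P a b p.
Proof.
move=> /allP h a b p; rewrite /tlook.
case: (ltnP a (size T)) => [aT|Ta]; last by rewrite nth_default.
have {h} := h a; rewrite mem_iota => /(_ aT).
elim: (nth [::] T a) => // e s IHs /= /andP[Pe Ps].
by case: eqP => [<- [<-]|_]; [|apply: IHs].
Qed.

Definition RK := tlook RKtab.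
Definition RK0 := tlook RK0tab.
Definition RB (a b : nat) := if (a < 10)%N then None else tlook RBtab (a - 10) b.
Definition noRule (a b : nat) : option lpoly := None.

Definition lodd (n : nat) : bool := n \in [:: 5; 6; 7; 8; 12; 13]%N.
Definition ldeg (n : nat) : nat := lodd n.
Definition gensK := [:: 0; 1; 2; 3; 4; 5; 6; 7; 8]%N.
Definition gensB := [:: 10; 11; 12; 13]%N.

Definition tl (i j : 'I_2) : nat := (i.*2 + j)%N.
Definition dl (i j : 'I_2) : nat := (5 + tl i j)%N.
Definition xl (i : 'I_2) : nat := (10 + i)%N.
Definition yl (i : 'I_2) : nat := (12 + i)%N.
Lemma xl1 : xl i1 = 10%N. Proof. by []. Qed.
Lemma xl2 : xl i2 = 11%N. Proof. by []. Qed.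
Lemma yl1 : yl i1 = 12%N. Proof. by []. Qed.
Lemma yl2 : yl i2 = 13%N. Proof. by []. Qed.
Definition xlE := (xl1, xl2, yl1, yl2).
Lemma tl11 : tl i1 i1 = 0%N. Proof. by []. Qed.
Lemma tl12 : tl i1 i2 = 1%N. Proof. by []. Qed.
Lemma tl21 : tl i2 i1 = 2%N. Proof. by []. Qed.
Lemma tl22 : tl i2 i2 = 3%N. Proof. by []. Qed.
Lemma dl11 : dl i1 i1 = 5%N. Proof. by []. Qed.
Lemma dl12 : dl i1 i2 = 6%N. Proof. by []. Qed.
Lemma dl21 : dl i2 i1 = 7%N. Proof. by []. Qed.
Lemma dl22 : dl i2 i2 = 8%N. Proof. by []. Qed.
Definition tlE := (tl11, tl12, tl21, tl22, dl11, dl12, dl21, dl22).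

Definition oi : seq 'I_2 := [:: i1; i2].

Lemma ord2P (P : 'I_2 -> Prop) : P i1 -> P i2 -> forall i, P i.
Proof.
move=> P1 P2 i; have [->//|/eqP n1] := eqVneq i i1.
suff -> : i = i2 by [].
by case: i n1 => [[|[]] // h] // n1; apply: val_inj => //; case: n1; apply: val_inj.
Qed.

Lemma sum2 (V : zmodType) (f : 'I_2 -> V) : \sum_i f i = f i1 + f i2.
Proof. by rewrite !big_ord_recl big_ord0 addr0; congr (_ + f _); apply: val_inj. Qed.

Definition Rl (i j k l : 'I_2) : seq (int * int) :=
  if (i == j) && (k == l) then (if i == k then [:: (1, 1)] else [:: (1, 0)])
  else if [&& i == i1, j == i2, k == i2 & l == i1] then [:: (1, 1); (-1, -1)] else [::].

(** The R-matrix expression of the calculus, times s, generated by running over all indices. The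
    relations of the calculus are thus computed from the R-matrix, and [pev_RRl] ties the
    computation to [Rmx]. *)
Definition RRl (s : int) (u v : 'I_2 -> 'I_2 -> nat) (i j k l : 'I_2) : lpoly :=
  flatten [seq flatten [seq flatten [seq flatten [seq
    flatten [seq [seq (s * (c.1 * c'.1), c.2 + c'.2, [:: u b n; v a m])
            | c' <- Rl m j n l] | c <- Rl k b i a]
    | n <- oi] | m <- oi] | b <- oi] | a <- oi].

Definition rdtt (x : 'I_2 * 'I_2 * 'I_2 * 'I_2) : lpoly :=
  let: (i, j, k, l) := x in (1, 0, [:: dl i j; tl k l]) :: RRl (-1) tl dl i j k l.
Definition rdtdt (x : 'I_2 * 'I_2 * 'I_2 * 'I_2) : lpoly :=
  let: (i, j, k, l) := x in (1, 0, [:: dl i j; dl k l]) :: RRl 1 dl dl i j k l.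
Definition o4 : seq ('I_2 * 'I_2 * 'I_2 * 'I_2) :=
  [seq (x, l) | x <- [seq (x, k) | x <- [seq (i, j) | i <- oi, j <- oi], k <- oi], l <- oi].
Definition relK : seq lpoly := gl2l ++ [seq rdtt x | x <- o4] ++ [seq rdtdt x | x <- o4].

(** * Relations between terms and vanishing polynomials *)

Section Links.
Variables (F : fieldType) (q : F) (q0 : q != 0).
Local Notation pev := (pev q).

(* The pterm relation s = t is the vanishing of l. *)
Definition same (I : Type) (code : I -> nat) (s t : pterm F I) (l : lpoly) : Prop :=
  forall (M : lmodType F) (op : nat -> M -> M), (forall n, linear (op n)) ->
  forall z, tact (fun i => op (code i)) s z - tact (fun i => op (code i)) t z = pev op l z.

Definition ogl2_code (g : ogl2_gen) : nat :=
  match g with OGLt i j => tl i j | OGLDi => 4 | OGLdt i j => dl i j end.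
Definition gl2_code (g : gl2_gen) : nat := match g with GLt i j => tl i j | GLDi => 4 end.
Definition oplane_code (g : oplane_gen) : nat :=
  match g with OPx i => xl i | OPdx i => yl i end.

Lemma zcN c e : zc q (- c) e = - zc q c e.
Proof. by rewrite /zc rmorphN mulNr. Qed.
Lemma zc1e e : zc q 1 e = q ^ e. Proof. by rewrite /zc mul1r. Qed.

Lemma zcp e : zc q (Posz 1) e = q ^ e. Proof. exact: zc1e. Qed.
Lemma zcm e : zc q (Negz 0) e = - q ^ e. Proof. by rewrite -zc1e -zcN. Qed.
Definition zcE := (zcp, zcm, (erefl : q ^ Posz 0 = 1), (erefl : q ^ Posz 1 = q),
  (erefl : q ^ Posz 2 = q ^+ 2), (erefl : q ^ Negz 0 = q^-1), (erefl : q ^ Negz 1 = q ^- 2)).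

(** Stated for an arbitrary type of generators because these relations occur both in C_q[GL_2] and
    among those of its calculus. *)
Lemma gl2_same (I : Type) (code : I -> nat) (t : 'I_2 -> 'I_2 -> I) (Di : I) :
  (forall i j, code (t i j) = tl i j) -> code Di = 4%N ->
  (forall s u, gl2_rel q (fun i j => TGen (t i j)) (TGen Di) s u ->
    exists2 l, l \in gl2l & same code s u l) /\
  (forall l, l \in gl2l ->
    exists s u, gl2_rel q (fun i j => TGen (t i j)) (TGen Di) s u /\ same code s u l).
Proof.
move=> ct cD.
pose T i j := @TGen F I (t i j); pose D' := @TGen F I Di.
have [H0 H1 H2 H3] : [/\ same code (T i2 i1 * T i1 i1)%P (q *: (T i1 i1 * T i2 i1))%P (nth [::] gl2l 1),
  same code (T i1 i2 * T i1 i1)%P (q *: (T i1 i1 * T i1 i2))%P (nth [::] gl2l 0),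
  same code (T i2 i2 * T i1 i2)%P (q *: (T i1 i2 * T i2 i2))%P (nth [::] gl2l 2) &
  same code (T i2 i2 * T i2 i1)%P (q *: (T i2 i1 * T i2 i2))%P (nth [::] gl2l 3)].
  by split=> M op opl z; rewrite /= !ct !pev_cons pev_nil /= !zcE !tlE; modeq M.
have [H4 H5] : same code (T i2 i1 * T i1 i2)%P (T i1 i2 * T i2 i1)%P (nth [::] gl2l 4) /\
  same code (T i2 i2 * T i1 i1)%P (T i1 i1 * T i2 i2 + (q - q^-1)%R *: (T i1 i2 * T i2 i1))%P (nth [::] gl2l 5).
  by split=> M op opl z; rewrite /= !ct !pev_cons pev_nil /= !zcE !tlE; modeq M.
have [H6 H7] : same code ((T i1 i1 * T i2 i2 + (- q^-1)%R *: (T i1 i2 * T i2 i1)) * D')%P 1%P (nth [::] gl2l 6) /\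
   same code (D' * (T i1 i1 * T i2 i2 + (- q^-1)%R *: (T i1 i2 * T i2 i1)))%P 1%P (nth [::] gl2l 7).
  split=> M op opl z; rewrite /= !ct !cD !pev_cons pev_nil /= !zcE !tlE.
    by modeq M.
  by rewrite (linD (opl _)) (linZ (opl _)); modeq M.
split.
  move=> s u []; [exists (nth [::] gl2l 0) | exists (nth [::] gl2l 1) | exists (nth [::] gl2l 2)
   | exists (nth [::] gl2l 3) | exists (nth [::] gl2l 4) | exists (nth [::] gl2l 5)
   | exists (nth [::] gl2l 6) | exists (nth [::] gl2l 7)] => //; exact: mem_nth.
move=> l /(nthP [::])[n]; case: n => [|[|[|[|[|[|[|[|n]]]]]]]] // _ <-;
 eexists; eexists; split; [exact: gl2_ba| exact: H1 | exact: gl2_ca | exact: H0 | exact: gl2_db | exact: H2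
  | exact: gl2_dc | exact: H3 | exact: gl2_cb | exact: H4 | exact: gl2_da | exact: H5 | exact: gl2_Dr | exact: H6 | exact: gl2_Dl | exact: H7].
Qed.

Lemma tact_sum (I : Type) (M : lmodType F) (op : I -> M -> M) (J : Type) (r : seq J)
    (f : J -> pterm F I) z :
  tact op (\big[@TAdd F I/0%P]_(j <- r) f j) z = \sum_(j <- r) tact op (f j) z.
Proof. by elim/big_rec2: _ => [|j x y _ <-] //=; rewrite scale0r. Qed.

Lemma pev_flatten (M : lmodType F) (op : nat -> M -> M) (J : Type) (r : seq J) (f : J -> lpoly) z :
  pev op (flatten [seq f j | j <- r]) z = \sum_(j <- r) pev op (f j) z.
Proof. by elim: r => [|j r IHr] /=; rewrite ?big_nil ?pev_nil // pev_cat IHr big_cons. Qed.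

Lemma sum_oi (V : zmodType) (f : 'I_2 -> V) : \sum_(i <- oi) f i = \sum_i f i.
Proof. by rewrite sum2 !big_cons big_nil addr0. Qed.

Lemma RlE i j k l : \sum_(c <- Rl i j k l) zc q c.1 c.2 = Rmx q i j k l.
Proof.
rewrite /Rl /Rmx; case: ifP => _.
  by case: ifP => _; rewrite big_seq1 /zc /= mul1r.
by case: ifP => _; rewrite ?big_nil // big_cons big_seq1 /zc /= mul1r mulN1r.
Qed.

Lemma pev_RRl (M : lmodType F) (op : nat -> M -> M) s u v i j k l z :
  pev op (RRl s u v i j k l) z =
  \sum_a \sum_b \sum_m \sum_n
    (s%:~R * (Rmx q k b i a * Rmx q m j n l)) *: op (u b n) (op (v a m) z).
Proof.
rewrite /RRl pev_flatten sum_oi; apply: eq_bigr => a _.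
rewrite pev_flatten sum_oi; apply: eq_bigr => b _.
rewrite pev_flatten sum_oi; apply: eq_bigr => m _.
rewrite pev_flatten sum_oi; apply: eq_bigr => n _.
rewrite pev_flatten -!RlE mulr_suml mulr_sumr scaler_suml; apply: eq_bigr => c _.
rewrite /pev big_map mulr_sumr mulr_sumr scaler_suml; apply: eq_bigr => c' _ /=.
by rewrite -{1}[c.2 + c'.2]add0r !zcM // {1}/zc expr0z mulr1.
Qed.

(** The first half feeds the universal property, where operators killed by the polynomials must
    respect the relations; the second half shows that the polynomials vanish in the presented
    algebra. *)
Lemma ogl2_link :
  (forall s t, ogl2_rel q s t -> exists2 l, l \in relK & same ogl2_code s t l) /\
  (forall l, l \in relK -> exists s t, ogl2_rel q s t /\ same ogl2_code s t l).
Proof.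
have [g1 g2] := @gl2_same ogl2_gen ogl2_code OGLt OGLDi (fun _ _ => erefl) erefl.
have m4 i j k l : (i, j, k, l) \in o4.
  by elim/ord2P: i; elim/ord2P: j; elim/ord2P: k; elim/ord2P: l.
have d1 i j k l : same ogl2_code (TGen (OGLdt i j) * TGen (OGLt k l))%P
    (\big[@TAdd F ogl2_gen/0%P]_(a : 'I_2) \big[@TAdd F ogl2_gen/0%P]_(b : 'I_2)
     \big[@TAdd F ogl2_gen/0%P]_(m : 'I_2) \big[@TAdd F ogl2_gen/0%P]_(n : 'I_2)
       ((Rmx q k b i a * Rmx q m j n l)%R *: (TGen (OGLt b n) * TGen (OGLdt a m)))%P)
    (rdtt (i, j, k, l)).
  move=> M op opl z; rewrite pev_cons zcp scale1r pev_RRl; congr (_ + _).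
  rewrite tact_sum -sumrN; apply: eq_bigr => a _.
  rewrite tact_sum -sumrN; apply: eq_bigr => b _.
  rewrite tact_sum -sumrN; apply: eq_bigr => m _.
  rewrite tact_sum -sumrN; apply: eq_bigr => n _.
  by rewrite /= mulN1r scaleNr.
have d2 i j k l : same ogl2_code (TGen (OGLdt i j) * TGen (OGLdt k l))%P
    (\big[@TAdd F ogl2_gen/0%P]_(a : 'I_2) \big[@TAdd F ogl2_gen/0%P]_(b : 'I_2)
     \big[@TAdd F ogl2_gen/0%P]_(m : 'I_2) \big[@TAdd F ogl2_gen/0%P]_(n : 'I_2)
       ((- (Rmx q k b i a * Rmx q m j n l))%R *: (TGen (OGLdt b n) * TGen (OGLdt a m)))%P)
    (rdtdt (i, j, k, l)).
  move=> M op opl z; rewrite pev_cons zcp scale1r pev_RRl; congr (_ + _).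
  rewrite tact_sum -sumrN; apply: eq_bigr => a _.
  rewrite tact_sum -sumrN; apply: eq_bigr => b _.
  rewrite tact_sum -sumrN; apply: eq_bigr => m _.
  rewrite tact_sum -sumrN; apply: eq_bigr => n _.
  by rewrite /= mul1r scaleNr opprK.
split=> [s t [s' t' /g1[l lg sl]|i j k l|i j k l]|l].
- by exists l => //; rewrite mem_cat lg.
- by exists (rdtt (i, j, k, l)); [rewrite !mem_cat map_f ?orbT | apply: d1].
- by exists (rdtdt (i, j, k, l)); [rewrite !mem_cat map_f ?orbT | apply: d2].
rewrite !mem_cat => /or3P[/g2[s [t [st sl]]]|/mapP[[[[i j] k] l'] _ ->]|/mapP[[[[i j] k] l'] _ ->]].
- by exists s, t; split=> //; apply: ogl2_tt.
- by eexists; eexists; split; [apply: ogl2_dtt | apply: d1].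
- by eexists; eexists; split; [apply: ogl2_dtdt | apply: d2].
Qed.

Lemma oplane_link :
  (forall s t, oplane_rel q s t -> exists2 l, l \in relB & same oplane_code s t l) /\
  (forall l, l \in relB -> exists s t, oplane_rel q s t /\ same oplane_code s t l).
Proof.
pose X i := @TGen F oplane_gen (OPx i); pose Y i := @TGen F oplane_gen (OPdx i).
have [H0 H1 H2 H3] : [/\ same oplane_code (X i2 * X i1)%P (q *: (X i1 * X i2))%P (nth [::] relB 0),
  same oplane_code (Y i1 * X i1)%P ((q ^+ 2)%R *: (X i1 * Y i1))%P (nth [::] relB 1),
  same oplane_code (Y i2 * X i2)%P ((q ^+ 2)%R *: (X i2 * Y i2))%P (nth [::] relB 2) &
  same oplane_code (Y i1 * X i2)%P (q *: (X i2 * Y i1))%P (nth [::] relB 3)].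
  by split=> M op opl z; rewrite /= !pev_cons pev_nil /= !zcE !xlE; modeq M.
have [H4 H5 H6 H7] : [/\ same oplane_code (Y i2 * X i1)%P
    (q *: (X i1 * Y i2) + (q ^+ 2 - 1)%R *: (X i2 * Y i1))%P (nth [::] relB 4),
  same oplane_code (Y i1 * Y i1)%P 0%P (nth [::] relB 5),
  same oplane_code (Y i2 * Y i2)%P 0%P (nth [::] relB 6) &
  same oplane_code (Y i2 * Y i1)%P ((- q^-1)%R *: (Y i1 * Y i2))%P (nth [::] relB 7)].
  by split=> M op opl z; rewrite /= !pev_cons pev_nil /= !zcE !xlE; modeq M.
split.
  move=> s t [s' t' []|||||]; [exists (nth [::] relB 0)| | exists (nth [::] relB 3)
    | exists (nth [::] relB 4)| | exists (nth [::] relB 7)] => //; try exact: mem_nth.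
    by elim/ord2P; [exists (nth [::] relB 1) | exists (nth [::] relB 2)] => //; exact: mem_nth.
  by elim/ord2P; [exists (nth [::] relB 5) | exists (nth [::] relB 6)] => //; exact: mem_nth.
move=> l /(nthP [::])[n]; case: n => [|[|[|[|[|[|[|[|n]]]]]]]] // _ <-;
  eexists; eexists; split; [exact: (oplane_xx (plane_xx q (fun i => TGen (OPx i)))) | exact: H0 | exact: (oplane_dxx q i1) | exact: H1
  | exact: (oplane_dxx q i2) | exact: H2 | exact: oplane_dx1x2 | exact: H3 | exact: oplane_dx2x1 | exact: H4
  | exact: (oplane_dxdx q i1) | exact: H5 | exact: (oplane_dxdx q i2) | exact: H6 | exact: oplane_dx2dx1 | exact: H7].
Qed.

Lemma plane_link s t : plane_rel q (fun i : 'I_2 => TGen i) s t ->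
  exists2 l, l \in relB & same xl s t l.
Proof.
case; exists (nth [::] relB 0); first exact: mem_nth.
by move=> M op opl z; rewrite /= !pev_cons pev_nil /= !zcE !xlE; modeq M.
Qed.

Lemma gl2_link s t : gl2_rel q (fun i j => TGen (GLt i j)) (TGen GLDi) s t ->
  exists2 l, l \in relK & same gl2_code s t l.
Proof.
have [g1 _] := @gl2_same gl2_gen gl2_code GLt GLDi (fun _ _ => erefl) erefl.
by move=> /g1[l lg sl]; exists l => //; rewrite mem_cat lg.
Qed.
End Links.

(** * Homogeneity of the relations *)

Section Homogeneous.
Variables (F : fieldType) (I : Type) (rel : pterm F I -> pterm F I -> Prop) (deg : I -> nat).

(** Zero is homogeneous of every degree, as relations like (dx_i)^2 = 0 and sums built from 0
    require. *)
Inductive thom : nat -> pterm F I -> Prop :=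
| thom_gen i : thom (deg i) (TGen i)
| thom_const c : thom 0 (TConst c)
| thom_0 d : thom d 0%P
| thom_add d s t : thom d s -> thom d t -> thom d (s + t)%P
| thom_mul d e s t : thom d s -> thom e t -> thom (d + e) (s * t)%P.

Lemma thom_scale d c t : thom d t -> thom d (c *: t)%P.
Proof. by move=> dt; rewrite -[d]add0n; apply: thom_mul dt; apply: thom_const. Qed.

Lemma thom_sum (J : Type) (r : seq J) (f : J -> pterm F I) d :
  (forall j, thom d (f j)) -> thom d (\big[@TAdd F I/0%P]_(j <- r) f j).
Proof.
by move=> df; elim/big_rec: _ => [|j t _ dt]; [apply: thom_0 | apply: thom_add].
Qed.

Lemma comp_thom d t : thom d t ->
  forall n, pres_comp rel deg n t = if n == d then pres_pi rel t else 0.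
Proof.
elim=> {d t} [i|c|d|d s t _ IHs _ IHt|d e s t _ IHs _ IHt] n.
- by rewrite /pres_comp /= eq_sym; case: ifP => // _; rewrite pres_piC scale0r.
- by rewrite compC pres_piC.
- by rewrite compC scale0r; case: ifP => _; rewrite ?pres_pi0; case: ifP.
- by rewrite compD IHs IHt pres_piD; case: ifP => //; rewrite addr0.
rewrite compM pres_piM.
case: eqP => [->|nde].
  have dn : (d < (d + e).+1)%N by rewrite ltnS leq_addr.
  rewrite (bigD1 (Ordinal dn)) //= IHs eqxx IHt addKn eqxx big1 ?addr0 // => k kd.
  rewrite IHs; case: eqP => [e'|]; last by rewrite mul0r.
  by case/eqP: kd; apply: val_inj.
apply: big1 => k _; rewrite IHs IHt; case: eqP => [kd|]; last by rewrite mul0r.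
case: eqP => [ke|]; last by rewrite mulr0.
by case: nde; rewrite -kd -ke subnKC // -ltnS.
Qed.

Lemma comp_rel : (forall s t, rel s t -> exists2 d, thom d s & thom d t) ->
  forall s t n, rel s t -> pres_comp rel deg n s = pres_comp rel deg n t.
Proof.
move=> h s t n st; have [d ds dt] := h _ _ st.
rewrite (comp_thom ds) (comp_thom dt); case: ifP => // _.
by apply/pres_piP/pres_rel.
Qed.

End Homogeneous.

(** Products with the sum of degrees already evaluated, so that the tactic [thm] can guess the
    degrees of the factors. *)
Lemma thom00 F I deg s t : @thom F I deg 0 s -> thom deg 0 t -> thom deg 0 (s * t)%P.
Proof. exact: thom_mul. Qed.
Lemma thom01 F I deg s t : @thom F I deg 0 s -> thom deg 1 t -> thom deg 1 (s * t)%P.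
Proof. exact: thom_mul. Qed.
Lemma thom10 F I deg s t : @thom F I deg 1 s -> thom deg 0 t -> thom deg 1 (s * t)%P.
Proof. exact: thom_mul. Qed.
Lemma thom11 F I deg s t : @thom F I deg 1 s -> thom deg 1 t -> thom deg 2 (s * t)%P.
Proof. exact: thom_mul. Qed.
Lemma thom_genE F I deg i d : deg i = d -> @thom F I deg d (TGen i).
Proof. by move<-; apply: thom_gen. Qed.
Ltac thm := solve [ apply: thom_genE; reflexivity | exact: thom_const | exact: thom_0 | apply: thom_add; thm
  | apply: thom_scale; thm | apply: thom00; thm | apply: thom01; thm | apply: thom10; thm
  | apply: thom11; thm | apply: thom_sum => ?; thm ].

(** * The four presented algebras and their rewriting rules *)

Section Models.
Variables (F : fieldType) (q : F) (q0 : q != 0).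
Local Notation pev := (pev q).

(* K is presented by generators kl n, for n in gens, and relations rel, together
   with kl n = 0 for n odd unless fl; moreover the rules r hold. *)
Record is_pres (fl : bool) (K : galg F) (kl : nat -> K) (gens : seq nat)
    (rel : seq lpoly) (r : nat -> nat -> option lpoly) : Prop := IsPres {
  pr_galg : is_galg K;
  pr_homog : forall n, homog (ldeg n) (kl n);
  pr_rules : rules q (@gmul F K) kl r;
  pr_gen : generated (fun x => exists2 n, n \in gens & x = kl n);
  pr_odd : fl = false -> forall n, lodd n -> kl n = 0;
  pr_act : forall (M : lmodType F) (op : nat -> M -> M), (forall n, linear (op n)) ->
    (forall l, l \in rel -> forall z, pev op l z = 0) ->
    (fl = false -> forall n, n \in gens -> lodd n -> forall z, op n z = 0) ->
    exists f : K -> M -> M, [/\ forall z, linear (f ^~ z), forall x, linear (f x),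
      forall z, f (gone K) z = z, forall x y z, f (x ∙ y) z = f x (f y z) &
      forall n z, n \in gens -> f (kl n) z = op n z]
}.

(** Let the generators act on the target by left multiplication with their intended images; the
    algebra map is the orbit of the unit, and the action is recovered as multiplication by that
    orbit. *)
Lemma pr_univ fl K kl gens rel r : @is_pres fl K kl gens rel r ->
  forall (U : lmodType F) mul (one : U) (g : nat -> U), is_alg mul one ->
    (forall l, l \in rel -> pev (fun n => mul (g n)) l one = 0) ->
    (fl = false -> forall n, n \in gens -> lodd n -> g n = 0) ->
    exists f : K -> U, alg_map mul one f /\ forall n, n \in gens -> f (kl n) = g n.
Proof.
move=> hK U mul one g aU hl g0.
have [f [fl_ fr f1 fM fE]] := pr_act hK (fun n => alg_mulr aU (g n))
  (fun l lr => pev_alg0 aU (hl l lr))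
  (fun e n nK n1 z => etrans (congr1 (mul ^~ z) (g0 e n nK n1)) (lin0 (alg_mull aU z))).
have E x : forall z, f x z = mul (f x one) z.
  apply: (pr_gen hK (P := fun x => forall z, f x z = mul (f x one) z)) => {x}
    [z|c x h z|x y hx hy z|x y hx hy z|x [n nK ->] z].
  - by rewrite !f1 (alg_mul1l aU).
  - by rewrite !(linZ (fl_ _)) h (linZ (alg_mull aU z)).
  - by rewrite !(linD (fl_ _)) hx hy (linD (alg_mull aU z)).
  - by rewrite !fM hx hy (alg_mulA aU) -hx.
  - by rewrite !fE // (alg_mul1r aU).
exists (f ^~ one); split=> [|n nK]; last by rewrite fE // (alg_mul1r aU).
by split=> // x y; rewrite fM E.
Qed.

Lemma presG_act (I : Type) (deg : I -> nat) rel (code : I -> nat) (rell : seq lpoly) :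
  (forall s t, rel s t -> exists2 l, l \in rell & same q code s t l) ->
  forall (M : lmodType F) (op : nat -> M -> M), (forall n, linear (op n)) ->
    (forall l, l \in rell -> forall z, pev op l z = 0) ->
  exists f : presGalg deg rel -> M -> M,
    [/\ forall z, linear (f ^~ z), forall x, linear (f x),
      forall z, f (gone (presGalg deg rel)) z = z, forall x y z, f (gmul x y) z = f x (f y z) &
      forall i z, f (pgen rel i) z = op (code i) z].
Proof.
move=> link M op opl hl; pose op' i := op (code i).
have opl' i : linear (op' i) := opl (code i).
have oprel s t z : rel s t -> tact op' s z = tact op' t z.
  move=> /link[l lr /(_ M op opl z)].
  by rewrite (hl l lr) => /eqP; rewrite subr_eq0 => /eqP.
exists (pact op'); split.
- exact: (lf_pactl opl' oprel).
- exact: (lf_pactr opl').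
- exact: (pact1 opl' oprel).
- exact: (pactM opl' oprel).
- exact: (pact_gen opl' oprel).
Qed.

Definition lD (K : galg F) (a b c d : K) : K := a ∙ d - q^-1 *: (b ∙ c).

Definition klO (n : nat) : OmGL2 q :=
  let t := @oglt F q in let dt := @ogldt F q in
  nth 0 [:: t i1 i1; t i1 i2; t i2 i1; t i2 i2; oglDi q; dt i1 i1; dt i1 i2; dt i2 i1; dt i2 i2;
    lD (t i1 i1) (t i1 i2) (t i2 i1) (t i2 i2)] n.
Definition klA (n : nat) : CqGL2 q :=
  let t := @glt F q in
  nth 0 [:: t i1 i1; t i1 i2; t i2 i1; t i2 i2; glDi q; 0; 0; 0; 0;
    lD (t i1 i1) (t i1 i2) (t i2 i1) (t i2 i2)] n.
(** As [n - 10] is truncated, the factor [*+ (10 <= n)] is what sends the letters below 10 to 0 and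
    not to x_1. *)
Definition blO (n : nat) : OmCq2 q :=
  nth 0 [:: oplx q i1; oplx q i2; opldx q i1; opldx q i2] (n - 10) *+ (10 <= n)%N.
Definition blB (n : nat) : Cq2 q :=
  nth 0 [:: plx q i1; plx q i2; 0; 0] (n - 10) *+ (10 <= n)%N.

Lemma OmGL2_hrel s t n : ogl2_rel q s t ->
  pres_comp (ogl2_rel q) ogl2_deg n s = pres_comp (ogl2_rel q) ogl2_deg n t.
Proof.
apply: comp_rel => {}s {}t [s' t' []|i j k l|i j k l]; try by exists 0%N; thm.
  by exists 1%N; thm.
by exists 2%N; thm.
Qed.

Lemma OmCq2_hrel s t n : oplane_rel q s t ->
  pres_comp (oplane_rel q) oplane_deg n s = pres_comp (oplane_rel q) oplane_deg n t.
Proof.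
by apply: comp_rel => {}s {}t [s' t' []|i|||i|]; [exists 0%N | exists 1%N | exists 1%N |
  exists 1%N | exists 2%N | exists 2%N]; thm.
Qed.

Lemma CqGL2_hrel s t n : gl2_rel q (fun i j => TGen (GLt i j)) (TGen GLDi) s t ->
  pres_comp (gl2_rel q (fun i j => TGen (GLt i j)) (TGen GLDi)) (fun _ => 0%N) n s =
  pres_comp (gl2_rel q (fun i j => TGen (GLt i j)) (TGen GLDi)) (fun _ => 0%N) n t.
Proof. by apply: comp_rel => {}s {}t []; exists 0%N; thm. Qed.

Lemma Cq2_hrel s t n : plane_rel q (fun i : 'I_2 => TGen i) s t ->
  pres_comp (plane_rel q (fun i : 'I_2 => TGen i)) (fun _ => 0%N) n s =
  pres_comp (plane_rel q (fun i : 'I_2 => TGen i)) (fun _ => 0%N) n t.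
Proof. by apply: comp_rel => {}s {}t []; exists 0%N; thm. Qed.

Lemma OmGL2_galg : is_galg (OmGL2 q).
Proof. exact: pres_galg OmGL2_hrel. Qed.
Lemma OmCq2_galg : is_galg (OmCq2 q).
Proof. exact: pres_galg OmCq2_hrel. Qed.
Lemma CqGL2_galg : is_galg (CqGL2 q).
Proof. exact: pres_galg CqGL2_hrel. Qed.
Lemma Cq2_galg : is_galg (Cq2 q).
Proof. exact: pres_galg Cq2_hrel. Qed.

Lemma deg0_homog (I : Type) rel (x : presGalg (fun _ : I => 0%N) rel) :
  (forall s t n, rel s t -> pres_comp rel (fun _ : I => 0%N) n s = pres_comp rel (fun _ => 0%N) n t) ->
  @homog F (presGalg (fun _ : I => 0%N) rel) 0 x.
Proof.
move=> h; have hG := pres_galg h; have mG := galg_is_gmod hG.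
apply: (@pres_generated _ _ _ _ (fun x : presGalg (fun _ : I => 0%N) rel => homog 0 x)) => //.
- exact: gone_homog.
- by move=> c y; apply: homogZ.
- by move=> y z; apply: homogD.
- by move=> y z; apply: (gmul_homog hG (m := 0) (n := 0)).
- by move=> y [i ->]; apply: pgen_homog.
Qed.

Lemma tact_pi (I : Type) (deg : I -> nat) rel t (z : presGalg deg rel) :
  is_galg (presGalg deg rel) ->
  tact (fun i => @gmul F (presGalg deg rel) (pgen rel i)) t z = gmul (pres_pi rel t : presGalg deg rel) z.
Proof.
move=> hG; have aG := galg_alg hG; elim: t z => [i|c|s IHs u IHu|s IHs u IHu] z //=.
- rewrite pres_piC; apply: esym; apply: etrans (linZ (alg_mull aG z) _ _) _.
  by rewrite (alg_mul1l aG).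
- by rewrite pres_piD mulrDl; congr (_ + _); [apply: IHs | apply: IHu].
- by rewrite pres_piM -mulrA; apply: etrans (IHs _) _; congr (_ * _); apply: IHu.
Qed.

Lemma pres_hold (I : Type) (deg : I -> nat) rel (code : I -> nat) (rell : seq lpoly)
    (kl : nat -> presGalg deg rel) : is_galg (presGalg deg rel) ->
  (forall l, l \in rell -> exists s t, rel s t /\ same q code s t l) ->
  (forall i, kl (code i) = pgen rel i) ->
  forall l, l \in rell -> forall z, pev (fun n => gmul (kl n)) l z = 0.
Proof.
move=> hG link kE l /link[s [t [st h]]] z; have aG := galg_alg hG.
rewrite -h; last by move=> n; apply: alg_mulr aG _.
have E u : tact (fun i => gmul (kl (code i))) u z = gmul (pres_pi rel u : presGalg deg rel) z.
  by rewrite -tact_pi //; congr (tact _ u z); apply/funext => i; rewrite kE.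
rewrite !E; have -> : pres_pi rel s = pres_pi rel t by apply/pres_piP/pres_rel.
by rewrite subrr.
Qed.

(* The squares of the differentials are special: the relations only give
   (1 + q^2) (dt)^2 = 0. *)
Definition chk0 (a b : nat) (p : lpoly) : bool :=
  has (fun l => reduces noRule letter ((1, 0, [:: a; b]) :: paddm (-1) 0 (p ++ l) [::])) relK ||
  nilp p && has (fun l => reduces noRule letter
    [:: (1, 0, [:: a; b]), (1, 2, [:: a; b]) & paddm (-1) 0 l [::]]) relK.

Definition Dpoly : lpoly := [:: (1, 0, [:: 0%N; 3%N]); (-1, -1, [:: 1%N; 2%N])].
(** Among the letters of K only 9 is not a generator; it is expanded into ad - q^-1 bc. *)
Definition sD (n : nat) : lpoly := if n == 9%N then Dpoly else letter n.

(** The rules involving the inverse of the determinant D. They are not tested by reduction but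
    derived by hand from invertibility of D and from the commutation rules of D. *)
Definition chkDi (a b : nat) (p : lpoly) : bool :=
  [|| [&& a == 4%N, b == 9%N & p == [:: (1, 0, [::])]],
      [&& a == 9%N, b == 4%N & p == [:: (1, 0, [::])]],
      [&& (a < 4)%N, b == 4%N & p == [:: (1, 0, [:: 4%N; a])]] |
      [&& (5 <= a < 9)%N, b == 4%N & p == [:: (1, -2, [:: 4%N; a])]]].

Definition chk1 (a b : nat) (p : lpoly) : bool :=
  chkDi a b p || reduces RK0 sD ((1, 0, [:: a; b]) :: paddm (-1) 0 p [::]).

Lemma RK0_chk : tall RK0tab chk0. Proof. by vm_cast_no_check (erefl true). Qed.
Lemma RK_chk : tall RKtab chk1. Proof. by vm_cast_no_check (erefl true). Qed.

Definition chkB (a b : nat) (p : lpoly) : bool :=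
  has (fun l => reduces noRule letter ((1, 0, [:: a; b]) :: paddm (-1) 0 (p ++ l) [::])) relB.
Lemma RB_chk : tall RBtab (fun a => chkB (10 + a)). Proof. by vm_cast_no_check (erefl true). Qed.

Lemma pev_diff (M : lmodType F) (op : nat -> M -> M) a b p z :
  pev op ((1, 0, [:: a; b]) :: paddm (-1) 0 p [::]) z = op a (op b z) - pev op p z.
Proof. by rewrite pev_cons zc1 scale1r pev_paddm // pev_nil addr0 zcN zc1 scaleN1r. Qed.

Lemma noRuleP (U : lmodType F) (mul : U -> U -> U) ev : rules q mul ev noRule.
Proof. by []. Qed.

Lemma reduces_letter (U : lmodType F) (mul : U -> U -> U) one (ev : nat -> U) r l :
  is_alg mul one -> rules q mul ev r -> reduces r letter l ->
  forall z, pev (fun n => mul (ev n)) l z = 0.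
Proof.
by move=> aU hr h; apply: (reducesP q0 aU hr) h => n z; rewrite pev_letter.
Qed.

Lemma lD_mul (K : galg F) (hK : is_galg K) (a b c d z : K) :
  lD a b c d ∙ z = a ∙ (d ∙ z) - q^-1 *: (b ∙ (c ∙ z)).
Proof.
have aK := galg_alg hK; rewrite (linB (alg_mull aK z)) (linZ (alg_mull aK z)).
by rewrite !(alg_mulA aK).
Qed.

Lemma klO_code i : klO (ogl2_code i) = pgen _ i.
Proof.
by case: i => [i j||i j] //; elim/ord2P: i; elim/ord2P: j.
Qed.

Let aO := galg_alg OmGL2_galg.

Lemma relK_hold l : l \in relK -> forall z, pev (fun n => gmul (klO n)) l z = 0.
Proof. exact: (pres_hold OmGL2_galg (ogl2_link q0).2 klO_code). Qed.

Hypothesis q2 : q ^+ 2 != -1.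

Lemma RK0_rules : rules q (@gmul F (OmGL2 q)) klO RK0.
Proof.
move=> a b p /(tallP RK0_chk) /orP[/hasP[l lr]|/andP[/nilP-> /hasP[l lr]]] h z.
  have := reduces_letter aO (noRuleP _ klO) h z.
  rewrite pev_diff pev_cat (relK_hold lr) addr0 => /eqP.
  by rewrite subr_eq0 => /eqP.
have := reduces_letter aO (noRuleP _ klO) h z.
rewrite !pev_cons pev_paddm // (relK_hold lr) scaler0 add0r !pev_nil addr0 /= !zcE -scalerDl.
(* The coefficient is 1 + q^2, which [q2] makes invertible. *)
move=> /eqP; rewrite scaler_eq0 => /orP[|/eqP//].
by rewrite addrC addr_eq0 (negPf q2).
Qed.

Lemma klO_sD n z : gmul (klO n) z = pev (fun n => gmul (klO n)) (sD n) z.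
Proof.
rewrite /sD; case: eqP => [->|_]; last by rewrite pev_letter.
rewrite [LHS](lD_mul OmGL2_galg) !pev_cons pev_nil addr0 /= !zcE scale1r.
by rewrite scaleNr.
Qed.

Lemma klO_Di z : klO 4 ∙ (klO 9 ∙ z) = z /\ klO 9 ∙ (klO 4 ∙ z) = z.
Proof.
have E9 y : klO 9 ∙ y = klO 0 ∙ (klO 3 ∙ y) - q^-1 *: (klO 1 ∙ (klO 2 ∙ y)) :> OmGL2 q.
  exact: (lD_mul OmGL2_galg).
split; rewrite E9.
  (* The relations number 7 and 6 say that D is inverted from the left and from the right. *)
  have := relK_hold (mem_nth [::] (isT : (7 < size relK)%N)) z.
  rewrite !pev_cons pev_nil addr0 !zcE scaleN1r scale1r addrC => /eqP.
  rewrite subr_eq0 => /eqP e; apply: etrans e.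
  by rewrite (linB (alg_mulr aO _)) (linZ (alg_mulr aO _)) scaleNr.
have := relK_hold (mem_nth [::] (isT : (6 < size relK)%N)) z.
rewrite !pev_cons pev_nil addr0 !zcE scaleN1r scale1r addrC => /eqP.
rewrite subr_eq0 => /eqP e; apply: etrans e.
by rewrite scaleNr.
Qed.

(** Multiplying x D = c D x by the inverse of D on both sides. *)
Lemma klO_commDi x c z : c != 0 -> (forall z, klO x ∙ (klO 9 ∙ z) = c *: (klO 9 ∙ (klO x ∙ z))) ->
  klO x ∙ (klO 4 ∙ z) = c^-1 *: (klO 4 ∙ (klO x ∙ z)).
Proof.
move=> c0 h; have := h (klO 4 ∙ z); rewrite (klO_Di z).2 => ->.
by rewrite (linZ (alg_mulr aO _)) (klO_Di _).1 scalerA mulVf // scale1r.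
Qed.

Lemma klO_RK a b p z : RK a b = Some p -> ~~ chkDi a b p ->
   klO a ∙ (klO b ∙ z) = pev (fun n => gmul (klO n)) p z.
Proof.
move=> /(tallP RK_chk) /orP[->//|h] _.
have := reducesP q0 aO RK0_rules klO_sD h z.
by rewrite pev_diff => /eqP; rewrite subr_eq0 => /eqP.
Qed.

(** Rules without the inverse of D follow by reduction with the basic rules after expanding D. Among
    them are t D = D t and (dt) D = q^2 D dt, from which the rules moving the inverse of D to the
    left are obtained by [klO_commDi]. *)
Lemma RK_rules : rules q (@gmul F (OmGL2 q)) klO RK.
Proof.
move=> a b p E z; have [|h] := boolP (chkDi a b p); last exact: klO_RK.
have t9 x : (x < 4)%N -> forall z, klO x ∙ (klO 9 ∙ z) = klO 9 ∙ (klO x ∙ z).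
  move=> x4 y; rewrite (@klO_RK x 9 [:: (1, 0, [:: 9%N; x])]) ?pev_cons ?pev_nil ?zc1 ?scale1r ?addr0 //.
    by move: x x4 => [|[|[|[|]]]].
  by move: x x4 => [|[|[|[|]]]].
have d9 x : (5 <= x < 9)%N -> forall z, klO x ∙ (klO 9 ∙ z) = q ^+ 2 *: (klO 9 ∙ (klO x ∙ z)).
  move=> x4 y; rewrite (@klO_RK x 9 [:: (1, 2, [:: 9%N; x])]) ?pev_cons ?pev_nil ?zcE ?addr0 //.
    by move: x x4 => [|[|[|[|[|[|[|[|[|]]]]]]]]].
  by move: x x4 => [|[|[|[|[|[|[|[|[|]]]]]]]]].
case/or4P=> /and3P[a4 /eqP-> /eqP->].
- by rewrite (eqP a4) (klO_Di z).1 pev1.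
- by rewrite (eqP a4) (klO_Di z).2 pev1.
- rewrite (@klO_commDi a 1) ?oner_eq0 // => [|y]; last by rewrite t9 ?scale1r.
  by rewrite pev_cons pev_nil addr0 zc1 invr1.
rewrite (@klO_commDi a (q ^+ 2)) ?expf_neq0 // => [|y]; last by rewrite d9.
by rewrite pev_cons pev_nil addr0 zcE.
Qed.

Lemma RB_rules : rules q (@gmul F (OmCq2 q)) blO RB.
Proof.
have aB := galg_alg OmCq2_galg.
move=> a b p; rewrite /RB; case: ltnP => // a10 /(tallP RB_chk) /hasP[l lr].
rewrite subnKC // => h z.
have := reduces_letter aB (noRuleP _ blO) h z.
rewrite pev_diff pev_cat.
have -> : pev (fun n => gmul (blO n)) l z = 0.
  apply: (pres_hold OmCq2_galg (oplane_link q).2 _ lr).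
  by case; elim/ord2P.
by rewrite addr0 => /eqP; rewrite subr_eq0 => /eqP.
Qed.

Lemma klO_pres : is_pres true klO gensK relK RK.
Proof.
split.
- exact: OmGL2_galg.
- move=> n; have mO := galg_is_gmod OmGL2_galg.
  have ht i j := pgen_homog OmGL2_hrel (OGLt i j).
  have hd i j := pgen_homog OmGL2_hrel (OGLdt i j).
  have hDi := pgen_homog OmGL2_hrel OGLDi.
  case: n => [|[|[|[|[|[|[|[|[|[|n]]]]]]]]]];
    [exact: ht | exact: ht | exact: ht | exact: ht | exact: hDi | exact: hd | exact: hd | exact: hd | exact: hd | |].
    by apply: (homogD mO); [|apply: (homogN mO); apply: (homogZ mO)];
      apply: (gmul_homog OmGL2_galg (m := 0) (n := 0)); apply: ht.
  by rewrite /klO nth_default //; apply: homog0.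
- exact: RK_rules.
- move=> P P1 PZ PD PM PG; apply: pres_generated => // x [i ->].
  by apply: PG; exists (ogl2_code i); [case: i => [i j||i j]; try (elim/ord2P: i; elim/ord2P: j) | rewrite klO_code].
- by [].
move=> M op opl hl _.
have [f [f1 f2 f3 f4 fE]] := @presG_act _ ogl2_deg _ _ _ (ogl2_link q0).1 _ _ opl hl.
exists f; split=> // n z.
rewrite !inE => /or4P[/eqP->|/eqP->|/eqP->|].
- exact: (fE (OGLt i1 i1) z).
- exact: (fE (OGLt i1 i2) z).
- exact: (fE (OGLt i2 i1) z).
case/or4P=> [/eqP->|/eqP->|/eqP->|].
- exact: (fE (OGLt i2 i2) z).
- exact: (fE OGLDi z).
- exact: (fE (OGLdt i1 i1) z).
case/or3P=> /eqP->; [exact: (fE (OGLdt i1 i2) z) | exact: (fE (OGLdt i2 i1) z) | exact: (fE (OGLdt i2 i2) z)].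
Qed.

Lemma blO_pres : is_pres true blO gensB relB RB.
Proof.
split.
- exact: OmCq2_galg.
- move=> n; have mO := galg_is_gmod OmCq2_galg.
  have hx i := pgen_homog OmCq2_hrel (OPx i).
  have hd i := pgen_homog OmCq2_hrel (OPdx i).
  rewrite /blO; case: (leqP 10 n) => [|_]; last by rewrite mulr0n; apply: homog0.
  move=> n10; rewrite -[n in ldeg n](subnKC n10) mulr1n.
  case: (n - 10)%N => [|[|[|[|m]]]]; [exact: hx | exact: hx | exact: hd | exact: hd |].
  by rewrite nth_default //; apply: homog0.
- exact: RB_rules.
- move=> P P1 PZ PD PM PG; apply: pres_generated => // x [i ->].
  by apply: PG; exists (oplane_code i); case: i; elim/ord2P.
- by [].
move=> M op opl hl _.
have [f [f1 f2 f3 f4 fE]] := @presG_act _ oplane_deg _ _ _ (oplane_link q).1 _ _ opl hl.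
exists f; split=> // n z.
rewrite !inE => /or4P[] /eqP->.
- exact: (fE (OPx i1) z).
- exact: (fE (OPx i2) z).
- exact: (fE (OPdx i1) z).
exact: (fE (OPdx i2) z).
Qed.

(** A rule is transported at the unit, where it is an identity between elements; associativity in
    the target restores the arbitrary right factor. *)
Lemma rules_map (K K' : galg F) (kl : nat -> K) (kl' : nat -> K') r (p : K -> K') :
  is_galg K -> is_galg K' ->
  alg_map (@gmul F K') (gone K') p -> (forall n, p (kl n) = kl' n) ->
  rules q (@gmul F K) kl r -> rules q (@gmul F K') kl' r.
Proof.
move=> hK hK' [pl p1 pM] pE hr a b w E z; have aK' := galg_alg hK'.
have := congr1 p (hr a b w E (gone K)).
rewrite (pev_map (op' := fun n => gmul (kl' n)) _ _ _ pl) => [|n y]; last by rewrite pM pE.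
rewrite !pM !pE p1 => /(congr1 (fun y => y ∙ z)).
by rewrite (pev_alg q kl' _ _ aK') -!(alg_mulA aK') (alg_mul1l aK').
Qed.

Lemma pev_odd_gen (K : galg F) (hK : is_galg K) (kl : nat -> K) (o : pred nat) l z :
  (forall n, o n -> kl n = 0) ->
  all (fun m : mono => has o m.2) l -> pev (fun n => gmul (kl n)) l z = 0.
Proof.
move=> k0; have aK := galg_alg hK.
have w0 w : has o w -> foldr (fun n => gmul (kl n)) z w = 0.
  elim: w => //= x w IHw /orP[/k0->|/IHw->]; first exact: (lin0 (alg_mull aK _)).
  exact: (lin0 (alg_mulr aK _)).
elim: l => [|[[c e] w] l IHl] /=; first by rewrite pev_nil.
by move=> /andP[/w0 E /IHl]; rewrite pev_cons E scaler0 add0r.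
Qed.

Lemma klA_code i : klA (gl2_code i) = pgen _ i.
Proof. by case: i => [i j|] //; elim/ord2P: i; elim/ord2P: j. Qed.

Lemma klA_odd n : lodd n -> klA n = 0.
Proof. by rewrite /lodd !inE => /or4P[/eqP->|/eqP->|/eqP->|/or3P[] /eqP->]. Qed.

Lemma klA_relK l : l \in relK -> forall z, pev (fun n => gmul (klA n)) l z = 0.
Proof.
rewrite mem_cat => /orP[lg|lr] z.
  have [_ g2] := @gl2_same _ q _ gl2_code GLt GLDi (fun _ _ => erefl) erefl.
  exact: (pres_hold CqGL2_galg g2 klA_code).
apply: (pev_odd_gen CqGL2_galg _ klA_odd).
have /allP/(_ _ lr) // : all (all (fun m : mono => has lodd m.2))
  ([seq rdtt x | x <- o4] ++ [seq rdtdt x | x <- o4]) by vm_cast_no_check (erefl true).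
Qed.

(** The projection killing all differentials. It transports the rewriting rules to C_q[GL_2] and
    later retracts the inclusion of C_q[GL_2] into its calculus, which gives injectivity. *)
Lemma pA_ex : exists p : OmGL2 q -> CqGL2 q,
  alg_map (@gmul F (CqGL2 q)) (gone _) p /\ forall n, p (klO n) = klA n.
Proof.
have [p [[pl p1 pM] pE]] := pr_univ klO_pres (galg_alg CqGL2_galg)
  (fun l lr => klA_relK lr _) (fun e : true = false => False_ind _ (Bool.diff_true_false e)).
exists p; split=> // n; case: (ltnP n 9) => n9.
  by apply: pE; move: n n9; do 9![case=> //].
case: n n9 => [|[|[|[|[|[|[|[|[|[|n]]]]]]]]]] // _.
  rewrite (linB pl) (linZ pl) !pM.
  by rewrite (pE 0%N) // (pE 1%N) // (pE 2%N) // (pE 3%N).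
by rewrite /klO /klA !nth_default // (lin0 pl).
Qed.

Lemma blB_code i : blB (xl i) = pgen _ i.
Proof. by elim/ord2P: i. Qed.

Lemma blB_odd n : lodd n -> blB n = 0.
Proof. by rewrite /lodd !inE => /or4P[/eqP->|/eqP->|/eqP->|/or3P[] /eqP->]. Qed.

Lemma blB_relB l : l \in relB -> forall z, pev (fun n => gmul (blB n)) l z = 0.
Proof.
rewrite in_cons => /orP[/eqP->|lr] z.
  apply: (pres_hold Cq2_galg (rell := [:: nth [::] relB 0]) _ blB_code); last by rewrite inE.
  move=> l'; rewrite inE => /eqP->.
  eexists; eexists; split; first exact: plane_xx.
  by move=> M op opl y; rewrite /= !pev_cons pev_nil /= !zcE !xlE; modeq M.
apply: (pev_odd_gen Cq2_galg _ blB_odd).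
have /allP/(_ _ lr) // : all (all (fun m : mono => has lodd m.2)) (behead relB) by [].
Qed.

Lemma pB_ex : exists p : OmCq2 q -> Cq2 q,
  alg_map (@gmul F (Cq2 q)) (gone _) p /\ forall n, p (blO n) = blB n.
Proof.
have [p [[pl p1 pM] pE]] := pr_univ blO_pres (galg_alg Cq2_galg)
  (fun l lr => blB_relB lr _) (fun e : true = false => False_ind _ (Bool.diff_true_false e)).
exists p; split=> // n; case: (boolP (10 <= n)%N) => n9; last first.
  by rewrite /blO /blB (negPf n9) !mulr0n (lin0 pl).
case: (ltnP n 14) => n14; first by apply: pE; rewrite -(subnKC n9); move: (n - 10)%N (subnKC n9) n14 => m <-;
  do 4![case: m => [|m] //].
by rewrite /blO /blB !nth_default ?mul0rn ?(lin0 pl) // -(leq_add2r 10) subnK.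
Qed.

Lemma klA_pres : is_pres false klA gensK relK RK.
Proof.
split.
- exact: CqGL2_galg.
- move=> n; case: (boolP (lodd n)) => [n1|n0]; last by rewrite /ldeg (negPf n0); apply: deg0_homog CqGL2_hrel.
  by rewrite klA_odd //; apply: homog0 (galg_is_gmod CqGL2_galg) _.
- have [p [pa pE]] := pA_ex.
  exact: (rules_map OmGL2_galg CqGL2_galg pa pE RK_rules).
- move=> P P1 PZ PD PM PG; apply: pres_generated => // x [i ->].
  by apply: PG; exists (gl2_code i); [case: i => [i j|]; try (elim/ord2P: i; elim/ord2P: j) | rewrite klA_code].
- by move=> _; apply: klA_odd.
move=> M op opl hl /(_ erefl) g0.
have [f [f1 f2 f3 f4 fE]] := @presG_act _ (fun _ => 0%N) _ _ _ (@gl2_link _ q) _ _ opl hl.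
exists f; split=> // n z nK; move: (nK).
case: (boolP (lodd n)) => [n1|n0]; first by rewrite klA_odd // g0 // (lin0 (f1 z)).
rewrite !inE => /or4P[/eqP->|/eqP->|/eqP->|].
- exact: (fE (GLt i1 i1) z).
- exact: (fE (GLt i1 i2) z).
- exact: (fE (GLt i2 i1) z).
case/or4P=> [/eqP->|/eqP->|/eqP e|].
- exact: (fE (GLt i2 i2) z).
- exact: (fE GLDi z).
- by rewrite e in n0.
by case/or3P=> /eqP e; rewrite e in n0.
Qed.

Lemma blB_pres : is_pres false blB gensB relB RB.
Proof.
split.
- exact: Cq2_galg.
- move=> n; case: (boolP (lodd n)) => [n1|n0]; last by rewrite /ldeg (negPf n0); apply: deg0_homog Cq2_hrel.
  by rewrite blB_odd //; apply: homog0 (galg_is_gmod Cq2_galg) _.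
- have [p [pa pE]] := pB_ex.
  exact: (rules_map OmCq2_galg Cq2_galg pa pE RB_rules).
- move=> P P1 PZ PD PM PG; apply: pres_generated => // x [i ->].
  by apply: PG; exists (xl i); [elim/ord2P: i | rewrite blB_code].
- by move=> _; apply: blB_odd.
move=> M op opl hl /(_ erefl) g0.
have [f [f1 f2 f3 f4 fE]] := @presG_act _ (fun _ => 0%N) _ _ _ (@plane_link _ q) _ _ opl hl.
exists f; split=> // n z nK; move: (nK).
case: (boolP (lodd n)) => [n1|n0]; first by rewrite blB_odd // g0 // (lin0 (f1 z)).
rewrite !inE => /or4P[/eqP->|/eqP->|/eqP e|/eqP e].
- exact: (fE i1 z).
- exact: (fE i2 z).
- by rewrite e in n0.
by rewrite e in n0.
Qed.

End Models.

Definition mapl (f : nat -> nat) (p : lpoly) : lpoly :=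
  [seq (m.1.1, m.1.2, map f m.2) | m : mono <- p].

(* In a tensor product the letters of the left and right factors become the even
   and the odd numbers. *)
Definition rst (o1 o2 : nat -> bool) (r1 r2 : nat -> nat -> option lpoly) (a b : nat) :
    option lpoly :=
  if odd a then
    if odd b then omap (mapl (fun n => n.*2.+1)) (r2 a./2 b./2)
    else Some [:: (if o2 a./2 && o1 b./2 then -1 else 1, 0, [:: b; a])]
  else if odd b then None else omap (mapl double) (r1 a./2 b./2).

Definition wdeg (d : nat -> nat) (w : seq nat) : nat := sumn (map d w).
Definition pdeg (d : nat -> nat) (k : nat) (p : lpoly) : bool :=
  all (fun m : mono => wdeg d m.2 == k) p.

Lemma zc_m1 (F : fieldType) (q : F) : zc q (-1) 0 = -1.
Proof. by rewrite zcN zc1. Qed.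

(** * Maps defined on generators *)

Section Systems.
Variables (F : fieldType) (q : F) (q0 : q != 0).
Local Notation pev := (pev q).

Definition gev (T : galg F) (ev : nat -> T) (p : lpoly) : T :=
  pev (fun n => @gmul F T (ev n)) p (gone T).

(** Letters that satisfy rewriting rules, without any universal property. Unlike a presentation this
    notion is stable under super tensor products and also covers the bosonisation, so that these can
    be targets of maps on generators. *)
Record is_sys (fl : bool) (T : galg F) (ev : nat -> T) (dT : nat -> nat)
    (rT : nat -> nat -> option lpoly) : Prop := IsSys {
  sys_galg : is_galg T;
  sys_homog : forall n, homog (dT n) (ev n);
  sys_odd : fl = false -> forall n, odd (dT n) -> ev n = 0;
  sys_rules : rules q (@gmul F T) ev rT
}.

Lemma pres_sys fl K kl gens rel r : @is_pres F q fl K kl gens rel r -> is_sys fl kl ldeg r.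
Proof. by case=> h1 h2 h3 h4 h5 h6; split=> // e n; rewrite oddb; apply: h5. Qed.

Lemma pev_mapl (M : lmodType F) (op : nat -> M -> M) f p z :
  pev op (mapl f p) z = pev (fun n => op (f n)) p z.
Proof. by rewrite /pev big_map; apply: eq_bigr => m _; rewrite foldr_map. Qed.

Section OneSystem.
Variables (fl : bool) (T : galg F) (ev : nat -> T) (dT : nat -> nat)
    (rT : nat -> nat -> option lpoly).
Hypothesis sT : is_sys fl ev dT rT.
Let hT := sys_galg sT.
Let mT := galg_is_gmod hT.
Let aT := galg_alg hT.

Lemma gev_mul p z : gev ev p ∙ z = pev (fun n => @gmul F T (ev n)) p z.
Proof. exact: pev_alg aT. Qed.

Lemma gev_letter n : gev ev (letter n) = ev n.
Proof. by rewrite /gev pev_letter (gmul1r hT). Qed.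

Lemma word_homog w : homog (wdeg dT w) (foldr (fun n => @gmul F T (ev n)) (gone T) w).
Proof.
elim: w => [|x w IHw]; first exact: gone_homog hT.
exact: (gmul_homog hT (sys_homog sT x) IHw).
Qed.

Lemma gev_homog k p : pdeg dT k p -> homog k (gev ev p).
Proof.
elim: p => [|[[c e] w] p IHp] /=; first by rewrite /gev pev_nil => _; apply: homog0.
move=> /andP[/eqP wk /IHp hp]; rewrite /gev pev_cons; apply: (homogD mT) => //.
by apply: (homogZ mT); rewrite -wk; apply: word_homog.
Qed.

Lemma gev_odd0 k p : fl = false -> odd k -> pdeg dT k p -> gev ev p = 0.
Proof.
move=> e k1 pk; apply: (pev_odd_gen (o := fun n => odd (dT n)) q hT) => [n|].
  exact: (sys_odd sT).
apply: sub_all pk => m /eqP mk; move: k1; rewrite -mk.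
by elim: (m.2) => //= x w IHw; rewrite /wdeg /= oddD; case: (odd (dT x)).
Qed.

Lemma sys_reduces l z : reduces rT letter l -> pev (fun n => @gmul F T (ev n)) l z = 0.
Proof. by move=> h; apply: (reduces_letter q0 aT (sys_rules sT) h). Qed.

Lemma gev_reduces s l : reduces rT s l ->
  gev (fun n => gev ev (s n)) l = 0.
Proof.
by move=> h; apply: (reducesP q0 aT (sys_rules sT)) h _ => n z; apply: gev_mul.
Qed.

(** Existence of a graded algebra map becomes two finite computations: the images satisfy the
    relations and have the right degrees. In degree 0, images of odd generators vanish because each
    of their words contains an odd letter. *)
Lemma pres_gmap K kl gens rel r s : @is_pres F q fl K kl gens rel r ->
  all (reduces rT s) rel -> all (fun n => pdeg dT (ldeg n) (s n)) gens ->
  exists f : K -> T, is_galg_map f /\ forall n, n \in gens -> f (kl n) = gev ev (s n).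
Proof.
move=> hK /allP hr /allP hd.
have [|l lr||f [fa fE]] := pr_univ hK (mul := @gmul F T) (one := gone T) (g := fun n => gev ev (s n)).
- exact: aT.
- exact: (gev_reduces (hr l lr)).
- move=> e n ng n1; apply: (gev_odd0 e (k := ldeg n)) (hd n ng).
  by rewrite oddb.
exists f; split=> //; apply: (generated_galg_map (pr_galg hK) hT (pr_gen hK)) fa _ => x [n ng ->].
by exists (ldeg n); [apply: pr_homog hK _ | rewrite fE //; apply: gev_homog; apply: hd].
Qed.

End OneSystem.

Lemma rules_map_letters (K K' : galg F) (kl : nat -> K) (kl' : nat -> K') r (p : K -> K') f :
  is_galg K -> is_galg K' -> alg_map (@gmul F K') (gone K') p -> (forall n, p (kl n) = kl' (f n)) ->
  rules q (@gmul F K) kl r ->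
  forall a b w, r a b = Some w -> forall z, kl' (f a) ∙ (kl' (f b) ∙ z) =
    pev (fun n => @gmul F K' (kl' n)) (mapl f w) z.
Proof.
move=> hK hK' pa pE hr a b w E z; rewrite pev_mapl.
exact: (rules_map (kl' := fun n => kl' (f n)) hK hK' pa pE hr E).
Qed.

Section Tensor.
Variables (fl : bool) (X Y : galg F) (evX : nat -> X) (evY : nat -> Y) (dX dY : nat -> nat)
  (rX rY : nat -> nat -> option lpoly).
Hypotheses (sX : is_sys fl evX dX rX) (sY : is_sys fl evY dY rY).
Let hX := sys_galg sX.
Let hY := sys_galg sY.
Let mX := galg_is_gmod hX.
Let mY := galg_is_gmod hY.

Definition evst (n : nat) : stens X Y :=
  if odd n then gone X ⊗ evY n./2 else evX n./2 ⊗ gone Y.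
Definition dst (n : nat) : nat := if odd n then dY n./2 else dX n./2.

Lemma stens_sys : is_sys fl evst dst
  (rst (fun n => odd (dX n)) (fun n => odd (dY n)) rX rY).
Proof.
have hT := stens_galg hX hY; have aT := galg_alg hT.
split=> //.
- move=> n; rewrite /evst /dst; case: ifP => _.
    exact: (tens_homog mX mY (gone_homog hX) (sys_homog sY _)).
  rewrite -[dX _]addn0; exact: (tens_homog mX mY (sys_homog sX _) (gone_homog hY)).
- move=> e n; rewrite /evst /dst; case: ifP => _ o1.
    by rewrite (sys_odd sY e o1) tens0r.
  by rewrite (sys_odd sX e o1) tens0l.
have ml := galg_map_alg (galg_map_inl hX hY).
have mr := galg_map_alg (galg_map_inr hX hY).
move=> a b p; rewrite /rst; case: ifP => a1; case: ifP => b1 //.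
- have Er n : gone X ⊗ evY n = evst n.*2.+1.
    by rewrite /evst /= odd_double /= uphalf_double.
  case E: (rY _ _) => [w|] //= [<-] z.
  rewrite -(rules_map_letters hY hT mr Er (sys_rules sY) E).
  by rewrite -!Er /evst a1 b1.
- move=> [<-] z; rewrite pev_cons pev_nil addr0 -[foldr _ _ _]/(evst b ∙ (evst a ∙ z)).
  rewrite !(gmulA hT) -(linZ (alg_mull aT z)); congr (_ ∙ z).
  rewrite /evst a1 b1.
  have pY := homog_ph mY (sys_homog sY a./2); have pX := homog_ph mX (sys_homog sX b./2).
  rewrite [LHS](smul_ph hX hY _ _ pY pX) [X in _ = _ *: X](smul_ph hX hY _ _ (ph1 hY) (ph1 hX)) /= scale1r.
  rewrite !(gmul1l hX) !(gmul1l hY) !(gmul1r hX) !(gmul1r hY); congr (_ *: _).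
  by case: ifP => _; rewrite ?zc_m1 ?zc1 // /sign ?expr1 ?expr0.
have El n : evX n ⊗ gone Y = evst n.*2 by rewrite /evst odd_double doubleK.
case E: (rX _ _) => [w|] //= [<-] z.
rewrite -(rules_map_letters hX hT ml El (sys_rules sX) E).
by rewrite -!El /evst a1 b1.
Qed.

End Tensor.
End Systems.

(** * The super opposite algebra and antipodes *)

Section Opposite.
Variables (F : fieldType) (K : galg F) (hK : is_galg K).
Let mK := galg_is_gmod hK.

(* Antipodes are algebra maps into the super opposite algebra. *)
Definition opm (x y : K) : K := \sum_(i : bool) sg i y ∙ par i x.
Definition sop : galg F := @Galg F (galg_gmod K) opm (gone K).

Lemma opmE i x y : ph i x -> opm x y = sg i y ∙ x.
Proof.
move=> xi; rewrite /opm big_bool /=.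
case: i xi => xi; first rewrite (par_id mK xi) (@par_neq _ _ mK true false) //.
  by rewrite (gmul0r hK) addr0.
by rewrite (par_id mK xi) (@par_neq _ _ mK false true) // (gmul0r hK) add0r.
Qed.

Lemma sg_sgD i j (x : K) : sg i (sg j x) = sg (i (+) j) x.
Proof.
move: x; apply: (ph_ext mK) => [||k x xk].
- exact: lf_comp (lf_sg mK i) (lf_sg mK j).
- exact: lf_sg.
rewrite !(sg_ph mK _ xk) (linZ (lf_sg mK i)) (sg_ph mK _ xk) scalerA.
by case: i j k {xk} => [] [] []; rewrite /sign /= ?expr1 ?expr0 ?mulr1 ?mul1r ?mulrNN ?mulr1.
Qed.

Lemma sop_galg : is_galg sop.
Proof.
have l1 y : linear (fun x => opm x y).
  by apply: lf_sum => i; apply: (lf_gmulr hK); apply: (lf_par mK).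
have l2 x : linear (opm x).
  by apply: lf_sum => i; apply: (lf_gmull hK); apply: (lf_sg mK).
split=> //=.
- move=> x y z; move: x; apply: (ph_ext mK) => [||i x xi]; first exact: l1.
    exact: lf_comp (l1 z) (l1 y).
  move: y; apply: (ph_ext mK) => [||j y yj].
  + exact: lf_comp (l2 x) (l1 z).
  + exact: lf_comp (l1 z) (l2 x).
  rewrite !(opmE _ xi) (opmE _ yj) (opmE (i := j (+) i)); last first.
    by apply: (phM hK) => //; apply: (ph_sg mK).
  by rewrite (sgM hK) sg_sgD addbC !(gmulA hK).
- by move=> x; rewrite (opmE _ (ph1 hK)) (sg0 mK) (gmul1r hK).
- move=> x; move: x; apply: (ph_ext mK) => [||i x xi]; [exact: l1 | exact: lf_id |].
  by rewrite (opmE _ xi) (sg1 hK) (gmul1l hK).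
- exact: gone_homog hK.
move=> m n x y xm yn; rewrite (opmE _ (homog_ph mK xm)) addnC.
by apply: (gmul_homog hK) => //; rewrite (sg_homog mK _ yn); apply: (homogZ mK).
Qed.

Variables (S : K -> K) (SP : @is_galg_map F K sop S).
Let Sg : is_glin S. Proof. by case: SP. Qed.
Let Sl : linear S. Proof. by case: Sg. Qed.

Lemma anti_mul i j x y : ph i x -> ph j y -> S (x ∙ y) = sign (i && j) *: (S y ∙ S x).
Proof.
move=> xi yj; case: SP => _ _ ->; rewrite [LHS](opmE _ (glin_ph Sg xi)).
by rewrite (sg_ph mK _ (glin_ph Sg yj)) (gmulZl hK).
Qed.

Variables (D : K -> stens K K) (DP : @is_galg_map F K (stens K K) D) (e : K -> F) (eP : is_char e).

Let bL : bilin (fun a b : K => S a ∙ b).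
Proof.
split=> x; first exact: (lf_gmull hK _ Sl).
exact: (lf_gmulr hK _ (@lf_id _ _)).
Qed.
Let bR : bilin (fun a b : K => a ∙ S b).
Proof.
split=> x; first exact: (lf_gmull hK _ (@lf_id _ _)).
exact: (lf_gmulr hK _ Sl).
Qed.
Let pL (t : tens K K) : K := \sw_(a, b <- t) S a ∙ b.
Let pR (t : tens K K) : K := \sw_(a, b <- t) a ∙ S b.
Let lL : linear pL. Proof. exact: lf_tlift bL. Qed.
Let lR : linear pR. Proof. exact: lf_tlift bR. Qed.

Lemma antiL_mul j X u v : ph j u -> pL (@smul F K K X (u ⊗ v)) = S u ∙ (sg j (pL X) ∙ v).
Proof.
have [bl br] := bilin_smul hK hK.
move=> uj; move: X; apply: (tens_phext mK mK) => [||i k a b ai bk].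
- exact: lf_comp lL (bl _).
- apply: (lf_gmulr hK); apply: (lf_gmull hK); exact: lf_comp (lf_sg mK j) lL.
rewrite (smul_ph hK hK _ _ bk uj) (linZ lL) /pL !tlift_pure // (anti_mul ai uj).
rewrite (sg_ph mK j (phM hK (glin_ph Sg ai) bk)) !(gmulZl hK) (gmulZr hK) scalerA !(gmulA hK).
by congr (_ *: _); case: (i); case: (j); case: (k); rewrite /sign /= ?expr1 ?expr0 ?mulr1 ?mul1r ?mulrNN ?mulr1.
Qed.

Lemma antiR_mul k a b Y : ph k b -> pR (@smul F K K (a ⊗ b) Y) = a ∙ sg k (pR Y) ∙ S b.
Proof.
have [bl br] := bilin_smul hK hK.
move=> bk; move: Y; apply: (tens_phext mK mK) => [||j l u v uj vl].
- exact: lf_comp lR (br _).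
- apply: (lf_gmull hK); apply: (lf_gmulr hK); exact: lf_comp (lf_sg mK k) lR.
rewrite (smul_ph hK hK _ _ bk uj) (linZ lR) /pR !tlift_pure // (anti_mul bk vl).
rewrite (sg_ph mK k (phM hK uj (glin_ph Sg vl))) !(gmulZr hK) !(gmulZl hK) scalerA !(gmulA hK).
by congr (_ *: _); case: (j); case: (k); case: (l); rewrite /sign /= ?expr1 ?expr0 ?mulr1 ?mul1r ?mulrNN ?mulr1.
Qed.

(** The antipode identity passes to products: in S((xy)_1)(xy)_2 the factor S(x_1)x_2 appears in the
    middle ([antiL_mul]), where it is a scalar and can be pulled out. The other side is
    symmetric. *)
Lemma antipode_gen (G : K -> Prop) : generated G ->
  (forall x, G x -> pL (D x) = e x *: gone K /\ pR (D x) = e x *: gone K) ->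
  is_antipode (@HopfOps F K D e S).
Proof.
move=> gK hG; have [Dl D1 DM] := galg_map_alg DP; have [bl br] := bilin_smul hK hK.
have S1 : S (gone K) = gone K by case: SP.
suff h x : pL (D x) = e x *: gone K /\ pR (D x) = e x *: gone K.
  by split=> // x; case: (h x).
apply: (gK (fun x => pL (D x) = e x *: gone K /\ pR (D x) = e x *: gone K)) x => [|c x [h1 h2]|x y [h1 h2] [h3 h4]|x y [h1 h2] [h3 h4]|x /hG //].
- by rewrite D1 /pL /pR !tlift_pure // S1 (gmul1l hK) (char_one eP) scale1r.
- by rewrite (linZ Dl) (linZ lL) (linZ lR) h1 h2 (linZ (char_lin eP)) !scalerA.
- by rewrite (linD Dl) (linD lL) (linD lR) h1 h2 h3 h4 (linD (char_lin eP)) !scalerDl.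
rewrite DM; split.
  suff -> : pL (D x ∙ D y) = e x *: pL (D y) by rewrite h3 scalerA (char_mul eP).
  move: (D y); apply: (tens_phext mK mK) => [||i j u v ui vj].
  - exact: lf_comp lL (br _).
  - exact: lf_scale.
  rewrite [LHS](antiL_mul _ _ ui) h1 (linZ (lf_sg mK i)) (sg1 hK) (gmulZl hK) (gmul1l hK).
  by rewrite (gmulZr hK) /pL tlift_pure.
suff -> : pR (D x ∙ D y) = e y *: pR (D x) by rewrite h2 scalerA mulrC (char_mul eP).
move: (D x); apply: (tens_phext mK mK) => [||i j u v ui vj].
- exact: lf_comp lR (bl _).
- exact: lf_scale.
rewrite [LHS](antiR_mul _ _ vj) h4 (linZ (lf_sg mK j)) (sg1 hK) (gmulZr hK) (gmul1r hK).
by rewrite (gmulZl hK) /pR tlift_pure.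
Qed.

End Opposite.

Section OppositeWords.
Variables (F : fieldType) (q : F) (K : galg F) (hK : is_galg K) (S : nat -> K) (d : nat -> nat).
Hypothesis Sh : forall n, homog (d n) (S n).
Let mK := galg_is_gmod hK.

Fixpoint rsign (w : seq nat) : bool :=
  if w is x :: w' then rsign w' (+) (odd (d x) && odd (wdeg d w')) else false.

(** The polynomial whose ordinary evaluation is the evaluation of [l] in the super opposite algebra:
    words are reversed, with the sign of permuting the odd letters. *)
Definition revl (l : lpoly) : lpoly :=
  [seq (if rsign m.2 then - m.1.1 else m.1.1, m.1.2, rev m.2) | m : mono <- l].

Lemma opm_word w : foldr (fun n => opm (S n)) (gone K) w =
  sign (rsign w) *: foldr (fun n => @gmul F K (S n)) (gone K) (rev w).
Proof.
have wh u : homog (wdeg d u) (foldr (fun n => @gmul F K (S n)) (gone K) u).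
  elim: u => [|x u IHu]; first exact: gone_homog hK.
  exact: (gmul_homog hK (Sh x) IHu).
elim: w => [|x w IHw]; first by rewrite scale1r.
rewrite /= IHw (opmE hK _ (homog_ph mK (Sh x))) (linZ (lf_sg mK _)) (sg_homog mK _ (wh _)).
rewrite rev_cons -cats1 foldr_cat /= scalerA signM.
have -> : wdeg d (rev w) = wdeg d w by rewrite /wdeg map_rev sumn_rev.
rewrite (gmulZl hK); congr (_ *: _).
elim: (rev w) => [|y u IHu] /=; first by rewrite (gmul1l hK) (gmul1r hK).
by rewrite -IHu (gmulA hK).
Qed.

Lemma pev_revl l : pev q (fun n => opm (S n)) l (gone K) =
  pev q (fun n => @gmul F K (S n)) (revl l) (gone K).
Proof.
rewrite /revl /pev big_map; apply: eq_bigr => m _; rewrite opm_word scalerA; congr (_ *: _) => /=.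
by case: (rsign _); rewrite ?zcN /sign ?expr1 ?expr0 ?mulr1 ?mulrN1.
Qed.
End OppositeWords.

(** * The Hopf algebras C_q[GL_2] and Omega(C_q[GL_2]) *)

Section CopTable.
Local Open Scope nat_scope.
Definition coptab : seq (seq (nat * nat)) := [::
  [:: (0, 0); (1, 2)]; [:: (0, 1); (1, 3)]; [:: (2, 0); (3, 2)]; [:: (2, 1); (3, 3)];
  [:: (4, 4)];
  [:: (5, 0); (6, 2); (0, 5); (1, 7)]; [:: (5, 1); (6, 3); (0, 6); (1, 8)];
  [:: (7, 0); (8, 2); (2, 5); (3, 7)]; [:: (7, 1); (8, 3); (2, 6); (3, 8)]].
End CopTable.
Definition copt (n : nat) : seq (nat * nat) := nth [::] coptab n.
Lemma copt0 : copt 0%N = [:: (0%N, 0%N); (1%N, 2%N)]. Proof. by []. Qed.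
Lemma copt1 : copt 1%N = [:: (0%N, 1%N); (1%N, 3%N)]. Proof. by []. Qed.
Lemma copt2 : copt 2%N = [:: (2%N, 0%N); (3%N, 2%N)]. Proof. by []. Qed.
Lemma copt3 : copt 3%N = [:: (2%N, 1%N); (3%N, 3%N)]. Proof. by []. Qed.
Lemma copt4 : copt 4%N = [:: (4%N, 4%N)]. Proof. by []. Qed.
Lemma copt5 : copt 5%N = [:: (5%N, 0%N); (6%N, 2%N); (0%N, 5%N); (1%N, 7%N)]. Proof. by []. Qed.
Lemma copt6 : copt 6%N = [:: (5%N, 1%N); (6%N, 3%N); (0%N, 6%N); (1%N, 8%N)]. Proof. by []. Qed.
Lemma copt7 : copt 7%N = [:: (7%N, 0%N); (8%N, 2%N); (2%N, 5%N); (3%N, 7%N)]. Proof. by []. Qed.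
Lemma copt8 : copt 8%N = [:: (7%N, 1%N); (8%N, 3%N); (2%N, 6%N); (3%N, 8%N)]. Proof. by []. Qed.
Definition coptE := (copt0, copt1, copt2, copt3, copt4, copt5, copt6, copt7, copt8).

Definition cop_s (n : nat) : lpoly := [seq (1, 0, [:: g.1.*2; g.2.*2.+1]) | g <- copt n].
Definition cou_t (n : nat) : bool := n \in [:: 0; 3; 4]%N.
Definition anti_s (n : nat) : lpoly := nth [::] antitab n.

Notation rKK := (rst (fun n => odd (ldeg n)) (fun n => odd (ldeg n)) RK RK).

Lemma cop_chk : all (reduces rKK cop_s) relK && all (fun n => pdeg (dst ldeg ldeg) (ldeg n) (cop_s n)) gensK.
Proof. by vm_cast_no_check (erefl true). Qed.

Lemma cou_chk : all (reduces noRule (fun n => if cou_t n then [:: (1, 0, [::])] else [::])) relK.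
Proof. by vm_cast_no_check (erefl true). Qed.

Lemma anti_chk : all (fun l => reduces RK anti_s (revl ldeg l)) relK && all (fun n => pdeg ldeg (ldeg n) (anti_s n)) gensK.
Proof. by vm_cast_no_check (erefl true). Qed.

(** An even letter 2n stands for the letter n and an odd letter 2n + 1 for its antipode, as
    [anti_eval] decodes them. *)
Definition antiL_s (n : nat) : lpoly := [seq (1, 0, [:: g.1.*2.+1; g.2.*2]) | g <- copt n].
Definition antiR_s (n : nat) : lpoly := [seq (1, 0, [:: g.1.*2; g.2.*2.+1]) | g <- copt n].
Definition anti_eval (n : nat) : lpoly := if odd n then anti_s n./2 else letter n./2.

Lemma antipode_chk : all (fun n =>
  reduces RK anti_eval (antiL_s n ++ (if cou_t n then [:: (-1, 0, [::])] else [::])) &&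
  reduces RK anti_eval (antiR_s n ++ (if cou_t n then [:: (-1, 0, [::])] else [::]))) gensK.
Proof. by vm_cast_no_check (erefl true). Qed.

Section HopfK.
Variables (F : fieldType) (q : F) (q0 : q != 0) (fl : bool) (K : galg F) (kl : nat -> K).
Hypothesis hP : is_pres q fl kl gensK relK RK.
Let hK := pr_galg hP.
Let mK := galg_is_gmod hK.
Let sK := pres_sys hP.
Let gK := pr_gen hP.
Let hKK := stens_galg hK hK.
Let mKK := galg_is_gmod hKK.

Lemma gev_map (T : galg F) (ev : nat -> T) (J : Type) (r : seq J) (w : J -> seq nat) :
  gev q ev [seq (1, 0, w g) | g <- r] = \sum_(g <- r) foldr (fun n => @gmul F T (ev n)) (gone T) (w g).
Proof.
rewrite /gev /pev big_map; apply: eq_bigr => g _ /=; by rewrite zc1 scale1r.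
Qed.

Lemma evst_pair (X Y : galg F) (hX : is_galg X) (hY : is_galg Y) (evX : nat -> X) (evY : nat -> Y) a b :
  foldr (fun n => @gmul F (stens X Y) (evst evX evY n)) (gone (stens X Y)) [:: a.*2; b.*2.+1]
   = evX a ⊗ evY b.
Proof.
have hT := stens_galg hX hY.
rewrite /foldr (gmul1r hT) /evst /= odd_double doubleK /= odd_double /= uphalf_double.
by rewrite (smul_ph hX hY _ _ (ph1 hY) (ph1 hX)) scale1r (gmul1r hX) (gmul1l hY).
Qed.

Lemma copK_ex : exists D : K -> stens K K, @is_galg_map F K (stens K K) D /\
  forall n, n \in gensK -> D (kl n) = \sum_(g <- copt n) kl g.1 ⊗ kl g.2.
Proof.
have /andP[c1 c2] := cop_chk.
have [D [DP DE]] := pres_gmap q0 (stens_sys sK sK) hP c1 c2.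
exists D; split=> [|n ng]; first exact: DP.
rewrite (DE n ng) gev_map; apply: eq_bigr => g _.
exact: evst_pair.
Qed.

Lemma couK_ex : exists e : K -> F, is_char e /\ (forall n v, e (gpr n.+1 v) = 0) /\
  forall n, n \in gensK -> e (kl n) = (cou_t n)%:R.
Proof.
pose g n : F^o := (cou_t n)%:R; pose mulF : F^o -> F^o -> F^o := *%R.
have [|l lr|_ n|e [[el e1 eM] eE]] := pr_univ hP (mul := mulF) (one := 1) (g := g).
- exact: field_alg.
- apply: (reducesP q0 (ev := fun _ => 0) (@field_alg F) (noRuleP _ _ _)) (allP cou_chk l lr) _ => n z.
  rewrite /g /mulF; case: (cou_t n); last by rewrite mul0r pev_nil.
  by rewrite mul1r pev1.
- by rewrite /lodd !inE => _ /or4P[/eqP->|/eqP->|/eqP->|/or3P[] /eqP->].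
have eh v : forall n, e (gpr n.+1 v) = 0.
  apply: (gK (P := fun v => forall n, e (gpr n.+1 v) = 0)) => {v} [n|c v h n|u v hu hv n|u v hu hv n|v [k kg ->] n].
  - by rewrite (homog_gpr mK _ (gone_homog hK)) (lin0 el).
  - by rewrite (linZ (lf_gpr mK _)) (linZ el) h scaler0.
  - by rewrite (linD (lf_gpr mK _)) (linD el) hu hv addr0.
  - rewrite (gprM hK) (lin_sum el) big1 // => i _; rewrite eM.
    case: (nat_of_ord i) => [|j]; last by rewrite hu /mulF mul0r.
    by rewrite subn0 hv /mulF mulr0.
  rewrite (homog_gpr mK _ (pr_homog hP k)) /ldeg; case: eqP => [kn|_]; last exact: (lin0 el).
  rewrite eE // /g; have : lodd k by case: (lodd k) kn.
  by rewrite /lodd !inE => /or4P[/eqP->|/eqP->|/eqP->|/or3P[] /eqP->].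
exists e; split; last by split.
exact: charI.
Qed.

Lemma antiK_ex : exists S : K -> K, @is_galg_map F K (sop K) S /\
  forall n, n \in gensK -> S (kl n) = gev q kl (anti_s n).
Proof.
have /andP[/allP c1 /allP c2] := anti_chk; have hS := sop_galg hK; have aK := galg_alg hK.
pose Sn n := if n \in gensK then gev q kl (anti_s n) else 0.
have Snh n : homog (ldeg n) (Sn n).
  rewrite /Sn; case: ifP => ng; last exact: homog0.
  by apply: (gev_homog sK); apply: c2.
have SnE n : gev q kl (anti_s n) = Sn n.
  rewrite /Sn; case: ifP => // ng; rewrite /anti_s nth_default ?/gev ?pev_nil //.
  by move: ng; do 9![case: n => [|n] //].
have [|l lr|e n ng n1|S [Sa SE]] := pr_univ hP (mul := @opm F K) (one := gone K) (g := Sn).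
- exact: galg_alg hS.
- rewrite (pev_revl q hK Snh).
  have := reducesP q0 aK (sys_rules sK) (g := Sn) (s := anti_s) _ (c1 l lr) (gone K).
  by apply=> n z; rewrite -SnE; exact: (gev_mul sK).
- by rewrite -SnE; apply: (gev_odd0 sK e (k := ldeg n)) (c2 n ng); rewrite oddb.
exists S; split; last by move=> n ng; rewrite (SE n ng) -SnE.
apply: (generated_galg_map hK hS gK) Sa _ => x [n ng ->].
by exists (ldeg n); [apply: pr_homog hP _ | rewrite (SE n ng); apply: Snh].
Qed.

Lemma hopfK_ex : exists H : hopf_ops K, is_shopf H /\
  (forall n, n \in gensK -> cop H (kl n) = \sum_(g <- copt n) kl g.1 ⊗ kl g.2) /\
  (forall n, n \in gensK -> cou H (kl n) = (cou_t n)%:R).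
Proof.
have [D [DP DE]] := copK_ex; have [e [eP [eh eE]]] := couK_ex; have [S [SP SE]] := antiK_ex.
have [Dg D1 DM] := DP; have Dl := Dg.1; have el := char_lin eP.
have il := @lf_id _ K; have iP := galg_map_id K.
have aK := galg_alg hK.
exists (HopfOps D e S); split; last by split.
have inK n g : n \in gensK -> g \in copt n -> (g.1 \in gensK) && (g.2 \in gensK).
  move=> ng gn.
  have /allP/(_ n ng)/allP/(_ g gn) // : all (fun n => all (fun g => (g.1 \in gensK) && (g.2 \in gensK)) (copt n)) gensK by [].
split=> //=.
- split=> //=.
  + move=> v; rewrite (tassocE _ Dl) -[LHS]/(tmap D (fun x => x) (D v)).
    move: v; apply: (generated_eq gK (mul := @gmul F (stens (stens K K) K)) (one := gone (stens (stens K K) K))).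
    * apply: galg_map_alg; refine (@galg_map_comp _ K (stens K K) (stens (stens K K) K) (tmap D (fun x => x)) D _ DP).
      exact: (galg_map_tmap hK hK hKK hK DP iP).
    * apply: galg_map_alg; refine (@galg_map_comp _ K (stens K (stens K K)) (stens (stens K K) K) (@tassoc _ K K K) _ _ _); first exact: galg_map_tassoc.
      refine (@galg_map_comp _ K (stens K K) (stens K (stens K K)) (tmap (fun x => x) D) D _ DP).
      exact: (galg_map_tmap hK hK hK hKK iP DP).
    move=> x [n ng ->]; rewrite DE //.
    rewrite (lin_sum (lf_tmap Dl il)) (lin_sum (lf_tmap il Dl)) (lin_sum (@lf_tassoc _ _ _ _)).
    transitivity (\sum_(g <- copt n) \sum_(h <- copt g.1) kl h.1 ⊗ kl h.2 ⊗ kl g.2).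
      apply: eq_big_seq => g gn; have /andP[g1 g2] := inK _ _ ng gn.
      by rewrite tmap_pure // DE // tens_suml.
    transitivity (\sum_(g <- copt n) \sum_(h <- copt g.2) kl g.1 ⊗ kl h.1 ⊗ kl h.2); last first.
      apply: eq_big_seq => g gn; have /andP[g1 g2] := inK _ _ ng gn.
      rewrite tmap_pure // DE // tens_sumr (lin_sum (@lf_tassoc _ _ _ _)).
      by apply: eq_bigr => h _; rewrite tassoc_pure.
    pose M : lmodType F := tens (tens K K) K.
    move: ng; rewrite !inE => /or4P[/eqP->|/eqP->|/eqP->|/or4P[/eqP->|/eqP->|/eqP->|/or3P[/eqP->|/eqP->|/eqP->]]];
      rewrite !coptE ?big_cons ?big_nil /= ?coptE ?big_cons ?big_nil /=; modeq M.
  + apply: (generated_eq gK (mul := @gmul F K) (one := gone K)).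
    * exact: (alg_map_comp (charl_alg hK hK eP) DP).
    * exact: galg_map_alg iP.
    move=> x [n ng ->]; rewrite DE // (lin_sum (lf_tlift _)); last by lin.
    transitivity (\sum_(g <- copt n) (cou_t g.1)%:R *: kl g.2).
      apply: eq_big_seq => g gn; have /andP[g1 g2] := inK _ _ ng gn.
      by rewrite tlift_pure ?eE //; lin.
    pose M : lmodType F := K.
    by move: ng; rewrite !inE => /or4P[/eqP->|/eqP->|/eqP->|/or4P[/eqP->|/eqP->|/eqP->|/or3P[/eqP->|/eqP->|/eqP->]]];
      rewrite !coptE !big_cons !big_nil /= ?scale0r ?scale1r ?add0r ?addr0.
  + apply: (generated_eq gK (mul := @gmul F K) (one := gone K)).
    * exact: (alg_map_comp (charr_alg hK hK eP) DP).
    * exact: galg_map_alg iP.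
    move=> x [n ng ->]; rewrite DE // (lin_sum (lf_tlift _)); last by lin.
    transitivity (\sum_(g <- copt n) (cou_t g.2)%:R *: kl g.1).
      apply: eq_big_seq => g gn; have /andP[g1 g2] := inK _ _ ng gn.
      by rewrite tlift_pure ?eE //; lin.
    by move: ng; rewrite !inE => /or4P[/eqP->|/eqP->|/eqP->|/or4P[/eqP->|/eqP->|/eqP->|/or3P[/eqP->|/eqP->|/eqP->]]];
      rewrite !coptE !big_cons !big_nil /= ?scale0r ?scale1r ?add0r ?addr0.
- exact: char_mul eP.
- exact: char_one eP.
apply: (antipode_gen hK SP DP eP gK) => x [n ng ->]; rewrite DE //.
have bl : bilin (fun a b : K => S a ∙ b).
  by have [[Sl _] _ _] := SP; split=> y; [apply: (lf_gmull hK _ Sl) | apply: (lf_gmulr hK _ (@lf_id _ _))].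
have br : bilin (fun a b : K => a ∙ S b).
  by have [[Sl _] _ _] := SP; split=> y; [apply: (lf_gmull hK _ (@lf_id _ _)) | apply: (lf_gmulr hK _ Sl)].
rewrite (lin_sum (lf_tlift bl)) (lin_sum (lf_tlift br)) eE //.
have /andP[c1 c2] := allP antipode_chk n ng.
have evE m : gev q kl (anti_eval m) = if odd m then gev q kl (anti_s m./2) else kl m./2.
  by rewrite /anti_eval; case: ifP => _; last exact: (gev_letter sK).
have E0 : gev q (fun m => gev q kl (anti_eval m)) (if cou_t n then [:: (-1, 0, [::])] else [::]) =
    - ((cou_t n)%:R *: gone K).
  rewrite /gev; case: (cou_t n); last by rewrite pev_nil scale0r oppr0.
  by rewrite pev_cons pev_nil addr0 zc_m1 scale1r scaleN1r.
split.
  have := gev_reduces q0 sK c1; rewrite {1}/gev pev_cat -/(gev _ _ _) -/(gev _ _ _) E0.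
  move=> /eqP; rewrite subr_eq0 => /eqP <-; rewrite /antiL_s gev_map.
  apply: eq_big_seq => g gn; have /andP[g1 g2] := inK _ _ ng gn.
  transitivity (gev q kl (anti_eval g.1.*2.+1) ∙ (gev q kl (anti_eval g.2.*2) ∙ gone K)); last by [].
  by rewrite (tlift_pure bl) (SE _ g1) !evE (gmul1r hK) /= !odd_double /= uphalf_double doubleK.
have := gev_reduces q0 sK c2; rewrite {1}/gev pev_cat -/(gev _ _ _) -/(gev _ _ _) E0.
move=> /eqP; rewrite subr_eq0 => /eqP <-; rewrite /antiR_s gev_map.
apply: eq_big_seq => g gn; have /andP[g1 g2] := inK _ _ ng gn.
transitivity (gev q kl (anti_eval g.1.*2) ∙ (gev q kl (anti_eval g.2.*2.+1) ∙ gone K)); last by [].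
by rewrite (tlift_pure br) (SE _ g2) !evE (gmul1r hK) /= !odd_double /= uphalf_double doubleK.
Qed.
End HopfK.

(** * The action on the quantum plane *)

Definition rhot (v n : nat) : lpoly := nth [::] (nth [::] rhotab (v - 10)) n.
Definition hd0 (w : seq nat) : nat := head 0%N w.

(* Letter 4 i + j is the matrix unit E_ij of size 4. *)
Definition unit_rule (a b : nat) : option lpoly :=
  if (a < 16)%N && (b < 16)%N then
    Some (if (a %% 4 == b %/ 4)%N then [:: (1, 0, [:: (4 * (a %/ 4) + b %% 4)%N])] else [::])
  else None.
(** Letters below 20 are represented by the matrices of the action; the letter 20 + k is the matrix
    unit k itself. *)
Definition rep_s (n : nat) : lpoly :=
  if (n < 20)%N then
    flatten [seq [seq (m.1.1, m.1.2, [:: 4 * (v - 10) + (hd0 m.2 - 10)]%N) | m : mono <- rhot v n] | v <- gensB]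
  else letter (n - 20).
Definition lapp (l : lpoly) (w : seq nat) : lpoly := [seq (m.1.1, m.1.2, m.2 ++ w) | m : mono <- l].

(** Relations may contain a constant term, but the identity matrix is not a matrix unit. Each
    relation is therefore multiplied from the right by the diagonal units 0, 5, 10, 15, whose sum is
    the identity. *)
Lemma rep_chk : all (fun l => all (fun k => reduces unit_rule rep_s (lapp l [:: k]))
  [:: 20; 25; 30; 35]%N) relK.
Proof. by vm_cast_no_check (erefl true). Qed.

(** Needed in degree 0, where the odd letters are represented by 0: a relation without odd letters
    is then unchanged, and one with an odd letter in every monomial becomes trivial. *)
Lemma parity_chk : all (fun l : lpoly => all (fun m : mono => ~~ has lodd m.2) l ||
  all (fun m : mono => has lodd m.2) l) relK.
Proof. by vm_cast_no_check (erefl true). Qed.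

Lemma rhot_chk : all (fun v => all (fun n => all (fun m : mono =>
  [&& m.2 == [:: hd0 m.2], hd0 m.2 \in gensB & ldeg v + ldeg n == ldeg (hd0 m.2)]%N) (rhot v n)) gensK) gensB.
Proof. by vm_cast_no_check (erefl true). Qed.

Lemma pev_lapp (F : fieldType) (q : F) (M : lmodType F) (op : nat -> M -> M) l w z :
  pev q op (lapp l w) z = pev q op l (foldr op z w).
Proof. by rewrite /pev big_map; apply: eq_bigr => m _; rewrite /= foldr_cat. Qed.

Section Representation.
Variables (F : fieldType) (q : F) (q0 : q != 0) (fl : bool) (K : galg F) (kl : nat -> K).
Hypothesis hP : is_pres q fl kl gensK relK RK.
Let hK := pr_galg hP.
Let mK := galg_is_gmod hK.
Let gK := pr_gen hP.

Let ix (v : nat) : 'I_4 := inord (v - 10).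

Definition munit (n : nat) : 'M[F]_4 := delta_mx (inord (n %/ 4)) (inord (n %% 4)).

Lemma mx_alg : is_alg (@mulmx F 4 4 4) 1%:M.
Proof.
split.
- by move=> y a u v; rewrite mulmxDl scalemxAl.
- by move=> x a u v; rewrite mulmxDr scalemxAr.
- exact: mulmxA.
- exact: mul1mx.
- exact: mulmx1.
Qed.

Lemma unit_rules : rules q (@mulmx F 4 4 4) munit unit_rule.
Proof.
move=> a b p; rewrite /unit_rule; case: ifP => // /andP[a16 b16] [<-] z.
rewrite mulmxA /munit mul_delta_mx_cond.
have a4 : (a %/ 4 < 4)%N by rewrite ltn_divLR.
have b4 : (b %/ 4 < 4)%N by rewrite ltn_divLR.
have a4' : (a %% 4 < 4)%N by rewrite ltn_pmod.
have b4' : (b %% 4 < 4)%N by rewrite ltn_pmod.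
rewrite -val_eqE /= !inordK //; case: eqP => _; last by rewrite mulr0n pev_nil mul0mx.
rewrite pev_cons pev_nil addr0 zc1 scale1r mulr1n /=.
by rewrite mulnC divnMDl // modnMDl [(b %% 4 %/ 4)%N]divn_small // addn0 modn_mod.
Qed.

Lemma sum_gensB (V : nmodType) (f : nat -> V) : \sum_(w <- gensB) f w = \sum_(j < 4) f (10 + j)%N.
Proof. by rewrite !big_cons big_nil !big_ord_recl big_ord0. Qed.

Lemma ixK (j : 'I_4) : ix (10 + j) = j.
Proof. by rewrite /ix addKn inord_val. Qed.

Lemma rep_ex : exists r : K -> nat -> nat -> F,
  [/\ forall v w, linear (fun k => r k v w : F^o),
      forall v w, v \in gensB -> w \in gensB -> r (gone K) v w = (v == w)%:R,
      forall x y v u, r (x ∙ y) v u = \sum_(w <- gensB) r x v w * r y w u,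
      forall (M : lmodType F) (X : nat -> M), (fl = false -> forall w, lodd w -> X w = 0) ->
        forall n v, n \in gensK -> v \in gensB ->
        \sum_(w <- gensB) r (kl n) v w *: X w = \sum_(m <- rhot v n) zc q m.1.1 m.1.2 *: X (hd0 m.2) &
      forall k n v w, v \in gensB -> w \in gensB -> (ldeg v + n)%N != ldeg w -> r (gpr n k) v w = 0].
Proof.
have aM := mx_alg.
pose g n := pev q (fun n => mulmx (munit n)) (rep_s n) 1%:M.
(* The degree 0 algebra sees the same matrices with those of the differentials replaced by 0. *)
pose g' n := if fl || ~~ lodd n then g n else 0.
have gE n (z : 'M[F]_4) : g n *m z = pev q (fun n => mulmx (munit n)) (rep_s n) z.
  exact: pev_alg aM.
have g1E (z : 'M[F]_4) : z = \sum_(k <- [:: 0; 5; 10; 15]%N) munit k *m z.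
  rewrite -mulmx_suml -[LHS]mul1mx; congr (_ *m _).
  rewrite !big_cons big_nil /munit /= addr0.
  apply/matrixP => i j; rewrite !mxE -!val_eqE /= !inordK //.
  by case: i j => [[|[|[|[|i]]]] hi] [[|[|[|[|j]]]] hj] //=; rewrite ?addr0 ?add0r.
have g20 k (z : 'M[F]_4) : g (20 + k)%N *m z = munit k *m z.
  by rewrite gE /rep_s ltnNge leq_addr /= addKn pev_letter.
have hg l : l \in relK -> pev q (fun n => mulmx (g n)) l 1%:M = 0.
  move=> lr; have /allP c := allP rep_chk l lr.
  have gl n : linear (mulmx (g n)) := alg_mulr aM _.
  rewrite (g1E 1%:M) (lin_sum (lf_pev _ gl _)) big1_seq // => k /andP[_ k4].
  rewrite -g20 -(pev_lapp q (fun n => mulmx (g n)) l [:: (20 + k)%N]).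
  apply: (reducesP q0 aM unit_rules gE); apply: c.
  by move: k4; rewrite !inE => /or4P[] /eqP->.
have hg' l : l \in relK -> pev q (fun n => mulmx (g' n)) l 1%:M = 0.
  move=> lr; have := hg l lr; rewrite /g'; case: (fl) => //= h.
  have /orP[/allP c|/allP c] := allP parity_chk l lr.
    rewrite -[RHS]h /pev; apply: eq_big_seq => m ml /=; congr (_ *: _).
    by elim: m.2 (c m ml) => //= x w IHw; rewrite negb_or => /andP[/negPf -> /IHw ->].
  rewrite /pev big1_seq // => m /andP[_ /c]; elim: m.2 => //= x w IHw; case: (lodd x) => /= [_|/IHw]; first by rewrite mul0mx scaler0.
  have [/eqP z0|zn0] := eqVneq (zc q m.1.1 m.1.2) 0; first by rewrite (eqP z0) !scale0r.
  by move=> /eqP; rewrite scaler_eq0 (negPf zn0) /= => /eqP->; rewrite mulmx0 scaler0.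
have g'0 : fl = false -> forall n, n \in gensK -> lodd n -> g' n = 0.
  by move=> e n _ n1; rewrite /g' e n1.
have [r [[rl r1 rM] rE]] := pr_univ hP aM hg' g'0.
have munitE v w i j : v \in gensB -> w \in gensB ->
    munit (4 * (v - 10) + (w - 10)) i j = ((i == ix v) && (j == ix w))%:R.
  move=> vg wg; rewrite /munit mxE /ix.
  have v4 : (v - 10 < 4)%N by move: vg; rewrite !inE => /or4P[] /eqP->.
  have w4 : (w - 10 < 4)%N by move: wg; rewrite !inE => /or4P[] /eqP->.
  by rewrite mulnC divnMDl // modnMDl [((w - 10) %/ 4)%N]divn_small // addn0 modn_small.
have ix_inj v w : v \in gensB -> w \in gensB -> (ix v == ix w) = (v == w).
  rewrite /ix -val_eqE !inE => /or4P[] /eqP-> /or4P[] /eqP->; by rewrite /= !inordK.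
have gX (M : lmodType F) (X : nat -> M) n v : n \in gensK -> v \in gensB ->
   \sum_(w <- gensB) g n (ix v) (ix w) *: X w = \sum_(m <- rhot v n) zc q m.1.1 m.1.2 *: X (hd0 m.2).
  move=> ng vg; pose T (A : 'M[F]_4) : M := \sum_(w <- gensB) A (ix v) (ix w) *: X w.
  have Tl : linear T.
    move=> a x y; rewrite /T scaler_sumr -big_split; apply: eq_bigr => w _.
    by rewrite /= !mxE scalerDl scalerA.
  have n20 : (n < 20)%N by move: ng; do 9![case: n => [|n] //].
  have Tu v' w' : v' \in gensB -> w' \in gensB ->
      T (munit (4 * (v' - 10) + (w' - 10))) = if v' == v then X w' else 0.
    move=> vg' wg'; rewrite /T (bigD1_seq w') //= munitE // eqxx andbT ix_inj // eq_sym.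
    rewrite big1_seq ?addr0; last first.
      move=> w /andP[ww' wg]; rewrite munitE // (ix_inj w w') // (negPf ww') andbF.
      by rewrite scale0r.
    by case: eqP; rewrite ?scale1r ?scale0r.
  have rc v' m : v' \in gensB -> m \in rhot v' n -> hd0 m.2 \in gensB.
    by move=> vg' mr; have /and3P[] := allP (allP (allP rhot_chk v' vg') n ng) m mr.
  rewrite -/(T (g n)) /g (lin_sum Tl) /rep_s n20 big_flatten big_map.
  rewrite (bigD1_seq v) //= [X in _ + X]big1_seq ?addr0; last first.
    move=> v' /andP[vv' vg']; rewrite big_map big1_seq // => m /andP[_ mr] /=.
    by rewrite (linZ Tl) mulmx1 Tu ?(negPf vv') ?scaler0 //; apply: rc mr.
  rewrite big_map; apply: eq_big_seq => m mr.
  by rewrite /= (linZ Tl) mulmx1 Tu ?eqxx //; apply: rc mr.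
have gdeg n v w : n \in gensK -> v \in gensB -> w \in gensB -> (ldeg v + ldeg n)%N != ldeg w ->
    g n (ix v) (ix w) = 0.
  move=> ng vg wg vnw.
  have := gX F^o (fun u => (u == w)%:R) n v ng vg.
  rewrite (bigD1_seq w) //= eqxx [X in _ + X]big1 ?addr0 => [|u /negPf->]; last by rewrite scaler0.
  rewrite -[_ *: 1]/(_ * 1) mulr1 => ->; rewrite big1_seq // => m /andP[_ mr].
  have /and3P[_ _ /eqP e] := allP (allP (allP rhot_chk v vg) n ng) m mr.
  case: eqP => [ew|_]; last by rewrite scaler0.
  by rewrite -ew -e eqxx in vnw.
have g'deg n v w : n \in gensK -> v \in gensB -> w \in gensB -> (ldeg v + ldeg n)%N != ldeg w ->
    g' n (ix v) (ix w) = 0.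
  by move=> ng vg wg vnw; rewrite /g'; case: ifP => _; rewrite ?gdeg // mxE.
have rME x y v u : r (x ∙ y) (ix v) (ix u) = \sum_(w <- gensB) r x (ix v) (ix w) * r y (ix w) (ix u).
  rewrite rM mxE sum_gensB; apply: eq_bigr => j _.
  by rewrite ixK.
have rel i j : linear (fun k => r k i j : F^o) by move=> a x y; rewrite rl !mxE.
exists (fun k v w => r k (ix v) (ix w)); split=> [v w|v w vg wg|||].
- exact: rel.
- by rewrite r1 mxE ix_inj.
- exact: rME.
- move=> M X X0 n v ng vg; rewrite (rE n ng) -(gX M X n v ng vg); apply: eq_big_seq => w wg.
  rewrite /g'; case: (fl) X0 => //= /(_ erefl) X0.
  case: (boolP (lodd n)) => //= n1; rewrite mxE scale0r.
  case: (boolP (lodd w)) => [/X0->|w0]; first by rewrite scaler0.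
  rewrite gdeg ?scale0r // /ldeg n1 (negPf w0).
  by case: (lodd v).
move=> k; apply: (gK (P := fun k => forall n v w, v \in gensB -> w \in gensB ->
  (ldeg v + n)%N != ldeg w -> r (gpr n k) (ix v) (ix w) = 0)) => {k}
  [n v w vg wg h|c x hx n v w vg wg h|x y hx hy n v w vg wg h|x y hx hy n v w vg wg h|x [m mg ->] n v w vg wg h].
- rewrite (homog_gpr mK _ (gone_homog hK)); case: eqP => [n0|_]; last by rewrite (lin0 rl) mxE.
  by rewrite r1 mxE ix_inj //; case: eqP => // e; rewrite e n0 addn0 eqxx in h.
- by rewrite (linZ (lf_gpr mK n)) (linZ rl) mxE (hx n v w) // mulr0.
- by rewrite (linD (lf_gpr mK n)) (linD rl) mxE (hx n v w) // (hy n v w) // addr0.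
- rewrite (gprM hK) (lin_sum (rel _ _)) big1 // => i _; rewrite rME big1_seq // => u /andP[_ ug].
  case: (eqVneq (ldeg v + i)%N (ldeg u)) => [e|ne]; last by rewrite (hx i v u) // mul0r.
  rewrite (hy (n - i)%N u w) ?mulr0 // -e -addnA subnKC //.
  by rewrite -ltnS.
rewrite (homog_gpr mK _ (pr_homog hP m)); case: eqP => [nm|_]; last by rewrite (lin0 rl) mxE.
by rewrite (rE m mg) g'deg // -nm.
Qed.

End Representation.

(* The cross relation v g = \sum (-1)^(|v| |g1|) g1 (v acted upon by g2). *)
Definition RX (v g : nat) : lpoly := flatten [seq [seq
  (if lodd v && lodd h.1 then - m.1.1 else m.1.1, m.1.2, h.1 :: m.2) | m : mono <- rhot v h.2] | h <- copt g].
(** The cross relations hold everywhere, but the relations of B only on the vector at the end of the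
    word, where they are an induction hypothesis. [P_chk] says that they then also hold on that
    vector multiplied by a generator of K. *)
Definition RP (a b : nat) (last : bool) : option lpoly :=
  if (10 <= a < 14)%N && (b < 9)%N then Some (RX a b) else if last then RB a b else None.

Lemma P_chk : all (fun l => all (fun g => vanishes RP letter (lapp l [:: g])) gensK) relB.
Proof. by vm_cast_no_check (erefl true). Qed.
Lemma relB_chk : all (reduces RB letter) relB.
Proof. by vm_cast_no_check (erefl true). Qed.
Lemma relB_letters : all (fun l : lpoly => all (fun m : mono => all (fun n => n \in gensB) m.2) l) relB.
Proof. by vm_cast_no_check (erefl true). Qed.

Lemma shift_homog (F : fieldType) (V W U : gmod F) (hV : is_gmod V) (hW : is_gmod W) (hU : is_gmod U)
    (f : tens V W -> U) c : linear f ->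
  (forall a b v w, homog a v -> homog b w -> homog (a + b + c) (f (v ⊗ w))) ->
  forall n t, @homog F (gtens V W) n t -> homog (n + c) (f t).
Proof.
move=> fl fh n t nt; rewrite -nt; move: t {nt}; apply: tens_ind => [v w|s t hs ht] /=.
  rewrite tpr_pure // (lin_sum fl); apply: (homog_sum hU) => k.
  have kn : (k <= n)%N by rewrite -ltnS.
  have := fh _ _ _ _ (gpr_homog hV k v) (gpr_homog hW (n - k)%N w); rewrite subnKC //; exact.
by rewrite (linD (lf_tpr_deg hV hW n)) (linD fl); apply: (homogD hU).
Qed.

Lemma par_mul_ph (F : fieldType) (A : galg F) (hA : is_galg A) i o (x y : A) :
  ph o x -> par i (x ∙ y) = x ∙ par (i (+) o) y.
Proof.
move=> xo; have mA := galg_is_gmod hA; move: y; apply: (ph_ext mA) => [||j y yj].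
- exact: lf_comp (lf_par mA i) (gmul_linearr hA x).
- exact: lf_comp (gmul_linearr hA x) (lf_par mA _).
have pxy := phM hA xo yj.
have [e|ne] := eqVneq i (o (+) j).
  by rewrite e (par_id mA pxy) addbAC addbb (par_id mA yj).
rewrite (par_neq mA pxy) // (par_neq mA yj) ?(gmul0r hA) //.
by apply: contraNneq ne => <-; rewrite addbC addbK.
Qed.

Lemma generated_left (F : fieldType) (A : galg F) (hA : is_galg A) (G P : A -> Prop) :
  generated G -> P (gone A) -> (forall c x, P x -> P (c *: x)) ->
  (forall x y, P x -> P y -> P (x + y)) -> (forall g x, G g -> P x -> P (g ∙ x)) -> forall x, P x.
Proof.
move=> gA P1 PZ PD PM x; rewrite -(gmul1r hA x); move: P1.
apply: (gA (fun x => forall y, P y -> P (x ∙ y))) => {x}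
  [y Py|c x hx y Py|x z hx hz y Py|x z hx hz y Py|x Gx y Py].
- by rewrite (gmul1l hA).
- by rewrite (gmulZl hA); apply: PZ; apply: hx.
- by rewrite (gmulDl hA); apply: PD; [apply: hx | apply: hz].
- by rewrite -(gmulA hA); apply: hx; apply: hz.
- exact: PM.
Qed.

(** * From the action on generators to the action on the quantum plane *)

Section Action.
Variables (F : fieldType) (q : F) (q0 : q != 0) (fl : bool) (K : galg F) (kl : nat -> K).
Variables (B : galg F) (bl : nat -> B).
Hypotheses (hP : is_pres q fl kl gensK relK RK) (hQ : is_pres q fl bl gensB relB RB).
Variables (H : hopf_ops K) (hH : is_shopf H).
Hypothesis copE : forall n, n \in gensK -> cop H (kl n) = \sum_(g <- copt n) kl g.1 ⊗ kl g.2.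
Variable r : K -> nat -> nat -> F.
Hypotheses (rl : forall v w, linear (fun k => r k v w : F^o))
  (r1 : forall v w, v \in gensB -> w \in gensB -> r (gone K) v w = (v == w)%:R)
  (rM : forall x y v u, r (x ∙ y) v u = \sum_(w <- gensB) r x v w * r y w u)
  (rX : forall (M : lmodType F) (X : nat -> M), (fl = false -> forall w, lodd w -> X w = 0) ->
        forall n v, n \in gensK -> v \in gensB ->
        \sum_(w <- gensB) r (kl n) v w *: X w = \sum_(m <- rhot v n) zc q m.1.1 m.1.2 *: X (hd0 m.2))
  (rdeg : forall k n v w, v \in gensB -> w \in gensB -> (ldeg v + n)%N != ldeg w -> r (gpr n k) v w = 0).
Let hK := pr_galg hP.
Let hB := pr_galg hQ.
Let mK := galg_is_gmod hK.
Let mB := galg_is_gmod hB.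
Let mT := gtens_gmod mK mB.
Let mKK := gtens_gmod mK mK.
Let gK := pr_gen hP.
Let gB := pr_gen hQ.
Let hC := shopf_coalg hH.
Let eK := shopf_char hH.
Let copP := shopf_cop hH.
Let copl : linear (cop H). Proof. by case: copP => -[]. Qed.
Let el : linear (cou H : K -> F^o). Proof. by case: eK. Qed.

Definition va (v : nat) (k : K) : B := \sum_(w <- gensB) r k v w *: bl w.

Lemma lf_va v : linear (va v).
Proof. by apply: lf_sum => w; apply: lf_scalel; apply: rl. Qed.

Let h_gmulKl := @lf_gmull _ K hK.
Let h_gmulKr := @lf_gmulr _ K hK.
Let h_gmulBl := @lf_gmull _ B hB.
Let h_gmulBr := @lf_gmulr _ B hB.
Let h_sgK := fun (T : lmodType F) i (f : T -> K) => @lf_sgc _ T K mK i f.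
Let h_sgB := fun (T : lmodType F) i (f : T -> B) => @lf_sgc _ T B mB i f.
Let h_cop (T : lmodType F) (f : T -> K) (h : linear f) := lf_comp copl h.
Let h_va (T : lmodType F) v (f : T -> K) (h : linear f) := lf_comp (lf_va v) h.
Let h_r (T : lmodType F) v w (f : T -> K) (h : linear f) := lf_comp (rl v w) h.
Let h_e (T : lmodType F) (f : T -> K) (h : linear f) := lf_comp el h.
Ltac lin_hook ::= first
  [ apply: h_gmulKl | apply: h_gmulKr | apply: h_gmulBl | apply: h_gmulBr
  | apply: h_sgK | apply: h_sgB | apply: h_cop | apply: h_va | apply: h_r | apply: h_e ].

Definition Lop (k : K) (t : tens K B) : tens K B := \sw_(a, b <- t) ((k ∙ a) ⊗ b).
(* Multiplication by v in the smash product, which does not exist yet: the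
   relations of B hold for these operators, so that B acts on the tensor product,
   and the action of k on b is read off from the counit applied to b (k tensor 1). *)
Definition Pop (v : nat) (t : tens K B) : tens K B :=
  \sw_(a, b <- t) \sw_(a1, a2 <- cop H a) (sg (lodd v) a1 ⊗ (va v a2 ∙ b)).

Let bLop k : bilin (fun (a : K) (b : B) => (k ∙ a) ⊗ b).
Proof. by lin. Qed.
Let bPop v : bilin (fun (a : K) (b : B) => \sw_(a1, a2 <- cop H a) (sg (lodd v) a1 ⊗ (va v a2 ∙ b))).
Proof. by lin. Qed.
Lemma lf_Lop k : linear (Lop k). Proof. exact: lf_tlift. Qed.
Lemma lf_Lopl t : linear (fun k => Lop k t).
Proof. by apply: lf_tlift_par => a b; lin. Qed.
Lemma lf_Pop v : linear (Pop v). Proof. exact: lf_tlift. Qed.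
Lemma Lop_pure k a b : Lop k (a ⊗ b) = (k ∙ a) ⊗ b.
Proof. exact: tlift_pure. Qed.
Lemma Pop_pure v a b : Pop v (a ⊗ b) = \sw_(a1, a2 <- cop H a) (sg (lodd v) a1 ⊗ (va v a2 ∙ b)).
Proof. exact: tlift_pure. Qed.

Lemma LopM k l t : Lop (k ∙ l) t = Lop k (Lop l t).
Proof.
move: t; apply: tens_ext => [||a b]; first exact: lf_Lop.
  exact: lf_comp (lf_Lop k) (lf_Lop l).
by rewrite !Lop_pure (gmulA hK).
Qed.

Lemma Lop1 t : Lop (gone K) t = t.
Proof.
move: t; apply: tens_ext => [||a b]; [exact: lf_Lop | exact: lf_id |].
by rewrite Lop_pure (gmul1l hK).
Qed.

Lemma va1 v : v \in gensB -> va v (gone K) = bl v.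
Proof.
move=> vg; rewrite /va (bigD1_seq v) //= r1 // eqxx scale1r.
rewrite big1_seq ?addr0 // => w /andP[wv wg].
by rewrite r1 // eq_sym (negPf wv) scale0r.
Qed.

Lemma Pop1 v b : v \in gensB -> Pop v (gone K ⊗ b) = gone K ⊗ (bl v ∙ b).
Proof.
move=> vg; rewrite Pop_pure; case: copP => _ -> _.
by rewrite tlift_pure ?va1 ?(sg1 hK) //; lin.
Qed.

Lemma r_par k j v w : v \in gensB -> w \in gensB -> ph j k -> lodd v (+) j != lodd w -> r k v w = 0.
Proof.
move=> vg wg kj vw; have [N hN] := gpr_bound mK k.
rewrite (gpr_sum mK hN) (lin_sum (rl v w)) big1 // => n _.
have [/eqP nj|nj] := boolP (odd n == j); last by rewrite kj // (lin0 (rl v w)).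
apply: rdeg => //; apply: contraNneq vw => e.
by have := congr1 odd e; rewrite oddD !oddb nj => ->.
Qed.

Lemma vaM v k l : va v (k ∙ l) = \sum_(w <- gensB) r k v w *: va w l.
Proof.
rewrite /va; under eq_bigr => u _ do rewrite rM scaler_suml.
rewrite exchange_big; apply: eq_bigr => w _; rewrite scaler_sumr.
by apply: eq_bigr => u _; rewrite scalerA.
Qed.

(** The cross relation as an identity of operators. A matrix coefficient vanishes unless the
    parities match, which is what lets the sign of v times that of the second leg be read as the
    sign of w. *)
Lemma PopL v k t : v \in gensB ->
  Pop v (Lop k t) = \sw_(k1, k2 <- cop H k)
    Lop (sg (lodd v) k1) (\sum_(w <- gensB) r k2 v w *: Pop w t).
Proof.
move=> vg.
have bR (t' : tens K B) : bilin (fun k1 k2 : K => Lop (sg (lodd v) k1) (\sum_(w <- gensB) r k2 v w *: Pop w t')).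
  split=> y; first by apply: lf_comp (lf_Lopl _) _; lin.
  by apply: lf_comp (lf_Lop _) _; apply: lf_sum => w; apply: lf_scalel; lin.
move: t; apply: tens_ext => [||a b].
- exact: lf_comp (lf_Pop v) (lf_Lop k).
- apply: lf_tlift_par => k1 k2; apply: lf_comp (lf_Lop _) _.
  by apply: lf_sum => w; apply: lf_scale; apply: lf_Pop.
rewrite Lop_pure Pop_pure; case: copP => _ _ ->.
have b1 : bilin (fun a1 a2 : K => sg (lodd v) a1 ⊗ (va v a2 ∙ b)) by lin.
have b2 w : bilin (fun a1 a2 : K => sg (lodd w) a1 ⊗ (va w a2 ∙ b)) by lin.
have [sl sr] := bilin_smul hK hK.
under [RHS]eq_tlift => k1 k2 do under eq_bigr => w _ do rewrite Pop_pure.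
move: (cop H a) => t.
have bR' : bilin (fun k1 k2 : K => Lop (sg (lodd v) k1) (\sum_(w <- gensB) r k2 v w *:
    (\sw_(a1, a2 <- t) (sg (lodd w) a1 ⊗ (va w a2 ∙ b))))).
  split=> y; first by apply: lf_comp (lf_Lopl _) _; lin.
  by apply: lf_comp (lf_Lop _) _; apply: lf_sum => w; apply: lf_scalel; lin.
move: (cop H k) t bR' => s t bR'; move: s; apply: (tens_phext mK mK) => [||i j k1 k2 k1i k2j].
- exact: lf_comp (lf_tlift b1) (sl t).
- exact: lf_tlift bR'.
rewrite (tlift_pure bR') {bR'}; move: t; apply: (tens_phext mK mK) => [||l m a1 a2 a1l a2m].
- exact: lf_comp (lf_tlift b1) (sr _).
- apply: lf_comp (lf_Lop _) _; apply: lf_sum => w; apply: lf_scale; exact: lf_tlift (b2 w).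
rewrite -[gmul _ _]/(@smul F K K (k1 ⊗ k2) (a1 ⊗ a2)) (smul_ph hK hK _ _ k2j a1l) (linZ (lf_tlift b1)) (tlift_pure b1) (sgM hK) vaM.
rewrite (lin_sum (lf_Lop _)) (lin_sum (gmul_linearl hB b)).
have hl (X : K) : linear (fun y : B => X ⊗ y) by lin.
rewrite (lin_sum (hl _)) scaler_sumr; apply: eq_big_seq => w wg.
rewrite (tlift_pure (b2 w)) (linZ (lf_Lop _)) Lop_pure (gmulZl hB) tensZr scalerA.
have [e|ne] := eqVneq (lodd v (+) j) (lodd w); last by rewrite (r_par vg wg k2j ne) mulr0 !scale0r.
rewrite !(sg_ph mK _ a1l) !(gmulZr hK) !tensZl !scalerA -e; congr (_ *: _).
by case: (lodd v); case: (j); case: (l); rewrite /sign /= ?expr1 ?expr0; ring.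
Qed.

Lemma K_deg0 : fl = false -> forall k : K, homog 0 k.
Proof.
move=> e; apply: gK => [|c x|x y|x y|x [n ng ->]].
- exact: gone_homog hK.
- exact: homogZ.
- exact: homogD.
- exact: (gmul_homog hK (m := 0) (n := 0)).
case: (boolP (lodd n)) => [n1|n0]; last by have := pr_homog hP n; rewrite /ldeg (negPf n0).
by rewrite (pr_odd hP e n1); apply: homog0.
Qed.

Lemma va_odd : fl = false -> forall v k, v \in gensB -> lodd v -> va v k = 0.
Proof.
move=> e v k vg v1; rewrite /va big1_seq // => w /andP[_ wg].
case: (boolP (lodd w)) => [w1|w0]; first by rewrite (pr_odd hQ e w1) scaler0.
rewrite -(K_deg0 e k) rdeg ?scale0r // /ldeg v1 (negPf w0) //.
Qed.

Lemma Pop_odd : fl = false -> forall v t, v \in gensB -> lodd v -> Pop v t = 0.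
Proof.
move=> e v t vg v1; rewrite /Pop (@eq_tlift _ _ _ _ _ (fun _ _ => 0)) => [|a b].
  by rewrite /tlift big1.
rewrite (@eq_tlift _ _ _ _ _ (fun _ _ => 0)) => [|a1 a2]; first by rewrite /tlift big1.
by rewrite va_odd // (gmul0l hB) tens0r.
Qed.

Definition opP (n : nat) (t : tens K B) : tens K B :=
  if (n < 10)%N then Lop (kl n) t else if n \in gensB then Pop n t else 0.

Lemma lf_opP n : linear (opP n).
Proof.
move=> a x y; rewrite /opP; case: ifP => _; first exact: lf_Lop.
by case: ifP => _; [exact: lf_Pop | rewrite scaler0 addr0].
Qed.

Lemma opP_K n t : n \in gensK -> opP n t = Lop (kl n) t.
Proof. by rewrite /opP !inE => /or4P[/eqP->|/eqP->|/eqP->|/or4P[/eqP->|/eqP->|/eqP->|/or3P[] /eqP->]]. Qed.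
Lemma opP_B n t : n \in gensB -> opP n t = Pop n t.
Proof. by rewrite /opP !inE => /or4P[] /eqP->. Qed.

Lemma copt_chk : all (fun n => all (fun g => (g.1 \in gensK) && (g.2 \in gensK)) (copt n)) gensK.
Proof. by []. Qed.

Lemma opP_cross v g t : v \in gensB -> g \in gensK -> opP v (opP g t) = pev q opP (RX v g) t.
Proof.
move=> vg gg; rewrite (opP_B _ vg) (opP_K _ gg) PopL // copE //.
have bR : bilin (fun k1 k2 : K => Lop (sg (lodd v) k1) (\sum_(w <- gensB) r k2 v w *: Pop w t)).
  split=> y; first by apply: lf_comp (lf_Lopl _) _; lin.
  by apply: lf_comp (lf_Lop _) _; apply: lf_sum => w; apply: lf_scalel; lin.
rewrite (lin_sum (lf_tlift bR)) /RX pev_flatten; apply: eq_big_seq => h hg.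
have /andP[h1 h2] := allP (allP copt_chk g gg) h hg.
rewrite (tlift_pure bR).
pose X w := if w \in gensB then Pop w t else 0.
have -> : \sum_(w <- gensB) r (kl h.2) v w *: Pop w t = \sum_(w <- gensB) r (kl h.2) v w *: X w.
  by apply: eq_big_seq => w wg; rewrite /X wg.
rewrite (rX _ h2 vg) => [|e w w1]; last by rewrite /X; case: ifP => // wg; apply: Pop_odd.
rewrite (lin_sum (lf_Lop _)) /pev big_map; apply: eq_big_seq => m mr.
have /and3P[/eqP me mg _] := allP (allP (allP rhot_chk v vg) _ h2) m mr.
rewrite (linZ (lf_Lop _)) /X mg me /= (opP_B _ mg) (opP_K _ h1).
rewrite (sg_homog mK _ (pr_homog hP _)) oddb (linZ (lf_Lopl _)) scalerA; congr (_ *: _).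
by case: ifP => _; rewrite ?zcN /sign ?expr1 ?expr0 ?mulr1 ?mulrN1.
Qed.

Let Zp t := forall l, l \in relB -> pev q opP l t = 0.

(** The tensors on which all relations of B vanish contain 1 ⊗ b, since B satisfies its own
    relations, and are stable under left multiplication by generators of K by [P_chk]. Hence they
    are all tensors. *)
Lemma opP_relation l t : l \in relB -> pev q opP l t = 0.
Proof.
have zcomb (op : nat -> tens K B -> tens K B) rt l' z (opl : forall n, linear (op n)) :
    vanishes rt letter l' ->
    (forall a b p, rt a b false = Some p -> forall z, op a (op b z) = pev q op p z) ->
    (forall a b p, rt a b true = Some p -> op a (op b z) = pev q op p z) -> pev q op l' z = 0.
  move=> h h1 h2; rewrite (@eq_pev _ q _ op (fun n => pev q op (letter n))) => [|n y]; last by rewrite pev_letter.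
  exact: (vanishesP q0 opl h1 h2 h).
have ZL g z : g \in gensK -> Zp z -> Zp (Lop (kl g) z).
  move=> gg zz l' lr; rewrite -(opP_K _ gg) -[opP g z]/(foldr opP z [:: g]) -pev_lapp.
  apply: (zcomb _ _ _ _ lf_opP (allP (allP P_chk l' lr) g gg)) => a b p; rewrite /RP.
    case: ifP => // /andP[ag bg] [<-] y; apply: opP_cross.
      by move: ag; do 14![case: a => [|a] //].
    by move: bg; do 9![case: b => [|b] //].
  case: ifP => [/andP[ag bg] [<-]|_ ].
    apply: opP_cross.
      by move: ag; do 14![case: a => [|a] //].
    by move: bg; do 9![case: b => [|b] //].
  rewrite /RB; case: ltnP => // a10 /(tallP RB_chk) /hasP[l2 lr2].
  rewrite subnKC // => h.
  have := zcomb opP _ _ z lf_opP h (fun _ _ _ e => False_rect _ (eq_ind None (fun x => if x is None then True else False) I _ e)) (fun _ _ _ e => False_rect _ (eq_ind None (fun x => if x is None then True else False) I _ e)).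
  rewrite pev_diff // pev_cat (zz _ lr2) addr0 => /eqP.
  by rewrite subr_eq0 => /eqP.
have ZD x y : Zp x -> Zp y -> Zp (x + y).
  by move=> hx hy l' lr; rewrite (linD (lf_pev q lf_opP l')) hx // hy // addr0.
have ZZ c x : Zp x -> Zp (c *: x).
  by move=> hx l' lr; rewrite (linZ (lf_pev q lf_opP l')) hx // scaler0.
have ZK k : forall z, Zp z -> Zp (Lop k z).
  apply: (gK (P := fun k => forall z, Zp z -> Zp (Lop k z))) => {k} [z|c x hx z zz|x y hx hy z zz|x y hx hy z zz|x [n ng ->] z zz].
  - by rewrite Lop1.
  - by rewrite (linZ (lf_Lopl z)); apply: ZZ; apply: hx.
  - by rewrite (linD (lf_Lopl z)); apply: ZD; [apply: hx | apply: hy].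
  - by rewrite LopM; apply: hx; apply: hy.
  - exact: ZL.
have Z1 b : Zp (gone K ⊗ b).
  move=> l' lr; have /allP lt := allP relB_letters l' lr.
  have -> : pev q opP l' (gone K ⊗ b) = gone K ⊗ pev q (fun n => @gmul F B (bl n)) l' b.
    have hl : linear (fun y : B => gone K ⊗ y) by lin.
    rewrite (lin_sum hl); apply: eq_big_seq => m /lt ml; rewrite (linZ hl); congr (_ *: _).
    elim: m.2 ml => //= x w IHw /andP[xg /IHw ->].
    by rewrite (opP_B _ xg) Pop1.
  by rewrite (sys_reduces q0 (pres_sys hQ) _ (allP relB_chk l' lr)) tens0r.
move: t l; suff h t : Zp t by move=> l t; apply: h.
move: t; apply: tens_ind => [a b|x y hx hy]; last exact: ZD.
have -> : a ⊗ b = Lop a (gone K ⊗ b) by rewrite Lop_pure (gmul1r hK).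
exact: ZK.
Qed.

Lemma actB_ex : exists f : B -> tens K B -> tens K B,
  [/\ forall z, linear (f ^~ z), forall x, linear (f x), forall z, f (gone B) z = z,
    forall x y z, f (x ∙ y) z = f x (f y z) & forall n z, n \in gensB -> f (bl n) z = Pop n z].
Proof.
have [|f [f1 f2 f3 f4 f5]] := pr_act hQ lf_opP (fun l lr t => opP_relation t lr).
  by move=> e n ng n1 z; rewrite (opP_B _ ng) Pop_odd.
by exists f; split=> // n z ng; rewrite f5 // opP_B.
Qed.

Definition epsl (t : tens K B) : B := \sw_(a, b <- t) cou H a *: b.
Let b_eps : bilin (fun (a : K) (b : B) => cou H a *: b). Proof. by lin. Qed.
Lemma lf_epsl : linear epsl. Proof. exact: lf_tlift. Qed.
Lemma epsl_pure a b : epsl (a ⊗ b) = cou H a *: b. Proof. exact: tlift_pure. Qed.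
Lemma epsl_Lop k t : epsl (Lop k t) = cou H k *: epsl t.
Proof.
move: t; apply: tens_ext => [||a b].
- exact: lf_comp lf_epsl (lf_Lop k).
- by apply: lf_scale; apply: lf_epsl.
by rewrite Lop_pure !epsl_pure (char_mul eK) scalerA.
Qed.

Section WithAction.
Variable f : B -> tens K B -> tens K B.
Hypotheses (fl1 : forall z, linear (f ^~ z)) (fl2 : forall x, linear (f x))
  (f1 : forall z, f (gone B) z = z) (fM : forall x y z, f (x ∙ y) z = f x (f y z))
  (fV : forall n z, n \in gensB -> f (bl n) z = Pop n z).

Definition acB (e : B) (k : K) : B := epsl (f e (k ⊗ gone B)).

Lemma lf_acBl k : linear (acB ^~ k). Proof. exact: lf_comp lf_epsl (fl1 _). Qed.
Lemma lf_acBr e : linear (acB e).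
Proof. by apply: lf_comp lf_epsl _; apply: lf_comp (fl2 e) _; lin. Qed.

Lemma f_unit e b : f e (gone K ⊗ b) = gone K ⊗ (e ∙ b).
Proof.
move: e b; apply: (generated_left hB gB) => [b|c x hx b|x y hx hy b|g x [n ng ->] hx b].
- by rewrite f1 (gmul1l hB).
- by rewrite (linZ (fl1 _)) hx (gmulZl hB) tensZr.
- by rewrite (linD (fl1 _)) hx hy (gmulDl hB) tensDr.
by rewrite fM hx fV // Pop1 // (gmulA hB).
Qed.

Lemma f_bl v t : v \in gensB -> forall k, \sum_(w <- gensB) r k v w *: Pop w t = f (va v k) t.
Proof.
move=> vg k; rewrite (lin_sum (fl1 t)); apply: eq_big_seq => w wg.
by rewrite (linZ (fl1 t)) fV.
Qed.

Let h_f1 (T : lmodType F) (g : T -> B) z (h : linear g) := lf_comp (fl1 z) h.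
Let h_f2 (T : lmodType F) (g : T -> tens K B) x (h : linear g) := lf_comp (fl2 x) h.
Let h_L1 (T : lmodType F) (g : T -> K) z (h : linear g) := lf_comp (lf_Lopl z) h.
Let h_L2 (T : lmodType F) (g : T -> tens K B) x (h : linear g) := lf_comp (lf_Lop x) h.
Let h_a1 (T : lmodType F) (g : T -> B) k (h : linear g) := lf_comp (lf_acBl k) h.
Let h_a2 (T : lmodType F) (g : T -> K) e (h : linear g) := lf_comp (lf_acBr e) h.
Ltac lin_hook ::= first
  [ apply: h_gmulKl | apply: h_gmulKr | apply: h_gmulBl | apply: h_gmulBr
  | apply: h_sgK | apply: h_sgB | apply: h_cop | apply: h_va | apply: h_r | apply: h_e
  | apply: h_f1 | apply: h_f2 | apply: h_L1 | apply: h_L2 | apply: h_a1 | apply: h_a2 ].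

(** The cross relation between e and all of K, as operators. The parity j only fixes the sign, so
    that the property makes sense before e is known to be of parity j. *)
Definition crossS (j : bool) (e : B) : Prop := forall k z,
  f e (Lop k z) = \sw_(k1, k2 <- cop H k) Lop (sg j k1) (f (acB e k2) z).

Lemma acB_bl v k : v \in gensB -> acB (bl v) k = va v k.
Proof.
move=> vg; rewrite /acB fV // Pop_pure (lin_tlift _ _ lf_epsl).
rewrite -[in RHS](coul hC k) (lin_tlift _ _ (lf_va v)); apply: eq_tlift => a b.
by rewrite epsl_pure (gmul1r hB) (char_sg hK _ _ eK) (linZ (lf_va v)).
Qed.

Lemma acB_one k : acB (gone B) k = cou H k *: gone B.
Proof. by rewrite /acB f1 epsl_pure. Qed.

Lemma acB1 e : acB e (gone K) = e.
Proof. by rewrite /acB f_unit epsl_pure (char_one eK) scale1r (gmul1r hB). Qed.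

Lemma crossS_acM j e k b : crossS j e -> epsl (f e (k ⊗ b)) = acB e k ∙ b.
Proof.
move=> he; have -> : k ⊗ b = Lop k (gone K ⊗ b) by rewrite Lop_pure (gmul1r hK).
rewrite he (lin_tlift _ _ lf_epsl) -[in RHS](coul hC k) (lin_tlift _ _ (lf_acBr e)).
rewrite (lin_tlift _ _ (gmul_linearl hB b)); apply: eq_tlift => a c.
by rewrite epsl_Lop f_unit epsl_pure (char_one eK) scale1r (char_sg hK _ _ eK) (linZ (lf_acBr e)) (gmulZl hB).
Qed.

(** Crossing e and then v past k splits k twice; coassociativity combines the two actions into the
    action of one leg on v e. *)
Lemma crossS_step v j e : v \in gensB -> crossS j e -> crossS (lodd v (+) j) (bl v ∙ e).
Proof.
move=> vg he.
have E k z : f (bl v ∙ e) (Lop k z) = \sw_(k1, s <- cop H k) \sw_(a, b <- cop H s)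
    Lop (sg (lodd v (+) j) k1) (f (va v (sg j a) ∙ acB e b) z).
  have cA : \sw_(k1, k2 <- cop H k) \sw_(a, b <- cop H k1)
      Lop (sg (lodd v (+) j) a) (f (va v (sg j b) ∙ acB e k2) z) =
      \sw_(k1, s <- cop H k) \sw_(a, b <- cop H s)
      Lop (sg (lodd v (+) j) k1) (f (va v (sg j a) ∙ acB e b) z).
    by rewrite (coassoc_trilin (copA hC k)) //; move=> *; lin.
  rewrite -cA fM he (lin_tlift _ _ (fl2 _)); apply: eq_tlift => k1 k2.
  rewrite fV // PopL //.
  have bb : bilin (fun a b : K => Lop (sg (lodd v) a) (\sum_(w <- gensB) r b v w *: Pop w (f (acB e k2) z))).
    split=> y; first by lin.
    by apply: h_L2; apply: lf_sum => w; apply: lf_scalel; lin.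
  rewrite (glin_sg mK mKK j k1 (cop_glin hC)) (tlift_sg mK mK j _ bb).
  by apply: eq_tlift => a b; rewrite f_bl // fM (sg_sgD hK).
have aM k : acB (bl v ∙ e) k = \sw_(a, b <- cop H k) (va v (sg j a) ∙ acB e b).
  have -> : acB (bl v ∙ e) k = epsl (f (bl v ∙ e) (Lop k (gone K ⊗ gone B))) by rewrite Lop_pure (gmul1r hK).
  rewrite E (lin_tlift _ _ lf_epsl).
  have hs : linear (fun s : K => \sw_(a, b <- cop H s) (va v (sg j a) ∙ acB e b)) by lin.
  rewrite -[in RHS](coul hC k) (lin_tlift _ _ hs); apply: eq_tlift => k1 s.
  rewrite (linZ hs) (lin_tlift _ _ lf_epsl) (@lin_tlift _ _ _ _ _ (fun y => cou H k1 *: y)); last by lin.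
  apply: eq_tlift => a b; rewrite epsl_Lop (char_sg hK _ _ eK) f_unit epsl_pure (char_one eK) scale1r.
  by rewrite (gmul1r hB).
move=> k z; rewrite E; apply: eq_tlift => k1 s.
rewrite aM (lin_tlift _ _ (fl1 z)) (lin_tlift _ _ (lf_Lop _)).
by apply: eq_tlift.
Qed.

(** Induction on left multiplication by generators, applied to each parity component separately
    because a general e has no parity of its own. *)
Lemma crossS_par e j : crossS j (par j e).
Proof.
have SZ i c x : crossS i x -> crossS i (c *: x).
  move=> hx k z; rewrite (linZ (fl1 _)) hx (@lin_tlift _ _ _ _ _ (fun y => c *: y)); last by lin.
  by apply: eq_tlift => a b; rewrite (linZ (lf_acBl b)) (linZ (fl1 z)) (linZ (lf_Lop _)).
have SD i x y : crossS i x -> crossS i y -> crossS i (x + y).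
  move=> hx hy k z; rewrite (linD (fl1 _)) hx hy /tlift -big_split; apply: eq_bigr => p _.
  by rewrite (linD (lf_acBl _)) (linD (fl1 z)) (linD (lf_Lop _)).
have S0 i : crossS i 0.
  move=> k z; rewrite (lin0 (fl1 _)) (@eq_tlift _ _ _ _ _ (fun _ _ => 0)) => [|a b].
    by rewrite /tlift big1.
  by rewrite (lin0 (lf_acBl b)) (lin0 (fl1 z)) (lin0 (lf_Lop _)).
move: e j; apply: (generated_left hB gB) => [j|c x hx j|x y hx hy j|g x [n ng ->] hx j].
- case: j; first by rewrite (par_neq mB (ph1 hB)).
  rewrite (par_id mB (ph1 hB)) => k z; rewrite f1 -[in LHS](coul hC k).
  rewrite (lin_tlift _ _ (lf_Lopl z)).
  have bb : bilin (fun a b : K => Lop (cou H a *: b) z) by lin.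
  have bb' : bilin (fun a b : K => Lop (cou H b *: a) z) by lin.
  transitivity (\sw_(a, b <- cop H k) Lop (cou H b *: a) z).
    by rewrite -!(lin_tlift _ _ (lf_Lopl z)) (coul hC) (cour hC).
  by apply: eq_tlift => a b; rewrite (sg0 mK) acB_one (linZ (fl1 z)) f1 (linZ (lf_Lop a)) (linZ (lf_Lopl z)).
- by rewrite (linZ (lf_par mB j)); apply: SZ.
- by rewrite (linD (lf_par mB j)); apply: SD.
have nn := homog_ph mB (pr_homog hQ n); rewrite oddb in nn.
rewrite (par_mul_ph hB _ _ nn).
have := crossS_step ng (hx (j (+) lodd n)).
by rewrite addbC addbK.
Qed.

Lemma crossS_ph j e : ph j e -> crossS j e.
Proof. by move=> ej; have := crossS_par e j; rewrite par_id. Qed.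

Lemma epsl_f e k b : epsl (f e (k ⊗ b)) = acB e k ∙ b.
Proof.
move: e; apply: (ph_ext mB) => [||j e ej].
- exact: lf_comp lf_epsl (fl1 _).
- by lin.
exact: crossS_acM (crossS_ph ej).
Qed.

Lemma acB_homog m n e k : homog m e -> homog n k -> homog (m + n) (acB e k).
Proof.
have va_h v a k' : v \in gensB -> homog a k' -> homog (ldeg v + a) (va v k').
  move=> vg ka; rewrite /va big_seq; apply: (big_ind (fun x : B => homog (ldeg v + a) x)).
  - exact: homog0.
  - exact: homogD.
  move=> w wg; have [E|ne] := eqVneq (ldeg v + a)%N (ldeg w).
    by rewrite E; apply: (homogZ mB); apply: (pr_homog hQ).
  by rewrite -ka rdeg // scale0r; apply: homog0.
have Pop_h v c t : v \in gensB -> @homog F (gtens K B) c t -> @homog F (gtens K B) (c + ldeg v) (Pop v t).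
  move=> vg; apply: (shift_homog mK mB mT (lf_Pop v)) => a b x y xa yb; rewrite Pop_pure.
  have bb : bilin (fun a1 a2 : K => sg (lodd v) a1 ⊗ (va v a2 ∙ y)) by lin.
  rewrite -addnA [(b + _)%N]addnC; apply: (shift_homog mK mK mT (lf_tlift bb)) => [a1 a2 x1 x2 x1a x2a|].
    rewrite (tlift_pure bb).
    have -> : (a1 + a2 + (ldeg v + b) = a1 + (ldeg v + a2 + b))%N by rewrite [(ldeg v + a2)%N]addnC !addnA.
    apply: (tens_homog mK mB).
      by rewrite (sg_homog mK _ x1a); apply: (homogZ mK).
    by apply: (gmul_homog hB) => //; apply: va_h.
  exact: (glin_homog (cop_glin hC)).
pose Q a x := forall c t, @homog F (gtens K B) c t -> @homog F (gtens K B) (c + a) (f x t).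
have QD a x y : Q a x -> Q a y -> Q a (x + y).
  by move=> hx hy c t ct; rewrite (linD (fl1 t)); apply: (homogD mT); [apply: hx | apply: hy].
have QZ a d x : Q a x -> Q a (d *: x).
  by move=> hx c t ct; rewrite (linZ (fl1 t)); apply: (homogZ mT); apply: hx.
have Q0 a : Q a 0 by move=> c t ct; rewrite (lin0 (fl1 t)); apply: homog0.
have hQ' x : forall a, Q a (gpr a x).
  apply: (gB (P := fun x => forall a, Q a (gpr a x))) => {x} [a|d x hx a|x y hx hy a|x y hx hy a|x [v vg ->] a].
  - rewrite (homog_gpr mB _ (gone_homog hB)); case: eqP => [->|_] //.
    by move=> c t ct; rewrite f1 addn0.
  - by rewrite (linZ (lf_gpr mB a)); apply: QZ.
  - by rewrite (linD (lf_gpr mB a)); apply: QD.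
  - rewrite (gprM hB); apply: (big_ind (Q a)) => [|u v|i _]; [exact: Q0 | exact: QD |].
    move=> c t ct; rewrite fM.
    have ia : (i <= a)%N by rewrite -ltnS.
    have := hx i _ _ (hy (a - i)%N _ _ ct).
    by rewrite -addnA subnK.
  rewrite (homog_gpr mB _ (pr_homog hQ v)); case: eqP => [->|_] //.
  by move=> c t ct; rewrite fV //; apply: Pop_h.
move=> em kn; rewrite addnC -[(n + m)%N]addn0 /acB.
apply: (shift_homog mK mB mB lf_epsl) => [a b x y xa yb|]; last first.
  rewrite -em; apply: hQ'; rewrite -[n]addn0.
  exact: (tens_homog mK mB kn (gone_homog hB)).
rewrite epsl_pure addn0; case: a xa => [|a] xa; first by apply: (homogZ mB).
by rewrite -xa (cou_homog hC) scale0r; apply: homog0.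
Qed.

Definition actC (D : B -> tens B K) : cmod K B := Cmod acB D.

(** The axioms follow from the cross relations by applying the counit to the K leg: the module law
    from e (kl), the product law from (uv) k. *)
Lemma acB_modalg D : is_modalg H (actC D).
Proof.
split=> //=.
- exact: lf_acBl.
- exact: lf_acBr.
- exact: acB_homog.
- exact: acB1.
- move=> e k l; move: e; apply: (ph_ext mB) => [||j e ej]; [lin | by lin |].
  have -> : acB e (k ∙ l) = epsl (f e (Lop k (l ⊗ gone B))) by rewrite Lop_pure.
  rewrite (crossS_ph ej) (lin_tlift _ _ lf_epsl) -[in RHS](coul hC k) (lin_tlift _ _ (lf_acBr e)).
  rewrite (lin_tlift _ _ (lf_acBl l)); apply: eq_tlift => a c.
  by rewrite epsl_Lop (char_sg hK _ _ eK) (linZ (lf_acBr e)) (linZ (lf_acBl l)).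
- exact: acB_one.
move=> j u v k vj; rewrite /acB fM.
have -> : k ⊗ gone B = Lop k (gone K ⊗ gone B) by rewrite Lop_pure (gmul1r hK).
rewrite (crossS_ph vj) (lin_tlift _ _ (fl2 u)) (lin_tlift _ _ lf_epsl); apply: eq_tlift => a b.
by rewrite f_unit Lop_pure (gmul1r hK) (gmul1r hB) epsl_f.
Qed.

End WithAction.
End Action.

Lemma action_ex (F : fieldType) (q : F) (q0 : q != 0) fl (K B : galg F) kl bl (H : hopf_ops K) :
  is_pres q fl kl gensK relK RK -> is_pres q fl bl gensB relB RB -> is_shopf H ->
  (forall n, n \in gensK -> cop H (kl n) = \sum_(g <- copt n) kl g.1 ⊗ kl g.2) ->
  exists ac : B -> K -> B, [/\ forall D, is_modalg H (@Cmod F K B ac D),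
    forall v g, v \in gensB -> g \in gensK -> ac (bl v) (kl g) = gev q bl (rhot v g) &
    forall v k, v \in gensB -> exists c : nat -> F, ac (bl v) k = \sum_(w <- gensB) c w *: bl w].
Proof.
move=> hP hQ hH copE; have [r [rl r1 rM rX rdeg]] := rep_ex q0 hP.
have [f [f1 f2 f3 f4 f5]] := actB_ex q0 hP hQ hH copE rl r1 rM rX rdeg.
have E v k : v \in gensB -> acB H f (bl v) k = va bl r v k := acB_bl hP hQ hH rl f5 k.
exists (acB H f); split=> [D|v g vg gg|v k vg].
- exact: (acB_modalg hP hQ hH rl r1 rM rdeg f1 f2 f3 f4 f5).
- rewrite (E v _ vg) /va (rX _ bl (pr_odd hQ)) // /gev; apply: eq_big_seq => m mr.
  have /and3P[/eqP me _ _] := allP (allP (allP rhot_chk v vg) _ gg) m mr.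
  by rewrite [in RHS]me /= (gmul1r (pr_galg hQ)).
- by exists (fun w => r k v w); rewrite (E v _ vg).
Qed.

(** * The coaction and the bosonisation *)

Section CoactTable.
Local Open Scope nat_scope.
Definition coattab : seq (seq (nat * nat)) := [::
  [:: (10, 0); (11, 2)]; [:: (10, 1); (11, 3)];
  [:: (12, 0); (13, 2); (10, 5); (11, 7)]; [:: (12, 1); (13, 3); (10, 6); (11, 8)]].
End CoactTable.
Definition coat (n : nat) : seq (nat * nat) := nth [::] coattab (n - 10).
Lemma coat10 : coat 10 = [:: (10, 0); (11, 2)]%N. Proof. by []. Qed.
Lemma coat11 : coat 11 = [:: (10, 1); (11, 3)]%N. Proof. by []. Qed.
Lemma coat12 : coat 12 = [:: (12, 0); (13, 2); (10, 5); (11, 7)]%N. Proof. by []. Qed.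
Lemma coat13 : coat 13 = [:: (12, 1); (13, 3); (10, 6); (11, 8)]%N. Proof. by []. Qed.
Definition coatE := (coat10, coat11, coat12, coat13).
Definition pair_s (g : nat * nat) : seq nat := [:: g.1.*2; g.2.*2.+1].
Definition coact_s (n : nat) : lpoly := [seq (1, 0, pair_s g) | g <- coat n].
Definition D_s (n : nat) : lpoly :=
  [seq (1, 0, pair_s g) | g <- coat n] ++ [:: (1, 0, [:: n.*2.+1])].
Definition copW_s (n : nat) : lpoly := if (n < 10)%N then cop_s n else D_s n.

(** Normal words have the letters of K in front, so a letter of K followed by one of B is never
    rewritten. *)
Definition RW (a b : nat) : option lpoly :=
  if (a < 10)%N then (if (b < 10)%N then RK a b else None)
  else if (b < 10)%N then (if (a < 14)%N && (b < 9)%N then Some (RX a b) else None) else RB a b.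
Notation lpar := (fun n => odd (ldeg n)).

Lemma coact_chk : all (reduces (rst lpar lpar RB RK) coact_s) relB &&
  all (fun n => pdeg (dst ldeg ldeg) (ldeg n) (coact_s n)) gensB.
Proof. by vm_cast_no_check (erefl true). Qed.
Lemma D_chk : all (reduces (rst lpar lpar RB RW) D_s) relB &&
  all (fun n => pdeg (dst ldeg ldeg) (ldeg n) (D_s n)) gensB.
Proof. by vm_cast_no_check (erefl true). Qed.
Lemma cross_chk : all (fun v => all (fun k => reduces (rst lpar lpar RW RW) copW_s
  ([:: (1, 0, [:: v; k])] ++ paddm (-1) 0 (RX v k) [::])) gensK) gensB.
Proof. by vm_cast_no_check (erefl true). Qed.
Lemma RX_chk : all (fun v => all (fun k => all (fun m : mono =>
  [&& m.2 == [:: hd0 m.2; hd0 (behead m.2)], hd0 m.2 \in gensK & hd0 (behead m.2) \in gensB]) (RX v k)) gensK) gensB.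
Proof. by vm_cast_no_check (erefl true). Qed.
Lemma RK_letters : tall RKtab (fun _ _ p => all (fun m : mono => all (fun n => n < 10)%N m.2) p).
Proof. by vm_cast_no_check (erefl true). Qed.
Lemma RB_letters : tall RBtab (fun _ _ p => all (fun m : mono => all (fun n => 10 <= n)%N m.2) p).
Proof. by vm_cast_no_check (erefl true). Qed.
Lemma eB_chk : all (reduces noRule (fun _ => [::])) relB.
Proof. by vm_cast_no_check (erefl true). Qed.
Lemma coat_chk : all (fun n => all (fun g => (g.1 \in gensB) && (g.2 \in gensK)) (coat n)) gensB.
Proof. by []. Qed.

Lemma eq_pev_in (F : fieldType) (q : F) (M : lmodType F) (op op' : nat -> M -> M) (P : pred nat) p z :
  (forall n, P n -> forall z, op n z = op' n z) -> all (fun m : mono => all P m.2) p ->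
  pev q op p z = pev q op' p z.
Proof.
move=> E /allP hp; apply: eq_big_seq => m /hp hm; congr (_ *: _).
by elim: m.2 hm => //= x w IHw /andP[/E-> /IHw->].
Qed.

Lemma gev_cat (F : fieldType) (q : F) (T : galg F) (ev : nat -> T) p p' :
  gev q ev (p ++ p') = gev q ev p + gev q ev p'.
Proof. exact: pev_cat. Qed.

Section Bosonisation.
Variables (F : fieldType) (q : F) (q0 : q != 0) (fl : bool) (K B : galg F).
Variables (kl : nat -> K) (bl : nat -> B).
Hypotheses (hP : is_pres q fl kl gensK relK RK) (hQ : is_pres q fl bl gensB relB RB).
Variables (H : hopf_ops K) (hH : is_shopf H).
Hypothesis copE : forall n, n \in gensK -> cop H (kl n) = \sum_(g <- copt n) kl g.1 ⊗ kl g.2.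
Hypothesis couE : forall n, n \in gensK -> cou H (kl n) = (cou_t n)%:R.
Variable C : cmod K B.
Hypothesis hM : is_modalg H C.
Hypothesis actE : forall v g, v \in gensB -> g \in gensK -> act C (bl v) (kl g) = gev q bl (rhot v g).
Let hK := pr_galg hP.
Let hB := pr_galg hQ.
Let mK := galg_is_gmod hK.
Let mB := galg_is_gmod hB.
Let sK := pres_sys hP.
Let sB := pres_sys hQ.
Let gK := pr_gen hP.
Let gB := pr_gen hQ.
Local Notation W := (bos H C).
Local Notation inl := (bos_inl H C).
Local Notation inr := (bos_inr H C).
Let hW := bos_galg hH hB hM.
Let mW := galg_is_gmod hW.
Let inlP := galg_map_bos_inl hH hB hM.
Let inrP := galg_map_bos_inr hH hB hM.

Definition evW (n : nat) : W := if (n < 10)%N then inl (kl n) else inr (bl n).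

Lemma evW_K n : n \in gensK -> evW n = inl (kl n).
Proof. by rewrite /evW !inE => /or4P[/eqP->|/eqP->|/eqP->|/or4P[/eqP->|/eqP->|/eqP->|/or3P[] /eqP->]]. Qed.
Lemma evW_B n : n \in gensB -> evW n = inr (bl n).
Proof. by rewrite /evW !inE => /or4P[] /eqP->. Qed.

Lemma bos_crossE v k : v \in gensB -> k \in gensK -> inr (bl v) ∙ inl (kl k) = gev q evW (RX v k).
Proof.
move=> vg kg; rewrite (bos_cross hH hB hM _ (homog_ph mB (pr_homog hQ v))) oddb (copE kg).
have bb : bilin (fun k1 k2 : K => sg (lodd v) k1 ⊗ act C (bl v) k2).
  split=> y; first by apply: lf_tpl; apply: (lf_sg mK).
  by apply: lf_tpr; apply: modalg_r hM _.
rewrite (lin_sum (lf_tlift bb)) /gev /RX pev_flatten; apply: eq_big_seq => h hg.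
have /andP[h1 h2] := allP (allP copt_chk k kg) h hg.
rewrite (tlift_pure bb) (actE vg h2) (sg_homog mK _ (pr_homog hP _)) oddb.
have hl : linear (fun y : B => (sign (lodd v && lodd h.1) *: kl h.1) ⊗ y : W) by apply: lf_tpr; apply: lf_id.
rewrite /gev {1}/pev (lin_sum hl) /pev big_map; apply: eq_big_seq => m mr.
have /and3P[/eqP me mg _] := allP (allP (allP rhot_chk v vg) _ h2) m mr.
rewrite (linZ hl) me -[foldr _ _ (h.1 :: _)]/(evW h.1 ∙ (evW (hd0 m.2) ∙ gone W)).
rewrite -[foldr _ _ [:: _]]/(bl (hd0 m.2) ∙ gone B) (gmul1r hB) (gmul1r hW) (evW_K h1) (evW_B mg).
rewrite -(bos_pureE hH hB hM) tensZl scalerA; congr (_ *: _).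
by case: ifP => _; rewrite /= ?zcN /sign ?expr1 ?expr0 ?mulr1 ?mulrN1.
Qed.

Lemma bos_sys : is_sys q fl evW ldeg RW.
Proof.
have aW := galg_alg hW.
split=> //.
- move=> n; rewrite /evW; case: ifP => _.
    exact: (glin_homog (galg_map_glin inlP) (pr_homog hP n)).
  exact: (glin_homog (galg_map_glin inrP) (pr_homog hQ n)).
- move=> e n n1; rewrite /evW; rewrite oddb in n1; have [[[ll _] _ _] [[lr _] _ _]] := (inlP, inrP).
  case: ifP => _; first by rewrite (pr_odd hP e n1) (lin0 ll).
  by rewrite (pr_odd hQ e n1) (lin0 lr).
move=> a b p; rewrite /RW; case: ifP => a10; case: ifP => b10 // E z.
- rewrite /evW a10 b10.
  rewrite (rules_map (kl' := fun n => inl (kl n)) hK hW (galg_map_alg inlP) (fun n => erefl) (pr_rules hP) E).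
  by apply: (eq_pev_in _ (P := fun n => (n < 10)%N)) (tallP RK_letters E) => n ->.
- move: E; case: ifP => // /andP[a14 b9] [<-].
  have ag : a \in gensB by move: (a) a14 a10; do 14![case=> //].
  have bg : b \in gensK by move: (b) b9; do 9![case=> //].
  rewrite (gmulA hW) (evW_B ag) (evW_K bg) (bos_crossE ag bg).
  exact: (pev_alg _ _ _ _ aW).
have RBl : all (fun m : mono => all (fun n => 10 <= n)%N m.2) p.
  by move: E; rewrite /RB a10 => /(tallP RB_letters).
rewrite /evW a10 b10.
rewrite (rules_map (kl' := fun n => inr (bl n)) hB hW (galg_map_alg inrP) (fun n => erefl) (pr_rules hQ) E).
by apply: (eq_pev_in _ (P := fun n => (10 <= n)%N)) RBl => n; rewrite leqNgt => /negPf ->.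
Qed.

(** The span of the generators x_i and dx_i and not just the set of them, since it must be stable
    under the action and under taking parity components. *)
Definition Vsp (b : B) : Prop := exists c : nat -> F, b = \sum_(w <- gensB) c w *: bl w.
Definition GK (x : K) : Prop := exists2 n, n \in gensK & x = kl n.

Lemma Vsp_bl v : v \in gensB -> Vsp (bl v).
Proof.
move=> vg; exists (fun w => (w == v)%:R); rewrite (bigD1_seq v) //= eqxx scale1r big1 ?addr0 // => w /negPf->.
by rewrite scale0r.
Qed.
Lemma Vsp_D u v : Vsp u -> Vsp v -> Vsp (u + v).
Proof.
by move=> [c ->] [d ->]; exists (fun w => c w + d w); rewrite -big_split; apply: eq_bigr => w _; rewrite scalerDl.
Qed.
Lemma Vsp_Z c v : Vsp v -> Vsp (c *: v).
Proof.
by move=> [d ->]; exists (fun w => c * d w); rewrite scaler_sumr; apply: eq_bigr => w _; rewrite scalerA.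
Qed.
Lemma Vsp_0 : Vsp 0.
Proof. by exists (fun _ => 0); rewrite big1 // => w _; rewrite scale0r. Qed.
Lemma Vsp_ind (P : B -> Prop) : P 0 -> (forall u v, P u -> P v -> P (u + v)) ->
  (forall c v, P v -> P (c *: v)) -> (forall v, v \in gensB -> P (bl v)) -> forall v, Vsp v -> P v.
Proof.
move=> P0 PD PZ Pb v [c ->]; rewrite big_seq; apply: (big_ind P) => // w wg.
by apply: PZ; apply: Pb.
Qed.

(** Turns the cross relation hypothesis of the universal property of W into a computation on pairs
    of generators: v k minus its crossed form must reduce to zero in the target. *)
Lemma cross_gen (U : lmodType F) (mul : U -> U -> U) (one : U) (evU : nat -> U) rU s
    (f : K -> U) (g : B -> U) : is_alg mul one -> rules q mul evU rU ->
  alg_map mul one f -> alg_map mul one g ->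
  (forall n, n \in gensK -> f (kl n) = pev q (fun n => mul (evU n)) (s n) one) ->
  (forall n, n \in gensB -> g (bl n) = pev q (fun n => mul (evU n)) (s n) one) ->
  all (fun v => all (fun k => reduces rU s ([:: (1, 0, [:: v; k])] ++ paddm (-1) 0 (RX v k) [::])) gensK) gensB ->
  forall v k, Vsp v -> GK k -> mul (g v) (f k) = bos_lift (H := H) (C := C) mul f g (inr v ∙ inl k).
Proof.
move=> aU hr hf hg fE gE chk v k hv [n ng ->]; have [gl_ _ _] := hg.
have [[[ll _] _ _] [[lr _] _ _]] := (inlP, inrP).
have bll := lf_bos_lift (H := H) (C := C) aU hf hg.
have sl := alg_mull aU.
move: v hv; apply: Vsp_ind => [|u v hu hv|c v hv|v vg].
- by rewrite (lin0 gl_) (lin0 (sl _)) (lin0 lr) (gmul0l hW) (lin0 bll).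
- by rewrite (linD gl_) (linD (sl _)) (linD lr) (gmulDl hW) (linD bll) hu hv.
- by rewrite (linZ gl_) (linZ (sl _)) (linZ lr) (gmulZl hW) (linZ bll) hv.
pose S m := pev q (fun n => mul (evU n)) (s m) one.
have SE m z : mul (S m) z = pev q (fun n => mul (evU n)) (s m) z by apply: pev_alg aU.
rewrite (bos_crossE vg ng).
have := reducesP q0 aU hr SE (allP (allP chk v vg) n ng) one.
rewrite pev_diff // => /eqP; rewrite subr_eq0 => /eqP.
rewrite (alg_mul1r aU) (gE _ vg) (fE _ ng) => ->.
rewrite /gev /pev (lin_sum bll); apply: eq_big_seq => m mr.
have /and3P[/eqP me m1 m2] := allP (allP (allP RX_chk v vg) n ng) m mr.
rewrite (linZ bll) me; congr (_ *: _).
rewrite -[foldr _ one _]/(mul (S (hd0 m.2)) (mul (S (hd0 (behead m.2))) one)).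
rewrite -[foldr _ (gone W) _]/(evW (hd0 m.2) ∙ (evW (hd0 (behead m.2)) ∙ gone W)).
rewrite (alg_mul1r aU) (gmul1r hW) (evW_K m1) (evW_B m2) -(bos_pureE hH hB hM).
by rewrite (bos_lift_pure H C aU hf hg) (fE _ m1) (gE _ m2).
Qed.

Lemma coactB_ex : exists D : B -> tens B K, @is_galg_map F B (stens B K) D /\
  forall n, n \in gensB -> D (bl n) = \sum_(g <- coat n) bl g.1 ⊗ kl g.2.
Proof.
have /andP[c1 c2] := coact_chk.
have [D [DP DE]] := pres_gmap q0 (stens_sys sB sK) hQ c1 c2.
exists D; split=> [|n ng]; first exact: DP.
rewrite (DE n ng) gev_map; apply: eq_bigr => g _.
exact: evst_pair.
Qed.

Lemma DB_ex : exists D : B -> stens B W, @is_galg_map F B (stens B W) D /\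
  forall n, n \in gensB -> D (bl n) = \sum_(g <- coat n) bl g.1 ⊗ inl (kl g.2) + gone B ⊗ inr (bl n).
Proof.
have /andP[c1 c2] := D_chk; have hBW := stens_galg hB hW.
have [D [DP DE]] := pres_gmap q0 (stens_sys sB bos_sys) hQ c1 c2.
exists D; split=> [|n ng]; first exact: DP.
rewrite (DE n ng) /D_s gev_cat gev_map; congr (_ + _).
  apply: eq_big_seq => g gn; have /andP[_ g2] := allP (allP coat_chk n ng) g gn.
  by rewrite -(evW_K g2); apply: evst_pair.
rewrite -[[:: _]]/(letter n.*2.+1) (gev_letter (stens_sys sB bos_sys)) /evst /= odd_double /= uphalf_double.
by rewrite (evW_B ng).
Qed.

Lemma eB_ex : exists e : B -> F, is_char e /\ (forall n v, e (gpr n.+1 v) = 0) /\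
  forall n, n \in gensB -> e (bl n) = 0.
Proof.
pose g (n : nat) : F^o := 0; pose mulF : F^o -> F^o -> F^o := *%R.
have [|l lr|_ n|e [[el e1 eM] eE]] := pr_univ hQ (mul := mulF) (one := 1) (g := g).
- exact: field_alg.
- apply: (reducesP q0 (ev := fun _ => 0) (@field_alg F) (noRuleP _ _ _)) (allP eB_chk l lr) _ => n z.
  by rewrite /g /mulF mul0r pev_nil.
- by [].
have eh v : forall n, e (gpr n.+1 v) = 0.
  apply: (gB (P := fun v => forall n, e (gpr n.+1 v) = 0)) => {v} [n|c v h n|u v hu hv n|u v hu hv n|v [k kg ->] n].
  - by rewrite (homog_gpr mB _ (gone_homog hB)) (lin0 el).
  - by rewrite (linZ (lf_gpr mB _)) (linZ el) h scaler0.
  - by rewrite (linD (lf_gpr mB _)) (linD el) hu hv addr0.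
  - rewrite (gprM hB) (lin_sum el) big1 // => i _; rewrite eM.
    case: (nat_of_ord i) => [|j]; last by rewrite hu /mulF mul0r.
    by rewrite subn0 hv /mulF mulr0.
  rewrite (homog_gpr mB _ (pr_homog hQ k)) /ldeg; case: eqP => [kn|_]; last exact: (lin0 el).
  by rewrite eE.
exists e; split; last by split.
exact: charI.
Qed.

Section WithCoaction.
Hypotheses (cP : @is_galg_map F B (stens B K) (coact C))
  (cE : forall n, n \in gensB -> coact C (bl n) = \sum_(g <- coat n) bl g.1 ⊗ kl g.2).
Variable D : B -> stens B W.
Hypotheses (DP : @is_galg_map F B (stens B W) D)
  (DE : forall n, n \in gensB -> D (bl n) = \sum_(g <- coat n) bl g.1 ⊗ inl (kl g.2) + gone B ⊗ inr (bl n)).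
Variable eB : B -> F.
Hypotheses (eBP : is_char eB) (eBh : forall n v, eB (gpr n.+1 v) = 0)
  (eB0 : forall n, n \in gensB -> eB (bl n) = 0).
Hypothesis actV : forall v k, v \in gensB -> exists c : nat -> F, act C (bl v) k = \sum_(w <- gensB) c w *: bl w.

Lemma Vsp_act v k : Vsp v -> Vsp (act C v k).
Proof.
move: v; apply: Vsp_ind => [|u v hu hv|c v hv|v vg].
- by rewrite (lin0 (modalg_l hM k)); apply: Vsp_0.
- by rewrite (linD (modalg_l hM k)); apply: Vsp_D.
- by rewrite (linZ (modalg_l hM k)); apply: Vsp_Z.
by have [c ->] := actV k vg; exists c.
Qed.
Lemma Vsp_par i v : Vsp v -> Vsp (par i v).
Proof.
move: v; apply: Vsp_ind => [|u v hu hv|c v hv|v vg].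
- by rewrite (lin0 (lf_par mB i)); apply: Vsp_0.
- by rewrite (linD (lf_par mB i)); apply: Vsp_D.
- by rewrite (linZ (lf_par mB i)); apply: Vsp_Z.
have pv := homog_ph mB (pr_homog hQ v); have [e|ne] := eqVneq i (odd (ldeg v)).
  by rewrite e par_id //; apply: Vsp_bl.
by rewrite (par_neq mB pv) //; apply: Vsp_0.
Qed.
Lemma Vsp_gen : generated Vsp.
Proof.
move=> P P1 PZ PD PM PG; apply: gB => // x [n ng ->]; apply: PG; exact: Vsp_bl.
Qed.

Let cl : linear (coact C). Proof. by case: cP => -[]. Qed.
Let Dl : linear D. Proof. by case: DP => -[]. Qed.
Let ll : linear inl. Proof. by case: inlP => -[]. Qed.
Let lr : linear inr. Proof. by case: inrP => -[]. Qed.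
Let idB := @lf_id _ B.
Let copLin : linear (cop H). Proof. by case: (shopf_cop hH) => -[]. Qed.

Lemma Vsp_coact v : Vsp v -> Vtens (K := K) Vsp (coact C v).
Proof.
have VtZ c (t : tens B K) : Vtens Vsp t -> Vtens Vsp (c *: t).
  elim=> [u w uV||s t' _ IHs _ IHt].
  - by rewrite -tensZl; apply: Vtens_pure; apply: Vsp_Z.
  - by rewrite scaler0; apply: Vtens_0.
  - by rewrite scalerDr; apply: Vtens_D.
move: v; apply: Vsp_ind => [|u v hu hv|c v hv|v vg].
- by rewrite (lin0 cl); apply: Vtens_0.
- by rewrite (linD cl); apply: Vtens_D.
- by rewrite (linZ cl); apply: VtZ.
rewrite cE // big_seq; apply: (big_ind (fun t : tens B K => Vtens Vsp t)) => [||g gv].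
- exact: Vtens_0.
- exact: Vtens_D.
by have /andP[g1 _] := allP (allP coat_chk v vg) g gv; apply: Vtens_pure; apply: Vsp_bl.
Qed.

Lemma DV v : Vsp v -> D v = tmap (fun x => x) inl (coact C v) + gone B ⊗ inr v.
Proof.
have tl := lf_tmap idB ll.
have hr : linear (fun v => gone B ⊗ inr v : tens B W) by apply: lf_tpr.
move: v; apply: Vsp_ind => [|u v hu hv|c v hv|v vg].
- by rewrite (lin0 Dl) (lin0 cl) (lin0 tl) (lin0 hr) addr0.
- by rewrite (linD Dl) (linD cl) (linD tl) (linD hr) hu hv addrACA.
- by rewrite (linZ Dl) (linZ cl) (linZ tl) (linZ hr) hv scalerDr.
rewrite DE // cE // (lin_sum tl); congr (_ + _).
by apply: eq_bigr => g _; rewrite tmap_pure.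
Qed.

Lemma coactA_B v : \sw_(v0, v1 <- coact C v) (coact C v0 ⊗ v1) =
    \sw_(v0, v12 <- coact C v) \sw_(v1, v2 <- cop H v12) (v0 ⊗ v1 ⊗ v2).
Proof.
have hBK := stens_galg hB hK; have hKK := stens_galg hK hK.
have iB := galg_map_id B; have iK := galg_map_id K; have idK := @lf_id _ K.
have copP := shopf_cop hH.
rewrite (tassocE _ copLin) -[LHS]/(tmap (coact C) (fun x => x) (coact C v)).
move: v; apply: (generated_eq gB (mul := @gmul F (stens (stens B K) K)) (one := gone (stens (stens B K) K))).
- apply: galg_map_alg; refine (@galg_map_comp _ B (stens B K) (stens (stens B K) K) (tmap (coact C) (fun x => x)) (coact C) _ cP).
  exact: (galg_map_tmap hB hK hBK hK cP iK).
- apply: galg_map_alg; refine (@galg_map_comp _ B (stens B (stens K K)) (stens (stens B K) K) (@tassoc _ B K K) _ _ _); first exact: galg_map_tassoc.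
  refine (@galg_map_comp _ B (stens B K) (stens B (stens K K)) (tmap (fun x => x) (cop H)) (coact C) _ cP).
  exact: (galg_map_tmap hB hK hB hKK iB copP).
move=> x [n ng ->]; rewrite (cE ng).
rewrite (lin_sum (lf_tmap cl idK)) (lin_sum (lf_tmap idB copLin)) (lin_sum (@lf_tassoc _ _ _ _)).
transitivity (\sum_(g <- coat n) \sum_(h <- coat g.1) bl h.1 ⊗ kl h.2 ⊗ kl g.2).
  apply: eq_big_seq => g gn; have /andP[g1 g2] := allP (allP coat_chk n ng) g gn.
  by rewrite tmap_pure // (cE g1) tens_suml.
transitivity (\sum_(g <- coat n) \sum_(h <- copt g.2) bl g.1 ⊗ kl h.1 ⊗ kl h.2); last first.
  apply: eq_big_seq => g gn; have /andP[g1 g2] := allP (allP coat_chk n ng) g gn.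
  rewrite tmap_pure // (copE g2) tens_sumr (lin_sum (@lf_tassoc _ _ _ _)).
  by apply: eq_bigr => h _; rewrite tassoc_pure.
pose M : lmodType F := tens (tens B K) K.
move: ng; rewrite !inE => /or4P[] /eqP->;
  rewrite !coatE ?big_cons ?big_nil /= ?coatE ?coptE ?big_cons ?big_nil /=; modeq M.
Qed.

Lemma coact_cou_B v : \sw_(v0, v1 <- coact C v) (cou H v1 *: v0) = v.
Proof.
have eK := shopf_char hH; have el := char_lin eK.
have bb : bilin (fun (v0 : B) (v1 : K) => cou H v1 *: v0).
  by split=> y; [apply: lf_scale; apply: lf_id | apply: lf_scalel].
move: v; apply: (generated_eq gB (mul := @gmul F B) (one := gone B)).
- exact: (alg_map_comp (charr_alg hK hB eK) cP).
- exact: galg_map_alg (galg_map_id B).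
move=> x [n ng ->]; rewrite (cE ng) (lin_sum (lf_tlift bb)).
transitivity (\sum_(g <- coat n) (cou_t g.2)%:R *: bl g.1).
  apply: eq_big_seq => g gn; have /andP[g1 g2] := allP (allP coat_chk n ng) g gn.
  by rewrite (tlift_pure bb) (couE g2).
by move: ng; rewrite !inE => /or4P[] /eqP->; rewrite !coatE !big_cons !big_nil /= ?scale0r ?scale1r ?add0r ?addr0.
Qed.

Lemma eBV v : Vsp v -> eB v = 0.
Proof.
have el := char_lin eBP.
move: v; apply: Vsp_ind => [|u v hu hv|c v hv|v vg].
- exact: lin0 el.
- by rewrite (linD el) hu hv addr0.
- by rewrite (linZ el) hv scaler0.
exact: eB0.
Qed.

Let hWW := stens_galg hW hW.
Let aWW := galg_alg hWW.
Let sWW := stens_sys bos_sys bos_sys.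

Lemma copl_gev n : n \in gensK -> copl H C (kl n) = gev q (evst evW evW) (copW_s n).
Proof.
move=> ng; have n10 : (n < 10)%N by move: ng; rewrite !inE => /or4P[/eqP->|/eqP->|/eqP->|/or4P[/eqP->|/eqP->|/eqP->|/or3P[] /eqP->]].
rewrite /copW_s n10 gev_map /copl (copE ng) (lin_sum (lf_tmap ll ll)).
apply: eq_big_seq => g gn; have /andP[g1 g2] := allP (allP copt_chk n ng) g gn.
by rewrite (tmap_pure ll ll) -(evW_K g1) -(evW_K g2); apply: esym; apply: evst_pair.
Qed.

Lemma copr_gev n : n \in gensB -> copr D (bl n) = gev q (evst evW evW) (copW_s n).
Proof.
move=> ng; have n10 : (n < 10)%N = false by move: ng; rewrite !inE => /or4P[] /eqP->.
have idW := @lf_id _ W; have r1 : inr (gone B) = gone W by case: inrP.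
rewrite /copW_s n10 /D_s gev_cat gev_map /copr (DE ng) (linD (lf_tmap lr idW)) (lin_sum (lf_tmap lr idW)).
congr (_ + _).
  apply: eq_big_seq => g gn; have /andP[g1 g2] := allP (allP coat_chk n ng) g gn.
  by rewrite (tmap_pure lr idW) -(evW_B g1) -(evW_K g2); apply: esym; apply: evst_pair.
rewrite (tmap_pure lr idW) r1 -[[:: _]]/(letter n.*2.+1) (gev_letter sWW) /evst /= odd_double /= uphalf_double.
by rewrite (evW_B ng).
Qed.

Lemma crossW v k : Vsp v -> GK k ->
  smul (copr D v) (copl H C k) = bos_lift (@smul F W W) (copl H C) (copr D) (inr v ∙ inl k).
Proof.
apply: (cross_gen aWW (sys_rules sWW) (s := copW_s)).
- exact: galg_map_alg (coplP hH hB hM).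
- refine (@galg_map_alg _ B (stens W W) _ (@galg_map_comp _ B (stens B W) (stens W W) (tmap inr (fun z => z)) D _ DP)).
  exact: (galg_map_tmap hB hW hW hW inrP (galg_map_id W)).
- exact: copl_gev.
- exact: copr_gev.
exact: cross_chk.
Qed.

Lemma braided_ex : exists HB : hopf_ops B, exists SW : W -> W,
  [/\ is_bhopf H C HB, (forall n, n \in gensB -> cop HB (bl n) = bl n ⊗ gone B + gone B ⊗ bl n),
   is_shopf (bos_hopf HB SW) /\ is_comodule_algebra (bos_hopf HB SW) D,
   (forall k, cop (bos_hopf HB SW) (inl k) = tmap inl inl (cop H k)) &
   (forall n, n \in gensB -> cop (bos_hopf HB SW) (inr (bl n)) =
      gone W ⊗ inr (bl n) + tmap inr inl (coact C (bl n)))].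
Proof.
have [SB [SBP SBm]] := braided_antipode hH hB hM gK Vsp_gen Vsp_D Vsp_Z Vsp_act Vsp_par cP coactA_B
  coact_cou_B Vsp_coact DP DV eBP eBV eBh crossW id.
have [SW SWP] := bos_shopf hH hB hM gK Vsp_gen Vsp_D Vsp_Z Vsp_act Vsp_par cP coactA_B
  coact_cou_B Vsp_coact DP DV eBP eBV eBh crossW SB.
exists (bHB D eB SB), SW; split.
- exact: (braided_bhopf hH hB hM gK Vsp_gen Vsp_act Vsp_par cP coactA_B
  coact_cou_B Vsp_coact DP DV eBP eBV eBh crossW SBP SBm).
- move=> n ng; apply: (bcopV hH hB hM Vsp_gen cP coactA_B coact_cou_B DP DV). exact: Vsp_bl.
- split; first exact: SWP.
  split; first exact: DP.
    move=> v; rewrite tassocE.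
      exact: (D_coassoc hH hB hM gK Vsp_gen Vsp_act Vsp_par cP coactA_B coact_cou_B Vsp_coact DP DV eB crossW SB).
    by case: (shopf_cop SWP) => -[].
  exact: (D_cour hH hB hM gK Vsp_gen Vsp_act Vsp_par cP coactA_B coact_cou_B DP DV eBP eBV eBh crossW SB).
- move=> k; exact: (bcop_inl hH hB hM Vsp_gen cP coactA_B coact_cou_B DP DV eB SB k).
move=> n ng; apply: etrans (bcop_inr hH hB hM Vsp_gen cP coactA_B coact_cou_B DP DV eB SB (bl n)) _.
rewrite (coprV hH hB hM DV (Vsp_bl ng)); exact: addrC.
Qed.

End WithCoaction.
End Bosonisation.

(* Letter 0 stands for (0, 1) in the triangular algebra, letter n + 1 for
   (x, 0) where x is letter n. *)
Definition rtri (o : nat -> bool) (r : nat -> nat -> option lpoly) (a b : nat) : option lpoly :=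
  if a is n.+1 then
    if b is m.+1 then omap (mapl S) (r n m)
    else Some [:: (if o n then -1 else 1, 0, [:: 0%N; n.+1])]
  else if b is _.+1 then None else Some [::].

Section DiffTable.
Local Open Scope nat_scope.
Local Notation mk c e w := (c%Z, e%Z, w) (only parsing).
(** The entry of letter 4 is -D^-1 (dD) D^-1 with the differential of D = ad - q^-1 bc expanded. *)
Definition dtab : seq lpoly := [::
  letter 5; letter 6; letter 7; letter 8;
  [:: mk (-1) 0 [:: 4; 5; 3; 4]; mk (-1) 0 [:: 4; 0; 8; 4]; mk 1 (-1) [:: 4; 6; 2; 4]; mk 1 (-1) [:: 4; 1; 7; 4]];
  [::]; [::]; [::]; [::]; [::]; letter 12; letter 13; [::]; [::]].
End DiffTable.
Definition dt (n : nat) : lpoly := nth [::] dtab n.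
(** The pair (x, dx) is (x, 0) + (0, 1)(dx, 0). *)
Definition d_s (n : nat) : lpoly :=
  letter n.+1 ++ [seq (m.1.1, m.1.2, 0%N :: map S m.2) | m : mono <- dt n].
(* For d (d x) = 0: letter 20 + n stands for (kl n, 0) and letter n for (kl n, d (kl n)). *)
Definition dd_s (n : nat) : lpoly := if (n < 20)%N then d_s n else letter (n - 20).+1.
(** The polynomial for dx at the pairs (y, dy) minus the same polynomial at the pairs (y, 0): the
    second entry of the difference is d(dx). *)
Definition dd_l (n : nat) : lpoly := dt n ++ paddm (-1) 0 (mapl (addn 20) (dt n)) [::].

Lemma dK_chk : all (reduces (rtri lpar RK) d_s) relK && all (fun n => reduces (rtri lpar RK) dd_s (dd_l n)) gensK.
Proof. by vm_cast_no_check (erefl true). Qed.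
Lemma dB_chk : all (reduces (rtri lpar RB) d_s) relB && all (fun n => reduces (rtri lpar RB) dd_s (dd_l n)) gensB.
Proof. by vm_cast_no_check (erefl true). Qed.
Lemma dW_chk : all (fun v => all (fun k => reduces (rtri lpar RW) d_s
  ([:: (1, 0, [:: v; k])] ++ paddm (-1) 0 (RX v k) [::])) gensK) gensB.
Proof. by vm_cast_no_check (erefl true). Qed.
Definition dt_ok (gens : seq nat) : bool := all (fun n => pdeg ldeg (ldeg n).+1 (dt n) &&
  all (fun m : mono => all (fun k => (k \in gens) && (k < 20)%N) m.2) (dt n)) gens.
Lemma dtK_chk : dt_ok gensK. Proof. by vm_cast_no_check (erefl true). Qed.
Lemma dtB_chk : dt_ok gensB. Proof. by vm_cast_no_check (erefl true). Qed.

(** * Existence of the differentials *)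

Section Derivations.
Variables (F : fieldType) (q : F) (q0 : q != 0).

Section TriSystem.
Variables (fl : bool) (T : galg F) (ev : nat -> T) (dT : nat -> nat) (rT : nat -> nat -> option lpoly).
Hypothesis sT : is_sys q fl ev dT rT.
Let hT := sys_galg sT.
Let mT := galg_is_gmod hT.
Let aT := galg_alg hT.
Local Notation trim := (@tri_mul F T).
Let aU : is_alg trim (gone T, 0) := tri_alg hT.

Definition evT (n : nat) : T * T := if n is m.+1 then (ev m, 0) else (0, gone T).

Lemma tri_theta z : trim (0, gone T) z = (0, z.1).
Proof.
by rewrite /tri_mul /= (lin0 (lf_sg mT true)) !(gmul0l hT) add0r (gmul1l hT).
Qed.

Lemma tri_inl x z : trim (x, 0) z = (x ∙ z.1, sg true x ∙ z.2).
Proof. by rewrite /tri_mul /= (gmul0l hT) addr0. Qed.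

Lemma pev_tri p z : pev q (fun n => trim (evT n.+1)) p z =
  (pev q (fun n => @gmul F T (ev n)) p z.1, sg true (pev q (fun n => @gmul F T (ev n)) p (sg true z.2))).
Proof.
have w1 w : foldr (fun n => trim (evT n.+1)) z w =
    (foldr (fun n => @gmul F T (ev n)) z.1 w, sg true (foldr (fun n => @gmul F T (ev n)) (sg true z.2) w)).
  elim: w => [|x w IHw]; first by rewrite /= (sg_sg hT) -surjective_pairing.
  transitivity (trim (evT x.+1) (foldr (fun n => trim (evT n.+1)) z w)); first by [].
  by rewrite IHw [LHS]tri_inl /= (sgM hT).
elim: p => [|[[c e] w] p IHp]; first by rewrite !pev_nil (lin0 (lf_sg mT true)).
by rewrite !pev_cons IHp w1 (linD (lf_sg mT true)) (linZ (lf_sg mT true)).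
Qed.

Lemma tri_rules : rules q trim evT (rtri (fun n => odd (dT n)) rT).
Proof.
move=> [|a] [|b] //= p.
- by move=> [<-] z; rewrite pev_nil !tri_theta.
- move=> [<-] z; rewrite pev_cons pev_nil addr0 -[foldr _ _ _]/(trim (evT 0) (trim (evT a.+1) z)).
  rewrite !tri_theta !tri_inl /= (gmul0r hT) (sg_homog mT _ (sys_homog sT a)) (gmulZl hT).
  congr (_, _); first by rewrite scaler0.
  by congr (_ *: _); case: (odd _); rewrite ?zc_m1 ?zc1 // /sign ?expr1 ?expr0.
case E: (rT a b) => [w|] //= [<-] z; rewrite pev_mapl pev_tri !tri_inl /=.
rewrite -!(sys_rules sT E) -[in LHS](sg_sg hT true z.2) -!(sgM hT).
by rewrite (gmulA hT) !(sgM hT) !(gmulA hT) sg_sg.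
Qed.

Lemma d_sE n : pev q (fun n => trim (evT n)) (d_s n) (gone T, 0) = (ev n, gev q ev (dt n)).
Proof.
rewrite /d_s pev_cat pev_letter tri_inl /= (gmul0r hT) (gmul1r hT).
have -> : pev q (fun n => trim (evT n)) [seq (m.1.1, m.1.2, 0%N :: [seq S i | i <- m.2]) | m <- dt n] (gone T, 0)
    = (0, gev q ev (dt n)).
  have E : pev q (fun n => trim (evT n)) [seq (m.1.1, m.1.2, 0%N :: [seq S i | i <- m.2]) | m <- dt n] (gone T, 0) =
      trim (evT 0) (pev q (fun n => trim (evT n.+1)) (dt n) (gone T, 0)).
    rewrite -(pev_mapl q (fun n => trim (evT n)) S) /mapl [in RHS]/pev (lin_sum (alg_mulr aU _)) /pev !big_map.
    by apply: eq_bigr => m _; rewrite (linZ (alg_mulr aU _)).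
  by rewrite E pev_tri tri_theta.
by congr (_, _); rewrite ?addr0 ?add0r.
Qed.

End TriSystem.

Section Leibniz.
Variables (K : galg F) (hK : is_galg K).
Let mK := galg_is_gmod hK.
Local Notation trim := (@tri_mul F K).

Lemma dga_tri (O : galg F) (i : K -> O) (d : K -> K) : is_dga d -> is_galg O -> is_galg_map i ->
  alg_map (@tri_mul F O) (gone O, 0) (fun x => (i x, i (d x))).
Proof.
move=> hd hO iP; have [[il _] i1 iM] := iP; have dl := dga_linear hd; have mO := galg_is_gmod hO; split=> [||x y].
- by move=> a x y; rewrite dl !il.
- by rewrite (dga_one hK hd) (lin0 il) i1.
by rewrite /tri_mul /= (dga_leib hK hd) (linD il) !iM (glin_sg mK mO true x (galg_map_glin iP)) addrC.
Qed.

Variables (f : K -> K * K) (fP : alg_map trim (gone K, 0) f) (f1 : forall x, (f x).1 = x).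
Let d x := (f x).2.

(** The Leibniz rule is multiplicativity of [f]. The degree and the vanishing of d^2 need only be
    known on generators: in d(d(xy)) the mixed terms cancel, as d anticommutes with the parity
    operator. *)
Lemma tri_dga (G : K -> Prop) : generated G ->
  (forall x, G x -> exists2 n, homog n x & homog n.+1 (d x)) -> (forall x, G x -> d (d x) = 0) -> is_dga d.
Proof.
move=> gK hG ddG; have [fl fo fM] := fP.
have dl : linear d by move=> a x y; rewrite /d fl.
have dM x y : d (x ∙ y) = d x ∙ y + sg true x ∙ d y.
  by rewrite /d fM /tri_mul /= !f1 addrC.
have d1 : d (gone K) = 0 by rewrite /d fo.
have dh x : forall n, homog n.+1 (d (gpr n x)).
  apply: (gK (fun x => forall n, homog n.+1 (d (gpr n x)))) => {x} [n|c x h n|x y hx hy n|x y hx hy n|x Gx n].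
  - rewrite (homog_gpr mK _ (gone_homog hK)); case: eqP => _; rewrite ?d1 ?(lin0 dl); exact: homog0.
  - by rewrite (linZ (lf_gpr mK n)) (linZ dl); apply: (homogZ mK).
  - by rewrite (linD (lf_gpr mK n)) (linD dl); apply: (homogD mK).
  - rewrite (gprM hK) (lin_sum dl); apply: (homog_sum mK) => i.
    have ni : (i <= n)%N by rewrite -ltnS.
    rewrite dM; apply: (homogD mK).
      by have := gmul_homog hK (hx i) (gpr_homog mK (n - i)%N y); rewrite addSn subnKC.
    rewrite (sg_homog mK _ (gpr_homog mK i x)) (gmulZl hK); apply: (homogZ mK).
    by have := gmul_homog hK (gpr_homog mK i x) (hy (n - i)%N); rewrite addnS subnKC.
  have [m xm dm] := hG x Gx; rewrite (homog_gpr mK _ xm); case: eqP => [->//|_].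
  by rewrite (lin0 dl); apply: homog0.
have dsg x : d (sg true x) = - sg true (d x).
  move: x; apply: (homog_ext mK) => [||n x xn].
  - exact: lf_comp dl (lf_sg mK _).
  - by apply: lf_opp; apply: lf_comp (lf_sg mK _) dl.
  have dx : homog n.+1 (d x) by rewrite -xn; apply: dh.
  rewrite !(sg_homog mK _ xn) (linZ dl) (sg_homog mK _ dx) -scaleNr; congr (_ *: _).
  by rewrite /=; case: (odd n); rewrite /sign ?expr1 ?expr0 ?opprK.
apply: dgaI => // [n x xn|x]; first by rewrite -xn; apply: dh.
apply: (gK (fun x => d (d x) = 0)) => {x} [|c x h|x y hx hy|x y hx hy|x Gx].
- by rewrite d1 (lin0 dl).
- by rewrite !(linZ dl) h scaler0.
- by rewrite !(linD dl) hx hy addr0.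
- by rewrite dM (linD dl) !dM hx hy dsg (linN (gmul_linearl hK _)) (gmul0l hK) (gmul0r hK) add0r addr0 subrr.
exact: ddG.
Qed.
End Leibniz.

(** The universal property gives x |-> (x, dx); its first component is an algebra map fixing the
    generators, hence the identity, so the second one is a super derivation. *)
Lemma pres_dga (K : galg F) (kl : nat -> K) gens rel r : is_pres q true kl gens rel r ->
  dt_ok gens -> all (reduces (rtri lpar r) d_s) rel ->
  all (fun n => reduces (rtri lpar r) dd_s (dd_l n)) gens ->
  exists d : K -> K, is_dga d /\ forall n, n \in gens -> d (kl n) = gev q kl (dt n).
Proof.
move=> hP /allP ok /allP c1 /allP c2; have hK := pr_galg hP; have mK := galg_is_gmod hK.
have sK := pres_sys hP; have aU := tri_alg hK; have tr := tri_rules sK.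
pose g n := pev q (fun n => @tri_mul F K (evT kl n)) (d_s n) (gone K, 0).
have gE n : g n = (kl n, gev q kl (dt n)) := d_sE sK n.
have gM n z : tri_mul (g n) z = pev q (fun n => @tri_mul F K (evT kl n)) (d_s n) z.
  exact: (pev_alg q (evT kl) _ _ aU).
have [f [fP fE]] := pr_univ hP aU (fun l lr => reducesP q0 aU tr gM (c1 l lr) _)
  (fun e : true = false => False_ind _ (Bool.diff_true_false e)).
have [fl fo fM] := fP.
have f1 x : (f x).1 = x.
  move: x; apply: (generated_eq (pr_gen hP) (mul := @gmul F K) (one := gone K)).
  - split=> [a x y||x y]; first by rewrite fl.
      by rewrite fo.
    by rewrite fM.
  - exact: galg_map_alg (galg_map_id K).
  by move=> x [n ng ->]; rewrite fE // gE.
have dE n : n \in gens -> (f (kl n)).2 = gev q kl (dt n) by move=> ng; rewrite fE // gE.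
exists (fun x => (f x).2); split; last exact: dE.
apply: (tri_dga hK fP f1 (pr_gen hP)) => x [n ng ->].
  exists (ldeg n); first exact: pr_homog hP n.
  by rewrite dE //; have /andP[h _] := ok n ng; apply: (gev_homog sK).
have /andP[_ /allP dn] := ok n ng.
rewrite (dE _ ng); set X := gev q kl (dt n).
pose h m := pev q (fun n => @tri_mul F K (evT kl n)) (dd_s m) (gone K, 0).
have hM m z : tri_mul (h m) z = pev q (fun n => @tri_mul F K (evT kl n)) (dd_s m) z.
  exact: (pev_alg q (evT kl) _ _ aU).
have := reducesP q0 aU tr hM (c2 n ng) (gone K, 0).
rewrite /dd_l pev_cat pev_paddm // pev_nil addr0 zc_m1 scaleN1r => /eqP; rewrite subr_eq0 => /eqP.
have -> : pev q (fun m => tri_mul (h m)) (dt n) (gone K, 0) = f X.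
  rewrite -fo /X /gev (pev_map (op' := fun m => tri_mul (f (kl m))) _ _ _ fl) => [|m y]; last by rewrite fM.
  apply: (@eq_pev_in _ _ _ _ _ (fun k => (k \in gens) && (k < 20)%N)) => [k /andP[kg k20] z|].
    by rewrite fE // /h /dd_s k20.
  by apply/allP => m /dn.
rewrite pev_mapl.
have -> : pev q (fun m => tri_mul (h (20 + m)%N)) (dt n) (gone K, 0) =
    pev q (fun m => tri_mul (evT kl m.+1)) (dt n) (gone K, 0).
  apply: eq_pev => k z; rewrite hM /dd_s ltnNge leq_addr /= addKn.
  exact: pev_letter.
by rewrite (pev_tri sK) => ->; rewrite /= (lin0 (lf_sg mK true)) (lin0 (lf_pev _ _ _)) ?(lin0 (lf_sg mK true)) // => k; apply: gmul_linearr.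
Qed.

End Derivations.

(** * Exterior algebras *)

Section Exterior.
Variable F : fieldType.

Section DgaMaps.
Variables (O O' : galg F) (d : O -> O) (d' : O' -> O') (f : O -> O').
Hypotheses (hd : is_dga d) (hd' : is_dga d') (fP : is_galg_map f).
Let hO := dga_is_galg hd.
Let hO' := dga_is_galg hd'.
Let mO := galg_is_gmod hO.
Let mO' := galg_is_gmod hO'.
Let dl := dga_linear hd.
Let dl' := dga_linear hd'.
Let fl : linear f. Proof. by case: fP => -[]. Qed.
Let f1 : f (gone O) = gone O'. Proof. by case: fP. Qed.
Let fM x y : f (x ∙ y) = f x ∙ f y. Proof. by case: fP. Qed.
Let com x := f (d x) = d' (f x).

Lemma com_one : com (gone O).
Proof. by rewrite /com f1 (dga_one hO hd) (dga_one hO' hd') (lin0 fl). Qed.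
Lemma com_scale c x : com x -> com (c *: x).
Proof. by rewrite /com => h; rewrite (linZ dl) !(linZ fl) (linZ dl') h. Qed.
Lemma com_add x y : com x -> com y -> com (x + y).
Proof. by rewrite /com => hx hy; rewrite (linD dl) !(linD fl) (linD dl') hx hy. Qed.
Lemma com_mul x y : com x -> com y -> com (x ∙ y).
Proof.
rewrite /com => hx hy; rewrite fM (dga_leib hO hd) (dga_leib hO' hd') (linD fl) !fM hx hy.
by rewrite (glin_sg mO mO' true x (galg_map_glin fP)).
Qed.
Lemma com_d x : com x -> com (d x).
Proof. by rewrite /com => h; rewrite (dga_dd hd) h (dga_dd hd') (lin0 fl). Qed.

(** Since x has degree 0, differentiating xy = 1 gives x dy = -(dx) y; multiply by y from the
    left. *)
Lemma dga_inv x y : homog 0 x -> x ∙ y = gone O -> y ∙ x = gone O -> d y = - (y ∙ d x ∙ y).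
Proof.
move=> x0 xy yx; have := dga_one hO hd; rewrite -{1}xy (dga_leib hO hd) (sg_homog mO _ x0) scale1r.
move=> /eqP; rewrite addrC addr_eq0 => /eqP E.
by rewrite -[LHS](gmul1l hO) -yx -(gmulA hO) E (linN (gmul_linearr hO y)) (gmulA hO).
Qed.

Lemma com_gen (G : O -> Prop) : generated G -> (forall x, G x -> com x) -> forall x, com x.
Proof.
move=> gO hG; apply: gO => //; [exact: com_one | exact: com_scale | exact: com_add | exact: com_mul].
Qed.
End DgaMaps.

Lemma com_inv (O O' : galg F) (d : O -> O) (d' : O' -> O') (f : O -> O') x y :
  is_dga d -> is_dga d' -> is_galg_map f -> homog 0 x -> x ∙ y = gone O -> y ∙ x = gone O ->
  f (d x) = d' (f x) -> f (d y) = d' (f y).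
Proof.
move=> hd hd' fP x0 xy yx h; have [[fl fg] f1 fM] := fP.
rewrite (dga_inv hd x0 xy yx) (linN fl) !fM h.
by rewrite (dga_inv hd' (x := f x) (y := f y)) -?fM ?xy ?yx //; apply: (glin_homog (galg_map_glin fP)).
Qed.

Lemma tdif_tmap (V W V' W' : gmod F) (hV : is_gmod V) (hW : is_gmod W) (hV' : is_gmod V') (hW' : is_gmod W')
  (dV : V -> V) (dW : W -> W) (dV' : V' -> V') (dW' : W' -> W') (f : V -> V') (g : W -> W') t :
  linear dV -> linear dW -> linear dV' -> linear dW' -> is_glin f -> is_glin g ->
  (forall v, f (dV v) = dV' (f v)) -> (forall w, g (dW w) = dW' (g w)) ->
  tmap f g (tdif dV dW t) = tdif dV' dW' (tmap f g t).
Proof.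
move=> lV lW lV' lW' fP gP fd gd; have [[fl _] [gl _]] := (fP, gP).
move: t; apply: tens_ext => [||v w].
- exact: lf_comp (lf_tmap fl gl) (lf_tdif hV hW lV lW).
- exact: lf_comp (lf_tdif hV' hW' lV' lW') (lf_tmap fl gl).
rewrite tdif_pure // (linD (lf_tmap fl gl)) !tmap_pure // tdif_pure // fd gd.
by rewrite (glin_sg hV hV' true v fP).
Qed.

(** If A and dA generate O, induction over generation shows that every component of degree 0 lies in
    A and every component of degree 1 in the span of the forms a db. A product has only two
    contributions in degree 1, so closure under multiplication by A from both sides is all that is
    needed. *)
Lemma exterior_gen (A O : galg F) (i : A -> O) (d : O -> O) : is_galg A -> (forall a : A, homog 0 a) ->
  is_dga d -> is_galg_map i -> injective i ->
  generated (fun x => (exists a, x = i a) \/ (exists a, x = d (i a))) -> is_exterior i d.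
Proof.
move=> hA A0 hd iP inj gen; have hO := dga_is_galg hd; have mO := galg_is_gmod hO.
have [[il ig] i1 iM] := iP; have dl := dga_linear hd.
have i0 a : homog 0 (i a) by apply: (glin_homog (galg_map_glin iP)).
have d1 a : homog 1 (d (i a)) by apply: (dga_homog hd).
have g0M (x y : O) : gpr 0 (x ∙ y) = gpr 0 x ∙ gpr 0 y by rewrite (gprM hO) big_ord1.
have g1M (x y : O) : gpr 1 (x ∙ y) = gpr 0 x ∙ gpr 1 y + gpr 1 x ∙ gpr 0 y.
  by rewrite (gprM hO) big_ord_recl big_ord1.
pose S1 (x : O) := exists s : seq (A * A), x = \sum_(p <- s) i p.1 ∙ d (i p.2).
have S1D x y : S1 x -> S1 y -> S1 (x + y).
  by move=> [s ->] [t ->]; exists (s ++ t); rewrite big_cat.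
have S1Z c x : S1 x -> S1 (c *: x).
  move=> [s ->]; exists [seq (c *: p.1, p.2) | p <- s]; rewrite big_map scaler_sumr.
  by apply: eq_bigr => p _; rewrite /= (linZ il) (gmulZl hO).
have S1_0 : S1 0 by exists [::]; rewrite big_nil.
have S1l a x : S1 x -> S1 (i a ∙ x).
  move=> [s ->]; exists [seq (a ∙ p.1, p.2) | p <- s]; rewrite big_map (lin_sum (gmul_linearr hO _)).
  by apply: eq_bigr => p _; rewrite /= iM (gmulA hO).
have S1p a b : S1 (i a ∙ d (i b)) by exists [:: (a, b)]; rewrite big_seq1.
have S1r a x : S1 x -> S1 (x ∙ i a).
  move=> [s ->]; rewrite (lin_sum (gmul_linearl hO _)); apply: (big_ind S1) => // p _.
  (* The Leibniz rule in the form (a db) c = a d(bc) - ab dc moves the coefficient to the left. *)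
  have -> : i p.1 ∙ d (i p.2) ∙ i a = i p.1 ∙ d (i (p.2 ∙ a)) + (-1) *: (i (p.1 ∙ p.2) ∙ d (i a)).
    rewrite !iM (dga_leib hO hd) (sg_homog mO _ (i0 _)) scale1r (linD (gmul_linearr hO _)) !(gmulA hO).
    by rewrite scaleN1r addrK.
  by apply: S1D => //; apply: S1Z.
have S x : (exists a, gpr 0 x = i a) /\ S1 (gpr 1 x).
  apply: (gen (fun x => (exists a, gpr 0 x = i a) /\ S1 (gpr 1 x))) => {x}
    [|c x [[a ha] h1]|x y [[a ha] h1] [[b hb] h2]|x y [[a ha] h1] [[b hb] h2]|x [[a ->]|[a ->]]].
  - split; first by exists (gone A); rewrite i1 (gone_homog hO).
    by rewrite (homog_gpr mO _ (gone_homog hO)).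
  - rewrite !(linZ (lf_gpr mO _)); split; last exact: S1Z.
    by exists (c *: a); rewrite ha (linZ il).
  - rewrite !(linD (lf_gpr mO _)); split; last exact: S1D.
    by exists (a + b); rewrite ha hb (linD il).
  - rewrite g0M g1M; split; first by exists (a ∙ b); rewrite ha hb iM.
    by rewrite ha hb; apply: S1D; [apply: S1l | apply: S1r].
  - split; first by exists a; rewrite (i0 a).
    by rewrite (homog_gpr mO _ (i0 a)).
  split; first by exists 0; rewrite (homog_gpr mO _ (d1 a)) (lin0 il).
  by rewrite (d1 a) -[d _](gmul1l hO) -i1.
split=> //.
- by move=> x x0; have [[a ha] _] := S x; exists a; rewrite -ha x0.
- move=> x; split=> [x1|[s ->]].
    by have [_] := S x; rewrite x1.
  by apply: (homog_sum mO) => p; apply: (gmul_homog hO (m := 0) (n := 1)).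
move=> P Pi P1 PD PM; apply: gen => //.
- by rewrite -i1.
- by move=> c x Px; rewrite -[x](gmul1l hO) -(gmulZl hO) -i1 -(linZ il); apply: PM.
- by move=> x [[a ->]|[a ->]] //; apply: P1.
Qed.
End Exterior.

(* The algebra in degree 0 is compared with its exterior algebra by sending the
   differentials, which are zero in the former, to zero. *)
Definition even_s (n : nat) : lpoly := if lodd n then [::] else letter n.
Lemma evenK_chk : all (reduces RK even_s) relK. Proof. by vm_cast_no_check (erefl true). Qed.
Lemma evenB_chk : all (reduces RB even_s) relB. Proof. by vm_cast_no_check (erefl true). Qed.
Lemma evenW_chk : all (fun v => all (fun k => reduces RW even_s
  ([:: (1, 0, [:: v; k])] ++ paddm (-1) 0 (RX v k) [::])) gensK) gensB.
Proof. by vm_cast_no_check (erefl true). Qed.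

Section Inclusion.
Variables (F : fieldType) (q : F) (q0 : q != 0).

Lemma even_gev fl T ev dT rT n : @is_sys F q fl T ev dT rT -> gev q ev (even_s n) = if lodd n then 0 else ev n.
Proof.
move=> sT; rewrite /even_s; case: ifP => _; last exact: (gev_letter sT).
by rewrite /gev pev_nil.
Qed.

Lemma pres_incl (A O : galg F) (ka : nat -> A) (ko : nat -> O) gens rel r :
  is_pres q false ka gens rel r -> is_pres q true ko gens rel r -> all (reduces r even_s) rel ->
  exists i : A -> O, is_galg_map i /\ forall n, n \in gens -> i (ka n) = if lodd n then 0 else ko n.
Proof.
move=> hA hO /allP c; have sO := pres_sys hO; have [gA gO] := (pr_galg hA, pr_galg hO).
have aO := galg_alg gO.
have [|l lr|_ n ng n1|i [ia iE]] := pr_univ hA (mul := @gmul F O) (one := gone O) (g := fun n => gev q ko (even_s n)).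
- exact: aO.
- exact: (gev_reduces q0 sO (c l lr)).
- by rewrite (even_gev _ sO) n1.
exists i; split; last by move=> n ng; rewrite (iE n ng) (even_gev _ sO).
apply: (generated_galg_map gA gO (pr_gen hA)) ia _ => x [n ng ->].
exists (ldeg n); first exact: (pr_homog hA).
rewrite (iE n ng) (even_gev _ sO); case: ifP => _; last exact: (pr_homog hO).
exact: homog0 (galg_is_gmod gO) _.
Qed.

Lemma incl_retract (A O : galg F) (ka : nat -> A) (ko : nat -> O) gens rel r (i : A -> O) (p : O -> A) :
  is_pres q false ka gens rel r -> is_galg_map i -> (forall n, n \in gens -> i (ka n) = if lodd n then 0 else ko n) ->
  alg_map (@gmul F A) (gone A) p -> (forall n, p (ko n) = ka n) -> forall a, p (i a) = a.
Proof.
move=> hA iP iE pP pE; have gA := pr_galg hA.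
apply: (generated_eq (pr_gen hA) (mul := @gmul F A) (one := gone A)).
- exact: (alg_map_comp pP iP).
- exact: galg_map_alg (galg_map_id A).
move=> x [n ng ->]; rewrite iE //; case: ifP => [n1|_]; last exact: pE.
by rewrite (pr_odd hA) //; case: pP => pl _ _; rewrite (lin0 pl).
Qed.
End Inclusion.

Lemma copt_even : all (fun n => lodd n || all (fun g => ~~ lodd g.1 && ~~ lodd g.2) (copt n)) gensK.
Proof. by []. Qed.
Lemma coat_even : all (fun n => lodd n || all (fun g => ~~ lodd g.1 && ~~ lodd g.2) (coat n)) gensB.
Proof. by []. Qed.

(** * Comparison of the calculi with their degree 0 parts *)

Section Model.
Variables (F : fieldType) (q : F).

(* fl tells the exterior algebras (true) from the algebras in degree 0 (false). *)
Record model (fl : bool) (K B : galg F) (kl : nat -> K) (bl : nat -> B) (H : hopf_ops K) (C : cmod K B)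
    (D : B -> tens B (bos H C)) (HB : hopf_ops B) (SW : bos H C -> bos H C) : Prop := Model {
  md_K : is_pres q fl kl gensK relK RK;
  md_B : is_pres q fl bl gensB relB RB;
  md_hopf : is_shopf H;
  md_cop : forall n, n \in gensK -> cop H (kl n) = \sum_(g <- copt n) kl g.1 ⊗ kl g.2;
  md_modalg : is_modalg H C;
  md_act : forall v g, v \in gensB -> g \in gensK -> act C (bl v) (kl g) = gev q bl (rhot v g);
  md_actV : forall v k, v \in gensB -> exists c : nat -> F, act C (bl v) k = \sum_(w <- gensB) c w *: bl w;
  md_coactP : @is_galg_map F B (stens B K) (coact C);
  md_coact : forall n, n \in gensB -> coact C (bl n) = \sum_(g <- coat n) bl g.1 ⊗ kl g.2;
  md_D : forall n, n \in gensB ->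
    D (bl n) = \sum_(g <- coat n) bl g.1 ⊗ bos_inl H C (kl g.2) + gone B ⊗ bos_inr H C (bl n);
  md_bhopf : is_bhopf H C HB;
  md_copB : forall n, n \in gensB -> cop HB (bl n) = bl n ⊗ gone B + gone B ⊗ bl n;
  md_shopf : is_shopf (bos_hopf HB SW);
  md_comod : is_comodule_algebra (bos_hopf HB SW) D;
  md_copWl : forall k, cop (bos_hopf HB SW) (bos_inl H C k) = tmap (bos_inl H C) (bos_inl H C) (cop H k);
  md_copWr : forall n, n \in gensB -> cop (bos_hopf HB SW) (bos_inr H C (bl n)) =
      gone (bos H C) ⊗ bos_inr H C (bl n) + tmap (bos_inr H C) (bos_inl H C) (coact C (bl n))
}.

Hypothesis q0 : q != 0.

Lemma model_ex fl (K B : galg F) (kl : nat -> K) (bl : nat -> B) :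
  is_pres q fl kl gensK relK RK -> is_pres q fl bl gensB relB RB ->
  exists H C D HB SW, @model fl K B kl bl H C D HB SW.
Proof.
move=> hP hQ; have [H [hH [copE couE]]] := hopfK_ex q0 hP.
have [ac [hM actE actV]] := action_ex q0 hP hQ hH copE.
have [co [cP cE]] := coactB_ex q0 hP hQ.
have hMc := hM co.
have [D [DP DE]] := DB_ex q0 hP hQ hH copE hMc actE.
have [e [eP [eh e0]]] := eB_ex q0 hQ.
have [HB [SW [h1 h2 [h3 h4] h5 h6]]] := braided_ex q0 hP hQ hH copE couE hMc actE cP cE DP DE eP eh e0 actV.
by exists H, (Cmod ac co), D, HB, SW; split.
Qed.

Section OneModel.
Variables (fl : bool) (K B : galg F) (kl : nat -> K) (bl : nat -> B) (H : hopf_ops K) (C : cmod K B).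
Variables (D : B -> tens B (bos H C)) (HB : hopf_ops B) (SW : bos H C -> bos H C).
Hypothesis md : model fl kl bl D HB SW.
Let hH := md_hopf md.
Let hM := md_modalg md.
Let hK := pr_galg (md_K md).
Let hB := pr_galg (md_B md).

Lemma md_sys : is_sys q fl (evW kl bl H C) ldeg RW.
Proof. exact: (bos_sys (md_K md) (md_B md) hH (md_cop md) hM (md_act md)). Qed.

Lemma md_lift (U : lmodType F) (mul : U -> U -> U) (one : U) (evU : nat -> U) rU s
    (f : K -> U) (g : B -> U) : is_alg mul one -> rules q mul evU rU ->
  alg_map mul one f -> alg_map mul one g ->
  (forall n, n \in gensK -> f (kl n) = pev q (fun n => mul (evU n)) (s n) one) ->
  (forall n, n \in gensB -> g (bl n) = pev q (fun n => mul (evU n)) (s n) one) ->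
  all (fun v => all (fun k => reduces rU s ([:: (1, 0, [:: v; k])] ++ paddm (-1) 0 (RX v k) [::])) gensK) gensB ->
  alg_map mul one (bos_lift (H := H) (C := C) mul f g).
Proof.
move=> aU hr hf hg fE gE chk.
refine (bos_lift_alg hH hB hM aU hf hg (pr_gen (md_K md)) (Vsp_gen (md_B md)) _ _ _).
- exact: (fun v k => @Vsp_act _ _ _ _ _ _ hM (md_actV md) v k).
- move=> v k; exact: (cross_gen q0 (md_K md) (md_B md) hH (md_cop md) hM (md_act md) aU hr hf hg fE gE chk).
exact: (fun i v => @Vsp_par _ _ _ _ _ (md_B md) i v).
Qed.
End OneModel.
End Model.

Lemma dt_even n : (n < 4)%N -> dt n = letter n.+4.+1.
Proof. by do 4![case: n => [|n] //]. Qed.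
Lemma dt_even_B n : n \in [:: 10; 11]%N -> dt n = letter n.+2.
Proof. by rewrite !inE => /orP[] /eqP->. Qed.

Lemma copt_low n : (n < 4)%N -> all (fun g => (g.1 < 4) && (g.2 < 4))%N (copt n).
Proof. by do 4![case: n => [|n] //]. Qed.

Lemma generated_sub (F : fieldType) (A : galg F) (G G' : A -> Prop) : generated G ->
  (forall x, G x -> G' x) -> generated G'.
Proof. by move=> gG h P P1 PZ PD PM PG; apply: gG => // x /h; apply: PG. Qed.

Section Calculus.
Variables (F : fieldType) (q : F) (q0 : q != 0).

Section DgaOnGenerators.
Variables (K : galg F) (kl : nat -> K) (d : K -> K) (gens : seq nat) (rel : seq lpoly) (r : nat -> nat -> option lpoly).
Hypotheses (hP : is_pres q true kl gens rel r) (hd : is_dga d).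
Hypothesis dE : forall n, n \in gens -> d (kl n) = gev q kl (dt n).
Variables (O' : galg F) (d' : O' -> O') (f : K -> O').
Hypotheses (hd' : is_dga d') (fP : is_galg_map f).
Let hK := pr_galg hP.

Lemma d_next n m : n \in gens -> dt n = letter m -> d (kl n) = kl m.
Proof. by move=> ng e; rewrite dE // e (gev_letter (pres_sys hP)). Qed.

Lemma com_next n m : n \in gens -> dt n = letter m -> f (d (kl n)) = d' (f (kl n)) ->
  f (d (kl m)) = d' (f (kl m)).
Proof. by move=> ng e h; rewrite -(d_next ng e); apply: (com_d hd hd'). Qed.
End DgaOnGenerators.

(** Only a, b, c, d have to be checked: their differentials follow from d^2 = 0, the determinant
    from the Leibniz rule, and its inverse from the formula for the differential of an inverse. *)
Lemma K_com (K : galg F) (kl : nat -> K) (d : K -> K) (O' : galg F) (d' : O' -> O') (f : K -> O') :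
  is_pres q true kl gensK relK RK -> is_dga d ->
  (forall n, n \in gensK -> d (kl n) = gev q kl (dt n)) -> is_dga d' -> is_galg_map f ->
  (forall n, (n < 4)%N -> f (d (kl n)) = d' (f (kl n))) -> forall x, f (d x) = d' (f x).
Proof.
move=> hP hd dE hd' fP h; have hK := pr_galg hP; have aK := galg_alg hK.
have h5 n : (n < 4)%N -> f (d (kl n.+4.+1)) = d' (f (kl n.+4.+1)).
  move=> n4; have ng : n \in gensK by do 4![case: n n4 => [|n] n4 //].
  exact: (com_next hP hd dE hd' fP ng (dt_even n4) (h n n4)).
(* The rewriting rule for ad introduces the determinant; read backwards it expresses letter 9 by the
   generators. *)
have E9 : kl 9 = kl 0 ∙ kl 3 + (- q^-1) *: (kl 1 ∙ kl 2).
  have := pr_rules hP (erefl (RK 0 3)) (gone K); rewrite !pev_cons pev_nil addr0 /= !zcE !(gmul1r hK) => ->.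
  by rewrite scale1r addrAC -scalerDl subrr scale0r add0r.
have h9 : f (d (kl 9)) = d' (f (kl 9)).
  rewrite E9; apply: (com_add hd hd' fP); first exact: (com_mul hd hd' fP (h 0 _) (h 3 _)).
  by apply: (com_scale hd hd' fP); apply: (com_mul hd hd' fP); apply: h.
have e94 : kl 9 ∙ kl 4 = gone K.
  by have := pr_rules hP (erefl (RK 9 4)) (gone K); rewrite pev1 !(gmul1r hK).
have e49 : kl 4 ∙ kl 9 = gone K.
  by have := pr_rules hP (erefl (RK 4 9)) (gone K); rewrite pev1 !(gmul1r hK).
have h4 : f (d (kl 4)) = d' (f (kl 4)) := com_inv hd hd' fP (pr_homog hP 9) e94 e49 h9.
apply: (com_gen hd hd' fP (pr_gen hP)) => x [n ng ->].
move: ng; rewrite !inE => /or4P[/eqP->|/eqP->|/eqP->|/or4P[/eqP->|/eqP->|/eqP->|/or3P[] /eqP->]];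
  solve [exact: h | exact: h4 | exact: (h5 0%N) | exact: (h5 1%N) | exact: (h5 2%N) | exact: (h5 3%N)].
Qed.

Lemma B_com (B : galg F) (bl : nat -> B) (d : B -> B) (O' : galg F) (d' : O' -> O') (f : B -> O') :
  is_pres q true bl gensB relB RB -> is_dga d ->
  (forall n, n \in gensB -> d (bl n) = gev q bl (dt n)) -> is_dga d' -> is_galg_map f ->
  (forall n, n \in [:: 10; 11]%N -> f (d (bl n)) = d' (f (bl n))) -> forall x, f (d x) = d' (f x).
Proof.
move=> hP hd dE hd' fP h.
apply: (com_gen hd hd' fP (pr_gen hP)) => x [n ng ->].
move: ng; rewrite !inE => /or4P[] /eqP->; try by apply: h.
  exact: (com_next hP hd dE hd' fP (isT : (10 \in gensB)%N) (dt_even_B (isT : (10 \in [:: 10; 11])%N)) (h 10%N isT)).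
exact: (com_next hP hd dE hd' fP (isT : (11 \in gensB)%N) (dt_even_B (isT : (11 \in [:: 10; 11])%N)) (h 11%N isT)).
Qed.

(** * The differential of the bosonisation and its compatibilities *)

Section Bosonisation.
Variables (K B : galg F) (kl : nat -> K) (bl : nat -> B) (H : hopf_ops K) (C : cmod K B).
Variables (D : B -> tens B (bos H C)) (HB : hopf_ops B) (SW : bos H C -> bos H C).
Hypothesis md : model q true kl bl D HB SW.
Variables (dK : K -> K) (dB : B -> B).
Hypotheses (hdK : is_dga dK) (dKE : forall n, n \in gensK -> dK (kl n) = gev q kl (dt n)).
Hypotheses (hdB : is_dga dB) (dBE : forall n, n \in gensB -> dB (bl n) = gev q bl (dt n)).
Let hP := md_K md.
Let hQ := md_B md.
Let hH := md_hopf md.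
Let hM := md_modalg md.
Let hK := pr_galg hP.
Let hB := pr_galg hQ.
Let mK := galg_is_gmod hK.
Let mB := galg_is_gmod hB.
Local Notation W := (bos H C).
Local Notation inl := (bos_inl H C).
Local Notation inr := (bos_inr H C).
Let hW : is_galg W := bos_galg hH hB hM.
Let mW := galg_is_gmod hW.
Let inlP : @is_galg_map F K W inl := galg_map_bos_inl hH hB hM.
Let inrP : @is_galg_map F B W inr := galg_map_bos_inr hH hB hM.
Let ll : linear inl. Proof. by case: inlP => -[]. Qed.
Let lr : linear inr. Proof. by case: inrP => -[]. Qed.
Let lK := dga_linear hdK.
Let lB := dga_linear hdB.
Definition dW : W -> W := tdif dK dB.

Let d_kl n : (n < 4)%N -> dK (kl n) = kl n.+4.+1.
Proof.
move=> n4; apply: (d_next hP dKE) (dt_even n4); first by do 4![case: n n4 => [|n] n4 //].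
Qed.
Let d_bl n : n \in [:: 10; 11]%N -> dB (bl n) = bl n.+2.
Proof.
move=> n4; apply: (d_next hQ dBE) (dt_even_B n4); by move: n4; rewrite !inE => /orP[] /eqP->.
Qed.

Lemma dW_inl k : dW (inl k) = inl (dK k).
Proof. by rewrite /dW /inl tdif_pure // (dga_one hB hdB) tens0r addr0. Qed.
Lemma dW_inr b : dW (inr b) = inr (dB b).
Proof. by rewrite /dW /inr tdif_pure // (dga_one hK hdK) tens0l add0r (sg1 hK). Qed.

Lemma evW_gevK n : n \in gensK -> inl (gev q kl (dt n)) = gev q (evW kl bl H C) (dt n).
Proof.
move=> ng; have [_ l1 lM] := inlP.
rewrite /gev (pev_map (op' := fun n => gmul (inl (kl n))) _ _ _ ll) => [|m z]; last by rewrite lM.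
rewrite l1; apply: (@eq_pev_in _ _ _ _ _ (fun k => (k \in gensK) && (k < 20)%N)) => [k /andP[kg _] z|].
  by rewrite (evW_K _ _ _ _ kg).
by have /andP[_] := allP dtK_chk n ng.
Qed.

Lemma evW_gevB n : n \in gensB -> inr (gev q bl (dt n)) = gev q (evW kl bl H C) (dt n).
Proof.
move=> ng; have [_ l1 lM] := inrP.
rewrite /gev (pev_map (op' := fun n => gmul (inr (bl n))) _ _ _ lr) => [|m z]; last by rewrite lM.
rewrite l1; apply: (@eq_pev_in _ _ _ _ _ (fun k => (k \in gensB) && (k < 20)%N)) => [k /andP[kg _] z|].
  by rewrite (evW_B _ _ _ _ kg).
by have /andP[_] := allP dtB_chk n ng.
Qed.

(** The issue is the Leibniz rule across the cross relations. The maps k |-> (k, dk) and b |-> (b,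
    db) into triangular matrices over W respect these relations ([dW_chk]) and so extend to W; on
    pure tensors the extension is t |-> (t, dW t). *)
Lemma dW_dga : is_dga dW.
Proof.
have sW := md_sys md.
have fA := @md_lift _ _ q0 _ _ _ _ _ _ _ _ _ _ md _ (@tri_mul F W) (gone W, 0) (evT (evW kl bl H C)) _ d_s
  (fun k => (inl k, inl (dK k))) (fun b => (inr b, inr (dB b))) (tri_alg hW) (tri_rules sW)
  (dga_tri hK hdK hW inlP) (dga_tri hB hdB hW inrP) _ _ dW_chk.
have {fA}[n ng|n ng|fl fo fM] := fA.
- by rewrite (d_sE sW) (evW_K _ _ _ _ ng) dKE // evW_gevK.
- by rewrite (d_sE sW) (evW_B _ _ _ _ ng) dBE // evW_gevB.
pose f t := bos_lift (H := H) (C := C) (@tri_mul F W) (fun k => (inl k, inl (dK k))) (fun b => (inr b, inr (dB b))) t.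
have fP : alg_map (@tri_mul F W) (gone W, 0) f by split.
have dWl : linear dW := lf_tdif mK mB lK lB.
have fE t : f t = (t, dW t).
  move: t; apply: tens_ext => [||w e].
  - exact: fl.
  - by move=> a x y; rewrite dWl.
  rewrite /f (bos_lift_pure H C (tri_alg hW) (dga_tri hK hdK hW inlP) (dga_tri hB hdB hW inrP)).
  transitivity ((inl w ∙ inr e, sg true (inl w) ∙ inr (dB e) + inl (dK w) ∙ inr e) : W * W); first by [].
  rewrite -(glin_sg mK mW true w (galg_map_glin inlP)) -!(bos_pureE hH hB hM).
  by congr (_, _); rewrite addrC /dW tdif_pure.
have f1 t : (f t).1 = t by rewrite fE.
have f2 t : (f t).2 = dW t by rewrite fE.
have -> : dW = fun t => (f t).2 by apply/funext => t; rewrite f2.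
apply: (tri_dga hW fP f1 (bos_generated hH hB hM (pr_gen hP) (pr_gen hQ))) => t.
  case=> [[k [n ng ->] ->]|[v [n ng ->] ->]]; exists (ldeg n); rewrite ?f2.
  - exact: (glin_homog (galg_map_glin inlP) (pr_homog hP n)).
  - rewrite dW_inl; exact: (glin_homog (galg_map_glin inlP) (dga_homog hdK (pr_homog hP n))).
  - exact: (glin_homog (galg_map_glin inrP) (pr_homog hQ n)).
  - rewrite dW_inr; exact: (glin_homog (galg_map_glin inrP) (dga_homog hdB (pr_homog hQ n))).
rewrite !f2; case=> [[k _ ->]|[v _ ->]]; first by rewrite !dW_inl (dga_dd hdK) (lin0 ll).
by rewrite !dW_inr (dga_dd hdB) (lin0 lr).
Qed.

Let hdW := dW_dga.
Let lW := dga_linear hdW.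
Let hKK := stens_dga hdK hdK.
Let hBK := stens_dga hdB hdK.
Let hBW := stens_dga hdB hdW.
Let hWW := stens_dga hdW hdW.
Let copP : @is_galg_map F K (stens K K) (cop H) := shopf_cop hH.
Let copl : linear (cop H). Proof. by case: copP => -[]. Qed.
Let coactP := md_coactP md.
Let coactl : linear (coact C). Proof. by case: coactP => -[]. Qed.

Let tdif_even (V V' : galg F) (mV : is_gmod V) (mV' : is_gmod V') (dV : V -> V) (dV' : V' -> V') x y :
  linear dV -> linear dV' -> homog 0 x -> tdif dV dV' (x ⊗ y) = dV x ⊗ y + x ⊗ dV' y.
Proof. by move=> l l' x0; rewrite tdif_pure // (sg_homog mV _ x0) /sign expr0 scale1r. Qed.

Lemma cop_dK x : cop H (dK x) = tdif dK dK (cop H x).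
Proof.
move: x; apply: (K_com hP hdK dKE hKK copP) => n n4.
have k0 m : (m < 4)%N -> homog 0 (kl m).
  by move=> m4; have := pr_homog hP m; do 4![case: m m4 => [|m] m4 //].
have ng : n \in gensK by do 4![case: n n4 => [|n] n4 //].
have ng5 : n.+4.+1 \in gensK by do 4![case: n n4 ng => [|n] n4 ng //].
rewrite d_kl // (md_cop md ng) (md_cop md ng5) (lin_sum (lf_tdif mK mK lK lK)).
have -> : \sum_(g <- copt n) tdif dK dK (kl g.1 ⊗ kl g.2) =
    \sum_(g <- copt n) (kl g.1.+4.+1 ⊗ kl g.2 + kl g.1 ⊗ kl g.2.+4.+1).
  apply: eq_big_seq => g gn.
  have /andP[g1 g2] := allP (copt_low n4) g gn.
  by rewrite (tdif_even mK mK _ lK lK (k0 _ g1)) !d_kl.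
pose M : lmodType F := tens K K.
by clear ng ng5; case: n n4 => [|[|[|[|n]]]] // _; rewrite ?coptE !big_cons !big_nil /=; modeq M.
Qed.

Lemma coact_dB x : coact C (dB x) = tdif dB dK (coact C x).
Proof.
move: x; apply: (B_com hQ hdB dBE hBK coactP) => n n4.
have ng : n \in gensB by move: n4; rewrite !inE => /orP[] /eqP->.
have ng5 : n.+2 \in gensB by move: n4; rewrite !inE => /orP[] /eqP->.
rewrite d_bl // (md_coact md ng) (md_coact md ng5) (lin_sum (lf_tdif mB mK lB lK)).
have -> : \sum_(g <- coat n) tdif dB dK (bl g.1 ⊗ kl g.2) =
    \sum_(g <- coat n) (bl g.1.+2 ⊗ kl g.2 + bl g.1 ⊗ kl g.2.+4.+1).
  apply: eq_big_seq => g gn.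
  have /andP[g1 g2] : (g.1 \in [:: 10; 11]) && (g.2 < 4)%N.
    have /allP/(_ g gn) // : all (fun g => (g.1 \in [:: 10; 11]) && (g.2 < 4))%N (coat n).
    by move: n4; rewrite !inE => /orP[] /eqP->.
  rewrite (tdif_even mB mK _ lB lK) ?d_kl ?d_bl //.
  by have := pr_homog hQ g.1; move: g1; rewrite !inE => /orP[] /eqP->.
pose M : lmodType F := tens B K.
by move: n4; rewrite !inE => /orP[] /eqP->; rewrite ?coatE !big_cons !big_nil /=; modeq M.
Qed.

Let idB := galg_map_glin (galg_map_id B).
Let DP : @is_galg_map F B (stens B W) D. Proof. exact: coma_map (md_comod md). Qed.
Let D_bl n : n \in gensB -> D (bl n) = tmap (fun x => x) inl (coact C (bl n)) + gone B ⊗ inr (bl n).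
Proof.
by move=> ng; apply: (DV hQ hH hM coactP (md_coact md) DP (md_D md)); apply: Vsp_bl.
Qed.
Let dg1 (x : W) : tdif dB dW (gone B ⊗ x) = gone B ⊗ dW x.
Proof. by rewrite (tdif_pure mB mW lB lW) (dga_one hB hdB) tens0l add0r (sg1 hB). Qed.
Let dg1W (x : W) : tdif dW dW (gone W ⊗ x) = gone W ⊗ dW x.
Proof. by rewrite (tdif_pure mW mW lW lW) (dga_one hW hdW) tens0l add0r (sg1 hW). Qed.

Lemma D_dB x : D (dB x) = tdif dB dW (D x).
Proof.
move: x; apply: (B_com hQ hdB dBE hBW DP) => n n4.
have ng : n \in gensB by move: n4; rewrite !inE => /orP[] /eqP->.
have ng5 : n.+2 \in gensB by move: n4; rewrite !inE => /orP[] /eqP->.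
rewrite {1}d_bl // !D_bl // -{1}d_bl // coact_dB (linD (lf_tdif mB mW lB lW)) dg1 dW_inr d_bl //.
congr (_ + _).
exact: (tdif_tmap mB mK mB mW (coact C (bl n)) lB lK lB lW idB (galg_map_glin inlP) (fun _ => erefl)
  (fun k => esym (dW_inl k))).
Qed.

Let HW := bos_hopf HB SW.
Let copWP : @is_galg_map F W (stens W W) (cop HW) := shopf_cop (md_shopf md).
Let gl := galg_map_glin inlP.
Let gr := galg_map_glin inrP.

Lemma cop_dW x : cop HW (dW x) = tdif dW dW (cop HW x).
Proof.
move: x; apply: (com_gen hdW hWW copWP (bos_generated hH hB hM (pr_gen hP) (pr_gen hQ))) => t.
case=> [[k _ ->]|[v _ ->]].
  rewrite dW_inl !(md_copWl md) cop_dK.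
  exact: (tdif_tmap mK mK mW mW (cop H k) lK lK lW lW gl gl
    (fun k => esym (dW_inl k)) (fun k => esym (dW_inl k))).
rewrite dW_inr; move: v.
refine (@B_com B bl dB (stens W W) (tdif dW dW) (fun b => cop HW (inr b)) hQ hdB dBE hWW _ _) => [|n n4].
  exact: (@galg_map_comp _ B W (stens W W) (cop HW) inr copWP inrP).
have ng : n \in gensB by move: n4; rewrite !inE => /orP[] /eqP->.
have ng5 : n.+2 \in gensB by move: n4; rewrite !inE => /orP[] /eqP->.
rewrite {1}d_bl // (md_copWr md ng) (md_copWr md ng5) -d_bl // coact_dB (linD (lf_tdif mW mW lW lW)) dg1W dW_inr.
congr (_ + _).
exact: (tdif_tmap mB mK mW mW (coact C (bl n)) lB lK lW lW gr gl
  (fun k => esym (dW_inr k)) (fun k => esym (dW_inl k))).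
Qed.
End Bosonisation.
End Calculus.

Lemma tmap_table (F : fieldType) (V V' W W' : lmodType F) (f : V -> V') (g : W -> W') (x : nat -> V) (x' : nat -> V')
  (y : nat -> W) (y' : nat -> W') (t : seq (nat * nat)) : linear f -> linear g ->
  (forall a, a \in t -> f (x a.1) = x' a.1 /\ g (y a.2) = y' a.2) ->
  tmap f g (\sum_(a <- t) x a.1 ⊗ y a.2) = \sum_(a <- t) x' a.1 ⊗ y' a.2.
Proof.
move=> fl gl h; rewrite (lin_sum (lf_tmap fl gl)); apply: eq_big_seq => a /h[h1 h2].
by rewrite tmap_pure // h1 h2.
Qed.

Section Comparison.
Variables (F : fieldType) (q : F) (q0 : q != 0).
Variables (K0 B0 : galg F) (kl0 : nat -> K0) (bl0 : nat -> B0) (H0 : hopf_ops K0) (C0 : cmod K0 B0).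
Variables (D0 : B0 -> tens B0 (bos H0 C0)) (HB0 : hopf_ops B0) (SW0 : bos H0 C0 -> bos H0 C0).
Hypothesis md0 : model q false kl0 bl0 D0 HB0 SW0.
Variables (K B : galg F) (kl : nat -> K) (bl : nat -> B) (H : hopf_ops K) (C : cmod K B).
Variables (D : B -> tens B (bos H C)) (HB : hopf_ops B) (SW : bos H C -> bos H C).
Hypothesis md : model q true kl bl D HB SW.
Variables (dK : K -> K) (dB : B -> B).
Hypotheses (hdK : is_dga dK) (dKE : forall n, n \in gensK -> dK (kl n) = gev q kl (dt n)).
Hypotheses (hdB : is_dga dB) (dBE : forall n, n \in gensB -> dB (bl n) = gev q bl (dt n)).
Hypotheses (degK : forall k : K0, homog 0 k) (degB : forall b : B0, homog 0 b).
Variables (iA : K0 -> K) (iB : B0 -> B).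
Hypotheses (iAP : is_galg_map iA) (iAE : forall n, n \in gensK -> iA (kl0 n) = if lodd n then 0 else kl n).
Hypotheses (iBP : is_galg_map iB) (iBE : forall n, n \in gensB -> iB (bl0 n) = if lodd n then 0 else bl n).
Variables (pA : K -> K0) (pB : B -> B0).
Hypotheses (pAl : linear pA) (pBl : linear pB) (pAK : forall a, pA (iA a) = a) (pBK : forall b, pB (iB b) = b).
Let hP := md_K md.
Let hQ := md_B md.
Let hH := md_hopf md.
Let hM := md_modalg md.
Let hK := pr_galg hP.
Let hB := pr_galg hQ.
Let mK := galg_is_gmod hK.
Let mB := galg_is_gmod hB.
Let hP0 := md_K md0.
Let hQ0 := md_B md0.
Let hH0 := md_hopf md0.
Let hM0 := md_modalg md0.
Let hK0 := pr_galg hP0.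
Let hB0 := pr_galg hQ0.
Let mK0 := galg_is_gmod hK0.
Let mB0 := galg_is_gmod hB0.
Local Notation W := (bos H C).
Local Notation inl := (bos_inl H C).
Local Notation inr := (bos_inr H C).
Local Notation W0 := (bos H0 C0).
Local Notation inl0 := (bos_inl H0 C0).
Local Notation inr0 := (bos_inr H0 C0).
Let hW : is_galg W := bos_galg hH hB hM.
Let mW := galg_is_gmod hW.
Let hW0 : is_galg W0 := bos_galg hH0 hB0 hM0.
Let mW0 := galg_is_gmod hW0.
Let inlP : @is_galg_map F K W inl := galg_map_bos_inl hH hB hM.
Let inrP : @is_galg_map F B W inr := galg_map_bos_inr hH hB hM.
Let inlP0 : @is_galg_map F K0 W0 inl0 := galg_map_bos_inl hH0 hB0 hM0.
Let inrP0 : @is_galg_map F B0 W0 inr0 := galg_map_bos_inr hH0 hB0 hM0.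
Let ll : linear inl. Proof. by case: inlP => -[]. Qed.
Let lr : linear inr. Proof. by case: inrP => -[]. Qed.
Let ll0 : linear inl0. Proof. by case: inlP0 => -[]. Qed.
Let lr0 : linear inr0. Proof. by case: inrP0 => -[]. Qed.
Let iAl : linear iA. Proof. by case: iAP => -[]. Qed.
Let iBl : linear iB. Proof. by case: iBP => -[]. Qed.
Let lK := dga_linear hdK.
Let lB := dga_linear hdB.
Local Notation dW := (dW (H := H) (C := C) dK dB).
Let hdW : is_dga dW := dW_dga q0 md hdK dKE hdB dBE.

Definition iW : W0 -> W := tmap iA iB.
Let iWl : linear iW := lf_tmap iAl iBl.

Lemma iW_inl k : iW (inl0 k) = inl (iA k).
Proof. by rewrite /iW /inl0 tmap_pure //; case: iBP => _ -> _. Qed.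
Lemma iW_inr b : iW (inr0 b) = inr (iB b).
Proof. by rewrite /iW /inr0 tmap_pure //; case: iAP => _ -> _. Qed.

(** The two bosonisations multiply through different actions, so [iW] is identified with the map
    given by the universal property of the degree 0 bosonisation, whose cross relations are checked
    in W. *)
Lemma iW_map : is_galg_map iW.
Proof.
have sW := md_sys md; have aW := galg_alg hW.
have hf : alg_map (@gmul F W) (gone W) (fun k => inl (iA k)).
  exact: galg_map_alg (@galg_map_comp _ K0 K W inl iA inlP iAP).
have hg : alg_map (@gmul F W) (gone W) (fun b => inr (iB b)).
  exact: galg_map_alg (@galg_map_comp _ B0 B W inr iB inrP iBP).
have fA := @md_lift _ _ q0 _ _ _ _ _ _ _ _ _ _ md0 _ (@gmul F W) (gone W) (evW kl bl H C) _ even_s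
  (fun k => inl (iA k)) (fun b => inr (iB b)) aW (sys_rules sW) hf hg _ _ evenW_chk.
have {fA}[n ng|n ng|fl f1 fM] := fA.
- rewrite -[RHS]/(gev q _ _) (even_gev _ sW) iAE // (evW_K _ _ _ _ ng).
  by case: ifP; rewrite // (lin0 ll).
- rewrite -[RHS]/(gev q _ _) (even_gev _ sW) iBE // (evW_B _ _ _ _ ng).
  by case: ifP; rewrite // (lin0 lr).
have E t : bos_lift (H := H0) (C := C0) (@gmul F W) (fun k => inl (iA k)) (fun b => inr (iB b)) t = iW t.
  move: t; apply: tens_ext => [||w e]; [exact: fl | exact: iWl |].
  by rewrite (bos_lift_pure H0 C0 aW hf hg) -(bos_pureE hH hB hM) /iW tmap_pure.
split.
- exact: (glin_tmap mK0 mB0 mK mB (galg_map_glin iAP) (galg_map_glin iBP)).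
- by rewrite -E.
by move=> x y; rewrite -!E.
Qed.

Lemma iW_inj : injective iW.
Proof.
apply: (can_inj (g := tmap pA pB)) => t.
by rewrite /iW tmap_comp // (eq_tmap _ pAK pBK) tmap_id.
Qed.

Lemma degW (t : W0) : homog 0 t.
Proof.
move: t; apply: tens_ind => [v w|s t]; first exact: (tens_homog mK0 mB0 (degK v) (degB w)).
exact: (homogD mW0).
Qed.

Let d_gen (O : galg F) (gens : seq nat) (ev : nat -> O) (dO : O -> O) n fl rT :
  is_sys q fl ev ldeg rT -> (forall n, n \in gens -> dO (ev n) = gev q ev (dt n)) ->
  n \in gens -> forall m, dt n = letter m -> dO (ev n) = ev m.
Proof. by move=> sT h ng m e; rewrite h // e (gev_letter sT). Qed.

(** Every generator of K is the image of one from degree 0 or the differential of such an image.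
    Used with X saying that an element lies in the degree 0 part or is the differential of one. *)
Lemma incl_gen_K (O : galg F) (f : K -> O) (dO : O -> O) (X : O -> Prop) :
  (forall k, f (dK k) = dO (f k)) -> (forall a, X (f (iA a))) -> (forall a, X (dO (f (iA a)))) ->
  forall n, n \in gensK -> X (f (kl n)).
Proof.
move=> fd X0 X1 n ng; have [n1|n0] := boolP (lodd n); last first.
  by have := iAE ng; rewrite (negPf n0) => <-.
have [m [mg m0 dm]] : exists m, [/\ m \in gensK, ~~ lodd m & dt m = letter n].
  move: ng n1; rewrite !inE => /or4P[/eqP->|/eqP->|/eqP->|/or4P[/eqP->|/eqP->|/eqP->|/or3P[/eqP->|/eqP->|/eqP->]]] // _;
    [exists 0%N | exists 1%N | exists 2%N | exists 3%N] => //.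
rewrite -(d_gen (pres_sys hP) dKE mg dm) fd; have := iAE mg; rewrite (negPf m0) => <-.
exact: X1.
Qed.

Lemma incl_gen_B (O : galg F) (f : B -> O) (dO : O -> O) (X : O -> Prop) :
  (forall k, f (dB k) = dO (f k)) -> (forall a, X (f (iB a))) -> (forall a, X (dO (f (iB a)))) ->
  forall n, n \in gensB -> X (f (bl n)).
Proof.
move=> fd X0 X1 n ng; have [n1|n0] := boolP (lodd n); last first.
  by have := iBE ng; rewrite (negPf n0) => <-.
have [m [mg m0 dm]] : exists m, [/\ m \in gensB, ~~ lodd m & dt m = letter n].
  by move: ng n1; rewrite !inE => /or4P[] /eqP-> // _; [exists 10%N | exists 11%N].
rewrite -(d_gen (pres_sys hQ) dBE mg dm) fd; have := iBE mg; rewrite (negPf m0) => <-.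
exact: X1.
Qed.

Lemma exterior_K : is_exterior iA dK.
Proof.
apply: (exterior_gen hK0 degK hdK iAP (can_inj pAK)).
apply: (generated_sub (pr_gen hP)) => x [n ng ->].
apply: (@incl_gen_K K (fun x => x) dK (fun x => (exists a, x = iA a) \/ (exists a, x = dK (iA a))) (fun _ => erefl)) ng => a; first by left; exists a.
by right; exists a.
Qed.

Lemma exterior_B : is_exterior iB dB.
Proof.
apply: (exterior_gen hB0 degB hdB iBP (can_inj pBK)).
apply: (generated_sub (pr_gen hQ)) => x [n ng ->].
apply: (@incl_gen_B B (fun x => x) dB (fun x => (exists a, x = iB a) \/ (exists a, x = dB (iB a))) (fun _ => erefl)) ng => a; first by left; exists a.
by right; exists a.
Qed.

Lemma exterior_W : is_exterior iW dW.
Proof.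
apply: (exterior_gen hW0 degW hdW iW_map iW_inj).
apply: (generated_sub (bos_generated hH hB hM (pr_gen hP) (pr_gen hQ))) => x.
case=> [[k [n ng ->] ->]|[v [n ng ->] ->]].
  apply: (@incl_gen_K W inl dW (fun x => (exists a, x = iW a) \/ (exists a, x = dW (iW a))) (fun k => esym (dW_inl md hdK hdB k))) ng => a.
    by left; exists (inl0 a); rewrite iW_inl.
  by right; exists (inl0 a); rewrite iW_inl.
apply: (@incl_gen_B W inr dW (fun x => (exists a, x = iW a) \/ (exists a, x = dW (iW a))) (fun k => esym (dW_inr md hdK hdB k))) ng => a.
  by left; exists (inr0 a); rewrite iW_inr.
by right; exists (inr0 a); rewrite iW_inr.
Qed.

Let iA0 n : n \in gensK -> ~~ lodd n -> iA (kl0 n) = kl n.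
Proof. by move=> ng n0; rewrite iAE // (negPf n0). Qed.
Let iB0 n : n \in gensB -> ~~ lodd n -> iB (bl0 n) = bl n.
Proof. by move=> ng n0; rewrite iBE // (negPf n0). Qed.
Let coat_in n g : n \in gensB -> ~~ lodd n -> g \in coat n -> [/\ g.1 \in gensB, g.2 \in gensK, ~~ lodd g.1 & ~~ lodd g.2].
Proof.
move=> ng n0 gn; have /andP[g1 g2] := allP (allP coat_chk n ng) g gn.
by have := allP coat_even n ng; rewrite (negPf n0) => /allP/(_ g gn)/andP[].
Qed.

Lemma cop_restr a : cop H (iA a) = tmap iA iA (cop H0 a).
Proof.
have [cP cP0] := (shopf_cop hH, shopf_cop hH0).
move: a; apply: (generated_eq (pr_gen hP0) (mul := @gmul F (stens K K)) (one := gone (stens K K))).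
- exact: galg_map_alg (@galg_map_comp _ K0 K (stens K K) (cop H) iA cP iAP).
- apply: galg_map_alg; refine (@galg_map_comp _ K0 (stens K0 K0) (stens K K) (tmap iA iA) (cop H0) _ cP0).
  exact: (galg_map_tmap hK0 hK0 hK hK iAP iAP).
move=> x [n ng ->]; have [n1|n0] := boolP (lodd n).
  rewrite (pr_odd hP0) // (lin0 iAl); case: cP => -[/lin0-> _] _ _; case: cP0 => -[/lin0-> _] _ _.
  exact: esym (lin0 (lf_tmap iAl iAl)).
rewrite iA0 // (md_cop md ng) (md_cop md0 ng); apply: esym; apply: tmap_table => // g gn.
have /andP[g1 g2] := allP (allP copt_chk n ng) g gn.
have := allP copt_even n ng; rewrite (negPf n0) => /allP/(_ g gn)/andP[e1 e2].
by rewrite !iA0.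
Qed.

Lemma coact_restr b : coact C (iB b) = tmap iB iA (coact C0 b).
Proof.
have [cP cP0] := (md_coactP md, md_coactP md0).
move: b; apply: (generated_eq (pr_gen hQ0) (mul := @gmul F (stens B K)) (one := gone (stens B K))).
- exact: galg_map_alg (@galg_map_comp _ B0 B (stens B K) (coact C) iB cP iBP).
- apply: galg_map_alg; refine (@galg_map_comp _ B0 (stens B0 K0) (stens B K) (tmap iB iA) (coact C0) _ cP0).
  exact: (galg_map_tmap hB0 hK0 hB hK iBP iAP).
move=> x [n ng ->]; have [n1|n0] := boolP (lodd n).
  rewrite (pr_odd hQ0) // (lin0 iBl); case: cP => -[/lin0-> _] _ _; case: cP0 => -[/lin0-> _] _ _.
  exact: esym (lin0 (lf_tmap iBl iAl)).
rewrite iB0 // (md_coact md ng) (md_coact md0 ng); apply: esym; apply: tmap_table => // g gn.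
have [g1 g2 e1 e2] := coat_in ng n0 gn.
by rewrite iA0 // iB0.
Qed.

Let DP : @is_galg_map F B (stens B W) D. Proof. exact: coma_map (md_comod md). Qed.
Let DP0 : @is_galg_map F B0 (stens B0 W0) D0. Proof. exact: coma_map (md_comod md0). Qed.

Lemma D_restr b : D (iB b) = tmap iB iW (D0 b).
Proof.
have iWP := iW_map.
move: b; apply: (generated_eq (pr_gen hQ0) (mul := @gmul F (stens B W)) (one := gone (stens B W))).
- exact: galg_map_alg (@galg_map_comp _ B0 B (stens B W) D iB DP iBP).
- apply: galg_map_alg; refine (@galg_map_comp _ B0 (stens B0 W0) (stens B W) (tmap iB iW) D0 _ DP0).
  exact: (galg_map_tmap hB0 hW0 hB hW iBP iWP).
move=> x [n ng ->]; have [n1|n0] := boolP (lodd n).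
  rewrite (pr_odd hQ0) // (lin0 iBl); case: DP => -[/lin0-> _] _ _; case: DP0 => -[/lin0-> _] _ _.
  exact: esym (lin0 (lf_tmap iBl iWl)).
rewrite iB0 // (md_D md ng) (md_D md0 ng) (linD (lf_tmap iBl iWl)) (tmap_pure iBl iWl) iW_inr iB0 //.
case: (iBP) => _ -> _; congr (_ + _); apply: esym.
apply: (@tmap_table _ _ _ _ _ iB iW bl0 bl (fun m => inl0 (kl0 m)) (fun m => inl (kl m))) => // g gn.
have [g1 g2 e1 e2] := coat_in ng n0 gn.
by rewrite iW_inl iA0 // iB0.
Qed.

Lemma copW_restr w : cop (bos_hopf HB SW) (iW w) = tmap iW iW (cop (bos_hopf HB0 SW0) w).
Proof.
have [cP cP0] := (shopf_cop (md_shopf md), shopf_cop (md_shopf md0)); have iWP := iW_map.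
have [[cl _] _ _] := cP; have [[cl0 _] _ _] := cP0; have iWWl := lf_tmap iWl iWl.
move: w; apply: (generated_eq (bos_generated hH0 hB0 hM0 (pr_gen hP0) (pr_gen hQ0))
  (mul := @gmul F (stens W W)) (one := gone (stens W W))).
- exact: galg_map_alg (@galg_map_comp _ W0 W (stens W W) (cop (bos_hopf HB SW)) iW cP iWP).
- apply: galg_map_alg; refine (@galg_map_comp _ W0 (stens W0 W0) (stens W W) (tmap iW iW) (cop (bos_hopf HB0 SW0)) _ cP0).
  exact: (galg_map_tmap hW0 hW0 hW hW iWP iWP).
move=> x [[k _ ->]|[v [n ng ->] ->]].
  rewrite iW_inl (md_copWl md) (md_copWl md0) cop_restr !tmap_comp //.
  by apply: eq_tmap => w; rewrite iW_inl.
have [n1|n0] := boolP (lodd n).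
  by rewrite (pr_odd hQ0) // (lin0 lr0) (lin0 iWl) (lin0 cl) (lin0 cl0) (lin0 iWWl).
rewrite iW_inr iB0 // (md_copWr md ng) (md_copWr md0 ng) (linD iWWl) (tmap_pure iWl iWl) iW_inr iB0 //.
case: (iWP) => _ -> _; congr (_ + _); rewrite -iB0 // coact_restr !tmap_comp //.
by apply: eq_tmap => w; rewrite ?iW_inl ?iW_inr.
Qed.

Lemma bicovariant_K : is_strongly_bicovariant H0 H iA dK.
Proof. by split; [exact: exterior_K | | | exact: cop_restr | exact: (cop_dK md hdK dKE)]. Qed.

Lemma bicovariant_W : is_strongly_bicovariant (bos_hopf HB0 SW0) (bos_hopf HB SW) iW dW.
Proof.
split; [exact: exterior_W | exact: md_shopf md0 | exact: md_shopf md | exact: copW_restr |].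
exact: (cop_dW q0 md hdK dKE hdB dBE).
Qed.

Lemma differentiable_D : is_differentiable iB dB iW dW D0.
Proof.
exists D; split; last exact: D_restr.
by split; [exact: DP | exact: (D_dB q0 md hdK dKE hdB dBE)].
Qed.

(** The counit of B applied to the second leg is a left inverse. *)
Lemma bos_inl_inj : injective inl.
Proof.
have [e [eP _]] := eB_ex q0 hQ; have el := char_lin eP.
have b : bilin (fun (w : K) (v : B) => e v *: w) by split=> y; [apply: lf_scale; apply: lf_id | apply: lf_scalel].
apply: (can_inj (g := fun t => \sw_(w, v <- t) e v *: w)) => k.
by rewrite /bos_inl (tlift_pure b) (char_one eP) scale1r.
Qed.

Lemma bos_inr_inj : injective inr.
Proof.
have eP := shopf_char hH; have el := char_lin eP.
have b : bilin (fun (w : K) (v : B) => cou H w *: v) by split=> y; [apply: lf_scalel | apply: lf_scale; apply: lf_id].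
apply: (can_inj (g := fun t => \sw_(w, v <- t) cou H w *: v)) => k.
by rewrite /bos_inr (tlift_pure b) (char_one eP) scale1r.
Qed.
End Comparison.

Lemma mx2_11 T (a b c d : T) : mx2 a b c d i1 i1 = a. Proof. by []. Qed.
Lemma mx2_12 T (a b c d : T) : mx2 a b c d i1 i2 = b. Proof. by []. Qed.
Lemma mx2_21 T (a b c d : T) : mx2 a b c d i2 i1 = c. Proof. by []. Qed.
Lemma mx2_22 T (a b c d : T) : mx2 a b c d i2 i2 = d. Proof. by []. Qed.
Definition mx2E := (mx2_11, mx2_12, mx2_21, mx2_22).

(** * The formulas of the theorem *)

Section Relations.
Variables (F : fieldType) (q : F) (q0 : q != 0).

Section GevWords.
Variables (T : galg F) (hT : is_galg T) (ev : nat -> T).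
Lemma gev_nil : gev q ev [::] = 0. Proof. exact: pev_nil. Qed.
Lemma gev_word1 c e n p : gev q ev ((c, e, [:: n]) :: p) = zc q c e *: ev n + gev q ev p.
Proof. by rewrite /gev pev_cons -[foldr _ _ _]/(ev n ∙ gone T) (gmul1r hT). Qed.
Lemma gev_word2 c e n m p : gev q ev ((c, e, [:: n; m]) :: p) = zc q c e *: (ev n ∙ ev m) + gev q ev p.
Proof. by rewrite /gev pev_cons -[foldr _ _ _]/(ev n ∙ (ev m ∙ gone T)) (gmul1r hT). Qed.
End GevWords.

Variables (fl : bool) (K B : galg F) (kl : nat -> K) (bl : nat -> B) (H : hopf_ops K) (C : cmod K B).
Variables (D : B -> tens B (bos H C)) (HB : hopf_ops B) (SW : bos H C -> bos H C).
Hypothesis md : model q fl kl bl D HB SW.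
Local Notation lam := (q - q^-1).
Let hK := pr_galg (md_K md).
Let hB := pr_galg (md_B md).
Let hW : is_galg (bos H C) := bos_galg (md_hopf md) hB (md_modalg md).
Let t i j := kl (tl i j).
Let dt i j := kl (dl i j).
Let x i := bl (xl i).
Let dx i := bl (yl i).
Let actE v g (vg : v \in gensB) (gg : g \in gensK) := md_act md vg gg.

Ltac tables i j M := elim/ord2P: i; elim/ord2P: j; rewrite /t /dt /x /dx ?tlE ?xlE actE // !mx2E;
  match goal with |- context [rhot ?a ?b] => let p := eval vm_compute in (rhot a b) in change (rhot a b) with p end;
  rewrite ?(gev_word1 hB) gev_nil ?zcE; modeq M.

Lemma act_x1 i j : act C (x i1) (t i j) =
  mx2 (q ^- 2 *: x i1) (- (q^-1 * lam) *: x i2) 0 (q^-1 *: x i1) i j.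
Proof. by pose M : lmodType F := B; tables i j M. Qed.
Lemma act_x2 i j : act C (x i2) (t i j) =
  mx2 (q^-1 *: x i2) 0 0 (q ^- 2 *: x i2) i j.
Proof. by pose M : lmodType F := B; tables i j M. Qed.
Lemma act_x1dt i j : act C (x i1) (dt i j) =
  mx2 (- (q^-1 * lam) *: dx i1) (- (q^-1 * lam) *: dx i2) 0 0 i j.
Proof. by pose M : lmodType F := B; tables i j M. Qed.
Lemma act_dx1 i j : act C (dx i1) (t i j) = mx2 (dx i1) 0 0 (q^-1 *: dx i1) i j.
Proof. by pose M : lmodType F := B; tables i j M. Qed.
Lemma act_x2dt i j : act C (x i2) (dt i j) =
  mx2 0 0 (- (q^-1 * lam) *: dx i1) (- (q^-1 * lam) *: dx i2) i j.
Proof. by pose M : lmodType F := B; tables i j M. Qed.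
Lemma act_dx2 i j : act C (dx i2) (t i j) =
  mx2 (q^-1 *: dx i2) 0 ((q^-1 * lam) *: dx i1) (dx i2) i j.
Proof. by pose M : lmodType F := B; tables i j M. Qed.
Lemma act_dxdt i k l : act C (dx i) (dt k l) = 0.
Proof.
pose M : lmodType F := B.
by elim/ord2P: i; elim/ord2P: k; elim/ord2P: l; rewrite /dt /dx tlE xlE actE //;
  match goal with |- context [rhot ?a ?b] => change (rhot a b) with (@nil mono) end; rewrite gev_nil.
Qed.

Lemma coact_x1 : coact C (x i1) = x i1 ⊗ t i1 i1 + x i2 ⊗ t i2 i1.
Proof. by rewrite /x xlE (md_coact md) // coatE !big_cons big_nil addr0. Qed.
Lemma coact_x2 : coact C (x i2) = x i1 ⊗ t i1 i2 + x i2 ⊗ t i2 i2.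
Proof. by rewrite /x xlE (md_coact md) // coatE !big_cons big_nil addr0. Qed.
Lemma coact_dx1 : coact C (dx i1) = dx i1 ⊗ t i1 i1 + dx i2 ⊗ t i2 i1 + x i1 ⊗ dt i1 i1 + x i2 ⊗ dt i2 i1.
Proof. by rewrite /dx xlE (md_coact md) // coatE !big_cons big_nil addr0 !addrA. Qed.
Lemma coact_dx2 : coact C (dx i2) = dx i1 ⊗ t i1 i2 + dx i2 ⊗ t i2 i2 + x i1 ⊗ dt i1 i2 + x i2 ⊗ dt i2 i2.
Proof. by rewrite /dx xlE (md_coact md) // coatE !big_cons big_nil addr0 !addrA. Qed.
Lemma copB_x i : cop HB (x i) = x i ⊗ gone B + gone B ⊗ x i.
Proof. by apply: (md_copB md); elim/ord2P: i. Qed.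
Lemma copB_dx i : cop HB (dx i) = dx i ⊗ gone B + gone B ⊗ dx i.
Proof. by apply: (md_copB md); elim/ord2P: i. Qed.
Lemma cop_t i j : cop H (t i j) = \sum_k t i k ⊗ t k j.
Proof.
by elim/ord2P: i; elim/ord2P: j; rewrite sum2 /t ?tlE (md_cop md) // coptE !big_cons big_nil addr0.
Qed.
Lemma cop_dt i j : cop H (dt i j) = \sum_k (dt i k ⊗ t k j + t i k ⊗ dt k j).
Proof.
pose M : lmodType F := tens K K.
by elim/ord2P: i; elim/ord2P: j; rewrite sum2 /t /dt ?tlE (md_cop md) // coptE !big_cons big_nil /=; modeq M.
Qed.

Local Notation W := (bos H C).
Let jA : K -> W := bos_inl H C.
Let jB : B -> W := bos_inr H C.
Let a := jA (t i1 i1).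
Let b := jA (t i1 i2).
Let c := jA (t i2 i1).
Let d := jA (t i2 i2).
Let da := jA (dt i1 i1).
Let db := jA (dt i1 i2).
Let dc := jA (dt i2 i1).
Let dd := jA (dt i2 i2).
Let x1 := jB (x i1).
Let x2 := jB (x i2).
Let dx1 := jB (dx i1).
Let dx2 := jB (dx i2).

Let crossE v k (vg : v \in gensB) (kg : k \in gensK) : jB (bl v) ∙ jA (kl k) = gev q (evW kl bl H C) (RX v k) :=
  bos_crossE (md_K md) (md_B md) (md_hopf md) (md_cop md) (md_modalg md) (md_act md) vg kg.
Let eK n (ng : n \in gensK) : evW kl bl H C n = jA (kl n) := evW_K kl bl H C ng.
Let eB n (ng : n \in gensB) : evW kl bl H C n = jB (bl n) := evW_B kl bl H C ng.
Let evE := (eK (isT : (0 \in gensK)%N), eK (isT : (1 \in gensK)%N), eK (isT : (2 \in gensK)%N),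
  eK (isT : (3 \in gensK)%N), eK (isT : (5 \in gensK)%N), eK (isT : (6 \in gensK)%N), eK (isT : (7 \in gensK)%N),
  eK (isT : (8 \in gensK)%N), eB (isT : (10 \in gensB)%N), eB (isT : (11 \in gensB)%N),
  eB (isT : (12 \in gensB)%N), eB (isT : (13 \in gensB)%N)).
Ltac crosses i j M := elim/ord2P: i; elim/ord2P: j; rewrite ?mx2E /a /b /c /d /da /db /dc /dd /x1 /x2 /dx1 /dx2;
  rewrite /t /dt /x /dx ?tlE ?xlE crossE //;
  match goal with |- context [RX ?a ?b] => let p := eval vm_compute in (RX a b) in change (RX a b) with p end;
  rewrite ?(gev_word2 hW) gev_nil ?zcE ?evE; modeq M.

Lemma cross_x1 i j : x1 ∙ jA (t i j) =
  mx2 (q ^- 2 *: (a ∙ x1)) (q^-1 *: (b ∙ x1) - (q^-1 * lam) *: (a ∙ x2))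
      (q ^- 2 *: (c ∙ x1)) (q^-1 *: (d ∙ x1) - (q^-1 * lam) *: (c ∙ x2)) i j.
Proof. by pose M : lmodType F := W; crosses i j M. Qed.
Lemma cross_x2 i j : x2 ∙ jA (t i j) =
  mx2 (q^-1 *: (a ∙ x2)) (q ^- 2 *: (b ∙ x2)) (q^-1 *: (c ∙ x2)) (q ^- 2 *: (d ∙ x2)) i j.
Proof. by pose M : lmodType F := W; crosses i j M. Qed.
Lemma cross_dx1 i j : dx1 ∙ jA (t i j) =
  mx2 (a ∙ dx1) (q^-1 *: (b ∙ dx1)) (c ∙ dx1) (q^-1 *: (d ∙ dx1)) i j.
Proof. by pose M : lmodType F := W; crosses i j M. Qed.
Lemma cross_dx2 i j : dx2 ∙ jA (t i j) =
  mx2 (q^-1 *: (a ∙ dx2) + (q^-1 * lam) *: (b ∙ dx1)) (b ∙ dx2)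
      (q^-1 *: (c ∙ dx2) + (q^-1 * lam) *: (d ∙ dx1)) (d ∙ dx2) i j.
Proof. by pose M : lmodType F := W; crosses i j M. Qed.
Lemma cross_x1dt i j : x1 ∙ jA (dt i j) =
  mx2 (q ^- 2 *: (da ∙ x1) - (q^-1 * lam) *: (a ∙ dx1))
      (q^-1 *: (db ∙ x1) - (q^-1 * lam) *: (da ∙ x2 + a ∙ dx2))
      (q ^- 2 *: (dc ∙ x1) - (q^-1 * lam) *: (c ∙ dx1))
      (q^-1 *: (dd ∙ x1) - (q^-1 * lam) *: (dc ∙ x2 + c ∙ dx2)) i j.
Proof. by pose M : lmodType F := W; crosses i j M. Qed.
Lemma cross_x2dt i j : x2 ∙ jA (dt i j) =
  mx2 (q^-1 *: (da ∙ x2) - (q^-1 * lam) *: (b ∙ dx1))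
      (q ^- 2 *: (db ∙ x2) - (q^-1 * lam) *: (b ∙ dx2))
      (q^-1 *: (dc ∙ x2) - (q^-1 * lam) *: (d ∙ dx1))
      (q ^- 2 *: (dd ∙ x2) - (q^-1 * lam) *: (d ∙ dx2)) i j.
Proof. by pose M : lmodType F := W; crosses i j M. Qed.
Lemma cross_dx1dt i j : dx1 ∙ jA (dt i j) =
  - mx2 (da ∙ dx1) (q^-1 *: (db ∙ dx1)) (dc ∙ dx1) (q^-1 *: (dd ∙ dx1)) i j.
Proof. by pose M : lmodType F := W; crosses i j M. Qed.
Lemma cross_dx2dt i j : dx2 ∙ jA (dt i j) =
  - mx2 (q^-1 *: (da ∙ dx2) + (q^-1 * lam) *: (db ∙ dx1)) (db ∙ dx2)
        (q^-1 *: (dc ∙ dx2) + (q^-1 * lam) *: (dd ∙ dx1)) (dd ∙ dx2) i j.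
Proof. by pose M : lmodType F := W; crosses i j M. Qed.

End Relations.

Section Identification.
Variables (F : fieldType) (q : F).
Lemma klA_tl i j : klA q (tl i j) = glt q i j.
Proof. by elim/ord2P: i; elim/ord2P: j. Qed.
Lemma klO_tl i j : klO q (tl i j) = oglt q i j.
Proof. by elim/ord2P: i; elim/ord2P: j. Qed.
Lemma klO_dl i j : klO q (dl i j) = ogldt q i j.
Proof. by elim/ord2P: i; elim/ord2P: j. Qed.
Lemma blB_xl i : blB q (xl i) = plx q i.
Proof. by elim/ord2P: i. Qed.
Lemma blO_xl i : blO q (xl i) = oplx q i.
Proof. by elim/ord2P: i. Qed.
Lemma blO_yl i : blO q (yl i) = opldx q i.
Proof. by elim/ord2P: i. Qed.
Lemma tl_gens i j : tl i j \in gensK. Proof. by elim/ord2P: i; elim/ord2P: j. Qed.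
Lemma xl_gens i : xl i \in gensB. Proof. by elim/ord2P: i. Qed.
Lemma yl_gens i : yl i \in gensB. Proof. by elim/ord2P: i. Qed.
Lemma dt_tl i j : dt (tl i j) = letter (dl i j). Proof. by elim/ord2P: i; elim/ord2P: j. Qed.
Lemma dt_xl i : dt (xl i) = letter (yl i). Proof. by elim/ord2P: i. Qed.
Lemma lodd_tl i j : lodd (tl i j) = false. Proof. by elim/ord2P: i; elim/ord2P: j. Qed.
Lemma lodd_xl i : lodd (xl i) = false. Proof. by elim/ord2P: i. Qed.
End Identification.

Theorem proposition4p12 (R : realType) (q : R[i])
    (q_neq0 : q != 0) (q2_neqN1 : q ^+ 2 != -1) :
  let lam := q - q^-1 in
  let A := CqGL2 q in let OA := OmGL2 q in
  let B := Cq2 q in let OB := OmCq2 q in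
  let x := @oplx _ q in let dx := @opldx _ q in
  let t := @oglt _ q in let dt := @ogldt _ q in
  exists (HA : hopf_ops A) (HOA : hopf_ops OA) (iA : A -> OA) (dA : OA -> OA)
         (iB : B -> OB) (dB : OB -> OB),
  (* the strongly bicovariant exterior algebra on C_q[GL_2] *)
  (is_strongly_bicovariant HA HOA iA dA /\
   iA (glDi q) = oglDi q /\
   dA (oglDi q) = - (oglDi q ∙ dA (t i1 i1 ∙ t i2 i2 - q^-1 *: (t i1 i2 ∙ t i2 i1))
                       ∙ oglDi q) /\
   forall i j,
     [/\ iA (glt q i j) = t i j,
         dA (t i j) = dt i j,
         cop HA (glt q i j) = \sum_k glt q i k ⊗ glt q k j,
         cop HOA (t i j) = \sum_k t i k ⊗ t k j &
         cop HOA (dt i j) = \sum_k (dt i k ⊗ t k j + t i k ⊗ dt k j)]) /\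
  (* the exterior algebra on C_q^2 *)
  (is_exterior iB dB /\
   forall i, iB (plx q i) = x i /\ dB (x i) = dx i) /\
  exists (C : cmod A B) (HB : hopf_ops B) (CO : cmod OA OB) (HOB : hopf_ops OB),
  (* C_q^2 is a braided-Hopf algebra in the category of A-crossed modules *)
  (is_bhopf HA C HB /\
   (forall i j, act C (plx q i1) (glt q i j) =
      mx2 (q ^- 2 *: plx q i1) (- (q^-1 * lam) *: plx q i2)
          0                    (q^-1 *: plx q i1) i j) /\
   (forall i j, act C (plx q i2) (glt q i j) =
      mx2 (q^-1 *: plx q i2) 0
          0                  (q ^- 2 *: plx q i2) i j) /\
   coact C (plx q i1) = plx q i1 ⊗ glt q i1 i1 + plx q i2 ⊗ glt q i2 i1 /\
   coact C (plx q i2) = plx q i1 ⊗ glt q i1 i2 + plx q i2 ⊗ glt q i2 i2 /\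
   (forall i, cop HB (plx q i) = plx q i ⊗ gone B + gone B ⊗ plx q i)) /\
  (* Omega(C_q^2) is a super braided-Hopf algebra in the category of super
     right Omega(A)-crossed modules *)
  (is_bhopf HOA CO HOB /\
   (forall i j, act CO (x i1) (t i j) =
      mx2 (q ^- 2 *: x i1) (- (q^-1 * lam) *: x i2)
          0                (q^-1 *: x i1) i j) /\
   (forall i j, act CO (x i2) (t i j) =
      mx2 (q^-1 *: x i2) 0
          0              (q ^- 2 *: x i2) i j) /\
   (forall i j, act CO (x i1) (dt i j) =
      mx2 (- (q^-1 * lam) *: dx i1) (- (q^-1 * lam) *: dx i2)
          0                         0 i j) /\
   (forall i j, act CO (dx i1) (t i j) =
      mx2 (dx i1) 0
          0       (q^-1 *: dx i1) i j) /\
   (forall i j, act CO (x i2) (dt i j) =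
      mx2 0                         0
          (- (q^-1 * lam) *: dx i1) (- (q^-1 * lam) *: dx i2) i j) /\
   (forall i j, act CO (dx i2) (t i j) =
      mx2 (q^-1 *: dx i2)         0
          ((q^-1 * lam) *: dx i1) (dx i2) i j) /\
   (forall i k l, act CO (dx i) (dt k l) = 0) /\
   coact CO (x i1) = x i1 ⊗ t i1 i1 + x i2 ⊗ t i2 i1 /\
   coact CO (x i2) = x i1 ⊗ t i1 i2 + x i2 ⊗ t i2 i2 /\
   coact CO (dx i1) = dx i1 ⊗ t i1 i1 + dx i2 ⊗ t i2 i1
                      + x i1 ⊗ dt i1 i1 + x i2 ⊗ dt i2 i1 /\
   coact CO (dx i2) = dx i1 ⊗ t i1 i2 + dx i2 ⊗ t i2 i2
                      + x i1 ⊗ dt i1 i2 + x i2 ⊗ dt i2 i2 /\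
   (forall i, cop HOB (x i) = x i ⊗ gone OB + gone OB ⊗ x i) /\
   (forall i, cop HOB (dx i) = dx i ⊗ gone OB + gone OB ⊗ dx i)) /\
  let W := bos HA C in let OW := bos HOA CO in
  let iW := tmap iA iB : W -> OW in
  let dW := tdif dA dB : OW -> OW in
  let jA := bos_inl HOA CO in let jB := bos_inr HOA CO in
  let a := jA (t i1 i1) in let b := jA (t i1 i2) in
  let c := jA (t i2 i1) in let d := jA (t i2 i2) in
  let da := jA (dt i1 i1) in let db := jA (dt i1 i2) in
  let dc := jA (dt i2 i1) in let dd := jA (dt i2 i2) in
  let x1 := jB (x i1) in let x2 := jB (x i2) in
  let dx1 := jB (dx i1) in let dx2 := jB (dx i2) in
  exists (SW : W -> W) (SOW : OW -> OW),
  let HW := bos_hopf HB SW in let HOW := bos_hopf HOB SOW in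
  (* the super bosonisation is a strongly bicovariant exterior algebra, *)
  is_strongly_bicovariant HW HOW iW dW /\
  (* with sub-exterior algebras Omega(A) and Omega(B), *)
  (is_dga_map dA dW jA /\ injective jA) /\
  (is_dga_map dB dW jB /\ injective jB) /\
  (* cross relations *)
  [/\ forall i j, x1 ∙ jA (t i j) =
        mx2 (q ^- 2 *: (a ∙ x1)) (q^-1 *: (b ∙ x1) - (q^-1 * lam) *: (a ∙ x2))
            (q ^- 2 *: (c ∙ x1)) (q^-1 *: (d ∙ x1) - (q^-1 * lam) *: (c ∙ x2))
            i j,
      forall i j, x2 ∙ jA (t i j) =
        mx2 (q^-1 *: (a ∙ x2)) (q ^- 2 *: (b ∙ x2))
            (q^-1 *: (c ∙ x2)) (q ^- 2 *: (d ∙ x2)) i j,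
      forall i j, dx1 ∙ jA (t i j) =
        mx2 (a ∙ dx1) (q^-1 *: (b ∙ dx1))
            (c ∙ dx1) (q^-1 *: (d ∙ dx1)) i j &
      forall i j, dx2 ∙ jA (t i j) =
        mx2 (q^-1 *: (a ∙ dx2) + (q^-1 * lam) *: (b ∙ dx1)) (b ∙ dx2)
            (q^-1 *: (c ∙ dx2) + (q^-1 * lam) *: (d ∙ dx1)) (d ∙ dx2) i j] /\
  [/\ forall i j, x1 ∙ jA (dt i j) =
        mx2 (q ^- 2 *: (da ∙ x1) - (q^-1 * lam) *: (a ∙ dx1))
            (q^-1 *: (db ∙ x1) - (q^-1 * lam) *: (da ∙ x2 + a ∙ dx2))
            (q ^- 2 *: (dc ∙ x1) - (q^-1 * lam) *: (c ∙ dx1))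
            (q^-1 *: (dd ∙ x1) - (q^-1 * lam) *: (dc ∙ x2 + c ∙ dx2)) i j,
      forall i j, x2 ∙ jA (dt i j) =
        mx2 (q^-1 *: (da ∙ x2) - (q^-1 * lam) *: (b ∙ dx1))
            (q ^- 2 *: (db ∙ x2) - (q^-1 * lam) *: (b ∙ dx2))
            (q^-1 *: (dc ∙ x2) - (q^-1 * lam) *: (d ∙ dx1))
            (q ^- 2 *: (dd ∙ x2) - (q^-1 * lam) *: (d ∙ dx2)) i j,
      forall i j, dx1 ∙ jA (dt i j) =
        - mx2 (da ∙ dx1) (q^-1 *: (db ∙ dx1))
              (dc ∙ dx1) (q^-1 *: (dd ∙ dx1)) i j &
      forall i j, dx2 ∙ jA (dt i j) =
        - mx2 (q^-1 *: (da ∙ dx2) + (q^-1 * lam) *: (db ∙ dx1)) (db ∙ dx2)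
              (q^-1 *: (dc ∙ dx2) + (q^-1 * lam) *: (dd ∙ dx1)) (dd ∙ dx2) i j] /\
  (* and super coproduct *)
  [/\ forall i, cop HOW (jB (x i)) =
        gone OW ⊗ jB (x i) + tmap jB jA (coact CO (x i)),
      forall i, cop HOW (jB (dx i)) =
        gone OW ⊗ jB (dx i) + tmap jB jA (coact CO (dx i)) &
      forall w, cop HOW (jA w) = tmap jA jA (cop HOA w)] /\
  (* the canonical coaction of the bosonisation on C_q^2 is differentiable *)
  exists D : B -> tens B W,
    [/\ is_comodule_algebra HW D,
        forall i, D (plx q i) = gone B ⊗ bos_inr HA C (plx q i)
                    + \sum_j plx q j ⊗ bos_inl HA C (glt q j i) &
        is_differentiable iB dB iW dW D].
Proof.
move=> lam A OA B OB x dx t dt'.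
have hA := klA_pres q_neq0 q2_neqN1; have hO := klO_pres q_neq0 q2_neqN1.
have hB := blB_pres q_neq0; have hOB := blO_pres q_neq0.
(* The whole construction for the algebras in degree 0; the next line repeats it for the exterior
   algebras. *)
have [HA [C [D [HB [SW md0]]]]] := model_ex q_neq0 hA hB.
have [HOA [CO [DO [HOB [SOW md]]]]] := model_ex q_neq0 hO hOB.
have /andP[dK1 dK2] := dK_chk; have [dA [hdA dAE]] := pres_dga q_neq0 hO dtK_chk dK1 dK2.
have /andP[dB1 dB2] := dB_chk; have [dB [hdB dBE]] := pres_dga q_neq0 hOB dtB_chk dB1 dB2.
have [iA [iAP iAE]] := pres_incl q_neq0 hA hO evenK_chk.
have [iB [iBP iBE]] := pres_incl q_neq0 hB hOB evenB_chk.
have [pA [pAP pAE]] := pA_ex q_neq0 q2_neqN1; have [pB [pBP pBE]] := pB_ex q_neq0.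
have pAK := incl_retract hA iAP iAE pAP pAE; have pBK := incl_retract hB iBP iBE pBP pBE.
have pAl : linear pA by case: pAP.
have pBl : linear pB by case: pBP.
have degA (k : A) : homog 0 k := deg0_homog k (@CqGL2_hrel _ q).
have degB (b : B) : homog 0 b := deg0_homog b (@Cq2_hrel _ q).
have tE i j : t i j = klO q (tl i j) := esym (klO_tl q i j).
have dtE i j : dt' i j = klO q (dl i j) := esym (klO_dl q i j).
have xE i : x i = blO q (xl i) := esym (blO_xl q i).
have dxE i : dx i = blO q (yl i) := esym (blO_yl q i).
have aE i j : glt q i j = klA q (tl i j) := esym (klA_tl q i j).
have pE i : plx q i = blB q (xl i) := esym (blB_xl q i).
exists HA, HOA, iA, dA, iB, dB; split; last split.
- split; first exact: (bicovariant_K md0 md hdA dAE degA iAP iAE pAK).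
  split; first exact: (iAE 4 isT).
  split.
    (* [klO] sends letter 9 to the determinant and letter 4 to its inverse; being two-sided inverses
       in degree 0 they obey the formula for the differential of an inverse. *)
    have e1 := (klO_Di q_neq0 (gone OA)).1; have e2 := (klO_Di q_neq0 (gone OA)).2.
    rewrite !(gmul1r (pr_galg hO)) in e1 e2.
    exact: (dga_inv hdA (pr_homog hO 9) e2 e1).
  move=> i j; split.
  + by rewrite aE (iAE _ (tl_gens i j)) lodd_tl tE.
  + by rewrite tE (d_next hO dAE (tl_gens i j) (dt_tl i j)) dtE.
  + rewrite aE (cop_t md0); by apply: eq_bigr => k _; rewrite !aE.
  + rewrite tE (cop_t md); by apply: eq_bigr => k _; rewrite !tE.
  + rewrite dtE (cop_dt md); by apply: eq_bigr => k _; rewrite !tE !dtE.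
- split; first exact: (exterior_B md0 md hdB dBE degB iBP iBE pBK).
  move=> i; split; first by rewrite pE (iBE _ (xl_gens i)) lodd_xl xE.
  by rewrite xE (d_next hOB dBE (xl_gens i) (dt_xl i)) dxE.
exists C, HB, CO, HOB; split; last split.
- split; first exact: (md_bhopf md0).
  split; first by move=> i j; rewrite aE; exact: (act_x1 q_neq0 md0 i j).
  split; first by move=> i j; rewrite aE; exact: (act_x2 md0 i j).
  split; first exact: (coact_x1 md0).
  split; first exact: (coact_x2 md0).
  by move=> i; rewrite pE; exact: (copB_x md0 i).
- split; first exact: (md_bhopf md).
  split; first by move=> i j; rewrite tE; exact: (act_x1 q_neq0 md i j).
  split; first by move=> i j; rewrite tE; exact: (act_x2 md i j).
  split; first by move=> i j; rewrite dtE; exact: (act_x1dt q_neq0 md i j).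
  split; first by move=> i j; rewrite tE; exact: (act_dx1 md i j).
  split; first by move=> i j; rewrite dtE; exact: (act_x2dt q_neq0 md i j).
  split; first by move=> i j; rewrite tE; exact: (act_dx2 q_neq0 md i j).
  split; first by move=> i k l; rewrite dtE dxE; exact: (act_dxdt md i k l).
  split; first exact: (coact_x1 md).
  split; first exact: (coact_x2 md).
  split; first exact: (coact_dx1 md).
  split; first exact: (coact_dx2 md).
  split; first by move=> i; rewrite xE; exact: (copB_x md i).
  by move=> i; rewrite dxE; exact: (copB_dx md i).
move=> W OW iW' dW' jA jB a b c d da db dc dd x1 x2 dx1 dx2.
exists SW, SOW => HW HOW; split.
  exact: (bicovariant_W q_neq0 md0 md hdA dAE hdB dBE degA degB iAP iAE iBP iBE pAl pBl pAK pBK).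
have hOA := pr_galg hO; have gOB := pr_galg hOB.
split.
  split; last by move=> y z; exact: (bos_inl_inj q_neq0 md).
  split; first exact: (galg_map_bos_inl (md_hopf md) gOB (md_modalg md)).
  by move=> k; apply: esym; exact: (dW_inl md hdA hdB k).
split.
  split; last by move=> y z; exact: (bos_inr_inj md).
  split; first exact: (galg_map_bos_inr (md_hopf md) gOB (md_modalg md)).
  by move=> k; apply: esym; exact: (dW_inr md hdA hdB k).
split.
  split=> i j; rewrite tE.
  + exact: (cross_x1 q_neq0 md i j).
  + exact: (cross_x2 md i j).
  + exact: (cross_dx1 md i j).
  + exact: (cross_dx2 q_neq0 md i j).
split.
  split=> i j; rewrite dtE.
  + exact: (cross_x1dt q_neq0 md i j).
  + exact: (cross_x2dt q_neq0 md i j).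
  + exact: (cross_dx1dt md i j).
  + exact: (cross_dx2dt q_neq0 md i j).
split.
  split.
  + by move=> i; rewrite xE; exact: (md_copWr md (xl_gens i)).
  + by move=> i; rewrite dxE; exact: (md_copWr md (yl_gens i)).
  + by move=> w; exact: (md_copWl md w).
exists D; split; first exact: (md_comod md0).
  move=> i; rewrite pE (md_D md0 (xl_gens i)) addrC; congr (_ + _).
  by rewrite sum2; elim/ord2P: i; rewrite xlE coatE !big_cons big_nil addr0.
exact: (differentiable_D q_neq0 md0 md hdA dAE hdB dBE iAP iAE iBP iBE).
Qed.
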